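(* Let $\ell\geq 2$. Write $\mathrm{Irr}$ for the set of irreducible representations of $\mathrm G(\mathfrak o_\ell)$ and $\mathrm{Irr}^{\mathrm{reg}}$ for the regular ones. (1) If $\rho_1,\rho_2$ are regular with $\mathrm{tt}(\rho_1)=\mathbf{ss}$, $\mathrm{tt}(\rho_2)=\mathbf{sns}$, then $\langle\rho_1\otimes\rho_2,\rho\rangle\leq 2$ for every $\rho\in\mathrm{Irr}$, and equality holds only if $\rho$ is regular with $\mathrm{tt}(\rho)=\mathbf{ss}$. (2) If $\rho_1,\rho_2$ are regular with $\mathrm{tt}(\rho_1)=\mathbf{cus}$ and $\mathrm{tt}(\rho_2)\neq\mathbf{cus}$, then $\langle\rho_1\otimes\rho_2,\rho\rangle\leq1$ for every $\rho\in\mathrm{Irr}$. (3) If $\rho_1,\rho_2$ are regular with $\mathrm{tt}(\rho_1)=\mathrm{tt}(\rho_2)=\mathbf{cus}$, then $\langle\rho_1\otimes\rho_2,\rho\rangle\leq 1$ for every $\rho\in\mathrm{Irr}^{\mathrm{reg}}$. (4) If $\rho_1,\rho_2$ are regular with $\mathrm{tt}(\rho_1)=\mathrm{tt}(\rho_2)=\mathbf{ss}$, then $\langle\rho_1\otimes\rho_2,\rho\rangle\leq \ell+1$ for every $\rho\in\mathrm{Irr}^{\mathrm{reg}}$ with $\mathrm{tt}(\rho)=\mathbf{ss}$. (5) There exists a regular $\rho$ with $\mathrm{tt}(\rho)=\mathbf{sns}$ such that $\langle\rho\otimes\rho,\rho\rangle\geq (q-2)q^{\lfloor \ell/2\rfloor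 -1}$.
   Context: Let $\mathcal O$ be a complete discrete valuation ring with maximal ideal $\mathfrak p=\pi\mathcal O$ and finite residue field of odd characteristic and cardinality $q$. Let $\mathfrak O=\mathcal O[\vartheta]$ be the unramified quadratic extension, with $\vartheta^2\in\mathcal O^\times$ a non-square, and Galois involution $x\mapsto x^\circ$, $\vartheta^\circ=-\vartheta$. Let $\mathfrak o_\ell=\mathcal O/\mathfrak p^\ell$ and $\mathfrak O_\ell=\mathfrak O/\pi^\ell\mathfrak O$. $\mathrm G$ denotes either $\mathrm{GL}_2$ (so $\mathrm G(\mathfrak o_\ell)=\mathrm{GL}_2(\mathfrak o_\ell)$, $R_\ell=\mathfrak o_\ell$, $\mathfrak g(\mathfrak o_\ell)=M_2(\mathfrak o_\ell)$) or $\mathrm{GU}_2$ (so $\mathrm G(\mathfrak o_\ell)=\{A\in \mathrm{GL}_2(\mathfrak O_\ell): A^\star A=I\}$ where $(a_{ij})^\star=W(a_{ji}^\circ)W^{-1}$, $W=\begin{pmatrix}0&1\\1&0\end{pmatrix}$, $R_\ell=\mathfrak O_\ell$, $\mathfrak g(\mathfrak o_\ell)=\{A\in M_2(\mathfrak O_\ell):A+A^\star=0\}$). Fix an additive character $\psi$ of $R_\ell$ nontrivial on $\pi^{\ell-1}\mathfrak o_\ell$. Let $K^{\ell-1}=\{I+\pi^{\ell-1}B\}\cap\mathrm G(\mathfrak o_\ell)$ and for $A\in\mathfrak g(\mathfrak o_1)$ let $\psi_A(I+\pi^{\ell-1}B)=\psi(\pi^{\ell-1}\mathrm{tr}(\tilde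 AB))$ with $\tilde A$ a lift of $A$. An irreducible representation $\rho$ of $\mathrm G(\mathfrak o_\ell)$ is regular if every $\psi_A$ occurring in $\rho|_{K^{\ell-1}}$ has $A$ non-scalar; its type $\mathrm{tt}(\rho)$ is $\mathbf{cus}$, $\mathbf{ss}$, $\mathbf{sns}$ according as $\dim\rho=(q-1)q^{\ell-1}$, $(q+1)q^{\ell-1}$, $(q^2-1)q^{\ell-2}$ (every regular representation has one of these dimensions). $\langle\cdot,\cdot\rangle$ is the usual inner product of characters. *)

(* Defs.v *)
From HB Require Import structures.
From mathcomp Require Import all_boot all_order all_algebra all_fingroup all_field all_character.

Set Implicit Arguments.
Unset Strict Implicit.
Unset Printing Implicit Defensive.

Import Order.TTheory GRing.Theory Num.Theory.
Local Open Scope ring_scope.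

Inductive Gkind := GLk | GUk.

Section Defs.
Variable R : finComUnitRingType.

Definition dvdR (a x : R) : bool := [exists y : R, x == a * y].

Definition Wmx : 'M[R]_2 := \matrix_(i, j) (if i == j then 0 else 1).

(* (a_ij)^* = W (a_ji^o) W^{-1}; note W^{-1} = W *)
Definition mxstar (c : R -> R) (A : 'M[R]_2) : 'M[R]_2 :=
  Wmx *m (map_mx c A)^T *m Wmx.

Lemma WmxK : Wmx *m Wmx = 1%:M.
Proof.
apply/matrixP=> i j; rewrite !mxE !big_ord_recr big_ord0 /= !mxE.
by case: i => [[|[|//]] ?]; case: j => [[|[|//]] ?];
  rewrite /= ?mul0r ?mul1r ?mulr0 ?mulr1 ?addr0 ?add0r.
Qed.

Lemma mxstarM (c : {rmorphism R -> R}) (A B : 'M[R]_2) :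
  mxstar c (A *m B) = mxstar c B *m mxstar c A.
Proof.
rewrite /mxstar map_mxM trmx_mul !mulmxA.
by rewrite -[_ *m Wmx *m Wmx]mulmxA WmxK mulmx1.
Qed.

Lemma mxstar1 (c : {rmorphism R -> R}) : mxstar c 1%:M = 1%:M.
Proof. by rewrite /mxstar map_mx1 trmx1 mulmx1 WmxK. Qed.

Definition unitary_set (c : {rmorphism R -> R}) : {set {'GL_2[R]}} :=
  [set g : {'GL_2[R]} | mxstar c (GLval g) *m GLval g == 1%:M].

Lemma unitary_group_set c : group_set (unitary_set c).
Proof.
apply/group_setP; split.
  by rewrite inE GL_1E mxstar1 mul1mx.
move=> x y; rewrite !inE GL_MxE => /eqP Hx /eqP Hy.
rewrite mxstarM mulmxA -[mxstar c _ *m _ *m GLval x]mulmxA Hx mulmx1 Hy.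
by [].
Qed.

Canonical unitary_group c := Group (unitary_group_set c).

(* G(o_l) : GL_2(o_l) (R = o_l) or GU_2(o_l) inside GL_2(O_l) (R = O_l) *)
Definition Ggrp (k : Gkind) (c : {rmorphism R -> R}) : {group {'GL_2[R]}} :=
  match k with GLk => [set: {'GL_2[R]}]%G | GUk => unitary_group c end.

(* the subring o_l of R_l: all of R for GL_2, the fixed points of ^o for GU_2 *)
Definition fixedR (c : R -> R) : {set R} := [set x | c x == x].
Definition oset (k : Gkind) (c : R -> R) : {set R} :=
  match k with GLk => [set: R] | GUk => fixedR c end.

(* the reduction mod pi of A lies in g(o_1) *)
Definition in_lie_mod (k : Gkind) (c : R -> R) (pi : R) (A : 'M[R]_2) : bool :=
  match k with
  | GLk => true
  | GUk => [forall i, forall j, dvdR pi ((A + mxstar c A) i j)]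
  end.

Definition scalar_mod (pi : R) (A : 'M[R]_2) : bool :=
  [exists a : R, [forall i, forall j, dvdR pi (A i j - a *+ (i == j))]].

Definition Kset k c (pi : R) (l : nat) : {set {'GL_2[R]}} :=
  [set g in Ggrp k c |
     [forall i, forall j, dvdR (pi ^+ l.-1) ((GLval g - 1%:M) i j)]].

(* psi_A (I + pi^{l-1} B) = psi (pi^{l-1} tr (A B)) = psi (tr (A (g - I))) *)
Definition psiA (psi : R -> algC) (A : 'M[R]_2) (g : {'GL_2[R]}) : algC :=
  psi (\tr (A *m (GLval g - 1%:M))).

(* psi_A occurs in chi|_{K^{l-1}} : <Res chi, psi_A>_K != 0 (up to 1/|K|) *)
Definition occurs k c pi l psi (chi : 'CF(Ggrp k c)) (A : 'M[R]_2) : bool :=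
  \sum_(g in Kset k c pi l) chi g * (psiA psi A g)^* != 0.
Arguments occurs : clear implicits.

Definition regular k c pi l psi (i : Iirr (Ggrp k c)) : Prop :=
  forall A : 'M[R]_2, in_lie_mod k c pi A ->
    occurs k c pi l psi 'chi_i A -> ~~ scalar_mod pi A.

(* finite chain ring conditions on the subring S with uniformizer pi:
   S/pi^l with S a complete DVR *)
Definition chain_on (S : {set R}) (pi : R) (l : nat) : Prop :=
  [/\ pi \in S, pi ^+ l = 0, pi ^+ l.-1 != 0 &
      forall x, x \in S -> x \is a GRing.unit \/ exists2 y, y \in S & x = pi * y].

Definition res_card (S : {set R}) (pi : R) : nat :=
  #|S| %/ #|[set pi * x | x in S]|.

Definition setting (k : Gkind) (c : {rmorphism R -> R}) (pi : R) (l q : nat) : Prop :=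
  [/\ chain_on (oset k c) pi l, res_card (oset k c) pi = q, odd q &
    match k with
    | GLk => True
    | GUk =>
      (forall x, c (c x) = x) /\
      exists theta : R,
        [/\ c theta = - theta, theta ^+ 2 \is a GRing.unit,
            ~ (exists2 a, a \in fixedR c & a ^+ 2 = theta ^+ 2) &
            forall x : R, exists! ab : R * R,
              [/\ ab.1 \in fixedR c, ab.2 \in fixedR c & x = ab.1 + ab.2 * theta]]
    end].

Definition additive_char (psi : R -> algC) : Prop :=
  psi 0 = 1 /\ forall x y, psi (x + y) = psi x * psi y.

End Defs.
Arguments regular {R} k c pi l psi i.
Arguments Ggrp {R} k c.

Section Types.
Variables (gT : finGroupType) (G : {group gT}).
Definition is_cus (q l : nat) (i : Iirr G) : Prop :=
  'chi_i 1%g = ((q - 1) * q ^ l.-1)%:R.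
Definition is_ss (q l : nat) (i : Iirr G) : Prop :=
  'chi_i 1%g = ((q + 1) * q ^ l.-1)%:R.
Definition is_sns (q l : nat) (i : Iirr G) : Prop :=
  'chi_i 1%g = ((q ^ 2 - 1) * q ^ l.-2)%:R.
End Types.

(* Main.v *)
Require Import Defs.
From HB Require Import structures.
From mathcomp Require Import all_boot all_order all_algebra all_fingroup all_solvable all_field all_character.
From mathcomp Require Import ring zify.

Set Implicit Arguments.
Unset Strict Implicit.
Unset Printing Implicit Defensive.

Import Order.TTheory GRing.Theory Num.Theory.
Local Open Scope ring_scope.

(* An irreducible character of GL_2 over a finite chain ring is regular exactly
   when it carries a Whittaker functional, and that functional is unique: the
   anti-involution exchanging the diagonal entries makes the corresponding
   corner of the group algebra commutative.  Hence a regular character has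
   degree (q - 1) q^(l-1) plus the dimension of the space V of vectors fixed by
   the upper unipotent matrices congruent to 1 modulo p^(l-1).

   A character of type ss is induced from a linear character of the Borel
   subgroup.  By Frobenius reciprocity a multiplicity involving it is the sum of
   a Whittaker contribution, which is at most 1, and of a contribution of V.
   For type sns, V is irreducible on a subgroup of the Iwahori subgroup and
   contributes at most 1; for type ss, V is the sum of two characters induced
   from the Borel subgroup, and counting conjugates bounds the contribution by l.

   If one factor is cuspidal, decompose both factors under the abelian
   congruence subgroup modulo p^ceil(l/2).  The multiplicity becomes a sum over
   pairs (A, B) of matrices with A elliptic.  For a fixed A, the matrices B with
   a nonzero summand lie over a fibre of the norm form of the unramified
   quadratic extension; counting the points of these fibres bounds the
   multiplicity by 2q/(q + 1), which is less than 2.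

   For the lower bound, induce psi(c/a) from the group of matrices (a, b; c, d)
   with a = d modulo p^floor(l/2) and c = 0 modulo p^ceil(l/2).  The restriction
   of the induced character to this group contains psi(s c/a) for every unit s.

   For GU_2, the groups Z GU_2 and Z GL_2(o_l) of invertible matrices over O_l,
   with Z the scalars, are conjugate by diag(1, theta), because of Hilbert 90 and
   of the surjectivity of the norm.  Irreducible characters of this common group
   stay irreducible on both subgroups, with the same triple products. *)

(** * Character theory *)

(** Operators rarely appear: multiplicities are sums of character values over explicit subgroups,
    and integrality or positivity enters by recognizing such a sum as the multiplicity of a linear
    character. One comparison recurs. The frequencies in p are the characters of R trivial on the
    socle p^(l-1), so the value at 0 of a unit-invariant function minus its average over the socle
    isolates the unit frequencies. Uniqueness of Whittaker functionals then caps the other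
    contributions, because V and its complement share a single line on a mirabolic-type subgroup.

    In the cuspidal case the obstacle is odd l. The isotypic components for the abelian congruence
    subgroup then have degree q instead of 1, and bounding values by the degree is too weak on
    elements that are not scalar modulo p. There the components behave like Heisenberg
    representations, with values of modulus at most 1. This still loses a factor, harmless because a
    multiplicity is an integer.

    A nonregular third factor escapes the sum over pairs. It is excluded separately: if it occurred
    in a product with a cuspidal factor, the other factor would be cuspidal as well. *)

Section CharacterTheory.
Variable gT : finGroupType.
Implicit Types G H K N P S : {group gT}.

(** A linear character kept as a bare function, so that explicit formulas such as [psi] of a matrix
    entry need no class function. [lin_of_mulon] and [mulon_mult_nat] return to characters where
    integrality is wanted. *)
Definition mulon (A : {set gT}) (f : gT -> algC) :=
  f 1%g = 1 /\ {in A &, forall x y, f (x * y)%g = f x * f y}.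

Lemma mulonV G f x : mulon G f -> x \in G -> f x * f x^-1%g = 1.
Proof. by case=> f1 fM xG; rewrite -fM ?groupV // mulgV. Qed.

Lemma mulon_neq0 G f x : mulon G f -> x \in G -> f x != 0.
Proof.
move=> fG xG; apply: contraTneq (oner_neq0 algC) => f0.
by rewrite -(mulonV fG xG) f0 mul0r eqxx.
Qed.

Lemma mulon_sum0 G f x : mulon G f -> x \in G -> f x != 1 ->
  \sum_(y in G) f y = 0.
Proof.
move=> [f1 fM] xG fx.
have: \sum_(y in G) f y = f x * \sum_(y in G) f y.
  rewrite mulr_sumr (reindex_inj (mulgI x)) /=.
  rewrite (eq_bigl (mem G)) => [|y]; last by rewrite /= groupMl.
  by apply: eq_bigr => y yG; rewrite fM.
move/eqP; rewrite -subr_eq0 -{1}[\sum_(y in G) f y]mul1r -mulrBl mulf_eq0.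
by rewrite subr_eq0 eq_sym (negPf fx) => /eqP.
Qed.

Lemma mulonX G f x n : mulon G f -> x \in G -> f (x ^+ n)%g = f x ^+ n.
Proof.
move=> [f1 fM] xG; elim: n => [|n IHn]; first by rewrite expg0.
by rewrite expgS fM ?groupX // IHn exprS.
Qed.

Lemma mulon_norm G f x : mulon G f -> x \in G -> `|f x| = 1.
Proof.
move=> fG xG; have := mulonX #[x]%g fG xG; rewrite expg_order.
case: (fG) => -> _ /esym fx.
by apply/eqP; rewrite -(@pexpr_eq1 _ _ #[x]%g) ?order_gt0 // -normrX fx normr1.
Qed.

Lemma mulon_conj G f x : mulon G f -> x \in G -> (f x)^* = f x^-1%g.
Proof.
move=> fG xG; apply: (mulfI (mulon_neq0 fG xG)).
by rewrite (mulonV fG xG) -normCK (mulon_norm fG xG) expr1n.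
Qed.

Lemma mulonM A f g : mulon A f -> mulon A g -> mulon A (fun x => f x * g x).
Proof.
move=> [f1 fM] [g1 gM]; split=> [|x y xA yA]; first by rewrite f1 g1 mulr1.
by rewrite fM // gM // mulrACA.
Qed.

Lemma mulonC A f : mulon A f -> mulon A (fun x => (f x)^*).
Proof.
move=> [f1 fM]; split=> [|x y xA yA]; first by rewrite f1 rmorph1.
by rewrite fM // rmorphM.
Qed.

Lemma lin_of_mulon G f : mulon G f ->
  exists2 mu : 'CF(G), mu \is a linear_char & {in G, mu =1 f}.
Proof.
move=> fG.
have rf : mx_repr G (fun x => (f x)%:M : 'M[algC]_1).
  case: fG => f1 fM; split=> [|x y xG yG]; first by rewrite f1.
  by rewrite fM // -scalar_mxM.
exists (cfRepr (MxRepresentation rf)).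
  by rewrite qualifE/= cfRepr_char cfRepr1 eqxx.
by move=> x xG; rewrite cfunE xG mulr1n /= mxtrace_scalar mulr1n.
Qed.

(* Schur: a class sum acts by a scalar. *)
Lemma irr_class_sum G (i : Iirr G) (X : {set gT}) (f : gT -> algC) :
  X \subset G -> {in X & G, forall x g, (x ^ g)%g \in X /\ f (x ^ g)%g = f x} ->
  exists w, {in G, forall g, \sum_(x in X) f x * 'chi_i (g * x)%g = w * 'chi_i g}.
Proof.
move=> /subsetP sXG fX.
have irrG : mx_absolutely_irreducible 'Chi_i by apply: groupC; apply: socle_irr.
move: (irrRepr i) irrG; move: 'Chi_i => rG irrRepr irrG.
pose Z := \sum_(x in X) f x *: rG x.
have cZ : centgmx rG Z.
  apply/centgmxP => g gG; rewrite mulmx_suml mulmx_sumr.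
  rewrite [RHS](reindex_inj (conjg_inj g)) /=; apply: eq_big => x.
    apply/idP/idP => [xX | xgX]; first by case: (fX x g xX gG).
    by case: (fX _ g^-1%g xgX); rewrite ?groupV // conjgK.
  move=> xX; have [xgX ->] := fX x g xX gG.
  rewrite -scalemxAl -scalemxAr -!repr_mxM ?(sXG _ xX) //; last by apply: sXG.
  by rewrite [in LHS]conjgC.
have /is_scalar_mxP[w Zw] := mx_abs_irr_cent_scalar irrG cZ.
exists w => g gG; rewrite -irrRepr [in RHS]cfunE gG mulr1n.
transitivity (\tr (rG g *m Z)).
  rewrite mulmx_sumr raddf_sum /=; apply: eq_bigr => x xX; have xG := sXG _ xX.
  by rewrite -scalemxAr mxtraceZ cfunE groupM // mulr1n -repr_mxM.
by rewrite Zw mul_mx_scalar mxtraceZ.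
Qed.

(** The [lam]-projector over [N] is central because [lam] is invariant, hence a scalar by
    [irr_class_sum]; being idempotent, it is 0 or 1. *)
Lemma irr_isotypic G N (lam : gT -> algC) (i : Iirr G) :
  N \subset G -> {in N & G, forall x g, (x ^ g)%g \in N /\ lam (x ^ g)%g = lam x} ->
  mulon N lam -> exists b : bool, {in G, forall g,
    #|N|%:R^-1 * \sum_(x in N) (lam x)^* * 'chi_i (g * x)%g = b%:R * 'chi_i g}.
Proof.
move=> sNG lamG lamN; have lamc : mulon N (fun x => (lam x)^*) by apply: mulonC.
have nzN : #|N|%:R != 0 :> algC by rewrite pnatr_eq0 -lt0n cardG_gt0.
have [|w Hw] := @irr_class_sum G i N (fun x => (lam x)^*) sNG.
  by move=> x g xN gG; have [? ->] := lamG x g xN gG.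
have ww : w * w = #|N|%:R * w.
  apply: (mulIf (irr1_neq0 i)); rewrite -!mulrA -(Hw 1%g) //.
  rewrite [LHS]mulr_sumr.
  transitivity (\sum_(x in N) \sum_(y in N) (lam x)^* * (lam y)^* * 'chi_i (x * y)%g).
    apply: eq_bigr => x xN; rewrite mul1g mulrCA -Hw ?(subsetP sNG) // mulr_sumr.
    by apply: eq_bigr => y yN; rewrite mulrA.
  transitivity (\sum_(x in N) \sum_(y in N) (lam y)^* * 'chi_i y).
    apply: eq_bigr => x xN; rewrite [RHS](reindex_inj (mulgI x)) /=.
    apply: eq_big => y; first by rewrite /= groupMl.
    by move=> yN; case: lamc => _ ->.
  rewrite sumr_const mulr_natl; congr (_ *+ _).
  by apply: eq_bigr => y; rewrite mul1g.
have [w0 | nzw] := eqVneq w 0.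
  by exists false => g gG; rewrite Hw // w0 /= !mul0r mulr0.
exists true => g gG; rewrite Hw // mulrA.
by rewrite (mulIf nzw ww) mulVf // mul1r.
Qed.

(* The lambda-isotypic part of a character, for lambda a G-invariant linear
   character of a normal subgroup. *)
Lemma isotypic_char G N (lam : gT -> algC) (chi : 'CF(G)) :
  N \subset G -> {in N & G, forall x g, (x ^ g)%g \in N /\ lam (x ^ g)%g = lam x} ->
  mulon N lam -> chi \is a character ->
  exists2 theta : 'CF(G), theta \is a character &
    {in G, forall g, theta g = #|N|%:R^-1 * \sum_(x in N) (lam x)^* * chi (g * x)%g}.
Proof.
move=> sNG lamG lamN Nchi.
have irr_case i := @irr_isotypic G N lam i sNG lamG lamN.
have [b Hb] := (fin_all_exists irr_case).
exists (\sum_i (b i)%:R * '[chi, 'chi_i] *: 'chi_i).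
  apply: rpred_sum => i _.
  have /natrP[n ->] := Cnat_cfdot_char_irr i Nchi.
  by rewrite -natrM scaler_nat rpredMn ?irr_char.
move=> g gG; rewrite sum_cfunE {2}[chi]cfun_sum_cfdot.
transitivity (\sum_i '[chi, 'chi_i] *
  (#|N|%:R^-1 * \sum_(x in N) (lam x)^* * 'chi_i (g * x)%g)).
  by apply: eq_bigr => i _; rewrite cfunE Hb //; ring.
rewrite mulr_sumr [RHS](eq_bigr (fun x => \sum_i '[chi, 'chi_i] *
    (#|N|%:R^-1 * ((lam x)^* * 'chi_i (g * x)%g)))) => [|x xN]; last first.
  rewrite sum_cfunE !mulr_sumr; apply: eq_bigr => i _.
  by rewrite cfunE; ring.
rewrite exchange_big /=. apply: eq_bigr => i _.
by rewrite !mulr_sumr.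
Qed.

(** When the trace of [c] has maximal modulus its eigenvalues coincide, so [c] acts as a scalar. *)
Lemma char_center_mul G (chi : 'CF(G)) c g : chi \is a character ->
  c \in G -> g \in G -> `|chi c| = chi 1%g ->
  chi (g * c)%g * chi 1%g = chi g * chi c.
Proof.
case/char_reprP=> [[n rG] ->] cG gG /=; rewrite cfRepr1 => nc.
have := max_cfRepr_norm_scalar cG; move/(_ n rG).
rewrite cfRepr1 => /(_ nc) [a _ rc].
rewrite !cfunE groupM // cG gG !mulr1n repr_mxM // rc.
by rewrite mul_mx_scalar mxtraceZ mxtrace_scalar -[a *+ n]mulr_natr; ring.
Qed.

Lemma cfnorm_char_ge1 G (chi : 'CF(G)) : chi \is a character -> chi != 0 -> 1 <= '[chi].
Proof.
move=> Nchi nz; have /natrP[n En] := Cnat_cfdot_char Nchi Nchi.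
by rewrite En ler1n lt0n; apply: contraNneq nz => n0; rewrite -cfnorm_eq0 En n0.
Qed.

(** The sum of the conjugates of [g^-1] under [H] commutes with the irreducible action of [H], hence
    is a scalar. Its trace identifies the scalar, and the trace of its product with [g] brings in
    commutators. The formula bounds ['chi_i g] when few commutators have a nonzero value. *)
Lemma irr_commutator_norm S H (i : Iirr S) g : H \subset S -> g \in S ->
  'Res[H] 'chi_i \in irr H ->
  `|'chi_i g| ^+ 2 =
    'chi_i 1%g / #|H|%:R * \sum_(x in H) 'chi_i (g * (x * g^-1 * x^-1))%g.
Proof.
move=> sHS gS /irrP[j Ej]; have sHS' := subsetP sHS.
have := irr1_degree i; move: (irrRepr i); move: 'Chi_i => rS Ei Ei1.
pose rH := subg_repr rS sHS.
have irrH : mx_absolutely_irreducible rH.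
  have irrj : mx_absolutely_irreducible 'Chi_j by apply: groupC; apply: socle_irr.
  have sim : mx_rsim rH 'Chi_j.
    by apply/cfRepr_rsimP; rewrite cfRepr_sub Ei irrRepr Ej eqxx.
  by rewrite (mx_rsim_abs_irr sim).
pose Z := \sum_(x in H) rS (x * g^-1 * x^-1)%g.
have cZ : centgmx rH Z.
  apply/centgmxP => h hH; have hS := sHS' _ hH; rewrite mulmx_suml mulmx_sumr.
  rewrite [LHS](reindex_inj (mulgI h)) /=; apply: eq_big => x.
    by rewrite /= groupMl.
  rewrite groupMl // => xH; have xS := sHS' _ xH.
  rewrite -!repr_mxM ?(groupM, groupV) //.
  by rewrite !invMg !mulgA mulgKV.
have /is_scalar_mxP[w Zw] := mx_abs_irr_cent_scalar irrH cZ.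
have nz : #|H|%:R != 0 :> algC by rewrite pnatr_eq0 -lt0n cardG_gt0.
have trZ : #|H|%:R * 'chi_i g^-1%g = w * 'chi_i 1%g.
  have <- : \tr Z = w * 'chi_i 1%g.
    by rewrite Zw mxtrace_scalar Ei1 mulr_natr.
  rewrite raddf_sum mulr_natl -sumr_const /=; apply: eq_bigr => x xH.
  have xS := sHS' _ xH.
  rewrite -(cfunJ 'chi_i g^-1%g (_ : x^-1%g \in S)) ?groupV //.
  rewrite conjgE invgK -Ei cfunE !(groupM, groupV) // mulr1n.
  by rewrite mulgA.
have trgZ : \sum_(x in H) 'chi_i (g * (x * g^-1 * x^-1))%g = w * 'chi_i g.
  transitivity (\tr (rS g *m Z)).
    rewrite mulmx_sumr raddf_sum /=; apply: eq_bigr => x xH.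
    have xS := sHS' _ xH.
    rewrite -repr_mxM ?(groupM, groupV) // -Ei cfunE.
    by rewrite !(groupM, groupV) // mulr1n.
  by rewrite Zw mul_mx_scalar mxtraceZ -Ei cfunE gS mulr1n.
rewrite trgZ normCK -irr_inv; apply: (mulfI nz).
rewrite mulrCA trZ; field; exact: nz.
Qed.

(** Since [G = H * K] there is a single double coset in Mackey's formula. The sum may run over all
    of [H] because [nu] is 0 off [K]. *)
Lemma cfdot_IndM_mulG G H K (mu : 'CF(H)) (nu : 'CF(K)) (phi : 'CF(G)) :
  (H * K)%g = G ->
  '['Ind[G] mu * 'Ind[G] nu, phi] =
    #|G|%:R / (#|H|%:R * #|K|%:R) * \sum_(x in H) mu x * nu x * (phi x)^*.
Proof.
move=> defG; have sHG : H \subset G by rewrite -defG mulG_subl.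
have sKG : K \subset G by rewrite -defG mulG_subr.
rewrite -cfIndM // -Frobenius_reciprocity cfdotE.
have -> : \sum_(x in H) (mu * 'Res[H] ('Ind[G] nu)) x * ('Res[H] phi x)^* =
   #|K|%:R^-1 * \sum_(y in G) \sum_(x in H) mu x * nu (x ^ y)%g * (phi x)^*.
  rewrite exchange_big mulr_sumr; apply: eq_bigr => x xH.
  by rewrite !cfunE !cfResE // cfIndE // -mulr_suml -mulr_sumr; ring.
have -> : \sum_(y in G) \sum_(x in H) mu x * nu (x ^ y)%g * (phi x)^* =
   \sum_(y in G) \sum_(x in H) mu x * nu x * (phi x)^*.
  apply: eq_bigr => y yG; have := yG; rewrite -{1}defG => /mulsgP[h k hH kK ->].
  rewrite [RHS](reindex_inj (conjg_inj h)) /=; apply: eq_big => x.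
    by rewrite memJ_norm // (subsetP (normG H)).
  by move=> xH; rewrite conjgM (cfunJ nu) ?(cfunJ mu) ?(cfunJ phi) ?(subsetP sHG).
rewrite sumr_const -[X in _ * (_ * X)]mulr_natl invfM; ring.
Qed.

Lemma cfdot_Ind_mulG G H K (mu : 'CF(H)) (nu : 'CF(K)) :
  (H * K)%g = G ->
  '['Ind[G] mu, 'Ind[G] nu] =
    #|G|%:R / (#|H|%:R * #|K|%:R) * \sum_(x in H) mu x * (nu x)^*.
Proof.
move=> defG; have sHG : H \subset G by rewrite -defG mulG_subl.
transitivity '['Ind[G] mu * 'Ind[G] (nu^*)%CF, 1].
  rewrite -cfAutInd !cfdotE; congr (_ * _); apply: eq_bigr => x xG.
  by rewrite !cfunE cfun1E xG rmorph1 mulr1.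
rewrite cfdot_IndM_mulG //; congr (_ * _); apply: eq_bigr => x xH.
by rewrite cfun1E (subsetP sHG) // rmorph1 mulr1 cfunE.
Qed.

Lemma mulon_mult_nat G H (chi : 'CF(G)) (lam : gT -> algC) :
  H \subset G -> chi \is a character -> mulon H lam ->
  #|H|%:R^-1 * (\sum_(x in H) chi x * (lam x)^*) \in Num.nat.
Proof.
move=> sHG Nchi /lin_of_mulon[mu lmu Emu].
have -> : #|H|%:R^-1 * (\sum_(x in H) chi x * (lam x)^*) = '['Res[H] chi, mu].
  by rewrite cfdotE; congr (_ * _); apply: eq_bigr => x xH; rewrite cfResE // Emu.
exact: Cnat_cfdot_char (cfRes_char _ Nchi) (lin_charW lmu).
Qed.

(** If [chi] were a sum of two nonzero characters, so would be its induction, whose norm would be at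
    least 2. *)
Lemma Ind_irr_irr G H (chi : 'CF(H)) : H \subset G -> chi \is a character ->
  'Ind[G] chi \in irr G -> chi \in irr H.
Proof.
move=> sHG Nchi /irrP[i Ei].
have nz : chi != 0.
  by apply: contraNneq (irr_neq0 i) => c0; rewrite -Ei c0 raddf0.
have [j Hj] := neq0_has_constt nz.
have [xi Nxi Exi] : exists2 xi, xi \is a character & chi = 'chi_j + xi.
  by have /(constt_charP _ Nchi)[xi Nxi ->] := Hj; exists xi.
have Nind (phi : 'CF(H)) : phi \is a character -> 'Ind[G] phi \is a character.
  by apply: cfInd_char.
have Nj := Nind _ (irr_char j); have Nx := Nind _ Nxi.
have nzj : 'Ind[G] 'chi_j != 0 by rewrite cfInd_eq0 ?irr_char ?irr_neq0.
have n1 : '['Ind[G] 'chi_j + 'Ind[G] xi] = 1 by rewrite -raddfD -Exi /= Ei cfnorm_irr.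
rewrite Exi; have [-> | nzx] := eqVneq xi 0; first by rewrite addr0 mem_irr.
have nzIx : 'Ind[G] xi != 0 by rewrite cfInd_eq0.
have := n1; rewrite cfnormD.
have h1 := cfnorm_char_ge1 Nj nzj; have h2 := cfnorm_char_ge1 Nx nzIx.
have h3 : 0 <= '['Ind[G] 'chi_j, 'Ind[G] xi] by rewrite natr_ge0 ?Cnat_cfdot_char.
move=> E; suff : 2%:R <= 1 :> algC by rewrite lern1.
rewrite -[X in _ <= X]E (natrD _ 1 1) -[X in X <= _]addr0; apply: lerD; first exact: lerD.
by rewrite addr_ge0 ?conjC_ge0.
Qed.

(** Clifford's theorem for linear characters. The sum of the conjugates of [l1] gives an invariant
    class sum, which acts by a scalar, nonzero because [l1] occurs. Tested on the [l2]-part, it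
    shows that [l2] is not orthogonal to some conjugate of [l1], hence equals it. *)
Lemma irr_linear_trans G N (i : Iirr G) (l1 l2 : gT -> algC) :
  (N <| G)%g -> mulon N l1 -> mulon N l2 ->
  \sum_(x in N) (l1 x)^* * 'chi_i x != 0 ->
  \sum_(x in N) (l2 x)^* * 'chi_i x != 0 ->
  exists2 g, g \in G & {in N, forall x, l2 x = l1 (x ^ g)%g}.
Proof.
move=> nNG l1N l2N n1 n2; have [sNG nN] := andP nNG.
have JN x g : g \in G -> ((x ^ g)%g \in N) = (x \in N).
  by move=> gG; rewrite memJ_norm // (subsetP nN).
pose f x := \sum_(g in G) (l1 (x ^ g)%g)^*.
have [|w Hw] := @irr_class_sum G i N f sNG.
  move=> x g xN gG; rewrite JN //; split=> //; rewrite /f.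
  rewrite [RHS](reindex_inj (mulgI g)) /=; apply: eq_big => h.
    by rewrite /= groupMl.
  by rewrite conjgM.
have sum1 (g : gT) : g \in G ->
    \sum_(x in N) (l1 (x ^ g)%g)^* * 'chi_i x = \sum_(x in N) (l1 x)^* * 'chi_i x.
  move=> gG; rewrite [RHS](reindex_inj (conjg_inj g)) /=; apply: eq_big => x.
    by rewrite JN.
  by move=> xN; rewrite cfunJ.
have nzw : w != 0.
  have := Hw 1%g (group1 G); apply: contra_eq_neq => ->; rewrite mul0r.
  rewrite (eq_bigr (fun x => \sum_(g in G) (l1 (x ^ g)%g)^* * 'chi_i x)).
    rewrite exchange_big /= (eq_bigr (fun=> \sum_(x in N) (l1 x)^* * 'chi_i x)) //.
    by rewrite sumr_const mulrn_eq0 negb_or n1 andbT -lt0n cardG_gt0.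
  by move=> x xN; rewrite mul1g mulr_suml.
have: w * \sum_(x in N) (l2 x)^* * 'chi_i x != 0 by rewrite mulf_neq0.
have -> : w * \sum_(x in N) (l2 x)^* * 'chi_i x =
   \sum_(g in G) (\sum_(x in N) (l1 (x ^ g)%g)^* * l2 x) *
      \sum_(y in N) (l2 y)^* * 'chi_i y.
  rewrite mulr_sumr (eq_bigr (fun y => \sum_(g in G) \sum_(x in N)
      (l2 y)^* * ((l1 (x ^ g)%g)^* * 'chi_i (y * x)%g))); last first.
    move=> y yN; rewrite mulrCA -Hw ?(subsetP sNG) // mulr_sumr.
    rewrite exchange_big; apply: eq_bigr => x xN.
    by rewrite /f mulr_suml mulr_sumr.
  rewrite exchange_big; apply: eq_bigr => g gG; rewrite exchange_big /= mulr_suml.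
  apply: eq_bigr => x xN; rewrite mulr_sumr.
  rewrite [RHS](reindex_inj (mulIg x)) /=; apply: eq_big => y.
    by rewrite groupMr.
  move=> yN; case: (l2N) => _ ->  //; rewrite rmorphM.
  have := mulonV l2N xN; rewrite -(mulon_conj l2N xN) => l2x.
  rewrite [RHS](_ : _ = (l2 x * (l2 x)^*) * ((l1 (x ^ g)%g)^* * (l2 y)^* * 'chi_i (y * x)%g)).
    by rewrite l2x mul1r; ring.
  by ring.
case: (boolP [exists g in G, \sum_(x in N) (l1 (x ^ g)%g)^* * l2 x != 0]).
  case/exists_inP=> g gG nz _; exists g => // x xN.
  have l1g : mulon N (fun x => l1 (x ^ g)%g).
    case: l1N => l11 l1M; split=> [|y z yN zN]; first by rewrite conj1g.
    by rewrite conjMg l1M ?JN.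
  apply/eqP; apply: contraNT nz => ne.
  have fM := mulonM (mulonC l1g) l2N.
  apply/eqP; apply: (mulon_sum0 fM xN).
  apply: contraNneq ne => E; have := mulonV l1g xN.
  rewrite -(mulon_conj l1g xN) => E1.
  by rewrite -[l2 x]mul1r -E1 -mulrA E mulr1.
rewrite negb_exists_in => /forall_inP H0.
rewrite big1 ?eqxx // => g gG; have /negPn/eqP -> := H0 g gG.
by rewrite mul0r.
Qed.

(** For normal [P], the character of the space of [P]-fixed vectors; [cfFixE] is the averaging
    formula. Selecting constituents makes it evident that this part and its complement are
    characters. *)
Definition cfFix G P (phi : 'CF(G)) : 'CF(G) :=
  \sum_(i | P \subset cfker 'chi_i) '[phi, 'chi_i] *: 'chi_i.

Lemma cfFix_char G P (phi : 'CF(G)) : phi \is a character -> cfFix P phi \is a character.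
Proof.
move=> Nphi; apply: rpred_sum => i _.
have /natrP[n ->] := Cnat_cfdot_char_irr i Nphi.
by rewrite scaler_nat rpredMn ?irr_char.
Qed.

Lemma cfFixC G P (phi : 'CF(G)) :
  phi - cfFix P phi = \sum_(i | ~~ (P \subset cfker 'chi_i)) '[phi, 'chi_i] *: 'chi_i.
Proof.
rewrite {1}[phi]cfun_sum_cfdot /cfFix.
by rewrite (bigID (fun i => P \subset cfker 'chi_i)) /= addrAC subrr add0r.
Qed.

Lemma cfFixC_char G P (phi : 'CF(G)) :
  phi \is a character -> phi - cfFix P phi \is a character.
Proof.
move=> Nphi; rewrite cfFixC; apply: rpred_sum => i _.
have /natrP[n ->] := Cnat_cfdot_char_irr i Nphi.
by rewrite scaler_nat rpredMn ?irr_char.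
Qed.

Lemma cfFixE G P (phi : 'CF(G)) g : (P <| G)%g -> g \in G ->
  cfFix P phi g = #|P|%:R^-1 * \sum_(x in P) phi (g * x)%g.
Proof.
move=> nPG gG; have [sPG nP] := andP nPG.
have irr_case (i : Iirr G) : #|P|%:R^-1 * \sum_(x in P) 'chi_i (g * x)%g =
    (P \subset cfker 'chi_i)%:R * 'chi_i g.
  have [||b Hb] := @irr_isotypic G P (fun=> 1) i sPG.
  - by move=> x h xP hG; rewrite memJ_norm ?(subsetP nP).
  - by split=> // x y _ _; rewrite mulr1.
  have nzP : #|P|%:R != 0 :> algC by rewrite pnatr_eq0 -lt0n cardG_gt0.
  have {}Hb : {in G, forall g, #|P|%:R^-1 * \sum_(x in P) 'chi_i (g * x)%g = b%:R * 'chi_i g}.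
    move=> h hG; rewrite -Hb //; congr (_ * _); apply: eq_bigr => x _.
    by rewrite rmorph1 mul1r.
  rewrite Hb //; congr (_%:R * _).
  suff -> : b = (P \subset cfker 'chi_i) by [].
  apply/idP/subsetP => [bT y yP | sP].
    rewrite cfkerEirr inE; apply/eqP; have yG := subsetP sPG y yP.
    have := Hb y yG; rewrite bT mul1r => <-; have := Hb 1%g (group1 G).
    rewrite bT mul1r => <-; congr (_ * _).
    rewrite [RHS](reindex_inj (mulgI y)) /=; apply: eq_big => x.
      by rewrite groupMl.
    by rewrite mul1g.
  have := Hb 1%g (group1 G); rewrite (eq_bigr (fun=> 'chi_i 1%g)); last first.
    by move=> x xP; rewrite mul1g cfker1 ?sP.
  rewrite sumr_const -[X in _ * X = _]mulr_natl mulKf // => E.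
  have := irr1_neq0 i; rewrite E; case: (b) => //; by rewrite mul0r eqxx.
rewrite [in RHS](cfun_sum_cfdot phi) /cfFix sum_cfunE.
transitivity (\sum_i '[phi, 'chi_i] * (#|P|%:R^-1 * \sum_(x in P) 'chi_i (g * x)%g)).
  rewrite big_mkcond; apply: eq_bigr => i _; rewrite irr_case.
  by case: ifP => _; rewrite ?cfunE ?mul1r ?mul0r ?mulr0.
transitivity (#|P|%:R^-1 * \sum_(x in P) \sum_i '[phi, 'chi_i] * 'chi_i (g * x)%g).
  rewrite exchange_big mulr_sumr; apply: eq_bigr => i _.
  by rewrite mulrCA mulr_sumr.
by congr (_ * _); apply: eq_bigr => x _; rewrite sum_cfunE; apply: eq_bigr => i _; rewrite cfunE.
Qed.

Lemma cfker_cfFix G P (phi : 'CF(G)) : P \subset G -> P \subset cfker (cfFix P phi).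
Proof.
move=> sPG; apply: subset_trans (cfker_sum _ _ _); rewrite subsetI sPG /=.
apply/bigcapsP => i Pi; exact: subset_trans Pi (cfker_scale _ _).
Qed.

Lemma cfdot_cfFixC G P (phi chi : 'CF(G)) : chi \is a character ->
  P \subset cfker chi -> '[chi, phi - cfFix P phi] = 0.
Proof.
move=> Nchi kerP; rewrite cfFixC cfdot_sumr big1 // => i nPi.
rewrite cfdotZr; apply/eqP; rewrite mulf_eq0 orbC; apply/orP; left.
apply: contraR nPi => ci; apply: subset_trans kerP (cfker_constt Nchi _).
by rewrite irr_consttE.
Qed.

(** As [P] acts trivially in [Y], multiplication by [Y] respects both the [P]-fixed part and its
    complement, so the cross terms vanish. *)
Lemma cfdot_cfFix_split G P (Y phi psi : 'CF(G)) :
  Y \is a character -> phi \is a character -> psi \is a character ->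
  P \subset cfker Y ->
  '[Y * phi, psi] = '[Y * cfFix P phi, cfFix P psi] +
                    '[Y * (phi - cfFix P phi), psi - cfFix P psi].
Proof.
move=> NY Nphi Npsi kY; have sPG := subset_trans kY (cfker_sub Y).
have kF (xi : 'CF(G)) : P \subset cfker (Y * cfFix P xi).
  by apply: subset_trans (cfker_mul _ _); rewrite subsetI kY cfker_cfFix.
have kFc (xi : 'CF(G)) : P \subset cfker (Y^*%CF * cfFix P xi).
  by apply: subset_trans (cfker_mul _ _); rewrite subsetI cfker_aut kY cfker_cfFix.
have e1 : '[Y * cfFix P phi, psi - cfFix P psi] = 0.
  by apply: cfdot_cfFixC => //; rewrite rpredM ?cfFix_char.
have e2 : '[Y * (phi - cfFix P phi), cfFix P psi] = 0.
  transitivity ('[Y^*%CF * cfFix P psi, phi - cfFix P phi]^*).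
    rewrite -cfdotC !cfdotE; congr (_ * _); apply: eq_bigr => x xG.
    by rewrite !cfunE !rmorphM /= conjCK; ring.
  by rewrite cfdot_cfFixC ?rmorph0 // rpredM ?cfConjC_char ?cfFix_char.
rewrite cfdotBr in e1; rewrite -[X in '[_ * X, _] = _](subrK (cfFix P phi)).
rewrite mulrDr cfdotDl [RHS]addrC; congr (_ + _).
  by rewrite cfdotBr e2 subr0.
exact/subr0_eq.
Qed.

End CharacterTheory.

(** * Finite chain rings *)

Lemma card_eq_fibres (T U : finType) (A : {set T}) (f : T -> U) k :
  (forall x, x \in A -> #|[set y in A | f y == f x]| = k) ->
  (#|A| = k * #|f @: A|)%N.
Proof.
move=> fk; rewrite -sum1_card (partition_big_imset f) /=.
rewrite (eq_bigr (fun=> k)); last first.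
  move=> z /imsetP[x xA ->]; rewrite -(fk x xA) -sum1_card.
  by apply: eq_bigl => y; rewrite inE.
by rewrite sum_nat_const mulnC.
Qed.

(** Models the quotient o_l without its discrete valuation ring: every element is a unit or a
    multiple of [pi], and the residue cardinality [q] is encoded as the index of the ideal generated
    by [pi]. *)
Definition chain_ring (R : finComUnitRingType) (pi : R) (l q : nat) : Prop :=
  [/\ (1 < l)%N, pi ^+ l = 0 /\ pi ^+ l.-1 != 0,
      (forall x : R, x \is a GRing.unit \/ exists y, x = pi * y),
      q = (#|R| %/ #|[set (pi * x)%R | x in [set: R]]|)%N & odd q].

Section ChainRing.
Variables (R : finComUnitRingType) (pi : R) (l q : nat).
Hypothesis chainR : chain_ring pi l q.

Notation D i x := (dvdR (pi ^+ i) x).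

Lemma l_gt1 : (1 < l)%N. Proof. by case: chainR. Qed.
Lemma l_gt0 : (0 < l)%N. Proof. exact: ltnW l_gt1. Qed.
Lemma pil : pi ^+ l = 0. Proof. by case: chainR => _ []. Qed.
Lemma odd_q : odd q. Proof. by case: chainR. Qed.

Lemma unitVpi (x : R) : x \is a GRing.unit \/ exists y, x = pi * y.
Proof. by case: chainR => _ _ /(_ x). Qed.

Lemma DP i x : reflect (exists y, x = pi ^+ i * y) (D i x).
Proof.
apply: (iffP existsP) => [[y /eqP->]|[y ->]]; first by exists y.
by exists y.
Qed.

Lemma D0x x : D 0 x. Proof. by apply/DP; exists x; rewrite mul1r. Qed.
Lemma Dx0 i : D i 0. Proof. by apply/DP; exists 0; rewrite mulr0. Qed.

Lemma DD i x y : D i x -> D i y -> D i (x + y).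
Proof. by move=> /DP[a ->] /DP[b ->]; apply/DP; exists (a + b); rewrite mulrDr. Qed.

Lemma DMl i x y : D i x -> D i (y * x).
Proof. by move=> /DP[a ->]; apply/DP; exists (y * a); rewrite mulrCA. Qed.

Lemma DMr i x y : D i x -> D i (x * y).
Proof. by rewrite mulrC; apply: DMl. Qed.

Lemma DN i x : D i (- x) = D i x.
Proof. by apply/idP/idP => /(DMl (-1)); rewrite mulN1r ?opprK. Qed.

Lemma DB i x y : D i x -> D i y -> D i (x - y).
Proof. by move=> Dx Dy; apply: DD; rewrite ?DN. Qed.

Lemma DM i j x y : D i x -> D j y -> D (i + j) (x * y).
Proof.
move=> /DP[a ->] /DP[b ->]; apply/DP; exists (a * b).
by rewrite exprD; ring.
Qed.

Lemma Dpi i : D i (pi ^+ i).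
Proof. by apply/DP; exists 1; rewrite mulr1. Qed.

Lemma DpiM i x : D i (pi ^+ i * x).
Proof. by apply/DP; exists x. Qed.

Lemma DW i j x : (i <= j)%N -> D j x -> D i x.
Proof.
move=> lij /DP[a ->]; apply/DP; exists (pi ^+ (j - i) * a).
by rewrite mulrA -exprD subnKC.
Qed.

Lemma Dge i x : (l <= i)%N -> D i x -> x = 0.
Proof. by move=> li /(DW li) /DP[y ->]; rewrite pil mul0r. Qed.

Lemma pige i : (l <= i)%N -> pi ^+ i = 0.
Proof. by move=> li; apply: (Dge li); apply: Dpi. Qed.

Lemma Dl x : D l x = (x == 0).
Proof. by apply/idP/eqP => [/(Dge (leqnn _)) | ->]; rewrite ?Dx0. Qed.

Lemma DBC i x y : D i (x - y) = D i (y - x).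
Proof. by rewrite -DN opprB. Qed.

Lemma Dcong i x y : D i (x - y) -> D i x = D i y.
Proof.
move=> Dxy; apply/idP/idP => [Dx | Dy]; last by rewrite -(subrK y x) DD.
by rewrite -(subrK x y) DD // DBC.
Qed.

Lemma unitN1 (x : R) : x \is a GRing.unit = ~~ D 1 x.
Proof.
apply/idP/idP => [Ux|]; last first.
  by case: (unitVpi x) => // [[y ->]]; case/negP; apply/DP; exists y.
apply/negP => /DP[y Ey]; case: chainR => _ [_ /eqP nz] _ _ _; apply: nz.
apply: (mulrI Ux); rewrite mulr0 Ey mulrAC expr1 -exprS prednK ?l_gt0 //.
by rewrite pil mul0r.
Qed.

Lemma unit_congr (x y : R) : D 1 (x - y) -> (x \is a GRing.unit) = (y \is a GRing.unit).
Proof. by move=> h; rewrite !unitN1 (Dcong h). Qed.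

Lemma unit_addD (x y : R) : x \is a GRing.unit -> D 1 y -> x + y \is a GRing.unit.
Proof. by move=> Ux Dy; rewrite (@unit_congr _ x) // addrC addKr. Qed.

Lemma valuation x : x != 0 -> exists k u, [/\ (k < l)%N, u \is a GRing.unit & x = pi ^+ k * u].
Proof.
move=> nzx; have [Dn | //] : D l x \/ exists k u, [/\ (k < l)%N, u \is a GRing.unit & x = pi ^+ k * u].
  elim: l => [|n [/DP[y Ey] | [k [u [lk Uu Ex]]]]]; first by left; apply: D0x.
    case: (unitVpi y) => [Uy | [z Ez]]; first by right; exists n, y.
    by left; apply/DP; exists z; rewrite Ey Ez mulrA exprSr.
  by right; exists k, u; split=> //; apply: ltnW.
by rewrite Dl (negPf nzx) in Dn.
Qed.

Lemma nzpi i : (i < l)%N -> pi ^+ i != 0.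
Proof.
move=> li; case: chainR => _ [_ nz] _ _ _; apply: contraNneq nz => i0.
by rewrite -(subnKC (_ : i <= l.-1)%N) ?exprD ?i0 ?mul0r // -ltnS prednK ?l_gt0.
Qed.

Lemma pi_unit_eq0 i (u : R) : u \is a GRing.unit -> (pi ^+ i * u == 0) = (l <= i)%N.
Proof.
move=> Uu; rewrite mulrC -{1}(mulr0 u) (inj_eq (mulrI Uu)).
by case: leqP => [/pige->|/nzpi/negPf]; rewrite ?eqxx.
Qed.

Lemma Dann i x : (i <= l)%N -> (pi ^+ i * x == 0) = D (l - i) x.
Proof.
move=> li; apply/eqP/idP => [ix0|/DP[y ->]]; last by rewrite mulrA -exprD subnKC // pil mul0r.
have [->|/valuation[k [u [lk Uu Ex]]]] := eqVneq x 0; first exact: Dx0.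
move/eqP: ix0; rewrite Ex mulrA -exprD pi_unit_eq0 // => lik.
by apply: DMr; apply: DW (Dpi k); rewrite leq_subLR.
Qed.

Lemma DpiE i j x : (i + j <= l)%N -> D (i + j) (pi ^+ i * x) = D j x.
Proof.
move=> lij; apply/idP/idP => [/DP[y]|]; last by move=> ?; apply: DM => //; apply: Dpi.
rewrite exprD -mulrA => /eqP; rewrite -subr_eq0 -mulrBr Dann; last by lia.
move=> /(@DW j); rewrite (_ : (j <= l - i)%N = true); last by lia.
by move=> /(_ isT) /Dcong->; apply: DpiM.
Qed.

Definition ideal i : {set R} := [set x | D i x].

Lemma idealS_im i : ideal i.+1 = [set pi * x | x in ideal i].
Proof.
apply/setP=> x; rewrite inE; apply/DP/imsetP => [[y ->]|[y]].
  by exists (pi ^+ i * y); rewrite ?inE ?DpiM // mulrA exprS.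
by rewrite inE => /DP[z ->] ->; exists z; rewrite mulrA exprS.
Qed.

(** Multiplication by [pi] maps [ideal i] onto [ideal i.+1] with kernel the socle [ideal l.-1], so
    all steps of the filtration have the same index. *)
Lemma card_ideal_step i : (i < l)%N -> (#|ideal i| = #|ideal l.-1| * #|ideal i.+1|)%N.
Proof.
move=> li; rewrite idealS_im; apply: card_eq_fibres => x; rewrite inE => Dx.
rewrite -[RHS](card_imset _ (addrI x)); apply: eq_card => y; rewrite !inE.
apply/andP/imsetP => [[Dy /eqP Exy]|[z]].
  exists (y - x); last by rewrite addrC subrK.
  rewrite inE -subn1 -Dann ?l_gt0 // expr1 mulrBr Exy subrr eqxx //.
rewrite inE -subn1 -Dann ?l_gt0 // expr1 => /eqP pz ->.
rewrite mulrDr pz addr0 eqxx; split=> //; apply: DD => //.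
apply: (@DW i (l - 1)); first by lia.
by rewrite -Dann ?l_gt0 // expr1 pz.
Qed.

Lemma qE : q = #|ideal l.-1|.
Proof.
case: chainR => _ _ _ Eq _.
have E0 : ideal 0 = [set: R] by apply/setP=> x; rewrite !inE D0x.
have := card_ideal_step l_gt0; rewrite idealS_im E0 cardsT => ER.
have gt0 : (0 < #|[set (pi * x)%R | x in [set: R]]|)%N.
  by apply/card_gt0P; exists (pi * 0); apply: imset_f; rewrite inE.
by rewrite Eq ER mulnK.
Qed.

Lemma card_ideal i : (i <= l)%N -> #|ideal i| = (q ^ (l - i))%N.
Proof.
move=> li; rewrite -{1}(subKn li); have: (l - i <= l)%N by rewrite leq_subr.
elim: (l - i)%N => [_|n IHn ln].
  rewrite subn0 expn0 -(cards1 (0 : R)); apply: eq_card => x.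
  by rewrite !inE Dl.
rewrite card_ideal_step; last by lia.
by rewrite -qE (_ : (l - n.+1).+1 = l - n)%N ?IHn ?expnS; lia.
Qed.

Lemma card_R : #|R| = (q ^ l)%N.
Proof.
rewrite -cardsT -[l in RHS]subn0 -card_ideal //.
by apply: eq_card => x; rewrite !inE D0x.
Qed.

Definition units : {set R} := [set x | x \is a GRing.unit].

Lemma unitsC : units = ~: ideal 1.
Proof. by apply/setP=> x; rewrite !inE unitN1. Qed.

Lemma card_units : #|units| = (q ^ l - q ^ l.-1)%N.
Proof. by rewrite unitsC cardsCs setCK card_R card_ideal ?l_gt0 // subn1. Qed.

Lemma q_gt0 : (0 < q)%N. Proof. by have := odd_q; case: q. Qed.

Lemma q_gt1 : (1 < q)%N.
Proof.
have [|//] := leqP q 1; move=> q1; have q1' : q = 1%N by have := q_gt0; lia.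
have := card_R; rewrite q1' exp1n => /eqP/fintype1P[x Ex].
by have := oner_neq0 R; rewrite (Ex 1) (Ex 0) eqxx.
Qed.

Lemma card_unitsE : #|units| = ((q - 1) * q ^ l.-1)%N.
Proof. by rewrite card_units mulnBl mul1n -expnS prednK // l_gt0. Qed.

(** Otherwise 2 would annihilate the socle, an additive group of odd order [q] that contains the
    nonzero element [pi ^+ l.-1]. *)
Lemma unit2 : (2%:R : R) \is a GRing.unit.
Proof.
rewrite unitN1; apply/negP => /DP[y]; rewrite expr1 => E2.
have nz := nzpi (_ : l.-1 < l)%N; have {}nz := nz (ltac:(rewrite prednK ?l_gt0 //)).
have H2 (x : R) : x \in ideal l.-1 -> x + x = 0.
  rewrite inE => /DP[z ->]; rewrite -mulr2n -mulr_natl E2.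
  rewrite (_ : pi * y * _ = pi * pi ^+ l.-1 * (y * z)); last by ring.
  by rewrite -exprS prednK ?l_gt0 // pil mul0r.
have /= := odd_q; rewrite qE => oddI.
have gI : group_set (ideal l.-1).
  apply/group_setP; split=> [|x z]; first by rewrite inE Dx0.
  by rewrite !inE; apply: DD.
pose p0 := pi ^+ l.-1; have := order_dvdG (_ : p0 \in Group gI); rewrite inE Dpi => /(_ isT).
have : (#[p0]%g %| 2)%N.
  by rewrite order_dvdn; apply/eqP; apply: H2; rewrite inE Dpi.
rewrite dvdn_divisors // !inE => /orP[/eqP o1|/eqP->]; last first.
  by rewrite dvdn2 /= oddI.
by move: (o1) => /eqP; rewrite order_eq1 => /eqP pi0; rewrite -/p0 pi0 eqxx in nz.
Qed.

Lemma unit2V (x : R) : 2%:R^-1 * x *+ 2 = x.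
Proof. by rewrite -mulr_natl mulVKr ?unit2. Qed.

Lemma D2 i (x : R) : D i (x *+ 2) = D i x.
Proof.
apply/idP/idP => [/(DMl 2%:R^-1)|Dx]; first by rewrite mulrnAr unit2V.
by rewrite mulr2n DD.
Qed.

Lemma DUl i (u x : R) : u \is a GRing.unit -> D i (u * x) = D i x.
Proof. by move=> Uu; apply/idP/idP => [/(DMl u^-1)|/(DMl u)]; rewrite ?mulKr. Qed.

Lemma DUr i (u x : R) : u \is a GRing.unit -> D i (x * u) = D i x.
Proof. by rewrite mulrC; apply: DUl. Qed.

Variable psi : R -> algC.
Hypothesis psi_add : additive_char psi.
Hypothesis psi_nt : exists2 x, x \in [set: R] & psi (pi ^+ l.-1 * x) != 1.

Lemma psi0 : psi 0 = 1. Proof. by case: psi_add. Qed.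
Lemma psiD x y : psi (x + y) = psi x * psi y. Proof. by case: psi_add. Qed.

Lemma psi_mulon : mulon [set: R] psi.
Proof. by split=> [|x y _ _]; [apply: psi0 | apply: psiD]. Qed.

Lemma psi_norm x : `|psi x| = 1.
Proof. exact: (@mulon_norm _ [set: R]%G _ _ psi_mulon). Qed.

Lemma psi_conj x : (psi x)^* = psi (- x).
Proof. exact: (@mulon_conj _ [set: R]%G _ _ psi_mulon). Qed.

Lemma psi_neq0 x : psi x != 0.
Proof. by rewrite -normr_gt0 psi_norm ltr01. Qed.

Lemma psi_conjM x : psi x * (psi x)^* = 1.
Proof. by rewrite psi_conj -psiD subrr psi0. Qed.

Lemma psi_nondeg i a : (i <= l)%N -> (forall x, D i x -> psi (a * x) = 1) -> D (l - i) a.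
Proof.
move=> li Ha; have [->|/valuation[k [u [lk Uu Ea]]]] := eqVneq a 0; first exact: Dx0.
rewrite Ea; apply: DMr; have [lik|ki] := leqP (l - i)%N k; first exact: DW lik (Dpi k).
have [x _ /eqP[]] := psi_nt.
(* If the valuation [k] of [a] were below [l - i], multiples of [a] by elements of p^i would fill
   the socle, where [psi] is not trivial. *)
have := Ha (u^-1 * pi ^+ (l.-1 - k) * x); rewrite Ea.
rewrite (_ : pi ^+ k * u * _ = (u * u^-1) * (pi ^+ k * pi ^+ (l.-1 - k)) * x); last by ring.
rewrite mulrV // mul1r -exprD subnKC; last by lia.
by apply; apply: DMr; apply: DMl; apply: DW (Dpi _); lia.
Qed.

Lemma psi_nondeg0 a : (forall x, psi (a * x) = 1) -> a = 0.
Proof. by move=> Ha; apply/eqP; rewrite -Dl -[l]subn0; apply: psi_nondeg. Qed.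

Lemma sum_psi_ideal i a : (i <= l)%N ->
  \sum_(x in ideal i) psi (a * x) = if D (l - i) a then (q ^ (l - i))%:R else 0.
Proof.
move=> li; case: ifPn => [Da|nDa].
  rewrite (eq_bigr (fun=> 1)) => [|x].
    by rewrite sumr_const card_ideal.
  rewrite inE => Dx; rewrite (_ : a * x = 0) ?psi0 //.
  by apply: (@Dge (l - i + i)); [lia | apply: DM].
have gI : group_set (ideal i).
  apply/group_setP; split=> [|x z]; first by rewrite inE Dx0.
  by rewrite !inE; apply: DD.
have fM : mulon (Group gI) (fun x => psi (a * x)).
  split=> [|x y _ _]; first by rewrite (_ : a * _ = 0) ?psi0 ?mulr0.
  by rewrite -psiD -mulrDr.
have /existsP[x /andP[xI nx]] : [exists x, (x \in ideal i) && (psi (a * x) != 1)].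
  apply: contraNT nDa; rewrite negb_exists => /forallP nE.
  apply: psi_nondeg => // x Dx; apply/eqP; have := nE x.
  by rewrite inE Dx negbK.
exact: (mulon_sum0 fM xI nx).
Qed.

Lemma sum_psi a : \sum_x psi (a * x) = if a == 0 then (q ^ l)%:R else 0.
Proof.
have := sum_psi_ideal a (leq0n l); rewrite subn0 Dl => <-.
by apply: eq_bigl => x; rewrite inE D0x.
Qed.

End ChainRing.

(** * Two by two matrices *)

Section Matrix2.
Variable R : comUnitRingType.

Definition mx2 (a b c d : R) : 'M[R]_2 :=
  \matrix_(i, j) (if i == 0 then (if j == 0 then a else b)
                  else (if j == 0 then c else d)).

Lemma mx2E a b c d : (mx2 a b c d 0 0 = a) * (mx2 a b c d 0 1 = b) *
  (mx2 a b c d 1 0 = c) * (mx2 a b c d 1 1 = d).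
Proof. by rewrite !mxE. Qed.

Lemma eq_mx2 (A B : 'M[R]_2) : A 0 0 = B 0 0 -> A 0 1 = B 0 1 ->
  A 1 0 = B 1 0 -> A 1 1 = B 1 1 -> A = B.
Proof.
move=> h00 h01 h10 h11; apply/matrixP=> i j.
have I2 (k : 'I_2) : k = 0 \/ k = 1.
  by case: k => [[|[|//]] ?]; [left | right]; apply: val_inj.
by case: (I2 i) => ->; case: (I2 j) => ->.
Qed.

Lemma mx2_eta (A : 'M[R]_2) : A = mx2 (A 0 0) (A 0 1) (A 1 0) (A 1 1).
Proof. by apply: eq_mx2; rewrite mx2E. Qed.

Lemma mulmx2E (A B : 'M[R]_2) i j : (A *m B) i j = A i 0 * B 0 j + A i 1 * B 1 j.
Proof. by rewrite mxE !big_ord_recl big_ord0 addr0; congr (A i _ * B _ j + A i _ * B _ j); apply: val_inj. Qed.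

Lemma mx2M a b c d a' b' c' d' : mx2 a b c d *m mx2 a' b' c' d' =
  mx2 (a * a' + b * c') (a * b' + b * d') (c * a' + d * c') (c * b' + d * d').
Proof. by apply: eq_mx2; rewrite mulmx2E !mx2E. Qed.

Lemma mx2D a b c d a' b' c' d' : mx2 a b c d + mx2 a' b' c' d' =
  mx2 (a + a') (b + b') (c + c') (d + d').
Proof. by apply: eq_mx2; rewrite mxE !mx2E. Qed.

Lemma mx2N a b c d : - mx2 a b c d = mx2 (- a) (- b) (- c) (- d).
Proof. by apply: eq_mx2; rewrite mxE !mx2E. Qed.

Lemma mx2Z k a b c d : k *: mx2 a b c d = mx2 (k * a) (k * b) (k * c) (k * d).
Proof. by apply: eq_mx2; rewrite mxE !mx2E. Qed.

Lemma mx2_scalar a : a%:M = mx2 a 0 0 a.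
Proof. by apply: eq_mx2; rewrite mxE mx2E. Qed.

Lemma mx2_tr (A : 'M[R]_2) : \tr A = A 0 0 + A 1 1.
Proof. by rewrite /mxtrace !big_ord_recl big_ord0 addr0; congr (_ + A _ _); apply: val_inj. Qed.

Lemma mx2_det (A : 'M[R]_2) : \det A = A 0 0 * A 1 1 - A 0 1 * A 1 0.
Proof.
rewrite (expand_det_row _ 0) !big_ord_recl big_ord0 addr0 /cofactor !det_mx11 !mxE /=.
have -> : lift 0 (0 : 'I_1) = 1 :> 'I_2 by apply: val_inj.
have -> : lift 1 (0 : 'I_1) = 0 :> 'I_2 by apply: val_inj.
by rewrite /= expr0 expr1 mul1r mulN1r mulrN.
Qed.

Lemma mx2_inj a b c d a' b' c' d' : mx2 a b c d = mx2 a' b' c' d' ->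
  [/\ a = a', b = b', c = c' & d = d'].
Proof. by move=> E; split; [have := congr1 (fun A : 'M_2 => A 0 0) E | have := congr1 (fun A : 'M_2 => A 0 1) E | have := congr1 (fun A : 'M_2 => A 1 0) E | have := congr1 (fun A : 'M_2 => A 1 1) E]; rewrite !mx2E. Qed.

End Matrix2.

Section IdempotentRank.
Variables (F : fieldType) (n : nat) (E : 'M[F]_n).
Hypothesis EE : E *m E = E.

Lemma idempotent_baseK : row_base E *m col_base E = 1%:M.
Proof.
have fr := row_base_free E; have fc := col_base_full E.
apply: (row_full_inj fc); apply: (row_free_inj fr) => /=.
by rewrite mulmx1 mulmxA mulmx_base -mulmxA mulmx_base EE.
Qed.

Lemma mxtrace_idempotent : \tr E = (\rank E)%:R.
Proof. by rewrite -{1}(mulmx_base E) mxtrace_mulC idempotent_baseK mxtrace1. Qed.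

(** Through a rank factorization of [E] the corner is a full matrix algebra of size [\rank E], and
    two elementary matrices fail to commute once that size reaches 2. *)
Lemma commutative_corner_rank :
  (forall X Y, (E *m X *m E) *m (E *m Y *m E) = (E *m Y *m E) *m (E *m X *m E)) ->
  (\rank E <= 1)%N.
Proof.
move=> cE; rewrite leqNgt; apply/negP => r2.
have := idempotent_baseK; have := mulmx_base E.
move: (\rank E) r2 (col_base E) (row_base E) => r r2 C L CL LC.
have EC : E *m C = C by rewrite -CL -mulmxA LC mulmx1.
have LE : L *m E = L by rewrite -CL mulmxA LC mul1mx.
have EX (P : 'M[F]_r) : E *m (C *m P *m L) *m E = C *m P *m L.
  by rewrite -!mulmxA LE [E *m (C *m _)]mulmxA EC.
have cPQ (P Q : 'M[F]_r) : P *m Q = Q *m P.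
  have M P1 P2 : (C *m P1 *m L) *m (C *m P2 *m L) = C *m (P1 *m P2) *m L.
    by rewrite -!mulmxA [L *m (C *m _)]mulmxA LC mul1mx.
  have K P1 : L *m (C *m P1 *m L) *m C = P1.
    by rewrite -!mulmxA LC mulmx1 mulmxA LC mul1mx.
  by have := cE (C *m P *m L) (C *m Q *m L); rewrite !EX !M => E1; rewrite -(K (P *m Q)) E1 K.
pose i0 := Ordinal (ltnW r2); pose i1 := Ordinal r2.
have := cPQ (delta_mx i0 i1) (delta_mx i1 i0).
rewrite !mul_delta_mx => /matrixP/(_ i0 i0); rewrite !mxE !eqxx /=.
by move/eqP; rewrite oner_eq0.
Qed.

End IdempotentRank.

(** * Uniqueness of Whittaker functionals *)

Section GL2.
Variable R : finComUnitRingType.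

(** Falls back to the identity when the determinant is not a unit, so every computation with [gl]
    carries a determinant side condition. *)
Definition gl (a b c d : R) : {'GL_2[R]} := insubd (1%g : {'GL_2[R]}) (mx2 a b c d).

Lemma gl_val a b c d : a * d - b * c \is a GRing.unit -> GLval (gl a b c d) = mx2 a b c d.
Proof.
move=> U; rewrite /gl -[GLval _]/(val _) val_insubd ifT //.
by change (mx2 a b c d \in unitmx); rewrite unitmxE mx2_det !mx2E.
Qed.

Notation e00 g := (GLval g 0 0).
Notation e01 g := (GLval g 0 1).
Notation e10 g := (GLval g 1 0).
Notation e11 g := (GLval g 1 1).

Lemma gl_det (g : {'GL_2[R]}) : e00 g * e11 g - e01 g * e10 g \is a GRing.unit.
Proof. by rewrite -mx2_det -unitmxE; exact: (valP g). Qed.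

Lemma gl_eta (g : {'GL_2[R]}) : gl (e00 g) (e01 g) (e10 g) (e11 g) = g.
Proof. by apply: val_inj; rewrite /= gl_val ?gl_det // -mx2_eta. Qed.

Lemma gl_eq (g h : {'GL_2[R]}) : GLval g = GLval h -> g = h.
Proof. exact: val_inj. Qed.

Lemma glM a b c d a' b' c' d' :
  a * d - b * c \is a GRing.unit -> a' * d' - b' * c' \is a GRing.unit ->
  (gl a b c d * gl a' b' c' d')%g =
  gl (a * a' + b * c') (a * b' + b * d') (c * a' + d * c') (c * b' + d * d').
Proof.
move=> U U'; apply: gl_eq; rewrite GL_MxE !gl_val // ?mx2M //.
rewrite (_ : _ - _ = (a * d - b * c) * (a' * d' - b' * c')) ?unitrM ?U //; ring.
Qed.

Lemma gl_inj a b c d a' b' c' d' :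
  a * d - b * c \is a GRing.unit -> a' * d' - b' * c' \is a GRing.unit ->
  gl a b c d = gl a' b' c' d' -> [/\ a = a', b = b', c = c' & d = d'].
Proof. by move=> U U' /(congr1 (@GLval _ _)); rewrite !gl_val // => /mx2_inj. Qed.

Definition u x := gl 1 x 0 1.
Definition v x := gl 1 0 x 1.
Definition dg a d := gl a 0 0 d.

Lemma det_u x : 1 * 1 - x * 0 \is a @GRing.unit R.
Proof. by rewrite mulr0 subr0 mulr1 unitr1. Qed.
Lemma det_v x : 1 * 1 - 0 * x \is a @GRing.unit R.
Proof. by rewrite mul0r subr0 mulr1 unitr1. Qed.
Lemma det_dg (a d : R) : a \is a GRing.unit -> d \is a GRing.unit ->
  a * d - 0 * 0 \is a GRing.unit.
Proof. by move=> Ua Ud; rewrite mulr0 subr0 unitrM Ua. Qed.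

Lemma uM x y : (u x * u y)%g = u (x + y).
Proof. by rewrite /u glM ?det_u //; congr gl; ring. Qed.
Lemma vM x y : (v x * v y)%g = v (x + y).
Proof. by rewrite /v glM ?det_v //; congr gl; ring. Qed.
Lemma u0 : u 0 = 1%g.
Proof. by apply: (mulgI (u 0)); rewrite uM addr0 mulg1. Qed.
Lemma v0 : v 0 = 1%g.
Proof. by apply: (mulgI (v 0)); rewrite vM addr0 mulg1. Qed.
Lemma uV x : (u x)^-1%g = u (- x).
Proof. by apply: (mulgI (u x)); rewrite mulgV uM subrr u0. Qed.
Lemma vV x : (v x)^-1%g = v (- x).
Proof. by apply: (mulgI (v x)); rewrite mulgV vM subrr v0. Qed.
Lemma u_inj : injective u.
Proof. by move=> x y /gl_inj[] //; apply: det_u. Qed.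
Lemma v_inj : injective v.
Proof. by move=> x y /gl_inj[] //; apply: det_v. Qed.

Definition GG : {group {'GL_2[R]}} := [set: {'GL_2[R]}]%G.

Lemma inGG g : g \in GG. Proof. by rewrite inE. Qed.

(* Conjugate elements are given by a commutation relation, avoiding inverses. *)
Lemma class_eq (chi : 'CF(GG)) x y g : (x * g)%g = (g * y)%g -> chi x = chi y.
Proof.
move=> E; have -> : y = (x ^ g)%g by rewrite conjgE E mulKg.
by rewrite cfunJ ?inGG.
Qed.

(** The transpose conjugated by the antidiagonal permutation, hence an anti-automorphism. *)
Definition sg (g : {'GL_2[R]}) := gl (e11 g) (e01 g) (e10 g) (e00 g).

Lemma det_sg (g : {'GL_2[R]}) : e11 g * e00 g - e01 g * e10 g \is a GRing.unit.
Proof. by rewrite mulrC gl_det. Qed.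

Lemma sgM g h : sg (g * h)%g = (sg h * sg g)%g.
Proof.
rewrite /sg glM ?det_sg // GL_MxE !mulmx2E; congr gl; ring.
Qed.

Lemma sg_u x : sg (u x) = u x.
Proof. by rewrite /sg /u gl_val ?det_u // !mx2E. Qed.

Variables (pi : R) (l q : nat) (psi : R -> algC).
Hypothesis chainR : chain_ring pi l q.
Hypothesis psi_add : additive_char psi.
Hypothesis psi_nt : exists2 x, x \in [set: R] & psi (pi ^+ l.-1 * x) != 1.

Notation D i x := (dvdR (pi ^+ i) x).

Section Whittaker.
Variables (b : R) (i : Iirr GG).
Hypothesis Ub : b \is a GRing.unit.
Let n := irr_degree (socle_of_Iirr i).
Variable rG : mx_representation algC GG n.
Hypothesis irr_rG : mx_absolutely_irreducible rG.
Hypothesis rG_chi : cfRepr rG = 'chi_i.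

(** Up to the factor [#|R|], the projector onto the vectors on which [u x] acts by [psi (b * x)]. *)
Let e := \sum_x psi (- (b * x)) *: rG (u x).

Let e_u x : e *m rG (u x) = psi (b * x) *: e.
Proof.
rewrite mulmx_suml scaler_sumr [RHS](reindex_inj (addIr x)) /=.
apply: eq_bigr => y _; rewrite -scalemxAl -repr_mxM ?inGG // uM scalerA -psiD //.
by congr (psi _ *: _); ring.
Qed.

Let u_e x : rG (u x) *m e = psi (b * x) *: e.
Proof.
rewrite mulmx_sumr scaler_sumr [RHS](reindex_inj (addrI x)) /=.
apply: eq_bigr => y _; rewrite -scalemxAr -repr_mxM ?inGG // uM scalerA -psiD //.
by congr (psi _ *: _); ring.
Qed.

Let ee : e *m e = #|R|%:R *: e.
Proof.
rewrite {2}/e mulmx_sumr (eq_bigr (fun=> e)) => [|x _].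
  by rewrite sumr_const scaler_nat.
by rewrite -scalemxAr e_u scalerA -psiD // addNr psi0 // scale1r.
Qed.

(** Under the hypothesis some [x] annihilated by [e10 g] satisfies [u x ** g = g ** u y] although
    [psi (b * x)] and [psi (b * y)] differ. Sandwiching the equation between two copies of [e] gives
    0. *)
Let ege0 (g : {'GL_2[R]}) : (forall y, e00 g - e11 g <> e10 g * y) -> e *m rG g *m e = 0.
Proof.
move=> nE; have [k [w [lk Uw Ec]]] : exists k w, [/\ (k <= l)%N, w \is a GRing.unit & e10 g = pi ^+ k * w].
  have [->|/(valuation chainR)[k [w [lk Uw ->]]]] := eqVneq (e10 g) 0.
    by exists l, 1; rewrite unitr1 (pil chainR) mul0r.
  by exists k, w; split=> //; apply: ltnW.
have Ug := gl_det g.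
have k0 : (0 < k)%N.
  rewrite lt0n; apply/eqP => k0; apply: (nE ((e10 g)^-1 * (e00 g - e11 g))).
  by rewrite mulVKr // Ec k0 expr0 mul1r.
have Uad : e00 g * e11 g \is a GRing.unit.
  rewrite -(subrK (e01 g * e10 g) (_ * _)) (unit_addD chainR) //.
  by apply: DMl; rewrite Ec; apply: DMr; apply: DW (Dpi _ _).
move: (Uad); rewrite unitrM => /andP[Ua Ud].
have /existsP[x /andP[Dx Px]] : [exists x, D (l - k) x && (psi (b * (1 - e11 g / e00 g) * x) != 1)].
  apply: contraT; rewrite negb_exists => /forallP nX.
  have /DP[y Ey] : D k (b * (1 - e11 g / e00 g)).
    rewrite -(subKn lk); apply: (psi_nondeg chainR psi_nt); first exact: leq_subr.
    by move=> x Dx; apply/eqP; have := nX x; rewrite Dx negbK.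
  case: (nE (w^-1 * (b^-1 * y * e00 g))); rewrite Ec.
  rewrite (_ : pi ^+ k * w * _ = (w * w^-1) * (b^-1 * (pi ^+ k * y) * e00 g)); last by ring.
  by rewrite -Ey mulKr // mulrV // mul1r mulrBl mul1r divrK.
have xc : x * e10 g = 0.
  by apply: (Dge chainR (_ : l <= (l - k) + k)%N); [lia | rewrite Ec; apply: DM => //; apply: DpiM].
pose y := x * e11 g / e00 g.
have ay : e00 g * y = x * e11 g by rewrite mulrC divrK.
have E : (u x * g)%g = (g * u y)%g.
  apply: gl_eq; rewrite !GL_MxE /u !gl_val ?det_u //.
  apply: eq_mx2; rewrite !mulmx2E !mx2E ?mul0r ?mul1r ?mulr0 ?mulr1 ?add0r ?addr0 //.
  - by rewrite xc addr0.
  - by rewrite ay addrC.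
  - have -> : e10 g * y = e11 g / e00 g * (x * e10 g) by rewrite /y; ring.
    by rewrite xc mulr0 add0r.
have := congr1 (fun M => e *m M *m e) (congr1 rG E).
rewrite /= !repr_mxM ?inGG // !mulmxA e_u -!mulmxA u_e -scalemxAl -!scalemxAr.
move/eqP; rewrite -subr_eq0 -scalerBl scaler_eq0 mulmxA => /orP[|/eqP//].
rewrite subr_eq0 => /eqP Exy; case/eqP: Px.
rewrite (_ : b * _ * x = b * x - b * y); last by rewrite /y; ring.
by rewrite psiD // Exy -psiD // subrr psi0.
Qed.

(* The anti-involution sg fixes every double coset of the unipotent group that
   supports a Whittaker function. *)
Let ege_sg (g : {'GL_2[R]}) : e *m rG g *m e = e *m rG (sg g) *m e.
Proof.
case: (boolP [exists y, e00 g - e11 g == e10 g * y]) => [/existsP[y /eqP Ey]|].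
  have -> : sg g = (u (- y) * g * u y)%g.
    apply: gl_eq; rewrite !GL_MxE /sg /u !gl_val ?det_u ?det_sg //.
    apply: eq_mx2; rewrite !mulmx2E !mx2E ?mul0r ?mul1r ?mulr0 ?mulr1 ?add0r ?addr0 //.
    - by rewrite mulNr mulrC -Ey; ring.
    - by rewrite -(subrK (e11 g) (e00 g)) Ey; ring.
    - by rewrite -(subrK (e11 g) (e00 g)) Ey; ring.
  rewrite !repr_mxM ?inGG // !mulmxA e_u -!mulmxA u_e -scalemxAl -!scalemxAr scalerA.
  by rewrite -psiD // mulrN addNr psi0 // scale1r.
rewrite negb_exists => /forallP nE; rewrite !ege0 // => [y|y] Ey.
  move: Ey; rewrite /sg gl_val ?det_sg // !mx2E => Ey.
  by have /eqP[] := nE (- y); rewrite mulrN -Ey opprB.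
by have /eqP[] := nE y.
Qed.

Let eghe (g h : {'GL_2[R]}) : e *m rG g *m e *m rG h *m e = e *m rG h *m e *m rG g *m e.
Proof.
have esum (X Y : 'M_n) : X *m e *m Y = \sum_x psi (- (b * x)) *: (X *m rG (u x) *m Y).
  rewrite mulmx_sumr mulmx_suml; apply: eq_bigr => x _.
  by rewrite -scalemxAr -scalemxAl.
(* Expanding the middle [e] leaves single group elements, on which the anti-involution reverses the
   order of the factors. *)
have step g1 h1 : e *m rG g1 *m e *m rG h1 *m e = e *m rG (sg h1) *m e *m rG (sg g1) *m e.
  rewrite -(mulmxA (_ *m e) (rG h1)) -(mulmxA (_ *m e) (rG (sg g1))) !esum.
  apply: eq_bigr => x _; congr (_ *: _); rewrite !mulmxA.
  rewrite -!(mulmxA e) -!repr_mxM ?inGG // !mulmxA ege_sg.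
  by rewrite !sgM sg_u !mulgA.
have nz : #|R|%:R != 0 :> algC by rewrite pnatr_eq0 -lt0n; apply/card_gt0P; exists 0.
apply: (scalerI nz); rewrite step.
have tr X Y : #|R|%:R *: (e *m X *m e *m Y *m e) = (e *m X *m e) *m (e *m Y *m e).
  by rewrite !mulmxA -(mulmxA _ e e) ee -scalemxAr -!scalemxAl.
by rewrite !tr -!ege_sg.
Qed.

(** An absolutely irreducible representation spans the full matrix algebra, so commutation for group
    elements extends linearly to the corner. *)
Let corner_comm (f : 'M_n) (k : algC) : f *m f = k *: f ->
  (forall g h : {'GL_2[R]}, f *m rG g *m f *m rG h *m f = f *m rG h *m f *m rG g *m f) ->
  forall X Y, (f *m X *m f) *m (f *m Y *m f) = (f *m Y *m f) *m (f *m X *m f).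
Proof.
move=> ff cf; have [_ [a_ Ha]] := mx_abs_irrP irr_rG.
have red X Y : (f *m X *m f) *m (f *m Y *m f) = k *: (f *m X *m f *m Y *m f).
  by rewrite !mulmxA -(mulmxA _ f f) ff -scalemxAr -!scalemxAl.
have linL X Y : f *m X *m f *m Y *m f = \sum_(g in GG) a_ g X *: (f *m rG g *m f *m Y *m f).
  rewrite {1}(Ha X) mulmx_sumr !mulmx_suml; apply: eq_bigr => g _.
  by rewrite -scalemxAr -!scalemxAl.
have linR X Y : f *m X *m f *m Y *m f = \sum_(g in GG) a_ g Y *: (f *m X *m f *m rG g *m f).
  rewrite {1}(Ha Y) mulmx_sumr !mulmx_suml; apply: eq_bigr => g _.
  by rewrite -scalemxAr -!scalemxAl.
move=> X Y; rewrite !red; congr (_ *: _); rewrite linL [RHS]linR.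
apply: eq_bigr => g _; congr (_ *: _); rewrite linR [RHS]linL.
by apply: eq_bigr => h _; rewrite cf.
Qed.

Lemma whittaker_rank : exists2 k : nat, (k <= 1)%N &
  (q ^ l)%:R^-1 * \sum_x 'chi_i (u x) * psi (- (b * x)) = k%:R.
Proof.
have nz : #|R|%:R != 0 :> algC by rewrite pnatr_eq0 -lt0n; apply/card_gt0P; exists 0.
pose E := #|R|%:R^-1 *: e.
have EE : E *m E = E.
  by rewrite /E -scalemxAl -scalemxAr ee !scalerA divfK.
exists (\rank E).
  apply: commutative_corner_rank => // X Y.
  rewrite /E -!(scalemxAl, scalemxAr) !scalerA; congr (_ *: _).
  exact: corner_comm ee eghe X Y.
rewrite -mxtrace_idempotent // /E mxtraceZ -(card_R chainR) raddf_sum /=.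
congr (_ * _); apply: eq_bigr => x _.
by rewrite mxtraceZ mulrC -rG_chi cfunE inGG mulr1n.
Qed.

End Whittaker.

(** The multiplicity of the character [psi (b * x)] of the upper unipotent group, that is, the
    dimension of the space of Whittaker functionals. *)
Definition wh (chi : 'CF(GG)) b := (q ^ l)%:R^-1 * \sum_x chi (u x) * psi (- (b * x)).

Lemma wh_le1 b i : b \is a GRing.unit -> exists2 k : nat, (k <= 1)%N & wh 'chi_i b = k%:R.
Proof.
move=> Ub; apply: (@whittaker_rank b i Ub 'Chi_i); last exact: irrRepr.
by apply: groupC; apply: socle_irr.
Qed.

End GL2.

Notation "x ** y" := (mulg x y) (at level 40, left associativity) : ring_scope.
Notation e00 g := (GLval g 0 0).
Notation e01 g := (GLval g 0 1).
Notation e10 g := (GLval g 1 0).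
Notation e11 g := (GLval g 1 1).

(** * Restriction to unipotent subgroups *)

Section Unipotent.
Variables (R : finComUnitRingType) (pi : R) (l q : nat) (psi : R -> algC).
Hypothesis chainR : chain_ring pi l q.
Hypothesis psi_add : additive_char psi.
Hypothesis psi_nt : exists2 x, x \in [set: R] & psi (pi ^+ l.-1 * x) != 1.

Notation D i x := (dvdR (pi ^+ i) x).
Notation ideal i := (ideal pi i).
Notation wh := (wh l q psi).
Notation GG := (GG R).
Implicit Types (g h : {'GL_2[R]}) (a b c d x y z s t : R).

Lemma nzq k : (q ^ k)%:R != 0 :> algC.
Proof. by rewrite pnatr_eq0 -lt0n expn_gt0 (q_gt0 chainR). Qed.

Lemma nzq1 : q%:R != 0 :> algC. Proof. by have := nzq 1; rewrite expn1. Qed.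

Lemma qlE : (q ^ l)%:R = q%:R * (q ^ l.-1)%:R :> algC.
Proof. by rewrite -natrM -expnS prednK ?(l_gt0 chainR). Qed.

Lemma predl : (l.-1 + 1 = l)%N. Proof. by rewrite addn1 prednK ?(l_gt0 chainR). Qed.

Lemma Dtop1 x y : D l.-1 x -> D 1 y -> x * y = 0.
Proof. by move=> Dx Dy; apply: (Dge chainR (leqnn l)); rewrite -predl; apply: DM. Qed.

Lemma Dtoptop x y : D l.-1 x -> D l.-1 y -> x * y = 0.
Proof.
move=> Dx Dy; apply: Dtop1 => //; apply: DW Dy; have := l_gt1 chainR; lia.
Qed.

Lemma Dtop_unit x : D l.-1 x -> 1 + x \is a GRing.unit.
Proof.
move=> Dx; apply: (unit_addD chainR); rewrite ?unitr1 //; apply: DW Dx.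
have := l_gt1 chainR; lia.
Qed.

Lemma sum_psi_idealN i a : (i <= l)%N ->
  \sum_(x in ideal i) psi (- (a * x)) = if D (l - i) a then (q ^ (l - i))%:R else 0.
Proof.
move=> li; rewrite -(DN pi (l - i) a) -(sum_psi_ideal chainR psi_add psi_nt) //.
by apply: eq_bigr => x _; rewrite mulNr.
Qed.

Lemma sum_psi_units a : \sum_(b in units R) psi (- (b * a)) =
  (if a == 0 then (q ^ l)%:R else 0) - (if D l.-1 a then (q ^ l.-1)%:R else 0).
Proof.
have := sum_psi_idealN a (leq0n l); rewrite subn0 (Dl chainR) => <-.
have := sum_psi_idealN a (l_gt0 chainR); rewrite subn1 => <-.
rewrite [X in _ = X - _](eq_bigl predT) => [|x]; last by rewrite inE D0x.
rewrite [X in _ = X - _](bigID (mem (ideal 1))) /= [X in _ = X - _]addrC addrK.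
by apply: eq_big => [x|x _]; rewrite ?(unitsC chainR) ?inE // mulrC.
Qed.

Section Fourier.
Variable f : R -> algC.
Hypothesis fU : forall a x, a \is a GRing.unit -> f (a * x) = f x.

(** Fourier coefficients of [f] on [R] and, in [mlow], on the maximal ideal. Invariance under units
    makes all unit frequencies share one coefficient. *)
Definition whf b := (q ^ l)%:R^-1 * \sum_x f x * psi (- (b * x)).
Definition mlow b := (q ^ l.-1)%:R^-1 * \sum_(x in ideal 1) f x * psi (- (b * x)).

Lemma whf_unit b : b \is a GRing.unit -> whf b = whf 1.
Proof.
move=> Ub; congr (_ * _); rewrite [RHS](reindex_inj (mulrI Ub)) /=.
by apply: eq_bigr => x _; rewrite fU // mul1r.
Qed.

Lemma mlow_unit b : b \is a GRing.unit -> mlow b = mlow 1.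
Proof.
move=> Ub; congr (_ * _); rewrite [RHS](reindex_inj (mulrI Ub)) /=.
by apply: eq_big => x; rewrite ?inE ?DUl // => _; rewrite fU // mul1r.
Qed.

(** Fourier inversion at 0. The frequencies in p are the characters trivial on the socle, and
    together they give the average over [ideal l.-1]; the unit frequencies contribute equally. *)
Lemma whf_sum : f 0 = q%:R^-1 * (\sum_(x in ideal l.-1) f x) + #|units R|%:R * whf 1.
Proof.
have -> : #|units R|%:R * whf 1 = \sum_(b in units R) whf b.
  rewrite mulr_natl -sumr_const; apply: eq_bigr => b; rewrite inE => Ub.
  by rewrite whf_unit.
rewrite /whf -mulr_sumr exchange_big /=.
have -> : \sum_x \sum_(b in units R) f x * psi (- (b * x)) =
  (q ^ l)%:R * f 0 - (q ^ l.-1)%:R * \sum_(x in ideal l.-1) f x.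
  rewrite (eq_bigr (fun x => (if x == 0 then f x * (q ^ l)%:R else 0) -
                     (if x \in ideal l.-1 then f x * (q ^ l.-1)%:R else 0))).
    rewrite big_split /= sumrN -!big_mkcond /= big_pred1_eq mulrC; congr (_ - _).
    by rewrite mulr_sumr; apply: eq_bigr => x _; rewrite mulrC.
  move=> x _; rewrite -mulr_sumr sum_psi_units mulrBr inE.
  by do 2!case: ifP => _; rewrite ?mulr0.
rewrite qlE; field; by rewrite nzq1 nzq.
Qed.

(** The same inversion on the maximal ideal. The factor [q] appears because [q] frequencies in [R]
    restrict to each of its characters. *)
Lemma mlow_sum : q%:R * f 0 = \sum_(x in ideal l.-1) f x + #|units R|%:R * mlow 1.
Proof.
have -> : #|units R|%:R * mlow 1 = \sum_(b in units R) mlow b.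
  rewrite mulr_natl -sumr_const; apply: eq_bigr => b; rewrite inE => Ub.
  by rewrite mlow_unit.
have zI : 0 \in ideal 1 by rewrite inE Dx0.
rewrite /mlow -mulr_sumr exchange_big /=.
have -> : \sum_(x in ideal 1) \sum_(b in units R) f x * psi (- (b * x)) =
  (q ^ l)%:R * f 0 - (q ^ l.-1)%:R * \sum_(x in ideal l.-1) f x.
  rewrite (eq_bigr (fun x => (if x == 0 then f x * (q ^ l)%:R else 0) -
                     (if x \in ideal l.-1 then f x * (q ^ l.-1)%:R else 0))).
    rewrite big_split /= sumrN -!big_mkcondr /=; congr (_ - _).
      rewrite (big_pred1 0) => [|x /=]; first by rewrite mulrC.
      by case: eqP => [->|]; rewrite ?zI ?andbF.
    rewrite mulr_sumr; apply: eq_big => [x|x _]; last by rewrite mulrC.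
    rewrite !inE andbC; case Dx: (D l.-1 x) => //=; apply: DW Dx.
    by have := l_gt1 chainR; lia.
  move=> x _; rewrite -mulr_sumr sum_psi_units mulrBr inE.
  by do 2!case: ifP => _; rewrite ?mulr0.
by rewrite qlE; field; rewrite nzq.
Qed.

End Fourier.

Lemma dg_u a d x : a \is a GRing.unit -> d \is a GRing.unit ->
  dg a d ** u x = u (a * x / d) ** dg a d.
Proof.
move=> Ua Ud; apply: gl_eq; rewrite !GL_MxE /u /dg !gl_val ?det_u ?det_dg // !mx2M.
by congr mx2; rewrite ?mulr0 ?mulr1 ?mul0r ?mul1r ?addr0 ?add0r ?divrK.
Qed.

Lemma dg_v a d x : a \is a GRing.unit -> d \is a GRing.unit ->
  dg a d ** v x = v (d * x / a) ** dg a d.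
Proof.
move=> Ua Ud; apply: gl_eq; rewrite !GL_MxE /v /dg !gl_val ?det_v ?det_dg // !mx2M.
by congr mx2; rewrite ?mulr0 ?mulr1 ?mul0r ?mul1r ?addr0 ?add0r ?divrK.
Qed.

Lemma dgM a d a' d' : a \is a GRing.unit -> d \is a GRing.unit ->
  a' \is a GRing.unit -> d' \is a GRing.unit ->
  dg a d ** dg a' d' = dg (a * a') (d * d').
Proof.
by move=> Ua Ud Ua' Ud'; rewrite /dg glM ?det_dg //; congr gl; ring.
Qed.

Lemma chi_uU (chi : 'CF(GG)) a x : a \is a GRing.unit -> chi (u (a * x)) = chi (u x).
Proof.
move=> Ua; apply: (@class_eq _ _ _ _ (dg a 1)); rewrite dg_u ?unitr1 //.
by rewrite divr1.
Qed.

Definition ww : {'GL_2[R]} := gl 0 1 1 0.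

Lemma det_ww : 0 * 0 - 1 * 1 \is a @GRing.unit R.
Proof. by rewrite mulr0 mulr1 sub0r unitrN unitr1. Qed.

Lemma u_ww x : u x ** ww = ww ** v x.
Proof.
apply: gl_eq; rewrite !GL_MxE /u /v /ww !gl_val ?det_u ?det_v ?det_ww // !mx2M.
by congr mx2; ring.
Qed.

Lemma chi_uv (chi : 'CF(GG)) x : chi (u x) = chi (v x).
Proof. exact: class_eq (u_ww x). Qed.

Definition hh s : {'GL_2[R]} := dg (1 + s) (1 - s).

Lemma hh_units s : D l.-1 s -> (1 + s \is a GRing.unit) /\ (1 - s \is a GRing.unit).
Proof. by move=> Ds; split; apply: Dtop_unit; rewrite ?DN. Qed.

Lemma hhM s t : D l.-1 s -> D l.-1 t -> hh s ** hh t = hh (s + t).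
Proof.
move=> Ds Dt; have [U1 U2] := hh_units Ds; have [U3 U4] := hh_units Dt.
rewrite /hh dgM //; have := Dtoptop Ds Dt => st.
rewrite (_ : (1 + s) * (1 + t) = 1 + (s + t)); last by rewrite -[RHS]addr0 -st; ring.
by rewrite (_ : (1 - s) * (1 - t) = 1 - (s + t)) // -[RHS]addr0 -st; ring.
Qed.

Lemma hh0 : hh 0 = 1%g.
Proof. by apply: (mulgI (hh 0)); rewrite hhM ?Dx0 // addr0 mulg1. Qed.

(** A working substitute for [regular], phrased with unipotent elements only; [regular_GL] and
    [agree_regular] connect the two. *)
Definition regc (chi : 'CF(GG)) : bool := [exists x, D l.-1 x && (chi (u x) != chi 1%g)].

Lemma wh1E (chi : 'CF(GG)) :
  chi 1%g = q%:R^-1 * (\sum_(x in ideal l.-1) chi (u x)) + #|units R|%:R * wh chi 1.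
Proof. by rewrite -u0 (whf_sum (fun a x => chi_uU chi x)). Qed.

Lemma regcP (i : Iirr GG) : wh 'chi_i 1 = (regc 'chi_i)%:R.
Proof.
have [[|[|//]] _ Ek] := wh_le1 chainR psi_add psi_nt i (unitr1 R).
  rewrite Ek; suff -> : regc 'chi_i = false by [].
  apply/existsP => [[x /andP[Dx /eqP[]]]]; have := wh1E 'chi_i.
  rewrite Ek mulr0 addr0 => E.
  have xI : x \in ideal l.-1 by rewrite inE.
  (* The average of the values on the socle equals the degree, the largest possible modulus, so
     every term does. *)
  apply: (@normC_sum_upper _ _ (mem (ideal l.-1)) (fun x => 'chi_i (u x)) (fun=> 'chi_i 1%g)) => //.
    by move=> y _; apply: char1_ge_norm; apply: irr_char.
  have nq := nzq1.
  by rewrite sumr_const -(qE chainR) -mulr_natl E mulVKf.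
rewrite Ek; suff -> : regc 'chi_i = true by [].
apply: contraT; rewrite negb_exists => /forallP nE.
have := wh1E 'chi_i; rewrite Ek mulr1 (eq_bigr (fun=> 'chi_i 1%g)); last first.
  move=> x; rewrite inE => Dx; have := nE x; rewrite Dx negbK => /eqP //.
rewrite sumr_const -(qE chainR) -[X in _ * X + _]mulr_natl (mulKf nzq1).
move/eqP; rewrite -{1}[X in X == _]addr0 (inj_eq (addrI _)).
rewrite eq_sym pnatr_eq0 (card_unitsE chainR) muln_eq0 expn_eq0.
by have := q_gt1 chainR; case: (q) => [|[|k]].
Qed.

Lemma irr1_reg (i : Iirr GG) : regc 'chi_i ->
  'chi_i 1%g = q%:R^-1 * (\sum_(x in ideal l.-1) 'chi_i (u x)) + ((q - 1) * q ^ l.-1)%:R.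
Proof. by move=> ri; rewrite {1}wh1E regcP ri mulr1 (card_unitsE chainR). Qed.

(* The terms with s <> 0 vanish: conjugating by v z multiplies them by psi (z * s). *)
Lemma mirabolic_mult (chi : 'CF(GG)) (tau : R -> algC) : tau 0 = 1 ->
  (q * q ^ l.-1)%:R^-1 * (\sum_(s in ideal l.-1) \sum_(y in ideal 1)
     chi (dg (1 + s) 1 ** v y) * (tau s * psi (- y))) = wh chi 1.
Proof.
move=> tau0.
have zI : 0 \in ideal l.-1 by rewrite inE Dx0.
rewrite (bigD1 0) //= [X in _ + X]big1 ?addr0 => [|s /andP[]]; last first.
  rewrite inE => Ds nzs.
  have [z nz] : exists z, psi (s * z) != 1.
    apply/existsP; apply: contraNT nzs; rewrite negb_exists => /forallP nE.
    apply/eqP; apply: (psi_nondeg0 chainR psi_nt) => x; apply/eqP.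
    by have := nE x; rewrite negbK.
  have U1 := Dtop_unit Ds.
  set S := \sum_(y in _) _; suff: S = psi (s * z) * S.
    move/eqP; rewrite -subr_eq0 -{1}[S]mul1r -mulrBl mulf_eq0 subr_eq0 eq_sym.
    by rewrite (negPf nz) => /eqP.
  have D1s : D 1 (s * z) by apply: DMr; apply: DW Ds; have := l_gt1 chainR; lia.
  rewrite /S mulr_sumr [LHS](reindex_inj (subIr (s * z))) /=; apply: eq_big => y.
    by rewrite !inE; apply/idP/idP => [h|h]; [rewrite -[y](subrK (s * z)) DD | rewrite DB].
  rewrite inE => Dy0; have Dy : D 1 y by rewrite -[y](subrK (s * z)) DD.
  have -> : chi (dg (1 + s) 1 ** v (y - s * z)) = chi (dg (1 + s) 1 ** v y).
    apply: (@class_eq _ _ _ _ (v (- z))); rewrite -mulgA vM.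
    rewrite [v _ ** (_ ** _)]mulgA.
    have -> : v (- z) ** dg (1 + s) 1 = dg (1 + s) 1 ** v (- z * (1 + s)).
      by rewrite dg_v ?unitr1 // mul1r mulrK.
    by rewrite -mulgA vM; congr (_ ** v _); ring.
  by rewrite opprB psiD //; ring.
have dg11 : dg (1 : R) 1 = 1%g by rewrite -hh0 /hh subr0 addr0.
rewrite (eq_bigr (fun y => chi (u y) * psi (- y))) => [|y _]; last first.
  by rewrite tau0 mul1r dg11 mul1g -chi_uv.
rewrite natrM invfM -mulrA.
have nU : #|units R|%:R != 0 :> algC.
  rewrite pnatr_eq0 -lt0n (card_unitsE chainR) muln_gt0 expn_gt0 (q_gt0 chainR).
  by have := q_gt1 chainR; lia.
have nq := nzq1.
have fU a x : a \is a GRing.unit -> chi (u (a * x)) = chi (u x) by apply: chi_uU.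
(* Comparing the two inversions, the coefficient on the maximal ideal is [q] times [wh chi 1], which
   absorbs the extra [q] in the normalization. *)
have h1 := whf_sum fU; have h2 := mlow_sum fU.
apply: (mulfI nq); rewrite mulVKf //; apply: (mulfI nU); apply: (addrI (\sum_(x in ideal l.-1) chi (u x))).
transitivity (q%:R * chi (u 0)).
  rewrite h2; congr (_ + _ * (_ * _)); apply: eq_bigr => y _.
  by rewrite !mul1r.
by rewrite h1 mulrDr mulVKf // [in RHS]mulrCA.
Qed.

End Unipotent.

(** * Split semisimple representations *)

Section Split.
Variables (R : finComUnitRingType) (pi : R) (l q : nat) (psi : R -> algC).
Hypothesis chainR : chain_ring pi l q.
Hypothesis psi_add : additive_char psi.
Hypothesis psi_nt : exists2 x, x \in [set: R] & psi (pi ^+ l.-1 * x) != 1.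

Notation D i x := (dvdR (pi ^+ i) x).
Notation ideal i := (ideal pi i).
Notation wh := (wh l q psi).
Notation GG := (GG R).
Notation regc := (regc pi l).
Implicit Types (g h : {'GL_2[R]}) (a b c d x y z s t : R).

(** One family covers three groups: [box 0 l] is the Borel subgroup, [box 0 1] the Iwahori subgroup,
    and [box l.-1 1] the subgroup on which V stays irreducible for type sns. *)
Definition box i j : {set {'GL_2[R]}} := [set g : {'GL_2[R]} | D i (e01 g) && D j (e10 g)].

Lemma entries1 : (GLval (1%g : {'GL_2[R]}) 0 0 = 1) * (GLval (1%g : {'GL_2[R]}) 0 1 = 0) *
  (GLval (1%g : {'GL_2[R]}) 1 0 = 0) * (GLval (1%g : {'GL_2[R]}) 1 1 = 1).
Proof. by rewrite GL_1E !mxE. Qed.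

Lemma entriesM g h i j : GLval (g ** h) i j = GLval g i 0 * GLval h 0 j + GLval g i 1 * GLval h 1 j.
Proof. by rewrite GL_MxE mulmx2E. Qed.

Lemma gl_ext g h : e00 g = e00 h -> e01 g = e01 h -> e10 g = e10 h -> e11 g = e11 h -> g = h.
Proof. by move=> *; apply: gl_eq; apply: eq_mx2. Qed.

Lemma box_group_set i j : group_set (box i j).
Proof.
apply/group_setP; split=> [|g h]; first by rewrite inE !entries1 !Dx0.
rewrite !inE !entriesM => /andP[g1 g2] /andP[h1 h2]; apply/andP; split.
  by apply: DD; [apply: DMl | apply: DMr].
by apply: DD; [apply: DMr | apply: DMl].
Qed.
Canonical box_group i j := Group (box_group_set i j).

Lemma box_sub i j i' j' : (i' <= i)%N -> (j' <= j)%N -> box i j \subset box i' j'.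
Proof.
move=> li lj; apply/subsetP => g; rewrite !inE => /andP[g1 g2].
by rewrite (DW li g1) (DW lj g2).
Qed.

Lemma box_units i j g : (0 < j)%N -> g \in box i j ->
  (e00 g \is a GRing.unit) /\ (e11 g \is a GRing.unit).
Proof.
move=> j0; rewrite inE => /andP[_ D2]; apply/andP; rewrite -unitrM.
rewrite -(subrK (e01 g * e10 g) (_ * _)); apply: (unit_addD chainR); first exact: gl_det.
by apply: DMl; apply: DW D2.
Qed.

Lemma card_box i j : (i <= l)%N -> (0 < j <= l)%N ->
  #|box i j| = (#|units R| ^ 2 * q ^ (l - i) * q ^ (l - j))%N.
Proof.
move=> li /andP[j0 lj].
pose A := setX (setX (units R) (units R)) (setX (ideal i) (ideal j)).
pose f (w : (R * R) * (R * R)) := gl w.1.1 w.2.1 w.2.2 w.1.2.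
have det_f w : w \in A -> w.1.1 * w.1.2 - w.2.1 * w.2.2 \is a GRing.unit.
  case: w => [[a d] [b c]]; rewrite !inE /= => /andP[/andP[Ua Ud] /andP[_ Dc]].
  apply: (unit_addD chainR); rewrite ?unitrM ?Ua // DN; apply: DMl.
  exact: DW Dc.
have injf : {in A &, injective f}.
  move=> w w' tA tA' /gl_inj[]; rewrite ?det_f //.
  by case: w w' {tA tA'} => [[a d] [b c]] [[a' d'] [b' c']] /= -> -> -> ->.
have -> : box i j = f @: A.
  apply/setP=> g; apply/idP/imsetP => [gB | [w tA ->]].
    exists ((e00 g, e11 g), (e01 g, e10 g)); last by rewrite /f gl_eta.
    have [U1 U2] := box_units j0 gB.
    by move: gB; rewrite !inE U1 U2.
  rewrite inE gl_val ?det_f // !mx2E.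
  by move: tA; rewrite !inE => /andP[_].
by rewrite card_in_imset // !cardsX !(card_ideal chainR) // mulnA mulnn.
Qed.

Lemma box_sum i j (F : {'GL_2[R]} -> algC) : (0 < j)%N ->
  \sum_(g in box i j) F g = \sum_(c in ideal j) \sum_(a in units R)
     \sum_(d in units R) \sum_(b in ideal i) F (gl a b c d).
Proof.
move=> j0; pose A := setX (ideal j) (setX (units R) (setX (units R) (ideal i))).
pose f (w : R * (R * (R * R))) := gl w.2.1 w.2.2.2 w.1 w.2.2.1.
have det_f w : w \in A -> w.2.1 * w.2.2.1 - w.2.2.2 * w.1 \is a GRing.unit.
  case: w => [c [a [d b]]]; rewrite !inE /= => /andP[Dc /and3P[Ua Ud _]].
  apply: (unit_addD chainR); rewrite ?unitrM ?Ua // DN; apply: DMl.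
  exact: DW Dc.
have injf : {in A &, injective f}.
  move=> w w' wA wA' /gl_inj[]; rewrite ?det_f //.
  by case: w w' {wA wA'} => [c [a [d b]]] [c' [a' [d' b']]] /= -> -> -> ->.
have -> : box i j = f @: A.
  apply/setP=> g; apply/idP/imsetP => [gB | [w wA ->]].
    exists (e10 g, (e00 g, (e11 g, e01 g))); last by rewrite /f gl_eta.
    have [U1 U2] := box_units j0 gB.
    by move: gB; rewrite !inE U1 U2 andbC.
  rewrite inE gl_val ?det_f // !mx2E.
  by move: wA; rewrite !inE => /and4P[-> _ _ ->].
rewrite big_imset //=.
rewrite (eq_bigl (fun w => (w.1 \in ideal j) && (w.2 \in setX (units R) (setX (units R) (ideal i))))); last first.
  by case=> ? ?; rewrite in_setX.
rewrite -(pair_big (mem (ideal j)) (mem (setX (units R) (setX (units R) (ideal i)))) (fun c w => F (f (c, w)))) /=.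
apply: eq_bigr => c _.
rewrite (eq_bigl (fun w => (w.1 \in units R) && (w.2 \in setX (units R) (ideal i)))); last first.
  by case=> ? ?; rewrite in_setX.
rewrite -(pair_big (mem (units R)) (mem (setX (units R) (ideal i))) (fun a w => F (f (c, (a, w))))) /=.
apply: eq_bigr => a _.
rewrite (eq_bigl (fun w => (w.1 \in units R) && (w.2 \in ideal i))); last first.
  by case=> ? ?; rewrite in_setX.
by rewrite -(pair_big (mem (units R)) (mem (ideal i)) (fun d b => F (f (c, (a, (d, b)))))).
Qed.

(** Off the Iwahori subgroup the lower left entry is a unit, so the determinant and the three other
    entries determine the upper right one. *)
Lemma card_GG : #|GG| = (#|units R| ^ 2 * (q ^ (l + l.-1) * (q + 1)))%N.
Proof.
have l0 := l_gt0 chainR.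
rewrite -(cardsID (box 0 1) GG) mulnDr muln1 mulnDr addnC; congr (_ + _)%N; last first.
  rewrite (setIidPr _) ?subsetT //.
  by rewrite card_box // subn0 -mulnA -expnD; congr (_ * q ^ _)%N; lia.
pose A := setX (setX [set: R] [set: R]) (setX (units R) (units R)).
pose f (w : (R * R) * (R * R)) := gl w.1.1 ((w.1.1 * w.1.2 - w.2.2) / w.2.1) w.2.1 w.1.2.
have det_f w : w \in A -> w.1.1 * w.1.2 - (w.1.1 * w.1.2 - w.2.2) / w.2.1 * w.2.1 = w.2.2.
  case: w => [[a d] [c z]]; rewrite !inE /= => /andP[Uc Uz].
  by rewrite divrK //; ring.
have Udet w (tA : w \in A) : w.1.1 * w.1.2 - (w.1.1 * w.1.2 - w.2.2) / w.2.1 * w.2.1 \is a GRing.unit.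
  by rewrite det_f //; move: tA; rewrite !inE => /andP[_ /andP[]].
have injf : {in A &, injective f}.
  move=> w w' tA tA' Ef; have [] := gl_inj (Udet _ tA) (Udet _ tA') Ef.
  have := det_f _ tA; have := det_f _ tA'.
  case: w w' {tA tA' Ef} => [[a d] [c z]] [[a' d'] [c' z']] /= h1 h2 E1 E2 E3 E4.
  by rewrite -h1 -h2 E2 E1 E3 E4.
have -> : GG :\: box 0 1 = f @: A.
  apply/setP=> g; rewrite !inE D0x andbT /=; apply/idP/imsetP => [gB | [w tA ->]].
    have Uc : e10 g \is a GRing.unit by rewrite (unitN1 chainR).
    exists ((e00 g, e11 g), (e10 g, e00 g * e11 g - e01 g * e10 g)).
      by rewrite !inE Uc gl_det.
    rewrite /f /= -[LHS]gl_eta; congr gl.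
    by rewrite opprB addrCA subrr addr0 mulrK.
  rewrite gl_val ?Udet // !mx2E.
  by move: tA; rewrite !inE -(unitN1 chainR) => /andP[_ /andP[]].
rewrite card_in_imset // !cardsX !cardsT (card_R chainR).
have -> : (q ^ (l + l.-1) * q = q ^ l * q ^ l)%N.
  by rewrite -expnSr -expnD; congr (q ^ _)%N; lia.
by rewrite mulnC mulnn.
Qed.

Lemma nzU : #|units R|%:R != 0 :> algC.
Proof.
rewrite pnatr_eq0 -lt0n (card_unitsE chainR) muln_gt0 expn_gt0 (q_gt0 chainR).
by have := q_gt1 chainR; lia.
Qed.

Notation Bg := (box_group 0 l).
Notation Ig := (box_group 0 1).
Notation Dg := (box_group l.-1 1).

Lemma u_box i x : D i x -> u x \in box i l.
Proof. by move=> Dx; rewrite inE gl_val ?det_u // !mx2E Dx Dx0. Qed.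

Lemma v_box j x : D j x -> v x \in box l j.
Proof. by move=> Dx; rewrite inE gl_val ?det_v // !mx2E Dx Dx0. Qed.

Lemma dg_box a d : a \is a GRing.unit -> d \is a GRing.unit -> dg a d \in box l l.
Proof. by move=> Ua Ud; rewrite inE gl_val ?det_dg // !mx2E !Dx0. Qed.

Lemma hh_box s : D l.-1 s -> hh s \in box l l.
Proof. by move=> Ds; have [? ?] := hh_units chainR Ds; apply: dg_box. Qed.

Lemma uE x : ((e00 (u x) = 1) * (e01 (u x) = x)) * ((e10 (u x) = 0) * (e11 (u x) = 1)).
Proof. by rewrite gl_val ?det_u // !mx2E. Qed.

Lemma vE x : ((e00 (v x) = 1) * (e01 (v x) = 0)) * ((e10 (v x) = x) * (e11 (v x) = 1)).
Proof. by rewrite gl_val ?det_v // !mx2E. Qed.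

Lemma dgE a d : a \is a GRing.unit -> d \is a GRing.unit ->
  ((e00 (dg a d) = a) * (e01 (dg a d) = 0)) * ((e10 (dg a d) = 0) * (e11 (dg a d) = d)).
Proof. by move=> Ua Ud; rewrite gl_val ?det_dg // !mx2E. Qed.

Lemma hhE s : D l.-1 s ->
  ((e00 (hh s) = 1 + s) * (e01 (hh s) = 0)) * ((e10 (hh s) = 0) * (e11 (hh s) = 1 - s)).
Proof. by move=> Ds; have [? ?] := hh_units chainR Ds; apply: dgE. Qed.

Lemma val_u x : GLval (u x) = mx2 1 x 0 1. Proof. by rewrite gl_val ?det_u. Qed.
Lemma val_v x : GLval (v x) = mx2 1 0 x 1. Proof. by rewrite gl_val ?det_v. Qed.
Lemma val_dg a d : a \is a GRing.unit -> d \is a GRing.unit -> GLval (dg a d) = mx2 a 0 0 d.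
Proof. by move=> Ua Ud; rewrite gl_val ?det_dg. Qed.
Lemma val_hh s : D l.-1 s -> GLval (hh s) = mx2 (1 + s) 0 0 (1 - s).
Proof. by move=> Ds; have [? ?] := hh_units chainR Ds; apply: val_dg. Qed.

(** Up to a positive factor, the multiplicity of the linear character [psi (k * s)] of the group of
    all [hh s ** u x]: it detects vectors fixed by u(p^i) on which the small torus acts with
    frequency [k]. *)
Definition fi i k (f : {'GL_2[R]} -> algC) :=
  \sum_(s in ideal l.-1) \sum_(x in ideal i) f (hh s ** u x) * psi (- (k * s)).

Lemma conj_hu i s x c : (0 < i < l)%N -> D l.-1 s -> D i.-1 x -> D (l - i) c ->
  (hh s ** u x) ** v c = v c ** (hh (s + x * c) ** u (x - x ^+ 2 * c)).
Proof.
move=> /andP[i0 il] Ds Dx Dc.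
have Dc1 : D 1 c by apply: DW Dc; lia.
have Dxc : D l.-1 (x * c) by rewrite (_ : l.-1 = i.-1 + (l - i))%N; [apply: DM | lia].
have xcc : x * c * c = 0 by apply: (Dtop1 chainR).
have sc : s * c = 0 by apply: (Dtop1 chainR).
have sxc : s * (x * c) = 0 by apply: (Dtoptop chainR).
have xcxc : x * c * (x * c) = 0 by apply: (Dtoptop chainR).
apply: gl_eq; rewrite !GL_MxE !val_u !val_v !val_hh ?DD // !mx2M; congr mx2; rewrite ?mulr0 ?mulr1 ?mul0r ?mul1r ?addr0 ?add0r.
- by rewrite -[RHS]addr0 -sxc; ring.
- rewrite (_ : (1 + (s + x * c)) * (x - x ^+ 2 * c) =
     (1 + s) * x - x * (s * (x * c)) - x * (x * c * (x * c))); last by ring.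
  by rewrite sxc xcxc !mulr0 !subr0.
- rewrite (_ : (1 - s) * c = c - s * c); last by ring.
  rewrite sc subr0 (_ : c * (1 + (s + x * c)) = c + s * c + x * c * c); last by ring.
  by rewrite sc xcc !addr0.
- rewrite (_ : c * ((1 + (s + x * c)) * (x - x ^+ 2 * c)) + (1 - (s + x * c)) =
    1 - s + s * c * x - s * c * (x ^+ 2 * c) - x * c * (x * c) * (x * c)); last by ring.
  by rewrite sc xcxc !mul0r !subr0 addr0.
Qed.

(** Vectors fixed by u(p^i) decompose under the characters [psi (b * x)] of p^(i-1)/p^i. As [k] is a
    unit, conjugation by [v c] with [c = - (b / k)] carries each of these parts to the one fixed by
    u(p^(i-1)). *)
Lemma fi_step (chi : 'CF(GG)) k i : k \is a GRing.unit -> (0 < i < l)%N ->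
  fi i k chi != 0 -> fi i.-1 k chi != 0.
Proof.
move=> Uk /andP[i0 il] nz.
pose fb b := \sum_(s in ideal l.-1) \sum_(x in ideal i.-1)
   chi (hh s ** u x) * psi (- (k * s)) * psi (b * x).
have sum_fb : \sum_(b in ideal (l - i)) fb b = (q ^ i)%:R * fi i k chi.
  rewrite /fb exchange_big mulr_sumr; apply: eq_bigr => s _.
  rewrite exchange_big mulr_sumr /=.
  rewrite (eq_bigr (fun x => if D i x then (q ^ i)%:R * (chi (hh s ** u x) * psi (- (k * s))) else 0)).
    rewrite -big_mkcondr; apply: eq_bigl => x; rewrite !inE andbC.
    by case Dx: (D i x) => //=; apply: DW Dx; lia.
  move=> x _; rewrite -mulr_sumr; under eq_bigr => b _ do rewrite mulrC.
  rewrite (sum_psi_ideal chainR) // ?leq_subr // subKn; last by lia.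
  by case: ifP => _; rewrite ?mulr0 // mulrC.
have /existsP[b /andP[Db nzb]] : [exists b, D (l - i) b && (fb b != 0)].
  apply: contraNT nz; rewrite negb_exists => /forallP nE.
  have nqi := nzq chainR i; rewrite -(inj_eq (mulfI nqi)) mulr0 -sum_fb.
  apply/eqP; apply: big1 => b; rewrite inE => Db; apply/eqP.
  by have := nE b; rewrite Db negbK.
suff <- : fb b = fi i.-1 k chi by [].
pose c := - (b / k).
have Dc : D (l - i) c by rewrite DN; apply: DMr.
have kc : k * c = - b by rewrite mulrN mulrC divrK.
transitivity (\sum_(s in ideal l.-1) \sum_(x in ideal i.-1)
   chi (hh (s + x * c) ** u (x - x ^+ 2 * c)) * psi (- (k * s)) * psi (b * x)).
  apply: eq_bigr => s; rewrite inE => Ds; apply: eq_bigr => x; rewrite inE => Dx.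
  by rewrite (class_eq chi (@conj_hu i s x c _ Ds Dx Dc)) ?i0.
have Dxc x : D i.-1 x -> D l.-1 (x * c).
  by move=> Dx; rewrite (_ : l.-1 = i.-1 + (l - i))%N; [apply: DM | lia].
have Dbx x : D i.-1 x -> D l.-1 (b * x).
  by move=> Dx; rewrite (_ : l.-1 = (l - i) + i.-1)%N; [apply: DM | lia].
have Dc1 : D 1 c by apply: DW Dc; lia.
rewrite exchange_big /= [RHS]exchange_big /=.
transitivity (\sum_(x in ideal i.-1) \sum_(s in ideal l.-1)
   chi (hh s ** u (x - x ^+ 2 * c)) * psi (- (k * s))).
  apply: eq_bigr => x; rewrite inE => Dx.
  rewrite [LHS](reindex_inj (addIr (- (x * c)))) /=; apply: eq_big => s.
    rewrite !inE; apply/idP/idP => [h|h]; last by apply: DB => //; apply: Dxc.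
    by rewrite -[s](subrK (x * c)) DD // Dxc.
  move=> _; rewrite subrK -mulrA -psiD //; congr (_ * psi _).
  by rewrite mulrBr opprB mulrCA kc; ring.
(* The substitution of [x - x ^+ 2 * c] for [x] is undone by the opposite sign, because
   [x * c * c = 0]. *)
have xK x : D i.-1 x -> (x - x ^+ 2 * c) + (x - x ^+ 2 * c) ^+ 2 * c = x.
  move=> Dx; have xcc : x * c * c = 0 by apply: (Dtop1 chainR) => //; apply: Dxc.
  rewrite (_ : _ + _ = x - x ^+ 2 * (x * c * c) *+ 2 + x ^+ 3 * c * (x * c * c)); last by ring.
  by rewrite xcc !mulr0 mul0rn subr0 addr0.
rewrite [RHS](reindex_onto (fun x => x - x ^+ 2 * c) (fun x => x + x ^+ 2 * c)) /=; last first.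
  move=> x; rewrite inE => Dx; have xcc : x * c * c = 0 by apply: (Dtop1 chainR) => //; apply: Dxc.
  rewrite (_ : _ - _ = x - x ^+ 2 * (x * c * c) *+ 2 - x ^+ 3 * c * (x * c * c)); last by ring.
  by rewrite xcc !mulr0 mul0rn !subr0.
apply: eq_bigl => x; rewrite !inE.
have Dx2 : D i.-1 x -> D i.-1 (x ^+ 2 * c) by move=> Dx; rewrite exprSr expr1 -mulrA DMr.
apply/idP/andP => [Dx | [Dx /eqP E]]; first by rewrite xK // DB ?Dx2.
by rewrite -E; apply: DD => //; rewrite exprSr expr1 -mulrA DMr.
Qed.

Lemma fi_top_bot (chi : 'CF(GG)) k : k \is a GRing.unit ->
  fi l.-1 k chi != 0 -> fi 0 k chi != 0.
Proof.
move=> Uk; have: (l.-1 < l)%N by rewrite prednK ?(l_gt0 chainR).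
elim: l.-1 => [//|n IHn] ln nz; apply: IHn; first exact: ltnW.
by have := @fi_step chi k n.+1 Uk; apply.
Qed.

Definition ssB k (mu : 'CF(Bg)) := [/\ mu \is a linear_char, (forall x, mu (u x) = 1) &
   forall s, D l.-1 s -> mu (hh s) = psi (k * s)].

Definition Uset : {set {'GL_2[R]}} := [set u x | x : R].

Lemma Uset_group_set : group_set Uset.
Proof.
apply/group_setP; split=> [|g h]; first by rewrite -(u0 R) imset_f ?inE.
by move=> /imsetP[x _ ->] /imsetP[y _ ->]; rewrite uM imset_f ?inE.
Qed.
Canonical Uset_group := Group Uset_group_set.
Notation Ug := Uset_group.

Lemma in_Ug g : (g \in Ug) = [&& e00 g == 1, e10 g == 0 & e11 g == 1].
Proof.
apply/imsetP/and3P => [[x _ ->]|[/eqP g1 /eqP g2 /eqP g3]]; first by rewrite !uE !eqxx.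
by exists (e01 g) => //; apply: gl_ext; rewrite !uE.
Qed.

Lemma in_Bg g : (g \in Bg) = (e10 g == 0).
Proof. by rewrite !inE D0x (Dl chainR). Qed.

Lemma Ug_normal : (Ug <| Bg)%g.
Proof.
apply/andP; split; first by apply/subsetP => g; rewrite in_Ug in_Bg => /and3P[].
apply/subsetP => g gB; rewrite inE; apply/subsetP => _ /imsetP[h hU ->].
have jB : (h ^ g)%g \in Bg.
  by rewrite groupJ // in_Bg; move: hU; rewrite in_Ug => /and3P[].
have [U1 U2] := box_units (l_gt0 chainR) gB.
have E : h ** g = g ** (h ^ g)%g by rewrite conjgE mulKVg.
move: (h ^ g)%g jB E => j jB E.
move: gB jB hU; rewrite !in_Ug !in_Bg => /eqP g10 j10 /and3P[/eqP h1 /eqP h2 /eqP h3].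
rewrite j10 /=; apply/andP; split; apply/eqP.
  have := congr1 (fun m : {'GL_2[R]} => e00 m) E; rewrite /= !entriesM h1 g10 (eqP j10) !mulr0 !addr0 mul1r.
  by rewrite -{1}[e00 g]mulr1 => /(mulrI U1).
have := congr1 (fun m : {'GL_2[R]} => e11 m) E; rewrite /= !entriesM h2 h3 g10 !mul0r !add0r mul1r.
by rewrite -{1}[e11 g]mulr1 => /(mulrI U2).
Qed.

Lemma Bg_der : (Bg^`(1) \subset Ug)%g.
Proof.
rewrite gen_subG; apply/subsetP => _ /imset2P[g h gB hB ->].
have cB : [~ g, h]%g \in Bg by rewrite groupR.
have [U1 U2] := box_units (l_gt0 chainR) gB.
have [U3 U4] := box_units (l_gt0 chainR) hB.
have E : g ** h = (h ** g) ** [~ g, h]%g by rewrite -commgC.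
move: [~ g, h]%g cB E => k cB E.
move: gB hB cB; rewrite in_Ug !in_Bg => /eqP g10 /eqP h10 c10.
rewrite c10 /=; apply/andP; split; apply/eqP.
  have : e00 (g ** h) = e00 ((h ** g) ** k) by rewrite E.
  rewrite !entriesM g10 h10 (eqP c10) !mulr0 !addr0 [e00 g * _]mulrC.
  by rewrite -{1}[_ * _]mulr1 => /(mulrI _)->; rewrite // unitrM U1 U3.
have : e11 (g ** h) = e11 ((h ** g) ** k) by rewrite E.
rewrite !entriesM g10 h10 !mul0r !mulr0 !add0r [e11 g * _]mulrC.
by rewrite mul0r add0r -{1}[_ * _]mulr1 => /(mulrI _)->; rewrite // unitrM U2 U4.
Qed.

Lemma cfFix_irr (gT : finGroupType) (G P : {group gT}) (i : Iirr G) :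
  cfFix P 'chi_i = if P \subset cfker 'chi_i then 'chi_i else 0.
Proof.
rewrite /cfFix (eq_bigr (fun j => if i == j then 'chi_i else 0)); last first.
  by move=> j _; rewrite cfdot_irr; case: eqP => [->|]; rewrite ?scale1r ?scale0r.
by rewrite -big_mkcondr; case: ifP => iP;
  [rewrite (big_pred1 i) // => j; rewrite /= andbC eq_sym; case: eqP => [->|] //; rewrite iP
  | rewrite big_pred0 // => j; rewrite andbC; case: eqP => [<-|] //; rewrite iP].
Qed.

(** After descending to [fi 0 k], a contributing constituent on the Borel subgroup has the whole
    unipotent radical in its kernel, and is linear because the quotient is abelian. *)
Lemma ss_eigen (i : Iirr GG) k : k \is a GRing.unit -> fi l.-1 k 'chi_i != 0 ->
  exists2 mu, ssB k mu & '['Res[Bg] 'chi_i, mu] != 0.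
Proof.
move=> Uk /(fi_top_bot Uk) nz.
have inB s x : D l.-1 s -> hh s ** u x \in Bg.
  move=> Ds; rewrite groupM //; last exact: (u_box (D0x pi x)).
  by apply: (subsetP (box_sub (leq0n l) (leqnn l))); apply: hh_box.
have EF : fi 0 k 'chi_i = \sum_j '['Res[Bg] 'chi_i, 'chi_j] * fi 0 k 'chi_j.
  rewrite /fi; under [RHS]eq_bigr => j _ do rewrite mulr_sumr.
  rewrite [RHS]exchange_big; apply: eq_bigr => s; rewrite inE => Ds.
  under [RHS]eq_bigr => j _ do rewrite mulr_sumr.
  rewrite [RHS]exchange_big; apply: eq_bigr => x _.
  rewrite -(cfResE _ (subsetT Bg)) ?inB // {1}['Res[Bg] 'chi_i]cfun_sum_cfdot sum_cfunE.
  by rewrite mulr_suml; apply: eq_bigr => j _; rewrite cfunE mulrA.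
have /existsP[j /andP[nz1 nz2]] :
   [exists j, ('['Res[Bg] 'chi_i, 'chi_j] != 0) && (fi 0 k 'chi_j != 0)].
  apply: contraNT nz; rewrite negb_exists => /forallP nE; rewrite EF big1 // => j _.
  by have := nE j; rewrite negb_and !negbK => /orP[] /eqP ->; rewrite ?mulr0 ?mul0r.
exists 'chi_j => //.
have kerU : Ug \subset cfker 'chi_j.
  apply: contraNT nz2 => nk; rewrite /fi big1 // => s; rewrite inE => Ds.
  have := @cfFixE _ Bg Ug 'chi_j (hh s) Ug_normal.
  rewrite cfFix_irr (negPf nk) cfunE -[hh s]mulg1 -(u0 R) => /(_ (inB s 0 Ds)) /esym/eqP.
  rewrite mulf_eq0 invr_eq0 pnatr_eq0 eqn0Ngt cardG_gt0 /= u0 mulg1 big_imset /=; last first.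
    by move=> x y _ _; apply: u_inj.
  move=> /eqP E; rewrite -mulr_suml (_ : \sum_(x in _) _ = 0) ?mul0r // -[RHS]E.
  by apply: eq_bigl => x; rewrite !inE D0x.
have lin : 'chi_j \is a linear_char.
  by rewrite lin_irr_der1 (subset_trans Bg_der kerU).
have ku x : 'chi_j (u x) = 1.
  by rewrite cfker1 ?(lin_char1 lin) // (subsetP kerU) // imset_f ?inE.
split=> // s0 Ds0.
have ugu s x : D l.-1 s -> 'chi_j (hh s ** u x) = 'chi_j (hh s).
  by move=> Ds; rewrite cfkerMr // (subsetP kerU) // imset_f ?inE.
have gI : group_set (ideal l.-1).
  apply/group_setP; split=> [|x z]; first by rewrite inE Dx0.
  by rewrite !inE; apply: DD.
have fM : mulon (Group gI) (fun s => 'chi_j (hh s) * psi (- (k * s))).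
  split=> [|s t]; first by rewrite (hh0 chainR) (lin_char1 lin) mulr0 oppr0 (psi0 psi_add) mulr1.
  rewrite !inE => Ds Dt.
  rewrite -[(s * t)%g]/(s + t) -(hhM chainR) // (lin_charM lin); last 2 first.
  - by have := inB s 0 Ds; rewrite u0 mulg1.
  - by have := inB t 0 Dt; rewrite u0 mulg1.
  by rewrite mulrDr opprD (psiD psi_add); ring.
have E1 : 'chi_j (hh s0) * psi (- (k * s0)) = 1.
  apply/eqP; apply: contraNT nz2 => ne; rewrite /fi.
  rewrite (eq_bigr (fun s => #|ideal 0|%:R * ('chi_j (hh s) * psi (- (k * s))))).
    have s0I : s0 \in Group gI by rewrite inE.
    by rewrite -mulr_sumr (mulon_sum0 fM s0I) // mulr0.
  move=> s; rewrite inE => Ds; rewrite mulr_natl -sumr_const; apply: eq_bigr => x _.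
  by rewrite ugu.
rewrite -[LHS]mulr1 -(psi0 psi_add) -(addNr (k * s0)) (psiD psi_add) mulrA E1 mul1r //.
Qed.

End Split.

(** * Characters induced from the Borel subgroup *)

Section Induced.
Variables (R : finComUnitRingType) (pi : R) (l q : nat) (psi : R -> algC).
Hypothesis chainR : chain_ring pi l q.
Hypothesis psi_add : additive_char psi.
Hypothesis psi_nt : exists2 x, x \in [set: R] & psi (pi ^+ l.-1 * x) != 1.

Notation D i x := (dvdR (pi ^+ i) x).
Notation ideal i := (ideal pi i).
Notation wh := (wh l q psi).
Notation GG := (GG R).
Notation regc := (regc pi l).
Notation fi := (fi pi l psi).
Notation ssB := (@ssB R pi l psi).
Implicit Types (g h : {'GL_2[R]}) (a b c d x y z s t : R).
Notation Bg := (box_group pi 0 l).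
Notation Ig := (box_group pi 0 1).
Notation Dg := (box_group pi l.-1 1).

Let l0 := l_gt0 chainR.
Let Dtop_unit := Dtop_unit chainR.

Lemma wh_sum (phi : 'CF(GG)) : wh phi 1 = \sum_j '[phi, 'chi_j] * (regc 'chi_j)%:R.
Proof.
under eq_bigr => j _ do rewrite -(regcP chainR psi_add psi_nt) /wh mulrCA mulr_sumr.
rewrite -mulr_sumr; congr (_ * _); rewrite exchange_big /=; apply: eq_bigr => x _.
rewrite {1}[phi]cfun_sum_cfdot sum_cfunE mulr_suml; apply: eq_bigr => j _.
by rewrite cfunE mulrA.
Qed.

Lemma wh_char_ge0 (phi : 'CF(GG)) : phi \is a character -> 0 <= wh phi 1.
Proof.
move=> Nphi; rewrite wh_sum; apply: sumr_ge0 => j _.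
by rewrite mulr_ge0 ?ler0n // natr_ge0 ?Cnat_cfdot_char_irr.
Qed.

Lemma whD (phi xi : 'CF(GG)) : wh (phi + xi) 1 = wh phi 1 + wh xi 1.
Proof.
by rewrite !wh_sum -big_split; apply: eq_bigr => j _; rewrite cfdotDl mulrDl.
Qed.

(** Every regular constituent contributes 1 to [wh phi 1], so there is room for only one. *)
Lemma wh1_irr (phi : 'CF(GG)) : phi \is a character -> wh phi 1 = 1 ->
  (forall j, '[phi, 'chi_j] != 0 -> regc 'chi_j) -> phi \in irr GG.
Proof.
move=> Nphi wphi rphi.
have nz : phi != 0.
  apply: contra_eq_neq wphi => ->; rewrite wh_sum big1 1?eq_sym ?oner_neq0 // => j _.
  by rewrite cfdot0l mul0r.
have [j Hj] := neq0_has_constt nz.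
have /(constt_charP _ Nphi)[xi Nxi Ephi] := Hj.
have rj : regc 'chi_j by apply: rphi; rewrite -irr_consttE.
have wxi : wh xi 1 = 0.
  move: wphi; rewrite Ephi whD (regcP chainR) // rj => /eqP.
  by rewrite -{2}[1]addr0 (inj_eq (addrI _)) => /eqP.
rewrite Ephi; have [->|nzx] := eqVneq xi 0; first by rewrite addr0 mem_irr.
have [k Hk] := neq0_has_constt nzx.
have /(constt_charP _ Nxi)[zeta Nz Exi] := Hk.
have rk : regc 'chi_k.
  apply: rphi; rewrite Ephi Exi !cfdotDl cfnorm_irr.
  rewrite gt_eqF // ltr_wpDl ?natr_ge0 ?Cnat_cfdot_char ?irr_char //.
  by rewrite ltr_wpDr ?ltr01 ?natr_ge0 ?Cnat_cfdot_char ?irr_char.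
have := wh_char_ge0 Nz; move: wxi; rewrite Exi whD (regcP chainR) // rk => /eqP.
by rewrite addrC addr_eq0 => /eqP->; rewrite lerNr oppr0 ler10.
Qed.

Lemma not_reg_ker (i : Iirr GG) : ~~ regc 'chi_i -> forall x, D l.-1 x ->
  [/\ u x \in cfker 'chi_i, v x \in cfker 'chi_i & hh x \in cfker 'chi_i].
Proof.
move=> nr; have ku x : D l.-1 x -> u x \in cfker 'chi_i.
  move=> Dx; rewrite cfkerEirr inE; move: nr; rewrite negb_exists => /forallP/(_ x).
  by rewrite Dx negbK.
have kv x : D l.-1 x -> v x \in cfker 'chi_i.
  by move=> Dx; have := ku x Dx; rewrite !cfkerEirr !inE chi_uv.
move=> x Dx; split; [exact: ku | exact: kv |].
have DNx : D l.-1 (- x) by rewrite DN.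
(* A conjugate of [u (- x)] produces [hh x] up to factors already known to lie in the kernel. *)
have E : u (- x) ** v (-1) = v (-1) ** (v x ** hh x ** u (- x)).
  have xx : x * x = 0 by apply: (Dtoptop chainR).
  apply: gl_eq; rewrite !GL_MxE !val_u !val_v (val_hh chainR) // !mx2M; congr mx2.
  - by ring.
  - rewrite [RHS](_ : _ = - x - x * x); last by ring.
    by rewrite xx; ring.
  - rewrite [RHS](_ : _ = -1 + x * x); last by ring.
    by rewrite xx; ring.
  - rewrite [RHS](_ : _ = 1 - x * x * x); last by ring.
    by rewrite xx; ring.
have E2 : (v x ** hh x ** u (- x)) \in cfker 'chi_i.
  have := ku _ DNx; rewrite !cfkerEirr !inE => /eqP <-; apply/eqP.
  by rewrite (class_eq 'chi_i E).
have := groupM (groupVr (kv x Dx)) (groupM E2 (groupVr (ku _ DNx))).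
by rewrite -!mulgA mulgV mulg1 mulKg.
Qed.

Lemma IndB_deg k (mu : 'CF(Bg)) : ssB k mu -> 'Ind[GG] mu 1%g = ((q + 1) * q ^ l.-1)%:R.
Proof.
case=> lmu _ _; rewrite cfInd1 ?subsetT // (lin_char1 lmu) mulr1; congr (_%:R).
apply/eqP; rewrite -(eqn_pmul2l (cardG_gt0 Bg)) (Lagrange (subsetT Bg)).
rewrite (card_GG chainR) (card_box chainR) ?leqnn ?l0 // subn0 subnn expn0 muln1.
by rewrite expnD; apply/eqP; ring.
Qed.

(** A coset of the Borel subgroup fixed by [u x] must lie in the Iwahori subgroup, since a unit
    lower left entry would force [x = 0]; conversely all those cosets are fixed. *)
Lemma IndB_u k (mu : 'CF(Bg)) x : ssB k mu -> D l.-1 x -> x != 0 ->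
  'Ind[GG] mu (u x) = (q ^ l.-1)%:R.
Proof.
case=> lmu mu1 _ Dx nzx; rewrite cfIndE ?subsetT //.
rewrite (eq_bigr (fun g => if g \in Ig then 1 else 0)) => [|g _].
  rewrite -big_mkcondr (eq_bigl (mem Ig)) => [|g]; last by rewrite inE.
  rewrite sumr_const !(card_box chainR) ?leqnn ?l0 // !subn0 subnn subn1.
  rewrite expn0 muln1 [X in _ * X]natrM mulKf // natrM mulf_neq0 ?(nzq chainR) //.
  by rewrite natrX expf_neq0 ?(nzU chainR).
have E : u x ** g = g ** (u x ^ g)%g by rewrite conjgE mulKVg.
move: (u x ^ g)%g E => j E.
case: ifPn => gI.
  suff -> : j = u (x * e11 g / e00 g) by rewrite mu1.
  apply: (mulgI g); rewrite -E; move: (gI); rewrite inE => /andP[_ Dc].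
  have [Ua Ud] := box_units chainR (ltn0Sn 0) gI.
  have xc : x * e10 g = 0 by apply: (Dtop1 chainR).
  apply: gl_ext; rewrite !entriesM !uE ?mul1r ?mulr1 ?mul0r ?mulr0 ?add0r ?addr0 //.
  - by rewrite xc addr0.
  - by rewrite [e00 g * _]mulrC divrK // addrC.
  - have -> : e10 g * (x * e11 g / e00 g) = x * e10 g * (e11 g / e00 g) by ring.
    by rewrite xc mul0r add0r.
apply: cfun0; apply: contra gI; rewrite (in_Bg chainR) => /eqP j10.
rewrite inE D0x /=; apply: contraT; rewrite -(unitN1 chainR) => Uc.
have := congr1 (fun m : {'GL_2[R]} => e10 m) E; have := congr1 (fun m : {'GL_2[R]} => e00 m) E.
rewrite !entriesM !uE j10 !mulr0 !addr0 mul0r mul1r add0r mul1r => E00 E10.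
have j00 : e00 j = 1 by apply: (mulrI Uc); rewrite -E10 mulr1.
move: E00; rewrite j00 mulr1 => /eqP; rewrite -{2}[e00 g]addr0 (inj_eq (addrI _)).
by move=> /eqP xc; case/eqP: nzx; apply: (mulIr Uc); rewrite mul0r.
Qed.

(** The socle average in [wh1E] is [2 * q ^ l.-1], which leaves exactly [#|units R|] for the unit
    frequencies. *)
Lemma IndB_wh k (mu : 'CF(Bg)) : ssB k mu -> wh ('Ind[GG] mu) 1 = 1.
Proof.
move=> smu; have := wh1E chainR psi_add psi_nt ('Ind[GG] mu).
rewrite (IndB_deg smu) (big_setD1 0) ?inE ?Dx0 //= u0 (IndB_deg smu).
rewrite (eq_bigr (fun=> (q ^ l.-1)%:R)) => [|x]; last first.
  by rewrite !inE => /andP[nzx Dx]; apply: IndB_u smu Dx nzx.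
rewrite sumr_const (_ : #|_| = (q - 1)%N); last first.
  by rewrite [in RHS](qE chainR) (cardsD1 0 (ideal l.-1)) inE Dx0 addKn.
have nU := nzU chainR; have n1 := nzq1 chainR => E.
apply: (mulfI nU); rewrite mulr1.
rewrite (canRL (addKr _) (esym E)).
rewrite (card_unitsE chainR) -[_ *+ (q - 1)]mulr_natr !natrM natrD natrB ?(q_gt0 chainR) //.
by move: (q ^ l.-1)%:R => Q; field.
Qed.

Lemma IndB_irr k (mu : 'CF(Bg)) : k \is a GRing.unit -> ssB k mu ->
  exists2 i, 'Ind[GG] mu = 'chi_i & regc 'chi_i.
Proof.
move=> Uk smu; have [lmu mu1 muh] := smu.
have Nmu := lin_charW lmu.
have rj j : '['Ind[GG] mu, 'chi_j] != 0 -> regc 'chi_j.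
  apply: contraR => nr; rewrite -Frobenius_reciprocity.
  have [s0 Ds0 ns0] : exists2 s, D l.-1 s & psi (k * s) != 1.
    have [x _ nx] := psi_nt; exists (pi ^+ l.-1 * (k^-1 * x)); first exact: DpiM.
    have -> : k * (pi ^+ l.-1 * (k^-1 * x)) = (k * k^-1) * (pi ^+ l.-1 * x) by ring.
    by rewrite mulrV ?mul1r.
  (* A constituent that is not regular would have [hh s0] in its kernel, whereas
     [mu (hh s0) = psi (k * s0)] differs from 1. *)
  have [_ _ kh] := not_reg_ker nr Ds0.
  have hB : hh s0 \in Bg.
    exact: (subsetP (box_sub pi (leq0n l) (leqnn l))) _ (hh_box chainR Ds0).
  set z := '[_, _]; suff : z = psi (k * s0) * z.
    move/eqP; rewrite -subr_eq0 -{1}[z]mul1r -mulrBl mulf_eq0 subr_eq0 eq_sym.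
    by rewrite (negPf ns0).
  rewrite /z cfdotE [RHS]mulrCA [X in _ = _ * X]mulr_sumr; congr (_ * _).
  rewrite [LHS](reindex_inj (mulgI (hh s0))) /=; apply: eq_big => g; first by rewrite groupMl.
  rewrite groupMl // => gB; rewrite (lin_charM lmu) // muh // !cfResE ?subsetT ?groupM //.
  by rewrite cfkerMl // mulrA.
have /irrP[i Ei] : 'Ind[GG] mu \in irr GG.
  by apply: wh1_irr; rewrite ?cfInd_char ?(IndB_wh smu).
by exists i => //; apply: rj; rewrite Ei cfnorm_irr oner_eq0.
Qed.

Lemma ssB_chi (i : Iirr GG) k mu : k \is a GRing.unit -> ssB k mu ->
  '['Res[Bg] 'chi_i, mu] != 0 -> 'chi_i = 'Ind[GG] mu.
Proof.
move=> Uk smu; rewrite cfdot_Res_l; have [j -> _] := IndB_irr Uk smu.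
by rewrite cfdot_irr; have [-> //|_] := eqVneq i j; rewrite mulr0n eqxx.
Qed.

(** The criterion used from here on: a unit torus frequency on V reveals that the character is
    induced from the Borel subgroup. *)
Lemma fi_ss (i : Iirr GG) k : k \is a GRing.unit -> fi l.-1 k 'chi_i != 0 ->
  exists2 mu, ssB k mu & 'chi_i = 'Ind[GG] mu.
Proof.
move=> Uk nz; have [mu smu nmu] := ss_eigen chainR psi_add psi_nt Uk nz.
by exists mu => //; apply: ssB_chi smu nmu.
Qed.

End Induced.

(** * Restriction to the Iwahori subgroup *)

Section Iwahori.
Variables (R : finComUnitRingType) (pi : R) (l q : nat) (psi : R -> algC).
Hypothesis chainR : chain_ring pi l q.
Hypothesis psi_add : additive_char psi.
Hypothesis psi_nt : exists2 x, x \in [set: R] & psi (pi ^+ l.-1 * x) != 1.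

Notation D i x := (dvdR (pi ^+ i) x).
Notation ideal i := (ideal pi i).
Notation wh := (wh l q psi).
Notation GG := (GG R).
Notation regc := (regc pi l).
Notation fi := (fi pi l psi).
Notation ssB := (@ssB R pi l psi).
Notation mlow := (mlow pi l q psi).
Implicit Types (g h : {'GL_2[R]}) (a b c d x y z s t : R).
Notation Bg := (box_group pi 0 l).
Notation Ig := (box_group pi 0 1).
Notation Dg := (box_group pi l.-1 1).

Let l0 := l_gt0 chainR.

Lemma Dtop_1 x : D l.-1 x -> D 1 x.
Proof. by apply: DW; have := l_gt1 chainR; lia. Qed.

Definition Dm i (A : 'M[R]_2) := [forall i1, forall i2, D i (A i1 i2)].

Lemma DmP i A : reflect (exists X, A = pi ^+ i *: X) (Dm i A).
Proof.
apply: (iffP forallP) => [H | [X ->] i1]; last first.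
  by apply/forallP => i2; rewrite mxE DpiM.
have [X HX] : exists X : 'I_2 -> 'I_2 -> R, forall i1 i2, A i1 i2 = pi ^+ i * X i1 i2.
  have H1 i1 : exists X : 'I_2 -> R, forall i2, A i1 i2 = pi ^+ i * X i2.
    apply: (@fin_all_exists _ (fun=> R) (fun i2 x => A i1 i2 = pi ^+ i * x)) => i2.
    by have /forallP/(_ i2)/DP := H i1.
  exact: (fin_all_exists H1).
by exists (\matrix_(i1, i2) X i1 i2); apply/matrixP => i1 i2; rewrite !mxE HX.
Qed.

Lemma Dm0 i : Dm i 0. Proof. by apply/DmP; exists 0; rewrite scaler0. Qed.
Lemma DmD i A B : Dm i A -> Dm i B -> Dm i (A + B).
Proof. by move=> /DmP[X ->] /DmP[Y ->]; apply/DmP; exists (X + Y); rewrite scalerDr. Qed.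
Lemma DmN i A : Dm i (- A) = Dm i A.
Proof.
by apply/idP/idP => /DmP[X E]; apply/DmP; exists (- X); rewrite scalerN -E ?opprK.
Qed.
Lemma DmB i A B : Dm i A -> Dm i B -> Dm i (A - B).
Proof. by move=> HA HB; rewrite DmD ?DmN. Qed.
Lemma DmMl i A B : Dm i B -> Dm i (A *m B).
Proof. by move=> /DmP[X ->]; apply/DmP; exists (A *m X); rewrite scalemxAr. Qed.
Lemma DmMr i A B : Dm i A -> Dm i (A *m B).
Proof. by move=> /DmP[X ->]; apply/DmP; exists (X *m B); rewrite scalemxAl. Qed.
Lemma DmM i j A B : Dm i A -> Dm j B -> Dm (i + j) (A *m B).
Proof.
move=> /DmP[X ->] /DmP[Y ->]; apply/DmP; exists (X *m Y).
by rewrite -scalemxAl -scalemxAr scalerA exprD.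
Qed.
Lemma DmW i j A : (i <= j)%N -> Dm j A -> Dm i A.
Proof.
move=> lij /forallP H; apply/forallP => i1; apply/forallP => i2.
by have /forallP/(_ i2) := H i1; apply: DW.
Qed.
Lemma Dmge i A : (l <= i)%N -> Dm i A -> A = 0.
Proof. by move=> li /DmP[X ->]; rewrite (pige chainR li) scale0r. Qed.
Lemma Dmpi i X : Dm i (pi ^+ i *: X). Proof. by apply/DmP; exists X. Qed.
Lemma Dmtr i A : Dm i A -> D i (\tr A).
Proof. by move=> /DmP[X ->]; rewrite mxtraceZ DpiM. Qed.
Lemma Dm2 i A : Dm i A = [&& D i (A 0 0), D i (A 0 1), D i (A 1 0) & D i (A 1 1)].
Proof.
apply/forallP/and4P => [H | [h1 h2 h3 h4] i1].
  by split; have /forallP := H 0; have /forallP := H 1 => H1 H0; rewrite ?H0 ?H1.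
have I2 (k : 'I_2) : k = 0 \/ k = 1.
  by case: k => [[|[|//]] ?]; [left | right]; apply: val_inj.
by apply/forallP => i2; case: (I2 i1) => ->; case: (I2 i2) => ->.
Qed.

Definition Kcong i : {set {'GL_2[R]}} := [set g : {'GL_2[R]} | Dm i (GLval g - 1)].

Lemma Kcong_group_set i : group_set (Kcong i).
Proof.
apply/group_setP; split=> [|g h]; first by rewrite inE GL_1E subrr Dm0.
rewrite !inE GL_ME => Kg Kh.
rewrite (_ : _ - _ = (GLval g - 1) *m GLval h + (GLval h - 1)); last first.
  by rewrite mulmxBl mul1mx addrA subrK.
by rewrite DmD // DmMr.
Qed.
Canonical Kcong_group i := Group (Kcong_group_set i).

Lemma valJ g h : GLval (g ^ h)%g - 1 = GLval h^-1%g *m (GLval g - 1) *m GLval h.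
Proof.
rewrite mulmxBr mulmxBl mulmx1 conjgE !GL_ME mulrA.
by congr (_ - _); rewrite -[_ *m _]GL_ME mulVg.
Qed.

Lemma Kcong_norm i : (Kcong_group i <| GG)%g.
Proof.
rewrite /normal subsetT; apply/subsetP => h _; rewrite inE.
by apply/subsetP => _ /imsetP[g Kg ->]; rewrite !inE valJ DmMr // DmMl //; rewrite inE in Kg.
Qed.

(** The elements 1 + X with X of trace 0 and divisible by pi^(l-1). Every [psi_A] with [A] scalar
    modulo p is trivial on it, which is why sums over this group detect regularity. *)
Definition Sset : {set {'GL_2[R]}} := [set g in Kcong l.-1 | \tr (GLval g) == 2%:R].

Lemma Sset_group_set : group_set Sset.
Proof.
apply/group_setP; split=> [|g h]; first by rewrite inE group1 GL_1E mxtrace1 eqxx.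
move=> /setIdP[Kg /eqP tg] /setIdP[Kh /eqP th]; apply/setIdP.
split; first exact: (@groupM _ (Kcong_group l.-1)).
rewrite inE in Kg; rewrite inE in Kh; rewrite GL_ME.
have -> : GLval g * GLval h = (GLval g - 1) *m (GLval h - 1) + GLval g + GLval h - 1.
  rewrite mulmxBl !mulmxBr mulmx1 !mul1mx -[GLval g * _]/(GLval g *m GLval h).
  by move: (GLval g *m GLval h) => M; apply/matrixP => i1 i2; rewrite !mxE; ring.
rewrite (_ : _ *m _ = 0); last first.
  by apply: (Dmge (_ : l <= l.-1 + l.-1)%N); [have := l_gt1 chainR; lia | apply: DmM].
by rewrite add0r !raddfD /= raddfN /= tg th mxtrace1 addrK.
Qed.

Canonical Sset_group := Group Sset_group_set.
Notation Sg := Sset_group.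

Lemma Sg_norm : (Sg <| GG)%g.
Proof.
rewrite /normal subsetT; apply/subsetP => h _; rewrite inE.
apply/subsetP => _ /imsetP[g /setIdP[Kg /eqP tg] ->]; apply/setIdP.
have [_ /subsetP nK] := andP (Kcong_norm l.-1).
split; first by rewrite memJ_norm // nK ?inGG.
have hV : GLval h *m GLval h^-1%g = 1 by have := GL_ME h h^-1%g; rewrite mulgV.
by rewrite conjgE !GL_ME -[_ * _]/(_ *m (_ *m _)) mxtrace_mulC -mulmxA hV mulmx1 tg.
Qed.

Definition su (w : R * (R * R)) := v w.1 ** (hh w.2.1 ** u w.2.2).

Lemma val_su x y s : D l.-1 x -> D l.-1 y -> D l.-1 s ->
  GLval (su (y, (s, x))) = mx2 (1 + s) x y (1 - s).
Proof.
move=> Dx Dy Ds; rewrite -[su _]/(v y ** (hh s ** u x)) !GL_MxE val_u val_v (val_hh chainR) // !mx2M.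
have sx := Dtoptop chainR Ds Dx; have sy := Dtoptop chainR Ds Dy.
have xy := Dtoptop chainR Dx Dy.
congr mx2; try ring.
- by rewrite [LHS](_ : _ = x + s * x); last (by ring); rewrite sx addr0.
- by rewrite [LHS](_ : _ = y + s * y); last (by ring); rewrite sy addr0.
- by rewrite [LHS](_ : _ = x * y + s * y * x + (1 - s)); last (by ring); rewrite sy xy mul0r !add0r.
Qed.

Lemma sum_Sg (f : {'GL_2[R]} -> algC) : \sum_(g in Sg) f g =
  \sum_(y in ideal l.-1) \sum_(s in ideal l.-1) \sum_(x in ideal l.-1) f (su (y, (s, x))).
Proof.
pose A := setX (ideal l.-1) (setX (ideal l.-1) (ideal l.-1)).
have inA y s x : ((y, (s, x)) \in A) = [&& D l.-1 y, D l.-1 s & D l.-1 x].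
  by rewrite !in_setX !inE.
have injf : {in A &, injective su}.
  move=> [y [s x]] [y' [s' x']]; rewrite !inA => /and3P[Dy Ds Dx] /and3P[Dy' Ds' Dx'].
  move/(congr1 (@GLval _ _)); rewrite !val_su // => /mx2_inj[/addrI-> -> -> _] //.
have -> : Sg = su @: A :> {set _}.
  apply/setP => g; apply/setIdP/imsetP => [[Kg /eqP tg] | [[y [s x]] wA ->]].
    move: Kg; rewrite inE Dm2 !mxE /= !mulr1n !mulr0n !subr0 => /and4P[h1 h2 h3 h4].
    exists (e10 g, (e00 g - 1, e01 g)); first by rewrite inA h1 h2 h3.
    apply: gl_eq; rewrite val_su // [LHS]mx2_eta; congr mx2; first by rewrite addrC subrK.
    by rewrite opprB addrA -[RHS]/(2%:R - _) -tg mx2_tr addrC addKr.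
  move: wA; rewrite inA => /and3P[Dy Ds Dx]; rewrite inE val_su //.
  rewrite Dm2 mx2_tr !mxE /= !mulr1n !mulr0n !subr0 addrAC subrr add0r Ds Dx Dy /=.
  rewrite addrAC subrr add0r DN Ds; split=> //; rewrite eqxx || idtac.
  by apply/eqP; ring.
rewrite big_imset //= (eq_bigl (fun w => (w.1 \in ideal l.-1) && (w.2 \in setX (ideal l.-1) (ideal l.-1)))); last first.
  by case=> ? ?; rewrite in_setX.
rewrite -(pair_big (mem (ideal l.-1)) (mem (setX (ideal l.-1) (ideal l.-1))) (fun y w => f (su (y, w)))) /=.
apply: eq_bigr => y _.
rewrite (eq_bigl (fun w => (w.1 \in ideal l.-1) && (w.2 \in ideal l.-1))); last first.
  by case=> ? ?; rewrite in_setX.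
by rewrite -(pair_big (mem (ideal l.-1)) (mem (ideal l.-1)) (fun s x => f (su (y, (s, x))))).
Qed.

Lemma reg_sum_SgM (i : Iirr GG) g : regc 'chi_i -> \sum_(h in Sg) 'chi_i (g ** h) = 0.
Proof.
move=> /existsP[x /andP[Dx ne]].
have nk : ~~ (Sg \subset cfker 'chi_i).
  apply/subsetPn; exists (u x); last by rewrite cfkerEirr inE.
  apply/setIdP; rewrite inE Dm2 val_u mx2_tr !mxE /= !mulr1n !mulr0n !subr0 subrr Dx Dx0.
  by split.
have := @cfFixE _ GG Sg 'chi_i g Sg_norm (inGG g).
rewrite cfFix_irr (negPf nk) cfunE => /esym/eqP; rewrite mulf_eq0 invr_eq0 pnatr_eq0.
by rewrite eqn0Ngt cardG_gt0 /= => /eqP.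
Qed.

Lemma reg_sum_Sg (i : Iirr GG) : regc 'chi_i -> \sum_(g in Sg) 'chi_i g = 0.
Proof.
move=> ri; rewrite -[RHS](reg_sum_SgM 1%g ri).
by apply: eq_bigr => g _; rewrite mul1g.
Qed.

Lemma uI_conj g x : g \in Ig -> D l.-1 x -> u x ** g = g ** u (x * e11 g / e00 g).
Proof.
move=> gI Dx; move: (gI); rewrite inE => /andP[_ Dc].
have [Ua Ud] := box_units chainR (ltn0Sn 0) gI.
have xc : x * e10 g = 0 by apply: (Dtop1 chainR).
apply: gl_ext; rewrite !entriesM !uE ?mul1r ?mulr1 ?mul0r ?mulr0 ?add0r ?addr0 //.
- by rewrite xc addr0.
- by rewrite [e00 g * _]mulrC divrK // addrC.
- have -> : e10 g * (x * e11 g / e00 g) = x * e10 g * (e11 g / e00 g) by ring.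
  by rewrite xc mul0r add0r.
Qed.

Lemma hhI_conj g s : g \in Ig -> D l.-1 s ->
  hh s ** g = g ** (hh s ** u (s * e01 g *+ 2 / e00 g)).
Proof.
move=> gI Ds; move: (gI); rewrite inE => /andP[_ Dc].
have [Ua Ud] := box_units chainR (ltn0Sn 0) gI.
have sc : s * e10 g = 0 by apply: (Dtop1 chainR).
have ss : s * s = 0 by apply: (Dtoptop chainR).
pose y := s * e01 g *+ 2 / e00 g; rewrite -/y.
have ay : e00 g * y = s * e01 g *+ 2 by rewrite mulrC divrK.
have sy : s * y = 0.
  have -> : s * y = s * s * (e01 g *+ 2 / e00 g) by rewrite /y; ring.
  by rewrite ss mul0r.
have cy : e10 g * y = 0.
  have -> : e10 g * y = s * e10 g * (e01 g *+ 2 / e00 g) by rewrite /y; ring.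
  by rewrite sc mul0r.
apply: gl_eq; rewrite !GL_MxE val_u (val_hh chainR) // [GLval g]mx2_eta !mx2M; congr mx2.
- by ring.
- rewrite [RHS](_ : _ = e00 g * y + e00 g * (s * y) + e01 g * (1 - s)); last by ring.
  by rewrite sy mulr0 ay; ring.
- rewrite [LHS](_ : _ = e10 g - s * e10 g); last by ring.
  rewrite [RHS](_ : _ = e10 g + s * e10 g); last by ring.
  by rewrite sc subr0 addr0.
- rewrite [RHS](_ : _ = e10 g * y + e10 g * (s * y) + e11 g * (1 - s)); last by ring.
  by rewrite sy mulr0 cy; ring.
Qed.

Definition Pset : {set {'GL_2[R]}} := [set u x | x in ideal l.-1].

Lemma Pset_group_set : group_set Pset.
Proof.
apply/group_setP; split=> [|g h].
  by rewrite -(u0 R) imset_f // inE Dx0.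
move=> /imsetP[x xI ->] /imsetP[y yI ->]; rewrite uM imset_f // inE.
by rewrite !inE in xI yI; apply: DD.
Qed.
Canonical Pset_group := Group Pset_group_set.
Notation Pg := Pset_group.

Lemma uI x : u x \in Ig.
Proof.
by have := subsetP (box_sub pi (leqnn 0) l0) _ (u_box l (D0x pi x)).
Qed.

Lemma vI y : D 1 y -> v y \in Ig.
Proof. by move=> Dy; have := subsetP (box_sub pi (leq0n l) (leqnn 1)) _ (v_box l Dy). Qed.

Lemma hhI s : D l.-1 s -> hh s \in Ig.
Proof. by move=> Ds; have := subsetP (box_sub pi (leq0n l) l0) _ (hh_box chainR Ds). Qed.

Lemma dgI a d : a \is a GRing.unit -> d \is a GRing.unit -> dg a d \in Ig.
Proof. by move=> Ua Ud; have := subsetP (box_sub pi (leq0n l) l0) _ (dg_box pi l Ua Ud). Qed.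

Lemma Pg_norm : (Pg <| Ig)%g.
Proof.
apply/andP; split; first by apply/subsetP => _ /imsetP[x _ ->]; apply: uI.
apply/subsetP => g gI; rewrite inE; apply/subsetP => _ /imsetP[_ /imsetP[x xI ->] ->].
rewrite inE in xI; rewrite conjgE (uI_conj gI xI) mulKg imset_f // inE.
by do 2!apply: DMr.
Qed.

Lemma card_Pg : #|Pg| = q.
Proof. by rewrite card_imset ?(qE chainR) //; apply: u_inj. Qed.

Lemma sum_Pg (f : {'GL_2[R]} -> algC) : \sum_(g in Pg) f g = \sum_(x in ideal l.-1) f (u x).
Proof. by rewrite big_imset //= => x y _ _; apply: u_inj. Qed.

(** The space V, as a character of the Iwahori subgroup, which normalizes [Pset]; [Wp] is the
    complement. *)
Definition Vp (i : Iirr GG) : 'CF(Ig) := cfFix Pg ('Res[Ig] 'chi_i).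
Definition Wp (i : Iirr GG) : 'CF(Ig) := 'Res[Ig] 'chi_i - Vp i.

Lemma Vp_char i : Vp i \is a character.
Proof. by rewrite cfFix_char ?cfRes_char ?irr_char. Qed.
Lemma Wp_char i : Wp i \is a character.
Proof. by rewrite cfFixC_char ?cfRes_char ?irr_char. Qed.

Lemma VWE i g : g \in Ig -> Vp i g + Wp i g = 'chi_i g.
Proof.
move=> gI; transitivity ((Vp i + Wp i) g); first by rewrite [RHS]cfunE.
by rewrite addrC subrK cfResE ?subsetT.
Qed.

Lemma VpE i g : g \in Ig -> Vp i g = q%:R^-1 * \sum_(x in ideal l.-1) 'chi_i (g ** u x).
Proof.
move=> gI; rewrite /Vp cfFixE ?Pg_norm // card_Pg sum_Pg; congr (_ * _).
by apply: eq_bigr => x _; rewrite cfResE ?subsetT // groupM // uI.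
Qed.

Lemma Vp1 i : Vp i 1%g = q%:R^-1 * \sum_(x in ideal l.-1) 'chi_i (u x).
Proof. by rewrite VpE ?group1 //; congr (_ * _); apply: eq_bigr => x _; rewrite mul1g. Qed.

Lemma reg_deg i : regc 'chi_i -> 'chi_i 1%g = Vp i 1%g + ((q - 1) * q ^ l.-1)%:R.
Proof. by move=> ri; rewrite Vp1 (irr1_reg chainR psi_add psi_nt ri). Qed.

Lemma fi_Vp i k : fi l.-1 k 'chi_i = q%:R * \sum_(s in ideal l.-1) Vp i (hh s) * psi (- (k * s)).
Proof.
rewrite mulr_sumr; apply: eq_bigr => s; rewrite inE => Ds.
by rewrite VpE ?hhI // !mulrA mulfV ?(nzq1 chainR) // mul1r mulr_suml.
Qed.

(** Fourier inversion in [k]: [fi l.-1 k] depends on [k] modulo p only, so once the unit frequencies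
    vanish only the trivial character of the elements [hh s] remains. *)
Lemma fi0_hh i : (forall k, k \is a GRing.unit -> fi l.-1 k 'chi_i = 0) ->
  forall s, D l.-1 s -> hh s \in cfker (Vp i).
Proof.
move=> fi0 s Ds; have nq := nzq1 chainR.
have E : \sum_(t in ideal l.-1) Vp i (hh t) = \sum_(t in ideal l.-1) Vp i 1%g.
  have S1 : \sum_(k in [set: R]) fi l.-1 k 'chi_i = q%:R * (q ^ l)%:R * Vp i 1%g.
    under eq_bigr => k _ do rewrite fi_Vp.
    rewrite -mulr_sumr exchange_big /= (bigD1 0) ?inE ?Dx0 //= [X in _ * (_ + X)]big1 ?addr0.
      rewrite -mulr_sumr (hh0 chainR) -mulrA; congr (_ * _); rewrite mulrC; congr (_ * _).
      rewrite (eq_bigr (fun=> 1)) => [|k _]; last by rewrite mulr0 oppr0 (psi0 psi_add).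
      by rewrite sumr_const cardsT (card_R chainR).
    move=> t /andP[_ nzt]; rewrite -mulr_sumr.
    rewrite (_ : \sum_(k in _) _ = 0) ?mulr0 //.
    have := sum_psi chainR psi_add psi_nt (- t); rewrite oppr_eq0 (negPf nzt) => E0.
    rewrite -[RHS]E0; apply: eq_big => k; rewrite ?inE // => _.
    by rewrite mulNr mulrC.
  have S2 : \sum_(k in [set: R]) fi l.-1 k 'chi_i = (q ^ l.-1)%:R * fi l.-1 0 'chi_i.
    rewrite (bigID (mem (ideal 1))) /= [X in _ + X]big1 ?addr0; last first.
      by move=> k /andP[_]; rewrite inE -(unitN1 chainR) => /fi0.
    rewrite (eq_bigr (fun=> fi l.-1 0 'chi_i)) => [|k /andP[_]]; last first.
      rewrite inE => Dk; rewrite !fi_Vp; congr (_ * _); apply: eq_bigr => t.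
      by rewrite inE => Dt; rewrite mul0r [k * t]mulrC (Dtop1 chainR Dt Dk).
    rewrite sumr_const mulr_natl; congr (_ *+ _); rewrite -subn1 -(card_ideal chainR) //.
    by apply: eq_card => k; rewrite -[LHS]/((k \in [set: R]) && (k \in ideal 1)) inE.
  move: S1; rewrite S2 fi_Vp (qlE chainR) sumr_const -(qE chainR) => S1.
  have nn : (q ^ l.-1)%:R != 0 :> algC by apply: nzq chainR _.
  apply: (mulfI nq); apply: (mulfI nn).
  under eq_bigr => t _ do rewrite -[Vp i _]mulr1 -(psi0 psi_add) -oppr0 -(mul0r t).
  by rewrite S1 -mulr_natl; ring.
have Es : Vp i (hh s) = Vp i 1%g.
  apply: (@normC_sum_upper _ _ (mem (ideal l.-1)) (fun t => Vp i (hh t)) (fun=> Vp i 1%g)) => //=.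
    by move=> t _; apply: char1_ge_norm; apply: Vp_char.
  by rewrite inE.
by rewrite cfkerEchar ?Vp_char // inE hhI // Es eqxx.
Qed.

Lemma VpJ i a x : a \is a GRing.unit -> D 1 x -> Vp i (v (a * x)) = Vp i (v x).
Proof.
move=> Ua Dx; have E : v x ** dg a 1 = dg a 1 ** v (a * x).
  by rewrite dg_v ?unitr1 // mul1r mulrAC mulrV // mul1r.
have -> : v (a * x) = conjg (v x) (dg a 1) by rewrite conjgE E mulKg.
by rewrite cfunJ // dgI ?unitr1.
Qed.

(** Averaging over the [v], [hh] and [u] of the socle is averaging over [Sset], and a regular
    character has no vectors fixed by that group. *)
Lemma Vp_fixv i : regc 'chi_i -> (forall s, D l.-1 s -> hh s \in cfker (Vp i)) ->
  \sum_(y in ideal l.-1) Vp i (v y) = 0.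
Proof.
move=> ri kh; have nq := nzq1 chainR; apply: (mulfI nq); rewrite mulr0.
apply: (mulfI nq); rewrite mulr0; apply: etrans (reg_sum_Sg ri).
rewrite sum_Sg mulrA [LHS]mulr_sumr.
apply: eq_bigr => y; rewrite inE => Dy.
transitivity (\sum_(s in ideal l.-1) q%:R * Vp i (v y ** hh s)).
  rewrite [RHS](eq_bigr (fun=> q%:R * Vp i (v y))) => [|s].
    by rewrite sumr_const -(qE chainR) -[RHS]mulr_natl mulrA.
  by rewrite inE => Ds; rewrite cfkerMr // kh.
apply: eq_bigr => s; rewrite inE => Ds.
rewrite VpE ?mulVKf ?groupM ?hhI ?vI ?Dtop_1 //.
by apply: eq_bigr => x _; rewrite /su mulgA.
Qed.

Definition ds s : {'GL_2[R]} := dg (1 + s) 1.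

Lemma val_dsv s y : D l.-1 s -> GLval (ds s ** v y) = mx2 (1 + s) 0 y 1.
Proof.
move=> Ds; rewrite GL_MxE val_v val_dg ?unitr1 ?(Dtop_unit chainR) // mx2M.
by congr mx2; ring.
Qed.

(** A truncated lower triangular mirabolic group. Its elements [ds s ** v y] carry the linear
    characters [tau s * psi y] whose multiplicity [mirabolic_mult] computes. *)
Definition M1set : {set {'GL_2[R]}} := [set g : {'GL_2[R]} | [&& e01 g == 0, e11 g == 1,
  D l.-1 (e00 g - 1) & D 1 (e10 g)]].

Lemma M1_group_set : group_set M1set.
Proof.
apply/group_setP; split=> [|g h].
  by rewrite inE !entries1 !eqxx subrr !Dx0.
rewrite !inE !entriesM => /and4P[/eqP g1 /eqP g2 g3 g4] /and4P[/eqP h1 /eqP h2 h3 h4].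
rewrite g1 g2 h1 h2 !mulr0 !mul0r !mul1r addr0 add0r eqxx addr0 /=.
rewrite eqxx /= (_ : _ * _ - 1 = (e00 g - 1) * e00 h + (e00 h - 1)); last by ring.
by rewrite DD ?DMr //= DD ?DMr.
Qed.
Canonical M1_group := Group M1_group_set.
Notation M1 := M1_group.

Lemma sum_M1 (f : {'GL_2[R]} -> algC) :
  \sum_(g in M1) f g = \sum_(s in ideal l.-1) \sum_(y in ideal 1) f (ds s ** v y).
Proof.
pose A := setX (ideal l.-1) (ideal 1); pose F (w : R * R) := ds w.1 ** v w.2.
have injF : {in A &, injective F}.
  move=> [s y] [s' y']; rewrite !in_setX !inE /= => /andP[Ds Dy] /andP[Ds' Dy'].
  by move/(congr1 (@GLval _ _)); rewrite !val_dsv //= => /mx2_inj[/addrI-> _ -> _].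
have -> : M1 = F @: A :> {set _}.
  apply/setP => g; rewrite inE; apply/and4P/imsetP => [[/eqP g1 /eqP g2 g3 g4]|[[s y]]].
    exists (e00 g - 1, e10 g); first by rewrite in_setX !inE g3.
    by apply: gl_eq; rewrite val_dsv // [LHS]mx2_eta g1 g2 /= addrC subrK.
  rewrite in_setX !inE /= => /andP[Ds Dy] ->.
  by rewrite val_dsv //= !mx2E !eqxx addrAC subrr add0r.
rewrite big_imset //= (eq_bigl (fun w => (w.1 \in ideal l.-1) && (w.2 \in ideal 1))); last first.
  by case=> ? ?; rewrite in_setX.
by rewrite -(pair_big (mem (ideal l.-1)) (mem (ideal 1)) (fun s y => f (F (s, y)))).
Qed.

Lemma card_M1 : #|M1| = (q * q ^ l.-1)%N.
Proof.
apply/eqP; rewrite -(eqr_nat algC) -[X in X%:R == _]sum1_card natr_sum; apply/eqP.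
rewrite sum_M1 (eq_bigr (fun=> (q ^ l.-1)%:R)) => [|s _]; last first.
  by rewrite sumr_const (card_ideal chainR) // subn1.
by rewrite sumr_const -(qE chainR) natrM mulr_natl.
Qed.

Definition addm (tau : R -> algC) := tau 0 = 1 /\
  forall s t, D l.-1 s -> D l.-1 t -> tau (s + t) = tau s * tau t.

Lemma addm_conj tau s : addm tau -> D l.-1 s -> tau s * (tau s)^* = 1.
Proof.
move=> [tau0 tauD] Ds.
have gI : group_set (ideal l.-1).
  apply/group_setP; split=> [|x z]; first by rewrite inE Dx0.
  by rewrite !inE; apply: DD.
have fM : mulon (Group gI) tau.
  by split=> // x y; rewrite !inE => Dx Dy; rewrite -[(x * y)%g]/(x + y) tauD.
have sI : s \in Group gI by rewrite inE.
by rewrite -normCK (mulon_norm fM sI) expr1n.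
Qed.

Lemma M1_nat (H : {group {'GL_2[R]}}) (phi : 'CF(H)) tau : M1 \subset H ->
  phi \is a character -> addm tau ->
  (q * q ^ l.-1)%:R^-1 * (\sum_(s in ideal l.-1) \sum_(y in ideal 1)
     phi (ds s ** v y) * ((tau s)^* * psi (- y))) \in Num.nat.
Proof.
move=> sMH Nphi [tau0 tauD].
pose lam g := tau (e00 g - 1) * psi (e10 g).
have lamM : mulon M1 lam.
  split=> [|g h]; first by rewrite /lam !entries1 subrr tau0 (psi0 psi_add) mulr1.
  rewrite !inE /lam !entriesM => /and4P[/eqP g1 /eqP g2 g3 g4] /and4P[/eqP h1 /eqP h2 h3 h4].
  rewrite g1 g2 mul0r mul1r addr0.
  have -> : e00 g * e00 h - 1 = (e00 g - 1) + (e00 h - 1) + (e00 g - 1) * (e00 h - 1) by ring.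
  rewrite (Dtoptop chainR g3 h3) addr0 tauD //.
  have -> : e10 g * e00 h + e10 h = e10 g + e10 h + (e00 h - 1) * e10 g by ring.
  by rewrite (Dtop1 chainR h3 g4) addr0 (psiD psi_add); ring.
have := mulon_mult_nat sMH Nphi lamM; rewrite card_M1 sum_M1.
rewrite (eq_bigr (fun s => \sum_(y in ideal 1) phi (ds s ** v y) * ((tau s)^* * psi (- y)))) //.
move=> s; rewrite inE => Ds; apply: eq_bigr => y _.
rewrite /lam val_dsv // !mx2E addrAC subrr add0r rmorphM /=.
by rewrite (psi_conj psi_add).
Qed.

Lemma central_tau (i : Iirr GG) : exists2 tau, addm tau & forall g s, D l.-1 s ->
  'chi_i (g ** dg (1 + s / 2%:R) (1 + s / 2%:R)) = tau s * 'chi_i g.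
Proof.
pose z s := dg (1 + s / 2%:R : R) (1 + s / 2%:R).
have D2 s : D l.-1 s -> D l.-1 (s / 2%:R) by apply: DMr.
have U s : D l.-1 s -> 1 + s / 2%:R \is a GRing.unit by move=> Ds; rewrite (Dtop_unit chainR) ?D2.
have cz s g : D l.-1 s -> (z s ^ g)%g = z s.
  move=> Ds; rewrite conjgE; apply: (mulgI g); rewrite mulKVg.
  by apply: gl_eq; rewrite !GL_MxE val_dg ?U // -mx2_scalar scalar_mxC.
have cent s : D l.-1 s -> exists w, forall g, 'chi_i (g ** z s) = w * 'chi_i g.
  move=> Ds; have [||w Hw] := @irr_class_sum _ GG i [set z s] (fun=> 1).
  - exact: subsetT.
  - by move=> x g /set1P-> _; rewrite cz // inE eqxx.
  by exists w => g; rewrite -Hw ?inGG // big_set1 mul1r.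
pose tau s := 'chi_i (z s) / 'chi_i 1%g.
have Htau s g : D l.-1 s -> 'chi_i (g ** z s) = tau s * 'chi_i g.
  move=> Ds; have [w Hw] := cent s Ds; rewrite Hw; congr (_ * _).
  by rewrite /tau -[z s]mul1g Hw mulfK ?irr1_neq0.
exists tau; last by move=> g s Ds; apply: Htau.
have z0 : z 0 = 1%g.
  by apply: gl_eq; rewrite /z mul0r addr0 val_dg ?unitr1 // -mx2_scalar.
split=> [|s t Ds Dt]; first by rewrite /tau z0 divff ?irr1_neq0.
have -> : tau (s + t) = 'chi_i (z s ** z t) / 'chi_i 1%g.
  congr ('chi_i _ / _); rewrite /z dgM ?U //; have st := Dtoptop chainR (D2 s Ds) (D2 t Dt).
  have -> : (1 + s / 2%:R) * (1 + t / 2%:R) = 1 + (s + t) / 2%:R + s / 2%:R * (t / 2%:R) by ring.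
  by rewrite st addr0.
by rewrite Htau // /tau; ring.
Qed.

(** [ds s] is [hh (s / 2)] times a scalar matrix; the first acts trivially on V, the second through
    the central character. *)
Lemma Vp_tau (i : Iirr GG) : (forall s, D l.-1 s -> hh s \in cfker (Vp i)) ->
  exists2 tau, addm tau & forall g s, g \in Ig -> D l.-1 s -> Vp i (g ** ds s) = tau s * Vp i g.
Proof.
move=> kh; have [tau atau Htau] := central_tau i; exists tau => // g s gI Ds.
have Ds2 : D l.-1 (s / 2%:R) by apply: DMr.
have U2 := unit2 chainR; have U1 := Dtop_unit chainR Ds2.
have s2 : s / 2%:R + s / 2%:R = s by rewrite -mulrDl -mulr2n -[s *+ 2]mulr_natr mulrK.
have ss := Dtoptop chainR Ds2 Ds2.
set z := dg (1 + s / 2%:R) (1 + s / 2%:R).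
have zI : z \in Ig by rewrite dgI.
have -> : ds s = hh (s / 2%:R) ** z.
  rewrite /ds /hh dgM ?(Dtop_unit chainR) ?DN //; congr dg.
    by rewrite -{1}s2 -[LHS]addr0 -ss; ring.
  by rewrite -[LHS]addr0 -{1}oppr0 -ss; ring.
have Vz h : h \in Ig -> Vp i (h ** z) = tau s * Vp i h.
  move=> hI; rewrite !VpE ?groupM // [RHS]mulrCA [X in _ = _ * X]mulr_sumr; congr (_ * _).
  apply: eq_bigr => x _; rewrite -Htau // -!mulgA; congr ('chi_i (h ** _)).
  by apply: gl_eq; rewrite !GL_MxE val_dg // -mx2_scalar scalar_mxC.
rewrite mulgA Vz ?groupM ?hhI //; congr (_ * _).
by rewrite cfkerMr // kh.
Qed.

Lemma M1_sub i : (i <= l)%N -> M1 \subset box_group pi i 1.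
Proof.
move=> li; apply/subsetP => g; rewrite !inE => /and4P[/eqP-> _ _ ->].
by rewrite Dx0.
Qed.

Lemma ds_v s y : D l.-1 s -> D 1 y -> ds s ** v y = v y ** ds s.
Proof.
move=> Ds Dy; have U1 := Dtop_unit chainR Ds; rewrite dg_v ?unitr1 //; congr (v _ ** _).
apply: (mulIr U1); rewrite divrK // mul1r mulrDr mulr1 mulrC (Dtop1 chainR Ds Dy) addr0 //.
Qed.

Lemma Vp_M1 i tau : addm tau ->
  (forall g s, g \in Ig -> D l.-1 s -> Vp i (g ** ds s) = tau s * Vp i g) ->
  (q * q ^ l.-1)%:R^-1 * (\sum_(s in ideal l.-1) \sum_(y in ideal 1)
     Vp i (ds s ** v y) * ((tau s)^* * psi (- y))) = mlow (fun y => Vp i (v y)) 1.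
Proof.
move=> atau Htau; rewrite /mlow natrM invfM [_^-1 * _^-1]mulrC -mulrA; congr (_ * _).
apply: (mulfI (nzq1 chainR)); rewrite mulVKf ?(nzq1 chainR) //.
rewrite [X in X%:R * _](qE chainR) mulr_natl -sumr_const.
apply: eq_bigr => s; rewrite inE => Ds; apply: eq_bigr => y; rewrite inE => Dy.
rewrite ds_v // Htau ?vI // mul1r.
have := addm_conj atau Ds => E.
transitivity ((tau s * (tau s)^*) * (Vp i (v y) * psi (- y))); first by ring.
by rewrite E mul1r.
Qed.

Lemma Vp_mlow i : regc 'chi_i -> (forall s, D l.-1 s -> hh s \in cfker (Vp i)) ->
  exists2 m : nat, (m <= 1)%N &
    mlow (fun y => Vp i (v y)) 1 = m%:R /\ q%:R * Vp i 1%g = #|units R|%:R * m%:R.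
Proof.
move=> ri kh; have [tau atau Htau] := Vp_tau kh.
have EV := Vp_M1 atau Htau.
have /natrP[m Em] := M1_nat (M1_sub (leq0n l)) (Vp_char i) atau.
have /natrP[n En] := M1_nat (M1_sub (leq0n l)) (Wp_char i) atau.
exists m; last first.
  rewrite -EV Em; split=> //.
  pose f y := if D 1 y then Vp i (v y) else 0.
  have fU a x : a \is a GRing.unit -> f (a * x) = f x.
    by move=> Ua; rewrite /f DUl //; case: ifP => // Dx; rewrite VpJ.
  have := mlow_sum chainR psi_add psi_nt fU; rewrite {1}/f Dx0 v0.
  rewrite (eq_bigr (fun y => Vp i (v y))) => [|y]; last by rewrite inE /f => /Dtop_1->.
  rewrite (Vp_fixv ri kh) add0r => ->; congr (_ * _); rewrite -Em EV.
  by congr (_ * _); apply: eq_bigr => y; rewrite inE /f => ->.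
have tc0 : (fun s => (tau s)^*) 0 = 1 by case: atau => /= ->; rewrite rmorph1.
have := @mirabolic_mult _ _ _ _ _ chainR psi_add psi_nt 'chi_i (fun s => (tau s)^*) tc0.
rewrite (regcP chainR psi_add psi_nt) ri.
rewrite (eq_bigr (fun s => (\sum_(y in ideal 1) Vp i (ds s ** v y) * ((tau s)^* * psi (- y))) +
   \sum_(y in ideal 1) Wp i (ds s ** v y) * ((tau s)^* * psi (- y)))); last first.
  move=> s; rewrite inE => Ds; rewrite -big_split; apply: eq_bigr => y; rewrite inE => Dy /=.
  rewrite -mulrDl VWE // groupM ?vI //.
  by rewrite dgI ?unitr1 ?(Dtop_unit chainR).
rewrite big_split /= mulrDr Em En -natrD => /eqP; rewrite eqr_nat => /eqP <-.
exact: leq_addr.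
Qed.

(** Without a unit frequency on V, [Vp_mlow] bounds the degree of V by [(q - 1) * q ^ l.-2], whereas
    the assumed degree requires [2 * q ^ l.-1]. *)
Lemma ss_struct (i : Iirr GG) : regc 'chi_i -> 'chi_i 1%g = ((q + 1) * q ^ l.-1)%:R ->
  exists k mu, [/\ k \is a GRing.unit, ssB k mu & 'chi_i = 'Ind[GG] mu].
Proof.
move=> ri deg.
have /existsP[k /andP[Uk nz]] : [exists k, (k \is a GRing.unit) && (fi l.-1 k 'chi_i != 0)].
  apply: contraT; rewrite negb_exists => /forallP nE.
  have fi0 k : k \is a GRing.unit -> fi l.-1 k 'chi_i = 0.
    by move=> Uk; apply/eqP; have := nE k; rewrite Uk negbK.
  have [m m1 [_ Em]] := Vp_mlow ri (fi0_hh fi0).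
  have := reg_deg ri; rewrite deg => /eqP; rewrite -subr_eq -natrB; last first.
    by rewrite leq_mul2r; apply/orP; right; lia.
  rewrite -mulnBl (_ : q + 1 - (q - 1) = 2)%N; last by have := q_gt0 chainR; lia.
  move=> /eqP EV; move: Em; rewrite -EV -!natrM (card_unitsE chainR) => /eqP.
  rewrite eqr_nat => /eqP E; have := q_gt0 chainR.
  have : (0 < q ^ l.-1)%N by rewrite expn_gt0 (q_gt0 chainR).
  move: (q ^ l.-1)%N E m1 => Q; case: (m) => [|[|//]]; nia.
have [mu smu Emu] := fi_ss chainR psi_add psi_nt Uk nz.
by exists k, mu.
Qed.

End Iwahori.

(** * Fourier analysis on the abelian congruence subgroup *)

Section Orbit.
Variables (R : finComUnitRingType) (pi : R) (l q : nat) (psi : R -> algC).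
Hypothesis chainR : chain_ring pi l q.
Hypothesis psi_add : additive_char psi.
Hypothesis psi_nt : exists2 x, x \in [set: R] & psi (pi ^+ l.-1 * x) != 1.

Notation D i x := (dvdR (pi ^+ i) x).
Notation ideal i := (ideal pi i).
Notation wh := (wh l q psi).
Notation GG := (GG R).
Notation regc := (regc pi l).
Implicit Types (g h k n : {'GL_2[R]}) (a b c d x y z s t : R) (A B X Y : 'M[R]_2).
Notation Dm := (Dm pi).
Notation m := (l./2).
Notation m' := (l - l./2)%N.
Notation Ng := (Kcong_group pi m').
Notation psA := (psiA psi).
Notation gv g := (GLval g : 'M[R]_2).
Notation Ig := (box_group pi 0 1).

Lemma m_gt0 : (0 < m)%N. Proof. by have := l_gt1 chainR; lia. Qed.
Lemma m'_gt0 : (0 < m')%N. Proof. by have := l_gt1 chainR; lia. Qed.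
Let m0 := m_gt0.
Let m'0 := m'_gt0.

Lemma gvM g h : gv (g ** h) = gv g *m gv h. Proof. by []. Qed.
Lemma gv1 : gv (1%g : {'GL_2[R]}) = 1%:M. Proof. by []. Qed.
Lemma gvJ g h : gv (conjg g h) - 1%:M = gv h^-1%g *m (gv g - 1%:M) *m gv h.
Proof. exact (valJ g h). Qed.
Lemma gvI g h : gv g = gv h -> g = h. Proof. exact: gl_eq. Qed.
Lemma inK i g : (g \in Kcong pi i) = Dm i (gv g - 1%:M). Proof. by rewrite inE. Qed.

Lemma GLvalV g : (gv g *m gv g^-1%g = 1%:M) * (gv g^-1%g *m gv g = 1%:M).
Proof.
by rewrite -!gvM mulgV mulVg gv1.
Qed.

Definition cj g A : 'M[R]_2 := gv g *m A *m gv g^-1%g.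

Lemma cj1 A : cj 1%g A = A. Proof. by rewrite /cj invg1 mul1mx mulmx1. Qed.
Lemma cjM g h A : cj (g ** h) A = cj g (cj h A).
Proof. by rewrite /cj invMg !gvM !mulmxA. Qed.
Lemma cjB g A B : cj g (A - B) = cj g A - cj g B.
Proof. by rewrite /cj mulmxBr mulmxBl. Qed.
Lemma cjD g A B : cj g (A + B) = cj g A + cj g B.
Proof. by rewrite /cj mulmxDr mulmxDl. Qed.
Lemma cj_scalar g a : cj g a%:M = a%:M.
Proof. by rewrite /cj scalar_mxC -mulmxA GLvalV mulmx1. Qed.
Lemma Dm_cjW i g A : Dm i A -> Dm i (cj g A).
Proof. by move=> HA; rewrite DmMr ?DmMl. Qed.
Lemma Dm_cj i g A : Dm i (cj g A) = Dm i A.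
Proof.
apply/idP/idP; last exact: Dm_cjW.
by move/(Dm_cjW g^-1%g); rewrite -cjM mulVg cj1.
Qed.
Lemma cjK g : cancel (cj g) (cj g^-1%g).
Proof. by move=> A; rewrite -cjM mulVg cj1. Qed.
Lemma cjKV g : cancel (cj g^-1%g) (cj g).
Proof. by move=> A; rewrite -cjM mulgV cj1. Qed.
Lemma cj_tr g A : \tr (cj g A) = \tr A.
Proof. by rewrite /cj mxtrace_mulC mulmxA GLvalV mul1mx. Qed.
Lemma cj_det g A : \det (cj g A) = \det A.
Proof.
rewrite /cj !det_mulmx mulrAC -det_mulmx GLvalV det1 mul1r //.
Qed.
Lemma cj_comm g A : gv g *m A - A *m gv g = (cj g A - A) *m gv g.
Proof. by rewrite mulmxBl /cj -[_ *m gv g^-1%g *m _]mulmxA GLvalV mulmx1. Qed.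
Lemma cj_commV g A : cj g A - A = (gv g *m A - A *m gv g) *m gv g^-1%g.
Proof. by rewrite cj_comm -mulmxA GLvalV mulmx1. Qed.
Lemma Dm_cj_comm i g A : Dm i (cj g A - A) = Dm i (gv g *m A - A *m gv g).
Proof.
by apply/idP/idP => H; [rewrite cj_comm | rewrite cj_commV]; apply: DmMr.
Qed.

Lemma K_elt i X : (0 < i)%N -> exists2 g, g \in Kcong pi i & gv g = 1%:M + pi ^+ i *: X.
Proof.
move=> i0.
have U : (1%:M + pi ^+ i *: X) 0 0 * (1%:M + pi ^+ i *: X) 1 1
        - (1%:M + pi ^+ i *: X) 0 1 * (1%:M + pi ^+ i *: X) 1 0 \is a GRing.unit.
  rewrite !mxE /= !mulr1n !mulr0n !add0r.
  have -> : (1 + pi ^+ i * X 0 0) * (1 + pi ^+ i * X 1 1) - pi ^+ i * X 0 1 * (pi ^+ i * X 1 0)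
    = 1 + pi ^+ i * (X 0 0 + X 1 1 + pi ^+ i * X 0 0 * X 1 1 - pi ^+ i * X 0 1 * X 1 0) by ring.
  by apply: (unit_addD chainR); rewrite ?unitr1 //; apply: DW (DpiM _ _ _).
exists (gl ((1%:M + pi ^+ i *: X) 0 0) ((1%:M + pi ^+ i *: X) 0 1)
  ((1%:M + pi ^+ i *: X) 1 0) ((1%:M + pi ^+ i *: X) 1 1)); last by rewrite gl_val // -mx2_eta.
by rewrite inE gl_val // -mx2_eta addrAC subrr add0r Dmpi.
Qed.

Lemma psi_mx_nondeg i B : (i <= l)%N ->
  (forall X, psi (\tr (B *m (pi ^+ i *: X))) = 1) -> Dm (l - i) B.
Proof.
move=> li H; apply/forallP => i1; apply/forallP => i2.
apply: (psi_nondeg chainR psi_nt li) => _ /DP[x ->].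
rewrite -[RHS](H (x *: delta_mx i2 i1)); congr psi.
rewrite -!scalemxAr !mxtraceZ (_ : \tr _ = B i1 i2); first by ring.
rewrite /mxtrace (bigD1 i1) //= big1 => [|j ne].
  by rewrite mxE (bigD1 i2) //= big1 => [|j ne]; rewrite !mxE ?eqxx ?mulr1 ?addr0 // (negPf ne) mulr0.
by rewrite mxE big1 // => k _; rewrite mxE (negPf ne) andbF mulr0.
Qed.

Lemma psA_mulon A : mulon Ng (psA A).
Proof.
split=> [|g h]; first by rewrite /psiA gv1 subrr mulmx0 mxtrace0 (psi0 psi_add).
rewrite !inE /psiA => Kg Kh; rewrite -(psiD psi_add); congr psi.
rewrite -mxtraceD -mulmxDr; congr (\tr (_ *m _)).
rewrite gvM (_ : _ *m _ = (gv g - 1%:M) *m (gv h - 1%:M) + gv g + gv h - 1%:M); last first.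
  by rewrite mulmxBl mulmxBr !mulmx1 mul1mx; apply/matrixP => i j; rewrite !mxE; ring.
rewrite (_ : _ *m _ = 0); last by apply: (Dmge chainR _ (DmM Kg Kh)); lia.
by rewrite add0r; apply/matrixP => i j; rewrite !mxE; ring.
Qed.

Lemma psA_J A g h : psA A (conjg g h) = psA (cj h A) g.
Proof.
by rewrite /psiA gvJ /cj !mulmxA mxtrace_mulC !mulmxA.
Qed.

Lemma psA_per A B g : g \in Ng -> Dm m (A - B) -> psA A g = psA B g.
Proof.
rewrite inE => Kg DAB; rewrite /psiA; apply: (mulIf (psi_neq0 psi_add (- \tr (B *m (gv g - 1%:M))))).
rewrite -!(psiD psi_add) subrr -raddfB -mulmxBl; congr psi.
by rewrite (Dmge chainR _ (DmM DAB Kg)) ?raddf0 //; lia.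
Qed.

Lemma psA_nondeg A B : {in Ng, psA A =1 psA B} -> Dm m (A - B).
Proof.
move=> H; have -> : m = (l - m')%N by lia.
apply: psi_mx_nondeg => [|X]; first by lia.
have [g Kg Eg] := K_elt X m'0; have := H g Kg; rewrite /psiA Eg addrAC subrr add0r => E.
by rewrite mulmxBl raddfB (psiD psi_add) E -(psiD psi_add) subrr (psi0 psi_add).
Qed.

(** The trace of [g] times the projector onto the [psA A]-isotypic part for the abelian group [Ng].
    For a class function it lives on the stabilizer of [psA A], by [FF_supp0]. *)
Definition FF (chi : {'GL_2[R]} -> algC) A g : algC :=
  #|Ng|%:R^-1 * \sum_(n in Ng) (psA A n)^* * chi (g ** n).

Lemma FF_per chi A B g : Dm m (A - B) -> FF chi A g = FF chi B g.
Proof. by move=> H; congr (_ * _); apply: eq_bigr => n nN; rewrite (psA_per nN H). Qed.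

Lemma NgJ h n : (conjg n h \in Ng) = (n \in Ng).
Proof. by rewrite memJ_norm //; have [_ /subsetP->] := andP (Kcong_norm pi m'); rewrite ?inGG. Qed.

Lemma FF_J (chi : 'CF(GG)) A g h : FF chi A (conjg g h) = FF chi (cj h A) g.
Proof.
congr (_ * _); rewrite (reindex_inj (conjg_inj h)) /=.
apply: eq_big => n; first by rewrite NgJ.
by move=> nN; rewrite -conjMg cfunJ ?inGG // psA_J.
Qed.

Lemma FF_mulN chi A g n : n \in Ng -> FF chi A (g ** n) = psA A n * FF chi A g.
Proof.
move=> nN; rewrite /FF mulrCA; congr (_ * _); rewrite mulr_sumr.
rewrite (reindex_inj (mulgI n^-1%g)) /=; apply: eq_big => n1; first by rewrite groupMl ?groupV.
rewrite groupMl ?groupV // => n1N; rewrite -mulgA mulKVg (psA_mulon A).2 ?groupV //.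
by rewrite rmorphM /= (mulon_conj (psA_mulon A)) ?groupV // invgK mulrA.
Qed.

Lemma sum_psi_mx B : \sum_A psi (\tr (A *m B)) = if B == 0 then (q ^ (4 * l))%:R else 0.
Proof.
case: eqP => [->|/eqP nz].
  rewrite (eq_bigr (fun=> 1)) => [|A _]; last by rewrite mulmx0 mxtrace0 (psi0 psi_add).
  by rewrite sumr_const card_mx (card_R chainR) -expnM mulnC.
have fM : mulon [set: 'M[R]_2] (fun A => psi (\tr (A *m B))).
  split=> [|A A' _ _]; first by rewrite -[1%g]/(0 : 'M[R]_2) mul0mx mxtrace0 (psi0 psi_add).
  by rewrite -[(A * A')%g]/(A + A') mulmxDl mxtraceD (psiD psi_add).
have [/existsP[A nA]|/existsPn H] := boolP [exists A, psi (\tr (A *m B)) != 1].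
  rewrite -[RHS](@mulon_sum0 _ [set: 'M[R]_2]%G _ A fM (in_setT _) nA).
  by apply: eq_bigl => ?; rewrite inE.
case/negP: nz; apply/eqP; apply: (Dmge chainR (leqnn l)); rewrite -[l]subn0.
apply: psi_mx_nondeg => // X; rewrite expr0 scale1r mxtrace_mulC.
by apply/eqP; have := H X; rewrite negbK.
Qed.

(** [psA A] depends on [A] modulo p^m only, so each character of [Ng] is counted
    [q ^ (4 * l) / #|Ng|] times. *)
Lemma FF_inv chi g : \sum_A FF chi A g = (q ^ (4 * l))%:R / #|Ng|%:R * chi g.
Proof.
rewrite -mulr_sumr exchange_big /= (bigD1 1%g) //= [X in _ * (_ + X)]big1 ?addr0; last first.
  move=> n /andP[nN n1]; rewrite -mulr_suml (_ : \sum_A _ = 0) ?mul0r //.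
  rewrite -rmorph_sum /= sum_psi_mx.
  case: eqP => [/eqP E|_]; last by rewrite rmorph0.
  by case/negP: n1; apply/eqP/gvI; rewrite gv1; apply/eqP; rewrite -subr_eq0.
rewrite mulg1 -mulr_suml mulrA [_^-1 * _]mulrC; congr (_ / _ * _).
rewrite (eq_bigr (fun=> 1)) => [|A _]; last by rewrite (psA_mulon A).1 rmorph1.
by rewrite sumr_const card_mx (card_R chainR) -expnM mulnC.
Qed.

(** Conjugation by [n] in the congruence subgroup of level [r] preserves [psA A], while [g ^ n = g *
    [g, n]] with [[g, n]] in [Ng], as [g] is scalar modulo p^(m'-r). Hence [psA A] is 1 on these
    commutators, and nondegeneracy of the trace form gives the congruence. *)
Lemma FF_supp (chi : 'CF(GG)) A g r s : (m <= r <= m')%N -> FF chi A g != 0 ->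
  Dm (m' - r) (gv g - s%:M) -> Dm (l - r) (cj g A - A).
Proof.
move=> /andP[mr rm'] nz Dg; apply: psi_mx_nondeg => [|X]; first by lia.
have [n Kn En] := K_elt X (leq_trans m0 mr).
have KnV : n^-1%g \in Kcong_group pi r by rewrite groupV.
have EC : gv [~ g, n]%g - 1%:M =
    gv g^-1%g *m gv n^-1%g *m (gv g *m gv n - gv n *m gv g).
  rewrite commgEl conjgE !gvM mulmxBr !mulmxA; congr (_ - _).
  by rewrite -[_ *m gv n^-1%g *m gv n]mulmxA GLvalV mulmx1 GLvalV.
have EX : gv g *m gv n - gv n *m gv g = pi ^+ r *: (gv g *m X - X *m gv g).
  by rewrite En mulmxDr mulmxDl mulmx1 mul1mx -scalemxAr -scalemxAl opprD addrACA subrr add0r scalerBr.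
have Dgx : Dm (m' - r) (gv g *m X - X *m gv g).
  have -> : gv g *m X - X *m gv g = (gv g - s%:M) *m X - X *m (gv g - s%:M).
    by rewrite mulmxBl mulmxBr scalar_mxC opprB addrA addrNK.
  by apply: DmB; [apply: DmMr | apply: DmMl].
have Dc : Dm m' (gv g *m gv n - gv n *m gv g).
  by have := DmM (Dmpi pi r 1%:M) Dgx; rewrite -scalemxAl mul1mx -EX subnKC.
have cN : [~ g, n]%g \in Ng by rewrite inE -[1]/(1%:M) EC DmMl.
have E1 : psA A [~ g, n]%g = 1.
  apply: (mulIf nz); rewrite mul1r -FF_mulN // commgEl mulKVg FF_J.
  apply: FF_per; rewrite Dm_cj_comm En mulmxDl mulmxDr mulmx1 mul1mx opprD addrACA subrr add0r.
  by apply: (@DmW _ _ _ r) => //; rewrite -scalemxAl -scalemxAr DmB ?Dmpi.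
(* The factor [n^-1] is 1 modulo p^r and the rest lies in p^m', with [r + m'] at least [l]. *)
have E2 : gv n^-1%g *m (gv g *m gv n - gv n *m gv g) =
          gv g *m gv n - gv n *m gv g.
  apply/eqP; rewrite -subr_eq0 -[X in _ - X]mul1mx -mulmxBl; apply/eqP.
  by move: KnV; rewrite inE => KnV; apply: (Dmge chainR _ (DmM KnV Dc)); lia.
move: E1; rewrite /psiA EC -mulmxA E2 EX => E1.
have EB : cj g A - A = - (A - cj g A) by rewrite opprB.
rewrite EB mulNmx raddfN /= -(psi_conj psi_add).
suff -> : \tr ((A - cj g A) *m (pi ^+ r *: X)) =
  \tr (A *m (gv g^-1%g *m (pi ^+ r *: (gv g *m X - X *m gv g)))) by rewrite E1 rmorph1.
rewrite -!scalemxAr !mxtraceZ; congr (_ * _).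
rewrite mulmxBl mulmxBr mulmxA GLvalV mul1mx mulmxBr !raddfB /=; congr (_ - _).
by rewrite /cj -!mulmxA [LHS]mxtrace_mulC -!mulmxA.
Qed.

Lemma FF_supp0 (chi : 'CF(GG)) A g : FF chi A g != 0 -> Dm m (cj g A - A).
Proof.
move=> nz; have -> : m = (l - m')%N by lia.
apply: (@FF_supp chi A g m' 0) => //; first by lia.
by rewrite subnn; apply/DmP; exists (gv g - 0%:M); rewrite expr0 scale1r.
Qed.

Lemma FF_suppV (chi : 'CF(GG)) A g s : FF chi A g != 0 ->
  Dm (m' - m) (gv g - s%:M) -> Dm m' (cj g A - A).
Proof. by move=> nz Dg; apply: (@FF_supp chi A g m s) => //; lia. Qed.

Definition SA A : {set {'GL_2[R]}} := [set g : {'GL_2[R]} | Dm m (cj g A - A)].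

Lemma SA_group_set A : group_set (SA A).
Proof.
apply/group_setP; split=> [|g h]; rewrite !inE ?cj1 ?subrr ?Dm0 // => Dg Dh.
rewrite cjM (_ : _ - _ = cj g (cj h A - A) + (cj g A - A)); last by rewrite cjB addrA subrK.
by rewrite DmD ?Dm_cj.
Qed.
Canonical SA_group A := Group (SA_group_set A).

Lemma Ng_SA A : Ng \subset SA A.
Proof.
apply/subsetP => n; rewrite !inE => Kn; rewrite Dm_cj_comm.
have -> : gv n *m A - A *m gv n = (gv n - 1%:M) *m A - A *m (gv n - 1%:M).
  by rewrite mulmxBl mulmxBr mul1mx mulmx1 opprB addrA addrNK.
by apply: (@DmW _ _ _ m'); [lia | apply: DmB; [apply: DmMr | apply: DmMl]].
Qed.

Lemma FF_char (chi : 'CF(GG)) A (H : {group {'GL_2[R]}}) : chi \is a character ->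
  Ng \subset H -> H \subset SA A ->
  exists2 theta : 'CF(H), theta \is a character & {in H, theta =1 FF chi A}.
Proof.
move=> Nchi sNH sHS.
have inv : {in Ng & H, forall k g, (k ^ g)%g \in Ng /\ psA A (k ^ g)%g = psA A k}.
  move=> k g kN gH; rewrite NgJ psA_J; split=> //; apply: psA_per => //.
  by have := subsetP sHS g gH; rewrite inE.
have [th Nth Eth] := isotypic_char sNH inv (psA_mulon A) (cfRes_char H Nchi).
exists th => // g gH; rewrite Eth //; congr (_ * _); apply: eq_bigr => x xN.
by rewrite cfResE ?subsetT // groupM // (subsetP sNH).
Qed.

Lemma FF1_ge0 (chi : 'CF(GG)) A : chi \is a character -> 0 <= FF chi A 1%g.
Proof.
move=> Nchi; have [th Nth Eth] := FF_char Nchi (Ng_SA A) (subxx (SA_group A)).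
by rewrite -Eth ?group1 // char1_ge0.
Qed.

Lemma FF_le1 (chi : 'CF(GG)) A g : chi \is a character -> `|FF chi A g| <= FF chi A 1%g.
Proof.
move=> Nchi; have [th Nth Eth] := FF_char Nchi (Ng_SA A) (subxx (SA_group A)).
have [gS|gS] := boolP (g \in SA A); first by rewrite -!Eth ?group1 // char1_ge_norm.
have [->|nz] := eqVneq (FF chi A g) 0; first by rewrite normr0 FF1_ge0.
by case/negP: gS; rewrite inE; apply: FF_supp0 nz.
Qed.

Lemma FF_mulS (chi : 'CF(GG)) A g h : chi \is a character ->
  `|FF chi A h| = FF chi A 1%g -> FF chi A (g ** h) * FF chi A 1%g = FF chi A g * FF chi A h.
Proof.
move=> Nchi Eh.
have [E0|nz1] := eqVneq (FF chi A 1%g) 0.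
  by move/eqP: Eh; rewrite E0 normr_eq0 => /eqP->; rewrite !mulr0.
have nzh : FF chi A h != 0 by rewrite -normr_eq0 Eh.
have hS : h \in SA A by rewrite inE; apply: FF_supp0 nzh.
have [th Nth Eth] := FF_char Nchi (Ng_SA A) (subxx (SA_group A)).
have [gS|gS] := boolP (g \in SA A).
  by rewrite -!Eth ?group1 ?groupM //; apply: char_center_mul; rewrite ?Eth ?group1.
have F0 k : k \notin SA A -> FF chi A k = 0.
  by move=> kS; apply/eqP; apply: contraNT kS => nz; rewrite inE; apply: FF_supp0 nz.
have ghS : g ** h \notin SA A.
  by apply: contra gS => ghS; rewrite -(mulgK h g) (@groupM _ (SA_group A)) // (@groupVr _ (SA_group A)).
by rewrite (F0 _ gS) (F0 _ ghS) !mul0r.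
Qed.

Lemma FF_orbit (i : Iirr GG) A B : FF 'chi_i A 1%g != 0 -> FF 'chi_i B 1%g != 0 ->
  exists h, Dm m (B - cj h A).
Proof.
have E C : FF 'chi_i C 1%g != 0 -> \sum_(x in Ng) (psA C x)^* * 'chi_i x != 0.
  rewrite /FF mulf_eq0 negb_or => /andP[_]; under eq_bigr do rewrite mul1g; by [].
move=> /E nA /E nB.
have [h _ Hh] := irr_linear_trans (Kcong_norm pi m') (psA_mulon A) (psA_mulon B) nA nB.
by exists h; apply: psA_nondeg => n nN; rewrite Hh // psA_J.
Qed.

Lemma card_Dm i : (i <= l)%N -> #|[set A | Dm i A]| = (q ^ (4 * (l - i)))%N.
Proof.
move=> li; pose I := ideal i.
pose f (w : (R * R) * (R * R)) := mx2 w.1.1 w.1.2 w.2.1 w.2.2.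
have -> : [set A | Dm i A] = f @: setX (setX I I) (setX I I).
  apply/setP => A; rewrite inE Dm2; apply/and4P/imsetP => [[h1 h2 h3 h4]|[[[a b] [c d]]]].
    exists ((A 0 0, A 0 1), (A 1 0, A 1 1)); first by rewrite !in_setX !inE h1 h2 h3.
    exact: mx2_eta.
  by rewrite !in_setX !inE /= => /andP[/andP[h1 h2] /andP[h3 h4]] ->; rewrite !mx2E.
rewrite card_imset; last by move=> [[a b] [c d]] [[a' b'] [c' d']] /mx2_inj[/= -> -> -> ->].
rewrite !cardsX /I (card_ideal chainR li) -!expnD; congr (_ ^ _)%N; lia.
Qed.

Lemma card_K i : (0 < i <= l)%N -> #|Kcong_group pi i| = (q ^ (4 * (l - i)))%N.
Proof.
move=> /andP[i0 li]; rewrite -(card_Dm li).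
have inj : injective (fun g : {'GL_2[R]} => gv g - 1%:M).
  by move=> g h /addIr; apply: gvI.
rewrite -(card_imset _ inj); apply: eq_card => A; rewrite inE.
apply/imsetP/idP => [[g + ->]|/DmP[X ->]]; first by rewrite inK.
have [g Kg Eg] := K_elt X i0.
by exists g => //; rewrite Eg addrAC subrr add0r.
Qed.

Lemma card_N : #|Ng| = (q ^ (4 * m))%N.
Proof. rewrite card_K; [congr (_ ^ _)%N; lia | lia]. Qed.

Lemma FFJ1 (chi : 'CF(GG)) A h : FF chi (cj h A) 1%g = FF chi A 1%g.
Proof. by rewrite -FF_J conj1g. Qed.

Lemma wh_unit (chi : 'CF(GG)) b : b \is a GRing.unit -> wh chi b = wh chi 1.
Proof.
by apply: (@whf_unit R l q psi (fun x => chi (u x))) => a x; apply: chi_uU.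
Qed.

Lemma sum_wh_coset (chi : 'CF(GG)) c : c \is a GRing.unit ->
  \sum_(x in ideal m') chi (u x) * psi (- (c * x)) = (q ^ l)%:R * wh chi 1.
Proof.
move=> Uc; apply: (mulfI (nzq chainR m')).
transitivity ((q ^ l)%:R * \sum_(b in ideal m) wh chi (c + b)); last first.
  rewrite (eq_bigr (fun=> wh chi 1)) => [|b]; last first.
    rewrite inE => Db; apply: wh_unit; apply: (unit_addD chainR) => //.
    by apply: DW Db.
  by rewrite sumr_const (card_ideal chainR); [rewrite -[wh chi 1 *+ _]mulr_natl; ring | lia].
rewrite /wh -mulr_sumr mulVKf ?(nzq chainR) // exchange_big /=.
rewrite mulr_sumr [RHS](bigID (mem (ideal m'))) /= [X in _ + X]big1 ?addr0; last first.
  move=> x; rewrite inE => nDx.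
  under eq_bigr => b _ do rewrite mulrDl opprD (psiD psi_add) mulrA [b * x]mulrC.
  rewrite -mulr_sumr (sum_psi_idealN chainR psi_add psi_nt); last by lia.
  by rewrite (negPf nDx) mulr0.
apply: eq_bigr => x; rewrite inE => Dx.
under eq_bigr => b _ do rewrite mulrDl opprD (psiD psi_add) mulrA [b * x]mulrC.
rewrite -mulr_sumr (sum_psi_idealN chainR psi_add psi_nt); last by lia.
by rewrite Dx mulrC.
Qed.

Lemma sum_psiN x : \sum_a psi (- (a * x)) = if x == 0 then (q ^ l)%:R else 0.
Proof.
have := sum_psi chainR psi_add psi_nt (- x); rewrite oppr_eq0 => <-.
by apply: eq_bigr => a _; rewrite mulNr mulrC.
Qed.

Lemma sum3_prod (f1 f2 f3 : R -> algC) w :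
  \sum_a \sum_b \sum_d f1 a * f2 b * f3 d * w =
  (\sum_a f1 a) * (\sum_b f2 b) * (\sum_d f3 d) * w.
Proof.
rewrite !mulr_suml; apply: eq_bigr => a _.
rewrite [f1 a * _]mulr_sumr !mulr_suml; apply: eq_bigr => b _.
by rewrite mulr_sumr mulr_suml.
Qed.

Lemma psA_conj_mx2 a b c d n : (psA (mx2 a b c d) n)^* =
  psi (- (a * (gv n 0 0 - 1))) * psi (- (b * gv n 1 0)) * psi (- (d * (gv n 1 1 - 1)))
  * psi (- (c * gv n 0 1)).
Proof.
rewrite /psiA (psi_conj psi_add) -!(psiD psi_add); congr psi.
rewrite mx2_tr !mulmx2E !mx2E !mxE /= !mulr1n !mulr0n; ring.
Qed.

(** Summing [psA] over the three free entries leaves only the upper unipotent elements of [Ng],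
    whose contribution is a Whittaker sum at frequency [c]. *)
Lemma sum_FF_corner (chi : 'CF(GG)) c : c \is a GRing.unit ->
  \sum_a \sum_b \sum_d FF chi (mx2 a b c d) 1%g = (q ^ (4 * l))%:R / #|Ng|%:R * wh chi 1.
Proof.
move=> Uc.
transitivity (#|Ng|%:R^-1 * \sum_(n in Ng)
    (\sum_a \sum_b \sum_d (psA (mx2 a b c d) n)^*) * chi n).
  under eq_bigr => a _ do under eq_bigr => b _ do rewrite -mulr_sumr exchange_big /=.
  under eq_bigr => a _ do rewrite -mulr_sumr exchange_big /=.
  rewrite -mulr_sumr exchange_big /=; congr (_ * _); apply: eq_bigr => n _.
  rewrite mulr_suml; apply: eq_bigr => a _; rewrite mulr_suml; apply: eq_bigr => b _.
  by rewrite mulr_suml; apply: eq_bigr => d _; rewrite mul1g.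
rewrite mulrAC [RHS]mulrC; congr (_ * _).
pose f n := (\sum_a \sum_b \sum_d (psA (mx2 a b c d) n)^*) * chi n.
have fE n : f n = if [&& gv n 0 0 == 1, gv n 1 0 == 0 & gv n 1 1 == 1]
                 then (q ^ (3 * l))%:R * (chi n * psi (- (c * gv n 0 1))) else 0.
  rewrite /f; under eq_bigr => a _ do under eq_bigr => b _ do under eq_bigr => d _ do
    rewrite psA_conj_mx2.
  rewrite sum3_prod !sum_psiN !subr_eq0.
  case: eqP => _; rewrite ?mul0r //; case: eqP => _; rewrite ?mulr0 ?mul0r //.
  case: eqP => _; rewrite ?mulr0 ?mul0r // (_ : 3 * l = l + l + l)%N; last by lia.
  by rewrite !expnD !natrM; ring.
rewrite -[LHS]/(\sum_(n in Ng) f n).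
have -> : (q ^ (4 * l))%:R * wh chi 1 = (q ^ (3 * l))%:R * ((q ^ l)%:R * wh chi 1).
  by rewrite mulrA -natrM -expnD; congr ((q ^ _)%:R * _); lia.
rewrite -(sum_wh_coset chi Uc) mulr_sumr.
rewrite (bigID (mem (@u R @: ideal m'))) /= [X in _ + X]big1 ?addr0; last first.
  move=> n /andP[nN nu]; rewrite fE; case: ifP => // /and3P[/eqP h1 /eqP h2 /eqP h3].
  case/negP: nu; apply/imsetP; exists (gv n 0 1).
    by move: nN; rewrite inK Dm2 !mxE /= !mulr0n !subr0 inE => /and4P[].
  by apply: gvI; rewrite val_u [LHS]mx2_eta h1 h2 h3.
rewrite (eq_bigl (mem (@u R @: ideal m'))) => [|n]; last first.
  apply: andb_idl => /imsetP[x]; rewrite inE => Dx ->.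
  by rewrite inK Dm2 val_u !mxE /= !mulr1n !mulr0n !subr0 subrr Dx Dx0.
rewrite big_imset /=; last by move=> x y _ _; apply: u_inj.
by apply: eq_bigr => x _; rewrite fE val_u !mx2E !eqxx /= mulrA.
Qed.

(** Conjugation by [u x] with [x = (a' - a) / c] moves [a] to [a'] and permutes the pairs of the two
    other entries. *)
Lemma sum_FF_row (chi : 'CF(GG)) a a' c : c \is a GRing.unit ->
  \sum_b \sum_d FF chi (mx2 a b c d) 1%g = \sum_b \sum_d FF chi (mx2 a' b c d) 1%g.
Proof.
move=> Uc; pose x := (a' - a) / c.
have xc : x * c = a' - a by rewrite divrK.
have E b d : FF chi (mx2 a b c d) 1%g = FF chi (mx2 a' (b + x * (d - x * c) - x * a) c (d - x * c)) 1%g.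
  rewrite -(FFJ1 _ _ (u x)); congr (FF _ _ _).
  rewrite /cj uV (val_u x) (val_u (- x)) !mx2M; congr mx2; try ring.
  by rewrite mulr1 mulr0 addr0 mul1r xc; ring.
under eq_bigr => b _ do under eq_bigr => d _ do rewrite E.
rewrite exchange_big [RHS]exchange_big /= (reindex_inj (addIr (x * c))) /=.
apply: eq_bigr => d _; rewrite addrK (reindex_inj (addIr (- (x * d) + x * a))) /=.
apply: eq_bigr => b _; congr (FF _ (mx2 _ _ _ _) _); ring.
Qed.

(** [sum_FF_corner] fixes the total over all matrices with a given corner. It does not depend on the
    upper left entry, and periodicity modulo p^m repeats each term [q ^ m'] times in both remaining
    entries. What is left is [q ^ (m' - m)]: 1 for even [l], [q] for odd [l]. *)
Lemma FF1_le_unit (chi : 'CF(GG)) A : chi \is a character -> wh chi 1 <= 1 ->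
  A 1 0 \is a GRing.unit -> FF chi A 1%g <= (q ^ (m' - m))%:R.
Proof.
move=> Nchi w1 Uc; set a := A 0 0; set b := A 0 1; set c := A 1 0; set d := A 1 1.
have E : (q ^ l)%:R * \sum_b1 \sum_d1 FF chi (mx2 a b1 c d1) 1%g =
    (q ^ (4 * l))%:R / #|Ng|%:R * wh chi 1.
  rewrite -(sum_FF_corner chi Uc) mulr_natl -(card_R chainR) -sumr_const.
  by apply: eq_big => a' // _; apply: sum_FF_row.
have F0 B : 0 <= FF chi B 1%g by apply: FF1_ge0.
have S : (q ^ m')%:R * (q ^ m')%:R * FF chi A 1%g <= \sum_b1 \sum_d1 FF chi (mx2 a b1 c d1) 1%g.
  rewrite (reindex_inj (addrI b)) /= (bigID (mem (ideal m))) /=.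
  rewrite -[leLHS]addr0 lerD ?sumr_ge0 // => [|b1 _]; last by rewrite sumr_ge0.
  rewrite -mulrA [(q ^ m')%:R * _]mulr_natl -(card_ideal chainR (_ : m <= l)%N); last by lia.
  rewrite -sumr_const; apply: ler_sum => b1; rewrite inE => Db.
  rewrite (reindex_inj (addrI d)) /= (bigID (mem (ideal m))) /=.
  rewrite -[leLHS]addr0 lerD ?sumr_ge0 //.
  rewrite mulr_natl -sumr_const; apply: ler_sum => d1; rewrite inE => Dd.
  rewrite (FF_per chi _ (_ : Dm m (A - mx2 a (b + b1) c (d + d1)))) //.
  by rewrite Dm2 !mxE /= !subrr !opprD !addrA !subrr !add0r !DN Db Dd Dx0.
have nq (e : nat) := nzq chainR e.
have p0 (e : nat) : 0 < (q ^ e)%:R :> algC by rewrite ltr0n expn_gt0 (q_gt0 chainR).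
move: S; move: (FF chi A 1%g) => F S.
have : (q ^ l)%:R * ((q ^ m')%:R * (q ^ m')%:R * F) <= (q ^ (4 * l))%:R / #|Ng|%:R.
  apply: le_trans (_ : (q ^ (4 * l))%:R / #|Ng|%:R * wh chi 1 <= _); last first.
    by rewrite ler_piMr // divr_ge0 ?ler0n.
  by rewrite -E ler_pM2l.
rewrite card_N ler_pdivlMr // mulrC !mulrA -!natrM -!expnD.
rewrite (_ : 4 * l = (4 * m + l + m' + m') + (m' - m))%N; last by lia.
by rewrite [in leRHS]expnD [leRHS]natrM ler_pM2l.
Qed.

Definition nonscalar A := [|| A 1 0 \is a GRing.unit, A 0 1 \is a GRing.unit |
  A 0 0 - A 1 1 \is a GRing.unit].

Lemma nonscalar_cj A : nonscalar A -> exists h, cj h A 1 0 \is a GRing.unit.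
Proof.
rewrite /nonscalar; have [Uc _|] := boolP (A 1 0 \is a GRing.unit).
  by exists 1%g; rewrite cj1.
rewrite (unitN1 chainR) negbK => Dc.
have [Ub _|] := boolP (A 0 1 \is a GRing.unit).
  exists (ww R).
  suff -> : cj (ww R) A = mx2 (A 1 1) (A 1 0) (A 0 1) (A 0 0) by rewrite mx2E.
  rewrite /cj.
  have -> : (ww R)^-1%g = ww R.
    apply: (mulgI (ww R)); rewrite mulgV; apply: gvI.
    by rewrite gvM gv1 gl_val ?det_ww // mx2M mx2_scalar; congr mx2; ring.
  by rewrite gl_val ?det_ww // [X in _ *m X *m _]mx2_eta !mx2M; congr mx2; ring.
rewrite (unitN1 chainR) negbK => Db /= Uad; exists (v 1).
rewrite /cj vV val_v val_v [X in _ *m X *m _]mx2_eta !mx2M mx2E.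
have -> : (1 * A 0 0 + 1 * A 1 0) * 1 + (1 * A 0 1 + 1 * A 1 1) * -1 =
  (A 0 0 - A 1 1) + (A 1 0 - A 0 1) by ring.
by apply: (unit_addD chainR) => //; rewrite DB.
Qed.

Lemma FF1_le (chi : 'CF(GG)) A : chi \is a character -> wh chi 1 <= 1 -> nonscalar A ->
  FF chi A 1%g <= (q ^ (m' - m))%:R.
Proof. by move=> Nchi w1 /nonscalar_cj[h Uh]; rewrite -(FFJ1 _ _ h) FF1_le_unit. Qed.

(** Vectors in the [psA A]-part are fixed by [P] when [psA A] is trivial on [P], and the last
    hypothesis leaves no such vectors. *)
Lemma FF_fix0 chi A (P : {group {'GL_2[R]}}) : P \subset Ng ->
  {in P, forall g, psA A g = 1} ->
  (forall n, n \in Ng -> \sum_(g in P) chi (g ** n) = 0) -> FF chi A 1%g = 0.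
Proof.
move=> sPN P1 S0; apply: (mulfI (neq0CG P)); rewrite mulr0 mulr_natl -sumr_const.
under eq_bigr => g gP.
  rewrite -[FF _ _ _]mul1r -(P1 g gP) -(FF_mulN chi A 1%g (subsetP sPN g gP)) mul1g.
  over.
rewrite -mulr_sumr exchange_big /= big1 ?mulr0 // => n nN.
by rewrite -mulr_sumr S0 ?mulr0.
Qed.

Lemma FF_nonscalar (i : Iirr GG) A : regc 'chi_i -> FF 'chi_i A 1%g != 0 -> nonscalar A.
Proof.
move=> ri; apply: contraR; rewrite /nonscalar !negb_or !(unitN1 chainR) !negbK => /and3P[Dc Db Da].
apply/eqP; apply: (@FF_fix0 _ _ (Sset_group chainR)).
- apply/subsetP => g /setIdP[]; rewrite !inE => Kg _; apply: DmW Kg; have := l_gt1 chainR; lia.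
- move=> g /setIdP[]; rewrite inE Dm2 !mxE /= !mulr1n !mulr0n !subr0 => /and4P[h1 h2 h3 h4] /eqP tg.
  rewrite /psiA -(psi0 psi_add); congr psi; rewrite mx2_tr !mulmx2E !mxE /= !mulr1n !mulr0n !subr0.
  move: tg; rewrite mx2_tr => tg.
  have E1 : gv g 1 1 - 1 = - (gv g 0 0 - 1).
    by apply/eqP; rewrite -subr_eq0 opprK addrACA [gv g 1 1 + _]addrC tg -opprD subrr.
  rewrite E1 mulrN [A 0 1 * _]mulrC (Dtop1 chainR h3 Db) [A 1 0 * _]mulrC (Dtop1 chainR h2 Dc).
  by rewrite addr0 add0r -mulrBl mulrC (Dtop1 chainR h1 Da).
- move=> n nN; rewrite -[RHS](reg_sum_SgM chainR n ri); apply: eq_bigr => g _.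
  apply: (@class_eq R 'chi_i _ _ g); by rewrite mulgA.
Qed.

(** A corner in p would make [psA A] trivial on [Pset], producing vectors in V, which is 0 here.
    Applied to every conjugate of [A], this makes [A] elliptic. *)
Lemma cus_corner_unit (i : Iirr GG) A : \sum_(x in ideal l.-1) 'chi_i (u x) = 0 ->
  FF 'chi_i A 1%g != 0 -> A 1 0 \is a GRing.unit.
Proof.
move=> S0; apply: contraR; rewrite (unitN1 chainR) negbK => Dc.
have V0 : Vp pi l i = 0.
  by apply/eqP; rewrite -(char1_eq0 (Vp_char pi l i)) (Vp1 chainR) S0 mulr0.
apply/eqP; apply: (@FF_fix0 _ _ (Pset_group pi l)).
- apply/subsetP => g /imsetP[x]; rewrite inE => Dx ->; rewrite inK val_u Dm2 !mxE /=.
  rewrite !mulr1n !mulr0n !subr0 subrr !Dx0 (DW _ Dx) //; have := l_gt1 chainR; lia.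
- move=> g /imsetP[x]; rewrite inE => Dx ->; rewrite /psiA -(psi0 psi_add); congr psi.
  rewrite val_u mx2_tr !mulmx2E !mxE /= !mulr1n !mulr0n !subr0 subrr !mulr0 !addr0 add0r.
  by rewrite mulrC (Dtop1 chainR Dx Dc).
- move=> n nN; rewrite sum_Pg.
  have nI : n \in Ig.
    rewrite inE D0x /=; move: nN; rewrite inK Dm2 !mxE /= !mulr0n !subr0 => /and4P[_ _ h _].
    by apply: DW h.
  have := VpE chainR i nI; rewrite V0 cfunE => /esym/eqP; rewrite mulf_eq0 invr_eq0.
  rewrite (negPf (nzq1 chainR)) /= => /eqP E; rewrite -[RHS]E; apply: eq_bigr => x _.
  by apply: (@class_eq R 'chi_i _ _ (u x)); rewrite mulgA.
Qed.

End Orbit.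

(** * Isotypic parts on their stabilizers *)

Section Heisenberg.
Variables (R : finComUnitRingType) (pi : R) (l q : nat) (psi : R -> algC).
Hypothesis chainR : chain_ring pi l q.
Hypothesis psi_add : additive_char psi.
Hypothesis psi_nt : exists2 x, x \in [set: R] & psi (pi ^+ l.-1 * x) != 1.

Notation D i x := (dvdR (pi ^+ i) x).
Notation ideal i := (ideal pi i).
Notation wh := (wh l q psi).
Notation GG := (GG R).
Implicit Types (g h k n : {'GL_2[R]}) (a b c d x y z s t : R) (A B X Y : 'M[R]_2).
Notation Dm := (Dm pi).
Notation m := (l./2).
Notation m' := (l - l./2)%N.
Notation Ng := (Kcong_group pi m').
Notation gv g := (GLval g : 'M[R]_2).
Notation FF := (FF pi l psi).
Notation SA := (SA pi l).

Let m0 := m_gt0 chainR.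
Let m'0 := m'_gt0 chainR.

(** Scalar modulo p when [l] is odd, and no condition when [l] is even, since then [m' = m]. *)
Definition scm g := [exists s, Dm (m' - m) (gv g - s%:M)].

Definition CS A r : {set {'GL_2[R]}} := [set g : {'GL_2[R]} | scm g && Dm r (cj g A - A)].

Lemma scmM g h : scm g -> scm h -> scm (g ** h).
Proof.
move=> /existsP[s Ds] /existsP[t Dt]; apply/existsP; exists (s * t); rewrite gvM.
have -> : gv g *m gv h - (s * t)%:M = (gv g - s%:M) *m gv h + s%:M *m (gv h - t%:M).
  by rewrite mulmxBl mulmxBr addrA subrK scalar_mxM.
by apply: DmD; [apply: DmMr | apply: DmMl].
Qed.

Lemma CS_group_set A r : group_set (CS A r).
Proof.
apply/group_setP; split=> [|g h].
  rewrite inE cj1 subrr Dm0 andbT; apply/existsP; exists 1.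
  by rewrite gv1 subrr Dm0.
rewrite 3!inE => /andP[sg Dg] /andP[sh Dh]; rewrite scmM //=.
rewrite cjM (_ : _ - _ = cj g (cj h A - A) + (cj g A - A)); last by rewrite cjB addrA subrK.
by rewrite DmD ?Dm_cj.
Qed.
Canonical CS_group A r := Group (CS_group_set A r).

Lemma CS_sub A : CS A m' \subset CS A m.
Proof.
apply/subsetP => g; rewrite 2!inE => /andP[-> H] /=; apply: DmW H; lia.
Qed.

Lemma CS_SA A : CS A m \subset SA A.
Proof. by apply/subsetP => g; rewrite 2!inE => /andP[]. Qed.

Lemma Ng_CS A : Ng \subset CS A m'.
Proof.
apply/subsetP => n; rewrite inK inE => Kn; apply/andP; split.
  by apply/existsP; exists 1; apply: DmW Kn; lia.
rewrite Dm_cj_comm.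
have -> : gv n *m A - A *m gv n = (gv n - 1%:M) *m A - A *m (gv n - 1%:M).
  by rewrite mulmxBl mulmxBr mul1mx mulmx1 opprB addrA addrNK.
by apply: DmB; [apply: DmMr | apply: DmMl].
Qed.

(** As trace and determinant of [A] are preserved and its corner is a unit, the first column of
    [w g] determines [w g] modulo p^m'. The map [f] records this column, scaled by [pi ^+ m] so that
    equality in [R] means congruence modulo p^m'. Its image is counted through elements 1 + pi^m
    X. *)
Lemma card_CS A : A 1 0 \is a GRing.unit ->
  (#|CS A m| = #|CS A m'| * (q ^ (m' - m)) ^ 2)%N.
Proof.
move=> Uc; pose w g := cj g A - A.
pose f g := (pi ^+ m * w g 0 0, pi ^+ m * w g 1 0).
have wtr g : w g 1 1 = - w g 0 0.
  by apply/eqP; rewrite -addr_eq0 addrC -mx2_tr raddfB /= cj_tr subrr.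
have wdet g : A 1 0 * w g 0 1 = w g 0 0 * (A 1 1 - A 0 0) - A 0 1 * w g 1 0
     - (w g 0 0 * w g 0 0 + w g 0 1 * w g 1 0).
  have := cj_det g A; rewrite -[cj g A](subrK A) -/(w g) !mx2_det ![(w g + A) _ _]mxE wtr.
  by move/eqP; rewrite -subr_eq0 => /eqP E; rewrite -[LHS]addr0 -E; ring.
have sq g : g \in CS A m -> D m' (w g 0 0 * w g 0 0 + w g 0 1 * w g 1 0).
  rewrite inE -/(w g) Dm2 => /andP[_ /and4P[h1 h2 h3 h4]].
  by apply: (@DW _ _ _ (m + m)); [lia | rewrite DD ?DM].
have fP g h : g \in CS A m -> h \in CS A m -> (f g == f h) = Dm m' (w g - w h).
  move=> gC hC; rewrite /f -pair_eqE /pair_eq /= -subr_eq0 -mulrBr (Dann chainR); last by lia.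
  rewrite -[X in _ && X]subr_eq0 -mulrBr (Dann chainR); last by lia.
  rewrite Dm2 ![(w g - w h) _ _]mxE ![(- w h) _ _]mxE !wtr.
  apply/andP/and4P => [[h1 h2] | [h1 h2 h3 h4]]; last by split.
  split=> //; last by rewrite opprK addrC -opprB DN.
  rewrite -(@DUl R pi m' _ _ Uc) mulrBr !wdet.
  set S := w g 0 0 * w g 0 0 + _; set T := w h 0 0 * w h 0 0 + _.
  have DS : D m' S by apply: sq.
  have DT : D m' T by apply: sq.
  have -> : w g 0 0 * (A 1 1 - A 0 0) - A 0 1 * w g 1 0 - S -
     (w h 0 0 * (A 1 1 - A 0 0) - A 0 1 * w h 1 0 - T) =
     (w g 0 0 - w h 0 0) * (A 1 1 - A 0 0) - A 0 1 * (w g 1 0 - w h 1 0) - S + T by ring.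
  by apply: DD => //; apply: DB => //; apply: DB; [apply: DMr | apply: DMl].
have fib h : h \in CS A m -> #|[set g in CS A m | f g == f h]| = #|CS A m'|.
  move=> hC; rewrite -(card_imset (mem (CS A m')) (mulgI h)); apply: eq_card => g.
  rewrite inE; apply/andP/imsetP => [[gC]|[k kC ->]].
    rewrite fP // => Dgh; exists (h^-1%g ** g); last by rewrite mulKVg.
    have : h^-1%g ** g \in CS A m by rewrite (@groupM _ (CS_group A m)) // (@groupVr _ (CS_group A m)).
    rewrite 2!inE => /andP[-> _] /=; rewrite cjM -[in X in _ - X](cjK h A) -cjB Dm_cj.
    by move: Dgh; rewrite /w opprB addrA subrK.
  have kC' := subsetP (CS_sub A) _ kC.
  have hkC : h ** k \in CS A m by apply: (@groupM _ (CS_group A m)).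
  split=> //; rewrite fP // /w opprB addrA subrK cjM -cjB Dm_cj.
  by move: kC; rewrite inE => /andP[].
rewrite (card_eq_fibres fib); congr (_ * _)%N.
have -> : f @: CS A m = setX (ideal (m + m)) (ideal (m + m)).
  apply/setP => -[x y]; rewrite in_setX; apply/imsetP/andP => [[g gC [-> ->]]|[]].
    move: gC; rewrite inE -/(w g) Dm2 => /andP[_ /and4P[h1 h2 h3 h4]].
    by rewrite !inE !DM ?Dpi.
  rewrite !inE => /DP[x' ->] /DP[y' ->].
  (* For this matrix [X] the product [A X] has first column 0 and [X A] has first column
     [(x', y')]. *)
  have [h Kh Eh] := K_elt chainR (mx2 0 (x' / A 1 0) 0 (y' / A 1 0)) m0.
  have [Z EZ] : exists Z, gv h^-1%g = 1%:M + pi ^+ m *: Z.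
    have : h^-1%g \in Kcong_group pi m by rewrite groupV.
    by rewrite inK => /DmP[Z EZ]; exists Z; rewrite -EZ addrC subrK.
  set X := mx2 _ _ _ _ in Eh.
  have Ew : w h = pi ^+ m *: (X *m A - A *m X) + pi ^+ (m + m) *: ((X *m A - A *m X) *m Z).
    have Ec : gv h *m A - A *m gv h = pi ^+ m *: (X *m A - A *m X).
      rewrite Eh mulmxDl mulmxDr mul1mx mulmx1 -scalemxAl -scalemxAr.
      by rewrite opprD addrACA subrr add0r -scalerBr.
    rewrite /w cj_commV Ec EZ mulmxDr mulmx1; congr (_ + _).
    by rewrite -scalemxAl -scalemxAr scalerA exprD.
  have p3 : pi ^+ m * pi ^+ (m + m) = 0 by rewrite -exprD (pige chainR) //; lia.
  have Ef i j : pi ^+ m * w h i j = pi ^+ (m + m) * (X *m A - A *m X) i j.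
    have mxZ a B : (a *: B) i j = a * B i j by rewrite mxE.
    by rewrite Ew mxE mulrDr !mxZ !mulrA p3 mul0r addr0 -exprD.
  exists h; last first.
    rewrite /f !Ef; congr pair; congr (_ * _); rewrite [RHS]mxE [X in _ = _ + X]mxE !mulmx2E !mx2E.
      by rewrite divrK // mul0r mulr0 mulr0 !addr0 subr0 add0r.
    by rewrite divrK // mul0r mulr0 mulr0 !addr0 subr0 add0r.
  rewrite inE; apply/andP; split.
    by apply/existsP; exists 1; rewrite -inK; move: Kh; rewrite !inE; apply: DmW; lia.
  rewrite -/(w h) Ew DmD ?Dmpi //; apply: DmW (Dmpi _ _ _); lia.
rewrite cardsX (card_ideal chainR); last by lia.
by rewrite mulnn; congr ((q ^ _) ^ 2)%N; lia.
Qed.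

(** The isotypic part is a nonzero character of [CS A m] supported on [CS A m'], so its norm is at
    least 1. By [card_CS] the mean of its squared modulus on [CS A m'] is then at least the square
    of the maximal degree allowed by [FF1_le_unit], and all bounds become equalities. *)
Lemma FF_central (chi : 'CF(GG)) A : chi \is a character -> wh chi 1 <= 1 ->
  A 1 0 \is a GRing.unit -> FF chi A 1%g != 0 ->
  FF chi A 1%g = (q ^ (m' - m))%:R /\
  {in CS A m', forall g, `|FF chi A g| = FF chi A 1%g}.
Proof.
move=> Nchi w1 Uc nz; set e := (q ^ (m' - m))%:R.
have Fe : FF chi A 1%g <= e by apply: (FF1_le_unit chainR psi_add psi_nt).
have F0 := FF1_ge0 chainR psi_add A Nchi.
have sN : Ng \subset CS A m := subset_trans (Ng_CS A) (CS_sub A).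
have [th Nth Eth] := FF_char chainR psi_add Nchi (H := CS_group A m) sN (CS_SA A).
have nzth : th != 0.
  by apply: contraNneq nz => th0; rewrite -Eth ?group1 // th0 cfunE.
have := cfnorm_char_ge1 Nth nzth; rewrite cfdotE.
have cH : 0 < #|CS A m|%:R :> algC by rewrite ltr0n (cardG_gt0 (CS_group A m)).
rewrite mulrC ler_pdivlMr // mul1r.
rewrite (big_setID (CS A m')) /= [X in _ + X]big1 ?addr0 => [|g]; last first.
  rewrite in_setD => /andP[gZ gH]; rewrite Eth //.
  have [->|nzg] := eqVneq (FF chi A g) 0; first by rewrite mul0r.
  case/negP: gZ; move: gH; rewrite 2!inE => /andP[sg _]; rewrite sg /=.
  by have /existsP[s Ds] := sg; apply: (FF_suppV chainR psi_add psi_nt nzg Ds).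
rewrite (setIidPr (CS_sub A)) => S1.
have E1 g : g \in CS A m' -> th g * (th g)^* = `|FF chi A g| ^+ 2.
  by move=> gZ; rewrite normCK Eth // (subsetP (CS_sub A)).
rewrite (eq_bigr _ E1) (card_CS Uc) natrM mulr_natl -sumr_const natrX in S1.
have le1 g : `|FF chi A g| ^+ 2 <= FF chi A 1%g ^+ 2.
  by rewrite lerXn2r ?nnegrE // (FF_le1 chainR psi_add psi_nt).
have le2 : FF chi A 1%g ^+ 2 <= e ^+ 2 by rewrite lerXn2r ?nnegrE ?ler0n.
have eqg g : g \in CS A m' -> `|FF chi A g| ^+ 2 = e ^+ 2.
  move=> gZ; apply/eqP; rewrite eq_sym -subr_eq0.
  have S0 : \sum_(g in CS A m') (e ^+ 2 - `|FF chi A g| ^+ 2) = 0.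
    apply/eqP; rewrite eq_le sumr_ge0 ?andbT => [|k _]; last first.
      by rewrite subr_ge0 (le_trans (le1 k)).
    by rewrite sumrB subr_le0.
  have := psumr_eq0P _ S0 gZ => -> // k _.
  by rewrite subr_ge0 (le_trans (le1 k)).
have e0 : 0 <= e by rewrite ler0n.
have F1 : FF chi A 1%g = e.
  have := eqg _ (group1 (CS_group A m')); rewrite ger0_norm // => /eqP.
  by rewrite eqrXn2 // => /eqP.
split=> // g gZ; apply/eqP; rewrite F1 -(@eqrXn2 _ 2) //; exact/eqP/eqg.
Qed.

End Heisenberg.

(** * The anisotropic norm form *)

Section Anisotropic.
Variables (R : finComUnitRingType) (pi : R) (l q : nat) (eps : R).
Hypothesis chainR : chain_ring pi l q.
Notation D i x := (dvdR (pi ^+ i) x).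
Notation ideal i := (ideal pi i).
Implicit Types (a b c d x y z s t : R).

Definition Qf (w : R * R) := w.1 ^+ 2 - eps * w.2 ^+ 2.

(** [Qf] is the norm form of R[sqrt eps]; anisotropy modulo p means that this quadratic extension is
    unramified. *)
Definition aniso := forall y z, D 1 (Qf (y, z)) -> D 1 y /\ D 1 z.
Hypothesis Qan : aniso.

Lemma eps_unit : eps \is a GRing.unit.
Proof.
rewrite (unitN1 chainR); apply/negP => De; have [|_ D1] := Qan (y := 0) (z := 1).
  by rewrite /Qf /= expr0n expr1n sub0r mulr1 DN.
by have := unitr1 R; rewrite (unitN1 chainR) D1.
Qed.

Lemma Qf_unit y z : (Qf (y, z) \is a GRing.unit) = (y \is a GRing.unit) || (z \is a GRing.unit).
Proof.
rewrite !(unitN1 chainR); apply/idP/idP.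
  apply: contraR; rewrite negb_or !negbK => /andP[Dy Dz].
  by rewrite /Qf /= !expr2; apply: DB; [apply: DMr | apply/DMl/DMr].
by apply: contraL => DQ; have [-> ->] := Qan DQ.
Qed.

(* Writing [y + z sqrt eps] for [(y, z)], a point with the same norm as [w0] is
   [lambda / conj lambda] times [w0] by Hilbert 90; here lambda = s + t sqrt eps. *)
Definition rot_num (w0 : R * R) s t : R * R :=
  ((s ^+ 2 + eps * t ^+ 2) * w0.1 + eps * (s * t * w0.2) *+ 2,
   (s ^+ 2 + eps * t ^+ 2) * w0.2 + s * t * w0.1 *+ 2).
Definition rot w0 s t : R * R :=
  ((rot_num w0 s t).1 / Qf (s, t), (rot_num w0 s t).2 / Qf (s, t)).

(** Rotations depend only on the point of the projective line given by [(s, t)], represented by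
    [(1, r)] or by [(r, 1)] with [r] in p. *)
Lemma rot_dir (w0 w : R * R) s t :
  Qf (s, t) * w.1 = (rot_num w0 s t).1 -> Qf (s, t) * w.2 = (rot_num w0 s t).2 ->
  Qf (s, t) \is a GRing.unit ->
  (exists r, w = rot w0 1 r) \/ (exists2 r, D 1 r & w = rot w0 r 1).
Proof.
rewrite Qf_unit => E1 E2; have [Us _|nUs /= Ut] := boolP (s \is a GRing.unit).
  left; exists (t / s); set r := t / s.
  have Et : t = s * r by rewrite mulrC divrK.
  have UQ : Qf (1, r) \is a GRing.unit by rewrite Qf_unit unitr1.
  have Us2 : s * s \is a GRing.unit by rewrite unitrM Us.
  case: w E1 E2 => y z /=; rewrite Et => E1 E2; congr pair; apply: (canRL (mulrK UQ)); apply: (mulrI Us2).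
    by apply: etrans (etrans E1 _); rewrite /Qf /rot_num /=; ring.
  by apply: etrans (etrans E2 _); rewrite /Qf /rot_num /=; ring.
right; exists (s / t); first by rewrite DMr // -[D 1 s]negbK -(unitN1 chainR).
set r := s / t; have Es : s = t * r by rewrite mulrC divrK.
have UQ : Qf (r, 1) \is a GRing.unit by rewrite Qf_unit unitr1 orbT.
have Ut2 : t * t \is a GRing.unit by rewrite unitrM Ut.
case: w E1 E2 => y z /=; rewrite Es => E1 E2; congr pair; apply: (canRL (mulrK UQ)); apply: (mulrI Ut2).
  by apply: etrans (etrans E1 _); rewrite /Qf /rot_num /=; ring.
by apply: etrans (etrans E2 _); rewrite /Qf /rot_num /=; ring.
Qed.

Lemma hilbert90 (w0 w : R * R) : Qf w0 \is a GRing.unit -> Qf w = Qf w0 ->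
  (exists r, w = rot w0 1 r) \/ (exists2 r, D 1 r & w = rot w0 r 1).
Proof.
case: w0 w => y0 z0 [y z] UQ EQ.
have E0 : y ^+ 2 - eps * z ^+ 2 - (y0 ^+ 2 - eps * z0 ^+ 2) = 0 by apply/eqP; rewrite subr_eq0; apply/eqP.
(* This is lambda = conj(w0) (w0 + w); equality of the norms gives w = w0 lambda / conj(lambda). *)
pose s := y0 * (y0 + y) - eps * z0 * (z0 + z); pose t := y0 * z - z0 * y.
have [U1|nU1] := boolP (Qf (s, t) \is a GRing.unit).
  apply: rot_dir U1; apply/eqP; rewrite -subr_eq0; apply/eqP; rewrite /rot_num /Qf /= /s /t.
    apply: etrans (_ : (y0 ^+ 2 - eps * z0 ^+ 2) * (y0 + y) *
      (y ^+ 2 - eps * z ^+ 2 - (y0 ^+ 2 - eps * z0 ^+ 2)) = _); first by ring.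
    by rewrite E0 mulr0.
  apply: etrans (_ : (y0 ^+ 2 - eps * z0 ^+ 2) * (z0 + z) *
    (y ^+ 2 - eps * z ^+ 2 - (y0 ^+ 2 - eps * z0 ^+ 2)) = _); first by ring.
  by rewrite E0 mulr0.
(* When the first choice is not invertible, sqrt(eps) conj(w0) (w0 - w) takes its place: its second
   coordinate is congruent to twice the norm of w0. *)
pose s' := - (eps * t); pose t' := y0 * (y0 - y) - eps * z0 * (z0 - z).
have U2 : Qf (s', t') \is a GRing.unit.
  have Ds : D 1 s.
    by apply: contraR nU1; rewrite -(unitN1 chainR) Qf_unit => ->.
  rewrite Qf_unit; apply/orP; right.
  have -> : t' = Qf (y0, z0) *+ 2 + (- s) by rewrite /t' /s /Qf /=; ring.
  apply: (unit_addD chainR); last by rewrite DN.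
  by rewrite -mulr_natl unitrM (unit2 chainR).
apply: rot_dir U2; apply/eqP; rewrite -subr_eq0; apply/eqP; rewrite /rot_num /Qf /= /s' /t' /t.
  apply: etrans (_ : eps * (y0 ^+ 2 - eps * z0 ^+ 2) * (y0 - y) *
    (y ^+ 2 - eps * z ^+ 2 - (y0 ^+ 2 - eps * z0 ^+ 2)) = _); first by ring.
  by rewrite E0 mulr0.
apply: etrans (_ : eps * (y0 ^+ 2 - eps * z0 ^+ 2) * (z0 - z) *
  (y ^+ 2 - eps * z ^+ 2 - (y0 ^+ 2 - eps * z0 ^+ 2)) = _); first by ring.
by rewrite E0 mulr0.
Qed.

(** The bound counts the projective line over [R]: [q ^ l] points [(1, r)] and [q ^ l.-1] points
    [(r, 1)]. *)
Lemma card_Q (k : R) : k \is a GRing.unit -> (#|[set w | Qf w == k]| <= (q + 1) * q ^ l.-1)%N.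
Proof.
move=> Uk; have [->|[w0]] := set_0Vmem [set w | Qf w == k]; first by rewrite cards0.
rewrite inE => /eqP E0; have Uw0 : Qf w0 \is a GRing.unit by rewrite E0.
apply: leq_trans (_ : #|[set rot w0 1%R r | r in [set: R]] :|: [set rot w0 r 1%R | r in ideal 1]| <= _)%N.
  apply/subset_leq_card/subsetP => w; rewrite inE => /eqP Ew.
  have [|[r ->]|[r Dr ->]] := hilbert90 (w := w) Uw0; first by rewrite Ew.
    by rewrite inE imset_f // inE.
  by apply/setUP; right; apply/imsetP; exists r; rewrite ?inE.
apply: leq_trans (leq_card_setU _ _) _.
have l0 := l_gt0 chainR.
apply: leq_trans (leq_add (leq_imset_card _ _) (leq_imset_card _ _)) _.
rewrite cardsT (card_R chainR) (card_ideal chainR) // subn1 mulnDl mul1n -expnS prednK //.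
Qed.

Lemma card_Q_coset (k : R) i : k \is a GRing.unit -> (0 < i <= l)%N ->
  (#|[set w | D i (Qf w - k)%R]| <= q ^ (l - i) * ((q + 1) * q ^ l.-1))%N.
Proof.
move=> Uk /andP[i0 li].
rewrite -sum1_card (partition_big (fun w => Qf w - k) (mem (ideal i))) /=; last first.
  by move=> w; rewrite !inE.
rewrite -(card_ideal chainR li) -sum_nat_const; apply: leq_sum => t; rewrite inE => Dt.
have Ukt : k + t \is a GRing.unit by apply: (unit_addD chainR) => //; apply: DW Dt.
apply: leq_trans (card_Q Ukt); rewrite sum1_card; apply/subset_leq_card/subsetP => w.
by rewrite unfold_in => /andP[_ /eqP <-]; rewrite inE addrC subrK.
Qed.

(** Multiplication by pi^d identifies points congruent modulo p^(l-d). These satisfy the same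
    congruence modulo p^i as [i + d <= l], so all fibres have size [q ^ (2 * d)]. *)
Lemma card_Q_scaled (k : R) (d i : nat) : k \is a GRing.unit -> (0 < i)%N -> (i + d <= l)%N ->
  (q ^ (2 * d) * #|[set (pi ^+ d * w.1, pi ^+ d * w.2)%R | w in [set w | D i (Qf w - k)%R]]|
    <= q ^ (l - i) * ((q + 1) * q ^ l.-1))%N.
Proof.
move=> Uk i0 lid; apply: leq_trans (card_Q_coset Uk _); last by lia.
pose f (w : R * R) := (pi ^+ d * w.1, pi ^+ d * w.2).
rewrite -(@card_eq_fibres _ _ _ f (q ^ (2 * d))) // => -[y z]; rewrite inE => DQ.
have inj : injective (fun w : R * R => (y + w.1, z + w.2)).
  by move=> [a b] [a' b'] [/addrI-> /addrI->].
have -> : (q ^ (2 * d) = #|setX (ideal (l - d)) (ideal (l - d))|)%N.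
  rewrite cardsX (card_ideal chainR); last by lia.
  by rewrite -expnD; congr (_ ^ _)%N; lia.
rewrite -(card_imset (mem (setX (ideal (l - d)) (ideal (l - d)))) inj); apply: eq_card => -[a b].
have Ed x s : (pi ^+ d * s == pi ^+ d * x) = D (l - d) (s - x).
  by rewrite -subr_eq0 -mulrBr (Dann chainR) //; lia.
rewrite inE; apply/andP/imsetP => [[_]|[[a' b'] + ->]].
  rewrite /f -pair_eqE /pair_eq /= !Ed => /andP[Da Db].
  exists (a - y, b - z); first by rewrite in_setX !inE Da.
  by rewrite /= ![_ + (_ - _)]addrC !subrK.
rewrite in_setX !inE /= => /andP[Da Db]; rewrite /f -pair_eqE /pair_eq /= !Ed.
rewrite (addrAC y) subrr add0r (addrAC z) subrr add0r Da Db; split=> //.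
have -> : Qf (y + a', z + b') - k = Qf (y, z) - k +
   (a' * (y *+ 2 + a') - b' * (eps * (z *+ 2 + b'))) by rewrite /Qf /=; ring.
apply: DD => //; apply: (@DW _ _ _ (l - d)); first by lia.
by apply: DB; apply: DMr.
Qed.

End Anisotropic.

(** * Coordinates adapted to an elliptic matrix *)

Section Coordinates.
Variables (R : finComUnitRingType) (pi : R) (l q : nat) (eps : R).
Hypothesis chainR : chain_ring pi l q.
Notation D i x := (dvdR (pi ^+ i) x).
Notation Dm := (Dm pi).
Notation Qf := (Qf eps).
Notation gv g := (GLval g : 'M[R]_2).
Hypothesis Qan : aniso pi eps.
Implicit Types (g h k n : {'GL_2[R]}) (a b c d x y z s t : R) (A B X Y : 'M[R]_2).

Let Ue := eps_unit chainR Qan.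
Let U2 := unit2 chainR.

(** Splits a matrix with respect to [al], where [al *m al = eps]: the part [a + b al] commutes with
    [al], the part [Ym y z] anticommutes, and the determinant is a difference of two norm forms. *)
Definition P4 a b y z := mx2 (a + y) ((b - z) * eps) (b + z) (a - y).
Definition al := mx2 0 eps 1 0 : 'M[R]_2.
Definition Ym y z := mx2 y (- (z * eps)) z (- y).

Lemma P4E a b y z : P4 a b y z = a%:M + b *: al + Ym y z.
Proof. by rewrite mx2_scalar mx2Z !mx2D; congr mx2; ring. Qed.

Lemma P4_tr a b y z : \tr (P4 a b y z) = a *+ 2.
Proof. rewrite mx2_tr !mx2E; ring. Qed.

Lemma P4_det a b y z : \det (P4 a b y z) = a ^+ 2 - eps * b ^+ 2 - Qf (y, z).
Proof. rewrite mx2_det !mx2E /Qf /=; ring. Qed.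

Lemma P4_onto A : exists a b y z, A = P4 a b y z.
Proof.
exists ((A 0 0 + A 1 1) / 2%:R), ((A 1 0 + A 0 1 / eps) / 2%:R),
  ((A 0 0 - A 1 1) / 2%:R), ((A 1 0 - A 0 1 / eps) / 2%:R).
have H x y : x = y *+ 2 -> x / 2%:R = y by move=> ->; rewrite -[y *+ 2]mulr_natr mulrK.
rewrite [LHS]mx2_eta; congr mx2; rewrite -?mulrDl -?mulrBl.
- by rewrite (H _ (A 0 0)) //; ring.
- by rewrite (H _ (A 0 1 / eps)); [rewrite divrK | ring].
- by rewrite (H _ (A 1 0)) //; ring.
- by rewrite (H _ (A 1 1)) //; ring.
Qed.

Lemma P4_Dm i a b y z a' b' y' z' : Dm i (P4 a b y z - P4 a' b' y' z') =
  [&& D i (a - a'), D i (b - b'), D i (y - y') & D i (z - z')].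
Proof.
rewrite /P4 mx2N mx2D Dm2 !mx2E; apply/and4P/and4P => [[h1 h2 h3 h4]|[h1 h2 h3 h4]].
  have e2 : D i ((b - z) - (b' - z')) by rewrite -(@DUr R pi i _ _ Ue) mulrBl.
  split; rewrite -(D2 chainR).
  - by rewrite (_ : _ *+ 2 = (a + y - (a' + y')) + (a - y - (a' - y'))); [exact: DD | ring].
  - by rewrite (_ : _ *+ 2 = (b + z - (b' + z')) + (b - z - (b' - z'))); [exact: DD | ring].
  - by rewrite (_ : _ *+ 2 = (a + y - (a' + y')) - (a - y - (a' - y'))); [exact: DB | ring].
  - by rewrite (_ : _ *+ 2 = (b + z - (b' + z')) - (b - z - (b' - z'))); [exact: DB | ring].
split.
- by rewrite (_ : _ - _ = (a - a') + (y - y')); [exact: DD | ring].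
- by rewrite (_ : _ - _ = ((b - b') - (z - z')) * eps); [apply/DMr/DB | ring].
- by rewrite (_ : _ - _ = (b - b') + (z - z')); [exact: DD | ring].
- by rewrite (_ : _ - _ = (a - a') - (y - y')); [exact: DB | ring].
Qed.

Lemma P4D a1 a b y z : mx2 a1 eps 1 a1 + P4 a b y z = P4 (a1 + a) (1 + b) y z.
Proof. by rewrite mx2D; congr mx2; ring. Qed.

Lemma Dm_comm_A1 i g a1 : Dm i (cj g (mx2 a1 eps 1 a1) - mx2 a1 eps 1 a1) =
  D i (gv g 0 1 - eps * gv g 1 0) && D i (gv g 1 1 - gv g 0 0).
Proof.
rewrite Dm_cj_comm [gv g]mx2_eta !mx2M mx2N mx2D Dm2 !mx2E.
set p := gv g 0 0; set r := gv g 0 1; set s := gv g 1 0; set t := gv g 1 1.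
apply/and4P/andP => [[h1 h2 h3 h4]|[h1 h2]].
  split; first by rewrite (_ : _ - _ = p * a1 + r * 1 - (a1 * p + eps * s)) //; ring.
  by rewrite (_ : _ - _ = s * a1 + t * 1 - (1 * p + a1 * s)) //; ring.
split.
- by rewrite (_ : _ - _ = r - eps * s) //; ring.
- by rewrite (_ : _ - _ = - (t - p) * eps) ?DMr ?DN //; ring.
- by rewrite (_ : _ - _ = t - p) //; ring.
- by rewrite (_ : _ - _ = - (r - eps * s)) ?DN //; ring.
Qed.

(** Modulo p^i such a [g] is [e00 g + e10 g * al], so only the commutator of [e10 g * al] with the
    anticommuting part survives. *)
Lemma Dm_comm_P4 i g a b y z : D i (gv g 0 1 - eps * gv g 1 0) -> D i (gv g 1 1 - gv g 0 0) ->
  Dm i (cj g (P4 a b y z) - P4 a b y z) = D i (gv g 1 0 * y) && D i (gv g 1 0 * z).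
Proof.
rewrite Dm_cj_comm [gv g]mx2_eta !mx2E.
set p := gv g 0 0; set r := gv g 0 1; set s := gv g 1 0; set t := gv g 1 1 => h1 h2.
rewrite /P4 !mx2M mx2N mx2D Dm2 !mx2E.
have E1 : p * (a + y) + r * (b + z) - ((a + y) * p + (b - z) * eps * s) =
  (r - eps * s) * (b + z) + s * z *+ 2 * eps by ring.
have E2 : p * ((b - z) * eps) + r * (a - y) - ((a + y) * r + (b - z) * eps * t) =
  - ((t - p) * ((b - z) * eps)) - (r - eps * s) * (y *+ 2) - s * y *+ 2 * eps by ring.
have E3 : s * (a + y) + t * (b + z) - ((b + z) * p + (a - y) * s) =
  (t - p) * (b + z) + s * y *+ 2 by ring.
have E4 : s * ((b - z) * eps) + t * (a - y) - ((b + z) * r + (a - y) * t) =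
  - ((r - eps * s) * (b + z)) - s * z *+ 2 * eps by ring.
rewrite E1 E2 E3 E4; apply/and4P/andP => [[k1 k2 k3 k4]|[ky kz]].
  split; rewrite -(D2 chainR).
    rewrite -[X in D i X](addKr ((t - p) * (b + z))); apply: DD => //.
    by rewrite DN; apply: DMr.
  rewrite -(@DUr R pi i _ _ Ue) -[X in D i X](addKr ((r - eps * s) * (b + z))); apply: DD => //.
  by rewrite DN; apply: DMr.
have ky2 : D i (s * y *+ 2) by rewrite (D2 chainR).
have kz2 : D i (s * z *+ 2) by rewrite (D2 chainR).
split.
- by apply: DD; apply: DMr.
- by apply: DB; [apply: DB; [rewrite DN|]; apply: DMr | apply: DMr].
- by apply: DD => //; apply: DMr.
- by apply: DB; [rewrite DN|]; apply: DMr.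
Qed.

Lemma P4_nonscalar a b y z : nonscalar (P4 a b y z) -> D 1 y -> D 1 z -> b \is a GRing.unit.
Proof.
move=> ns Dy Dz; rewrite (unitN1 chainR); apply/negP => Db; move: ns.
rewrite /nonscalar /P4 !mx2E !(unitN1 chainR) => /or3P[] /negP[].
- exact: DD.
- by apply/DMr/DB.
- by rewrite (_ : _ - _ = y *+ 2); [rewrite (D2 chainR) | ring].
Qed.

Lemma al2 : al *m al = eps%:M.
Proof. by rewrite mx2M mx2_scalar; congr mx2; ring. Qed.
Lemma al_tr : \tr al = 0. Proof. by rewrite mx2_tr !mx2E addr0. Qed.
Lemma P4al_tr a b y z : \tr (P4 a b y z *m al) = b * eps *+ 2.
Proof. rewrite mx2M mx2_tr !mx2E; ring. Qed.

End Coordinates.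

(** * Variation of isotypic traces along an orbit *)

Section Omega.
Variables (R : finComUnitRingType) (pi : R) (l q : nat) (psi : R -> algC).
Hypothesis chainR : chain_ring pi l q.
Hypothesis psi_add : additive_char psi.
Hypothesis psi_nt : exists2 x, x \in [set: R] & psi (pi ^+ l.-1 * x) != 1.

Notation D i x := (dvdR (pi ^+ i) x).
Notation ideal i := (ideal pi i).
Notation wh := (wh l q psi).
Notation GG := (GG R).
Notation regc := (regc pi l).
Implicit Types (g h k n : {'GL_2[R]}) (a b c d x y z s t : R) (A B X Y : 'M[R]_2).
Notation Dm := (Dm pi).
Notation m := (l./2).
Notation m' := (l - l./2)%N.
Notation Ng := (Kcong_group pi m').
Notation gv g := (GLval g : 'M[R]_2).
Notation FF := (FF pi l psi).
Notation psA := (psiA psi).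
Notation e := ((q ^ (m' - m))%:R : algC).

Let m0 := m_gt0 chainR.
Let m'0 := m'_gt0 chainR.

(** The trace at [g] for the conjugated matrix is the trace at [g ^ h] for the original one. The
    change [nu] of [al] under conjugation lies in p^d, so [g^-1 ** g ^ h] belongs to [Ng], and the
    phase is the value of [psA] there. *)
Lemma FF_phase (chi : 'CF(GG)) eps h g (j d : nat) t a b y z a' b' y' z' :
  cj h (P4 eps a b y z) = P4 eps a' b' y' z' -> (j + d = m')%N ->
  D d y -> D d z -> D d y' -> D d z' -> D d (b - b') -> b' \is a GRing.unit ->
  gv g = 1%:M + (pi ^+ j * t) *: al eps ->
  1 - (pi ^+ j * t) ^+ 2 * eps \is a GRing.unit ->
  FF chi (P4 eps a' b' y' z') g = FF chi (P4 eps a b y z) g *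
    psi ((pi ^+ j * t) * (b' - b) * eps *+ 2 / (1 - (pi ^+ j * t) ^+ 2 * eps)).
Proof.
move=> EP jd Dy Dz Dy' Dz' Db Ub' Eg Ud; set T := pi ^+ j * t; set dl := 1 - _.
pose P := P4 eps a b y z; pose P' := P4 eps a' b' y' z'.
pose al1 := cj h^-1%g (al eps); pose nu := al1 - al eps.
have Ea : a = a'.
  have := cj_tr h P; rewrite EP !P4_tr => /eqP; rewrite -subr_eq0 -mulrnBl => /eqP E.
  by apply/esym/eqP; rewrite -subr_eq0 -(mulr_natr (a' - a) 2) in E *; rewrite -(mulrK (unit2 chainR) (a' - a)) E mul0r.
have EPb : P = a'%:M + b' *: al1 + cj h^-1%g (Ym eps y' z').
  rewrite -[P](cjK h) -/P EP P4E !cjD cj_scalar; congr (_ + _ + _).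
  by rewrite /cj -scalemxAr -scalemxAl.
have Enu : b' *: nu = (b - b') *: al eps + Ym eps y z - cj h^-1%g (Ym eps y' z').
  apply/eqP; rewrite -subr_eq0; apply/eqP.
  transitivity (a'%:M + b' *: al1 + cj h^-1%g (Ym eps y' z') - (a%:M + b *: al eps + Ym eps y z)).
    by rewrite Ea /nu; apply/matrixP => i1 i2; rewrite !mxE; ring.
  by rewrite -EPb -P4E subrr.
have DY x1 x2 : D d x1 -> D d x2 -> Dm d (Ym eps x1 x2).
  by move=> h1 h2; rewrite Dm2 !mx2E !DN h1 h2 (DMr _ h2).
have Dnu : Dm d nu.
  rewrite -[nu]scale1r -(mulVr Ub') -scalerA; apply/DmP.
  have : Dm d (b' *: nu).
    rewrite Enu; apply: DmB; last by rewrite Dm_cj DY.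
    apply: DmD; last exact: DY.
    by have /DP[x ->] := Db; apply/DmP; exists (x *: al eps); rewrite scalerA.
  by case/DmP => X ->; exists (b'^-1 *: X); rewrite !scalerA mulrC.
pose n := g^-1%g ** conjg g h.
have Econj : gv (conjg g h) - gv g = T *: nu.
  have := gvJ g h; rewrite Eg addrAC subrr add0r -scalemxAr -scalemxAl => E.
  rewrite -[gv (conjg g h)](subrK 1%:M) E addrKA scalerBr.
  by rewrite /al1 /cj invgK.
have En : gv n - 1%:M = gv g^-1%g *m (T *: nu).
  by rewrite -Econj mulmxBr -gvM GLvalV.
have DT : Dm m' (T *: nu).
  have [X ->] := DmP _ _ _ Dnu; apply/DmP; exists (t *: X).
  by rewrite !scalerA -jd exprD; congr (_ *: _); rewrite /T; ring.
have nN : n \in Ng by rewrite inK En; apply: DmMl.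
have -> : FF chi P' g = FF chi P g * psA P n.
  by rewrite /P' -EP -/P -FF_J -[conjg g h](mulKVg g) -/n (FF_mulN chainR psi_add) // mulrC.
congr (_ * _); rewrite /psiA En; congr psi.
have EV : gv g^-1%g = dl^-1 *: (1%:M - T *: al eps).
  have E1 : (1%:M - T *: al eps) *m gv g = dl%:M.
    by rewrite Eg !mx2_scalar mx2Z mx2N !mx2D mx2M /dl; congr mx2; ring.
  rewrite -[LHS]scale1r -[X in X *: _](mulVr Ud) -scalerA; congr (_ *: _).
  have := congr1 (mulmx^~ (gv g^-1%g)) E1; rewrite -mulmxA GLvalV mulmx1 => ->.
  by rewrite mul_scalar_mx.
have T2 x : D (d + d) x -> T * (T * x) = 0.
  case/DP => w ->; rewrite /T.
  have -> : pi ^+ j * t * (pi ^+ j * t * (pi ^+ (d + d) * w)) = pi ^+ (j + j + (d + d)) * (t * t * w).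
    by rewrite !exprD; ring.
  by rewrite (pige chainR) ?mul0r // addnACA jd; clear; lia.
have tnu : \tr nu = 0 by rewrite /nu raddfB /= cj_tr al_tr subrr.
have al12 : al1 *m al1 = eps%:M.
  rewrite /al1 /cj invgK !mulmxA -[_ *m gv h *m gv h^-1%g]mulmxA GLvalV mulmx1.
  by rewrite -[_ *m _ *m al eps]mulmxA al2 scalar_mxC -mulmxA GLvalV mulmx1.
(* Since [al + nu] has the same square as [al], the trace of [al *m nu] is of second order in [nu],
   and [T ^+ 2] kills it. *)
have talnu : T * (T * \tr (al eps *m nu)) = 0.
  have E0 : al eps *m nu + nu *m al eps + nu *m nu = 0.
    have := al12; rewrite (_ : al1 = al eps + nu); last by rewrite addrC subrK.
    rewrite mulmxDl !mulmxDr al2 => /eqP; rewrite -subr_eq0 => /eqP <-.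
    by move: (al eps *m nu) (nu *m al eps) (nu *m nu) => M1 M2 M3; apply/matrixP => i1 i2; rewrite !mxE; ring.
  have E2 : \tr (al eps *m nu) *+ 2 = - \tr (nu *m nu).
    have := congr1 mxtrace E0; rewrite mxtraceD mxtraceD mxtrace0 [\tr (nu *m al eps)]mxtrace_mulC => /eqP.
    by rewrite addr_eq0 => /eqP <-; rewrite mulr2n.
  have := T2 (\tr (nu *m nu)) (Dmtr (DmM Dnu Dnu)).
  rewrite -[\tr (nu *m nu)]opprK -E2 => E3.
  apply: (mulIr (unit2 chainR)); rewrite mul0r.
  transitivity (- (T * (T * - (\tr (al eps *m nu) *+ 2)))); first by ring.
  by rewrite E3 oppr0.
(* The main term: [al1] pairs with the first matrix as [al] pairs with its conjugate. *)
have tP : \tr (P *m nu) = (b' - b) * eps *+ 2.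
  rewrite /nu mulmxBr raddfB /= P4al_tr (_ : \tr (P *m al1) = b' * eps *+ 2); first by ring.
  rewrite -[RHS](P4al_tr eps a' b' y' z') -EP /al1 /cj invgK !mulmxA mxtrace_mulC !mulmxA.
  by [].
have tPa : T * (T * \tr (P *m al eps *m nu)) = 0.
  rewrite /P P4E !mulmxDl !mxtraceD mul_scalar_mx -!scalemxAl al2 mul_scalar_mx !mxtraceZ tnu.
  rewrite !mulr0 addr0 mulrDr mulrDr (T2 (\tr (Ym eps y z *m al eps *m nu))) ?addr0; last first.
    by apply: Dmtr; apply: (DmM (i := d) (j := d)) => //; apply/DmMr/DY.
  by rewrite [T * (a * _)]mulrCA [T * (a * _)]mulrCA talnu mulr0.
rewrite EV -scalemxAl -!scalemxAr !mxtraceZ mulmxBl mul1mx mulmxBr.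
have -> : \tr (P *m nu - P *m (T *: al eps *m nu)) = \tr (P *m nu) - T * \tr (P *m al eps *m nu).
  by rewrite raddfB /= -scalemxAl -scalemxAr mxtraceZ mulmxA.
rewrite [X in _ * X]mulrBr tPa subr0 tP -/T.
ring.
Qed.

End Omega.

(** * Values off the centre at odd level *)

Section OddLevel.
Variables (R : finComUnitRingType) (pi : R) (l q : nat) (psi : R -> algC) (eps : R).
Hypothesis chainR : chain_ring pi l q.
Hypothesis psi_add : additive_char psi.
Hypothesis psi_nt : exists2 x, x \in [set: R] & psi (pi ^+ l.-1 * x) != 1.
Hypothesis Qan : aniso pi eps.

Notation D i x := (dvdR (pi ^+ i) x).
Notation ideal i := (ideal pi i).
Notation wh := (wh l q psi).
Notation GG := (GG R).
Implicit Types (g h k n : {'GL_2[R]}) (a b c d x y z s t : R) (A B X Y : 'M[R]_2).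
Notation Dm := (Dm pi).
Notation m := (l./2).
Notation m' := (l - l./2)%N.
Notation Ng := (Kcong_group pi m').
Notation gv g := (GLval g : 'M[R]_2).
Notation FF := (FF pi l psi).
Notation Km := (Kcong_group pi m).
Notation al := (al eps).
Notation P4 := (P4 eps).

Let m0 := m_gt0 chainR.
Let m'0 := m'_gt0 chainR.

Lemma m_le_l : (m <= l)%N. Proof. by lia. Qed.
Lemma m'_le2m : (m' <= m + m)%N. Proof. by have := m0; lia. Qed.

Lemma cj_comm_al i g : Dm i (cj g al - al) =
  D i (gv g 0 1 - eps * gv g 1 0) && D i (gv g 1 1 - gv g 0 0).
Proof. exact: Dm_comm_A1. Qed.

(** For odd [l], the part of the level [m] congruence subgroup that supports the isotypic traces met
    in [odd_le1]. *)
Definition Kal : {set {'GL_2[R]}} := [set g in Km | Dm m' (cj g al - al)].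

Lemma card_Kal : (#|Kal| <= q ^ (2 * m' + 2 * m))%N.
Proof.
pose f g := ((gv g 0 0 - 1, gv g 1 0), (gv g 0 1 - eps * gv g 1 0, gv g 1 1 - gv g 0 0)).
have inj : injective f.
  move=> g h [/addIr E1 E2 E3 E4]; apply: gvI; rewrite [LHS]mx2_eta [RHS]mx2_eta.
  by move: E3 E4; rewrite E1 E2 => /addIr-> /addIr->.
rewrite -(card_imset _ inj).
apply: leq_trans (_ : #|setX (setX (ideal m) (ideal m)) (setX (ideal m') (ideal m'))| <= _)%N.
  apply/subset_leq_card/subsetP => _ /imsetP[g + ->]; rewrite inE inK cj_comm_al.
  rewrite Dm2 !mxE /= !mulr1n !mulr0n !subr0 => /andP[/and4P[h1 h2 h3 h4] /andP[h5 h6]].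
  by rewrite !in_setX !inE h1 h3 h5 h6.
rewrite !cardsX !(card_ideal chainR); [|lia|lia].
by rewrite -!expnD leq_exp2l ?(q_gt1 chainR) //; lia.
Qed.

Lemma Km_comm n B : n \in Km -> Dm m B -> Dm m' (cj n B - B).
Proof.
rewrite inK => Kn DB; rewrite Dm_cj_comm; apply: (DmW m'_le2m).
have -> : gv n *m B - B *m gv n = (gv n - 1%:M) *m B - B *m (gv n - 1%:M).
  by rewrite mulmxBl mulmxBr mul1mx mulmx1 opprB addrA addrNK.
by apply: DmB; apply: DmM.
Qed.

Lemma Km_al n a b y z : n \in Km -> D m y -> D m z -> b \is a GRing.unit ->
  Dm m' (cj n (P4 a b y z) - P4 a b y z) = Dm m' (cj n al - al).
Proof.
move=> Kn Dy Dz Ub.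
have DY : Dm m (Ym eps y z) by rewrite Dm2 !mx2E !DN Dy Dz (DMr _ Dz).
have E : cj n (P4 a b y z) - P4 a b y z = b *: (cj n al - al) + (cj n (Ym eps y z) - Ym eps y z).
  rewrite P4E !cjD cj_scalar scalerBr (_ : cj n (b *: al) = b *: cj n al); last first.
    by rewrite /cj -scalemxAr -scalemxAl.
  by apply/matrixP => i1 i2; rewrite !mxE; ring.
have DZ M : Dm m' M -> Dm m' (b *: M) by case/DmP => X ->; apply/DmP; exists (b *: X); rewrite !scalerA mulrC.
rewrite E; apply/idP/idP => H; last by apply: DmD (DZ _ H) (Km_comm Kn DY).
have : Dm m' (b *: (cj n al - al)).
  by rewrite -[X in Dm _ X](addrK (cj n (Ym eps y z) - Ym eps y z)) DmB // Km_comm.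
by case/DmP => X EX; apply/DmP; exists (b^-1 *: X); rewrite scalerA mulrC -scalerA -EX scalerA mulVr ?scale1r.
Qed.

(** Let [w] be the change of [al] under [n^-1]. Modulo p^m' the hypothesis makes [w] commute with
    [g], hence with [al], as [g] is a combination of 1 and [al] modulo p^m with unit coefficient at
    [al]. But [al + w] has the same square as [al], so [w] also anticommutes with [al], and [2 al w]
    vanishes. *)
Lemma comm_Kal g n : n \in Km -> Dm m (cj g al - al) -> gv g 1 0 \is a GRing.unit ->
  Dm m' (cj (g ** (n ** g^-1%g ** n^-1%g)) al - al) -> n \in Kal.
Proof.
move=> Kn Sg Ug Dc; have [w Ew] : exists w, w = cj n^-1%g al - al by eexists.
have [v0 Ev] : exists v0, v0 = cj g^-1%g al - al by eexists.
have cjN h B : cj h (- B) = - cj h B by rewrite /cj mulmxN mulNmx.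
have KnV : n^-1%g \in Km by rewrite groupV.
have Dw : Dm m w.
  rewrite Ew Dm_cj_comm; have := KnV; rewrite inK => Kv.
  have -> : gv n^-1%g *m al - al *m gv n^-1%g = (gv n^-1%g - 1%:M) *m al - al *m (gv n^-1%g - 1%:M).
    by rewrite mulmxBl mulmxBr mul1mx mulmx1 opprB addrA addrNK.
  by apply: DmB; [apply: DmMr | apply: DmMl].
have Dv : Dm m v0.
  by rewrite Ev -(Dm_cj pi m g) cjB cjKV -DmN opprB.
have D1 : Dm m' (cj g w - w).
  have E1 : cj n^-1%g al = al + w by rewrite Ew addrC subrK.
  have E2 : cj g^-1%g al = al + v0 by rewrite Ev addrC subrK.
  have E3 : cj n al + cj n w = al by rewrite -cjD -E1 cjKV.
  have E4 : cj g al + cj g v0 = al by rewrite -cjD -E2 cjKV.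
  have E5 : cj (g ** (n ** g^-1%g ** n^-1%g)) al - al =
    cj g (- (cj n w - w) + (cj n v0 - v0) + (cj n (cj g^-1%g w) - cj g^-1%g w)) - (cj g w - w).
    have -> : - (cj n w - w) = cj n al - al + w.
      have -> : cj n w = al - cj n al by apply/eqP; rewrite eq_sym subr_eq addrC E3.
      by move: (cj n al) => M; apply/matrixP => i1 i2; rewrite !mxE; ring.
    rewrite !cjM E1 cjD E2 !cjD !cjN cjKV -[X in _ - X = _]E4.
    move: (cj g (cj n al)) (cj g (cj n v0)) (cj g (cj n (cj g^-1%g w))) (cj g al) (cj g v0) (cj g w).
    by move=> M1 M2 M3 M4 M5 M6; apply/matrixP => i1 i2; rewrite !mxE; ring.
  rewrite -DmN -[X in Dm _ X](addKr (cj g (- (cj n w - w) + (cj n v0 - v0) + (cj n (cj g^-1%g w) - cj g^-1%g w)))).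
  rewrite -E5; apply: DmD Dc; rewrite DmN Dm_cj; apply: DmD; last by apply: Km_comm; rewrite ?Dm_cj.
  by apply: DmD; [rewrite DmN|]; apply: Km_comm.
have D2 : Dm m' (gv g *m w - w *m gv g) by rewrite -Dm_cj_comm.
have D3 : Dm m' (al *m w - w *m al).
  pose X := gv g - ((gv g 0 0)%:M + gv g 1 0 *: al).
  have DX : Dm m X.
    move: Sg; rewrite cj_comm_al => /andP[h1 h2].
    rewrite Dm2 /X mx2_scalar mx2Z mx2D [gv g]mx2_eta mx2N mx2D !mx2E.
    apply/and4P; split.
    - by rewrite [M in D m M](_ : _ = 0) ?Dx0 //; ring.
    - by rewrite [M in D m M](_ : _ = gv g 0 1 - eps * gv g 1 0) //; ring.
    - by rewrite [M in D m M](_ : _ = 0) ?Dx0 //; ring.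
    - by rewrite [M in D m M](_ : _ = gv g 1 1 - gv g 0 0) //; ring.
  have H G p r X0 : G = p%:M + r *: al + X0 ->
      G *m w - w *m G = r *: (al *m w - w *m al) + (X0 *m w - w *m X0).
    move=> ->; rewrite !mulmxDl !mulmxDr -!scalemxAl -!scalemxAr [w *m p%:M]scalar_mxC scalerBr.
    move: (p%:M *m w) (r *: (al *m w)) (r *: (w *m al)) (X0 *m w) (w *m X0) => M1 M2 M3 M4 M5.
    by apply/matrixP => i1 i2; rewrite !mxE; ring.
  have Eg : gv g = (gv g 0 0)%:M + gv g 1 0 *: al + X by rewrite addrC subrK.
  have : Dm m' (gv g 1 0 *: (al *m w - w *m al)).
    rewrite -[M in Dm _ M](addrK (X *m w - w *m X)) -(H _ _ _ _ Eg) DmB //.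
    by apply: (@DmW _ _ _ (m + m)); [exact: m'_le2m | apply: DmB; apply: DmM].
  case/DmP => Y EY; apply/DmP; exists ((gv g 1 0)^-1 *: Y).
  by rewrite scalerA mulrC -scalerA -EY scalerA mulVr ?scale1r.
have D4 : Dm m' (al *m w + w *m al).
  have : (al + w) *m (al + w) = eps%:M.
    rewrite (_ : al + w = cj n^-1%g al); last by rewrite Ew addrC subrK.
    rewrite /cj invgK !mulmxA -[_ *m gv n *m gv n^-1%g]mulmxA GLvalV mulmx1.
    by rewrite -[_ *m _ *m al]mulmxA al2 scalar_mxC -mulmxA GLvalV mulmx1.
  rewrite mulmxDl !mulmxDr al2 -addrA -[RHS]addr0 => /addrI; rewrite addrA => /eqP.
  rewrite addr_eq0 => /eqP->; rewrite DmN; apply: (DmW m'_le2m).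
  exact: DmM.
have D5 : Dm m' w.
  have : Dm m' (al *m (2%:R *: (al *m w))).
    apply: DmMl; rewrite scaler_nat.
    have -> : al *m w *+ 2 = (al *m w - w *m al) + (al *m w + w *m al) by rewrite addrACA addNr addr0 mulr2n.
    exact: DmD.
  rewrite -scalemxAr mulmxA al2 mul_scalar_mx scalerA => /DmP[X EX].
  have U : 2%:R * eps \is a GRing.unit by rewrite unitrM (unit2 chainR) (eps_unit chainR Qan).
  by apply/DmP; exists ((2%:R * eps)^-1 *: X); rewrite scalerA mulrC -scalerA -EX scalerA mulVr ?scale1r.
by rewrite inE Kn /= -(Dm_cj pi m' n^-1%g) cjB cjK -DmN opprB -Ew.
Qed.

(** On the level [m] congruence subgroup the isotypic part is irreducible of degree [q] and vanishes
    off [Kal], whose index is at least [q ^ 2]. In [irr_commutator_norm] only elements of [Kal]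
    contribute, by [comm_Kal], which gives the bound 1. *)
Lemma odd_le1 (chi : 'CF(GG)) a b y z g : (m' = m.+1)%N ->
  chi \is a character -> wh chi 1 <= 1 -> D m y -> D m z -> b \is a GRing.unit ->
  Dm m (cj g al - al) -> gv g 1 0 \is a GRing.unit ->
  FF chi (P4 a b y z) 1%g != 0 -> `|FF chi (P4 a b y z) g| <= 1.
Proof.
move=> mS Nchi w1 Dy Dz Ub Sg Ug nz; set A := P4 a b y z.
have [E0|nzg] := eqVneq (FF chi A g) 0; first by rewrite E0 normr0 ler01.
have Uc : A 1 0 \is a GRing.unit by rewrite /A /P4 !mx2E (unit_addD chainR) // (DW _ Dz).
have [F1 Fz] := FF_central chainR psi_add psi_nt Nchi w1 Uc nz.
have e1 : (m' - m = 1)%N by rewrite mS subSnn.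
rewrite e1 expn1 in F1.
have [th Nth Eth] := FF_char chainR psi_add Nchi (Ng_SA chainR A) (subxx (SA_group pi l A)).
have sKS : Km \subset SA_group pi l A.
  apply/subsetP => n Kn; rewrite inE Dm_cj_comm; move: Kn; rewrite inK => Kn.
  have -> : gv n *m A - A *m gv n = (gv n - 1%:M) *m A - A *m (gv n - 1%:M).
    by rewrite mulmxBl mulmxBr mul1mx mulmx1 opprB addrA addrNK.
  by apply: DmB; [apply: DmMr | apply: DmMl].
have gS : g \in SA_group pi l A by rewrite inE; apply: FF_supp0 chainR psi_add psi_nt _ _ _ nzg.
have thK n : n \in Km -> n \notin Kal -> th n = 0.
  move=> Kn nK; rewrite Eth ?(subsetP sKS) //; apply/eqP; apply: contraNT nK => nzn.
  rewrite inE Kn -(Km_al a Kn Dy Dz Ub); apply: (FF_suppV chainR psi_add psi_nt (s := 1) nzn).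
  by move: Kn; rewrite inK; apply: DmW; rewrite e1.
have thle n : n \in SA_group pi l A -> `|th n| <= q%:R.
  by move=> nS; rewrite Eth // -F1 (FF_le1 chainR psi_add psi_nt).
have cK : #|Km| = (q ^ (4 * m'))%N by rewrite (card_K chainR) // m0 m_le_l.
have nzK : 0 < #|Km|%:R :> algC by rewrite ltr0n cardG_gt0.
have cKal : q%:R ^+ 2 * #|Kal|%:R <= #|Km|%:R :> algC.
  rewrite -natrX -natrM ler_nat cK; apply: leq_trans (_ : q ^ 2 * q ^ (2 * m' + 2 * m) <= _)%N.
    by rewrite leq_mul2l card_Kal orbT.
  by rewrite -expnD leq_exp2l ?(q_gt1 chainR) //; clear -mS; lia.
have Kal_sub : Kal \subset Km by apply/subsetP => n; rewrite inE => /andP[].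
have irrK : 'Res[Km] th \in irr Km.
  rewrite irrEchar cfRes_char // eq_le cfnorm_char_ge1 ?cfRes_char ?andbT //; last first.
    apply: contraNneq nz => E; have := congr1 (fun f : 'CF(Km) => f 1%g) E.
    by rewrite /= cfRes1 cfunE -Eth ?group1 // => ->.
  rewrite cfdotE mulrC ler_pdivrMr // mul1r; apply: le_trans cKal.
  rewrite (big_setID Kal) /= [X in _ + X]big1 ?addr0 => [|n]; last first.
    by rewrite in_setD => /andP[nK Kn]; rewrite cfResE // thK // mul0r.
  rewrite (setIidPr Kal_sub) mulr_natr -sumr_const; apply: ler_sum => n nK.
  have Kn := subsetP Kal_sub n nK; rewrite cfResE // -normCK lerXn2r ?nnegrE ?ler0n //.
  by rewrite thle // (subsetP sKS).
have /irrP[i Ei] : th \in irr (SA_group pi l A) := cfRes_irr_irr Nth irrK.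
have Ri : 'Res[Km] 'chi_i \in irr Km by rewrite -Ei.
have := irr_commutator_norm sKS gS Ri; rewrite -Ei => En.
have nK := subsetP (normal_norm (Kcong_norm pi m)).
have comK n : n \in Km -> g ** (n ** g^-1%g ** n^-1%g) \in Km.
  move=> Kn; have -> : g ** (n ** g^-1%g ** n^-1%g) = conjg n g^-1%g ** n^-1%g.
    by rewrite conjgE invgK !mulgA.
  by rewrite groupM ?groupV // memJ_norm // nK ?inGG.
have S1 : `|\sum_(n in Km) th (g ** (n ** g^-1%g ** n^-1%g))| <= q%:R * #|Kal|%:R.
  apply: le_trans (ler_norm_sum _ _ _) _.
  rewrite (big_setID Kal) /= [X in _ + X]big1 ?addr0 => [|n]; last first.
    rewrite in_setD => /andP[nKal Kn]; apply/eqP; rewrite normr_eq0; apply: contraNT nKal => nzn.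
    have cn := comK n Kn; apply: (comm_Kal Kn Sg Ug).
    have : g ** (n ** g^-1%g ** n^-1%g) \in Kal by apply: contraNT nzn => /(thK _ cn)->.
    by rewrite inE => /andP[].
  rewrite (setIidPr Kal_sub) mulr_natr -sumr_const; apply: ler_sum => n nKal.
  by rewrite thle // (subsetP sKS) // comK // (subsetP Kal_sub).
rewrite -Eth // -(@ler_pXn2r _ 2) ?nnegrE ?ler01 // expr1n -[leLHS]ger0_norm ?exprn_ge0 // En.
rewrite normrM normrM normfV (ger0_norm (ler0n _ _)) (ger0_norm (char1_ge0 Nth)) Eth ?group1 // F1.
apply: le_trans (ler_wpM2l _ S1) _; first by rewrite divr_ge0 ?ler0n.
by rewrite mulrAC ler_pdivrMr // mul1r mulrA -expr2.
Qed.

End OddLevel.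

(** * Products with a cuspidal character *)

Section Triple.
Variables (R : finComUnitRingType) (pi : R) (l q : nat) (psi : R -> algC).
Hypothesis chainR : chain_ring pi l q.
Hypothesis psi_add : additive_char psi.
Hypothesis psi_nt : exists2 x, x \in [set: R] & psi (pi ^+ l.-1 * x) != 1.

Notation D i x := (dvdR (pi ^+ i) x).
Notation ideal i := (ideal pi i).
Notation wh := (wh l q psi).
Notation GG := (GG R).
Notation regc := (regc pi l).
Implicit Types (g h k n : {'GL_2[R]}) (a b c x y z s t : R) (A B X Y : 'M[R]_2).
Notation Dm := (Dm pi).
Notation m := (l./2).
Notation m' := (l - l./2)%N.
Notation Ng := (Kcong_group pi m').
Notation gv g := (GLval g : 'M[R]_2).
Notation FF := (FF pi l psi).
Notation psA := (psiA psi).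
Notation e := ((q ^ (m' - m))%:R : algC).

Let m0 := m_gt0 chainR.
Let m'0 := m'_gt0 chainR.
Let ml := m_le_l chainR.

Lemma wh_irr_le1 (i : Iirr GG) : wh 'chi_i 1 <= 1.
Proof. by rewrite (regcP chainR psi_add psi_nt); case: regc; rewrite ?lexx ?ler01. Qed.

Variables i1 i2 i3 : Iirr GG.
Hypothesis r1 : regc 'chi_i1.
Hypothesis r2 : regc 'chi_i2.
Hypothesis r3 : regc 'chi_i3.
Hypothesis cus1 : \sum_(x in ideal l.-1) 'chi_i1 (u x) = 0.

Notation F1 := (FF 'chi_i1).
Notation F2 := (FF 'chi_i2).
Notation F3 := (FF 'chi_i3).

(** The contribution of one pair of types. The product of the first two factors transforms under
    [Ng] by [psA (A + B)], so only that part of the third character pairs with it. *)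
Definition Om A B := \sum_g F1 A g * F2 B g * (F3 (A + B) g)^*.

Lemma Om_chi A B : Om A B = \sum_g F1 A g * F2 B g * ('chi_i3 g)^*.
Proof.
have nzN : #|Ng|%:R != 0 :> algC by rewrite neq0CG.
transitivity (#|Ng|%:R^-1 * \sum_(n in Ng) \sum_g F1 A g * F2 B g * ('chi_i3 g)^*); last first.
  by rewrite sumr_const; apply: (mulfI nzN); rewrite mulVKf // mulr_natl.
rewrite mulr_sumr.
transitivity (\sum_g \sum_(n in Ng) #|Ng|%:R^-1 * (F1 A (g ** n) * F2 B (g ** n) * ('chi_i3 (g ** n))^*)).
  apply: eq_bigr => g _.
  have -> : (F3 (A + B) g)^* = \sum_(n in Ng) #|Ng|%:R^-1 * (psA (A + B) n * ('chi_i3 (g ** n))^*).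
    rewrite /FF rmorphM /= rmorph_sum fmorphV /= rmorph_nat mulr_sumr.
    by apply: eq_bigr => n _; rewrite rmorphM /= conjCK.
  rewrite mulr_sumr; apply: eq_bigr => n nN; rewrite !(FF_mulN chainR psi_add) //.
  have -> : psA (A + B) n = psA A n * psA B n by rewrite /psiA mulmxDl mxtraceD (psiD psi_add).
  by move: (F1 A g) (F2 B g) (psA A n) (psA B n) => ? ? ? ?; ring.
rewrite exchange_big /=; apply: eq_bigr => n _; rewrite -mulr_sumr; congr (_ * _).
by rewrite [RHS](reindex_inj (mulIg n)).
Qed.

Lemma sum_Om : \sum_A \sum_B Om A B =
  (q ^ (4 * m'))%:R ^+ 2 * #|GG|%:R * '['chi_i1 * 'chi_i2, 'chi_i3].
Proof.
have K0 : (q ^ (4 * l))%:R / #|Ng|%:R = (q ^ (4 * m'))%:R :> algC.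
  rewrite (card_N chainR); apply: (canLR (mulfK (nzq chainR _))); rewrite -natrM -expnD.
  by congr ((q ^ _)%:R); clear; lia.
rewrite cfdotE -[RHS]mulrA mulVKf ?neq0CG // mulr_sumr.
under eq_bigr => A _ do under eq_bigr => B _ do rewrite Om_chi.
under eq_bigr => A _ do rewrite exchange_big /=.
rewrite exchange_big /=; apply: eq_big => [g|g _]; first by rewrite inGG.
transitivity ((\sum_A F1 A g) * (\sum_B F2 B g) * ('chi_i3 g)^*).
  rewrite mulr_suml mulr_suml; apply: eq_bigr => A _; rewrite mulr_sumr mulr_suml.
  by apply: eq_bigr => B _.
by rewrite !(FF_inv chainR psi_add psi_nt) K0 [('chi_i1 * _) g]cfunE; ring.
Qed.

Lemma Om_cj h A B : Om (cj h A) (cj h B) = Om A B.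
Proof.
rewrite /Om [RHS](reindex_inj (conjg_inj h)); apply: eq_bigr => g _.
by rewrite !FF_J cjD.
Qed.

Lemma F1_0 (i : Iirr GG) A g : FF 'chi_i A 1%g = 0 -> FF 'chi_i A g = 0.
Proof.
move=> E; apply/eqP; rewrite -normr_eq0 eq_le normr_ge0 andbT -E.
by apply: (FF_le1 chainR psi_add psi_nt); rewrite irr_char.
Qed.

Lemma Om_neq0 A B : Om A B != 0 ->
  [/\ F1 A 1%g != 0, F2 B 1%g != 0 & F3 (A + B) 1%g != 0].
Proof.
move=> nz; split; apply: contraNneq nz => E; rewrite /Om big1 // => g _; rewrite (F1_0 _ E).
- by rewrite !mul0r.
- by rewrite mulr0 mul0r.
- by rewrite rmorph0 mulr0.
Qed.

(** All three factors are multiplicative along [g], so translating the sum by [g] multiplies it by a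
    phase, which is trivial when the sum is nonzero. *)
Lemma Om_phase A B g : Om A B != 0 -> `|F1 A g| = F1 A 1%g -> `|F2 B g| = F2 B 1%g ->
  `|F3 (A + B) g| = F3 (A + B) 1%g ->
  F1 A g * F2 B g * (F3 (A + B) g)^* = F1 A 1%g * F2 B 1%g * (F3 (A + B) 1%g)^*.
Proof.
move=> nz E1 E2 E3; apply: (mulfI nz); rewrite mulr_suml; apply/esym.
rewrite /Om (reindex_inj (mulIg g)) /= mulr_suml; apply: eq_bigr => h _.
have mulS i A0 := @FF_mulS _ _ _ _ _ chainR psi_add psi_nt 'chi_i A0 h g (irr_char i).
have M1 := mulS _ _ E1; have M2 := mulS _ _ E2; have M3 := mulS _ _ E3.
move: M1 M2 M3; move: (F1 A (h ** g)) (F1 A 1%g) (F1 A h) (F1 A g) => x1 x2 x3 x4.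
move: (F2 B (h ** g)) (F2 B 1%g) (F2 B h) (F2 B g) => y1 y2 y3 y4.
move: (F3 (A + B) (h ** g)) (F3 (A + B) 1%g) (F3 (A + B) h) (F3 (A + B) g) => z1 z2 z3 z4.
move=> M1 M2 /(congr1 (fun z : algC => z^*)); rewrite !rmorphM /= => M3.
transitivity ((x1 * x2) * (y1 * y2) * (z1^* * z2^*)); first by ring.
by rewrite M1 M2 M3; ring.
Qed.

Lemma Om_bound A B (S : {set {'GL_2[R]}}) : Om A B != 0 ->
  (forall g, F1 A g != 0 -> F2 B g != 0 -> g \in S) ->
  `|Om A B| <= F1 A 1%g * e ^+ 2 * #|S|%:R.
Proof.
move=> nz HS; have [n1 n2 n3] := Om_neq0 nz.
have Fe (i : Iirr GG) A0 g : regc 'chi_i -> FF 'chi_i A0 1%g != 0 -> `|FF 'chi_i A0 g| <= e.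
  move=> ri ni; apply: le_trans (FF_le1 chainR psi_add psi_nt _ _ (irr_char i)) _.
  apply: (FF1_le chainR psi_add psi_nt) (irr_char i) (wh_irr_le1 i) _.
  exact: FF_nonscalar chainR psi_add _ _ ri ni.
apply: le_trans (ler_norm_sum _ _ _) _.
rewrite (bigID (mem S)) /= [X in _ + X]big1 ?addr0 => [|g gS]; last first.
  have [->|nz1] := eqVneq (F1 A g) 0; first by rewrite !mul0r normr0.
  have [->|nz2] := eqVneq (F2 B g) 0; first by rewrite mulr0 mul0r normr0.
  by rewrite (HS g nz1 nz2) in gS.
have H (x y z a1 b1 : algC) : `|x| <= a1 -> `|y| <= b1 -> `|z| <= b1 -> `|x * y * z^*| <= a1 * b1 ^+ 2.
  move=> h1 h2 h3; rewrite !normrM norm_conjC -mulrA expr2; apply: ler_pM => //; first by rewrite mulr_ge0.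
  by apply: ler_pM.
rewrite mulr_natr -sumr_const; apply: ler_sum => g _; apply: H; try exact: Fe.
by apply: (FF_le1 chainR psi_add psi_nt); rewrite irr_char.
Qed.

(** An upper triangular conjugation equalizes the diagonal and normalizes the corner to 1. An
    isotropic [(y, z)] modulo p would give, through [v (z / y)], a conjugate with corner
    [1 - eps * (z / y) ^+ 2] in p, against [cus_corner_unit]. *)
Lemma normal_form A : F1 A 1%g != 0 ->
  exists h a1 eps, cj h A = mx2 a1 eps 1 a1 /\ aniso pi eps.
Proof.
move=> nz; have Uc := cus_corner_unit chainR psi_add cus1 nz.
have cu B : F1 B 1%g != 0 -> B 1 0 \is a GRing.unit.
  by move=> nB; apply: (cus_corner_unit chainR psi_add cus1 nB).
have U2 := unit2 chainR.
pose x := (A 1 1 - A 0 0) / (A 1 0 *+ 2).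
have Uc2 : A 1 0 *+ 2 \is a GRing.unit by rewrite -mulr_natl unitrM U2.
have Ex : x * (A 1 0 *+ 2) = A 1 1 - A 0 0 by rewrite divrK.
have UcV : (A 1 0)^-1 \is a GRing.unit by rewrite unitrV.
pose dc := dg 1 (A 1 0)^-1; pose h := dc ** u x.
have [eps E] : exists eps, cj h A = mx2 (A 0 0 + x * A 1 0) eps 1 (A 0 0 + x * A 1 0).
  eexists; rewrite /h cjM /cj uV val_u val_u.
  have dV : dc^-1%g = dg 1 (A 1 0).
    have d1 : dg 1 1 = 1%g :> {'GL_2[R]}.
      by apply: gvI; rewrite (val_dg (unitr1 _) (unitr1 _)) gv1 mx2_scalar.
    apply/eqP; rewrite eq_invg_mul (dgM (unitr1 _) UcV (unitr1 _) Uc).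
    by rewrite (mulVr Uc) (mulr1 (1 : R)) d1.
  rewrite dV /dc (val_dg (unitr1 _) UcV) (val_dg (unitr1 _) Uc) [X in _ *m (_ *m X *m _) *m _]mx2_eta !mx2M; congr mx2.
  - by ring.
  - by apply: etrans (mulVr Uc); ring.
  - rewrite [LHS](_ : _ = (A 1 0)^-1 * A 1 0 * (A 1 1 - x * A 1 0)); last by ring.
    by rewrite mulVr // mul1r -[A 1 1](subrK (A 0 0)) -Ex; ring.
exists h, (A 0 0 + x * A 1 0), eps; split=> //.
have nzE k : cj k (mx2 (A 0 0 + x * A 1 0) eps 1 (A 0 0 + x * A 1 0)) 1 0 \is a GRing.unit.
  by apply: cu; rewrite FFJ1 -E FFJ1.
move: (A 0 0 + x * A 1 0) nzE => a1 nzE {E}.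
have Dy2 y : D 1 (y ^+ 2) -> D 1 y.
  by move=> H; rewrite -[D 1 y]negbK -(unitN1 chainR) -(unitrX_pos _ (ltn0Sn 1)) (unitN1 chainR) H.
have Ueps : eps \is a GRing.unit.
  have := nzE (ww R); rewrite /cj.
  have -> : (ww R)^-1%g = ww R.
    apply/eqP; rewrite eq_invg_mul; apply/eqP/gvI.
    by rewrite gvM gv1 gl_val ?det_ww // mx2M mx2_scalar; congr mx2; ring.
  by rewrite gl_val ?det_ww // !mx2M mx2E (_ : _ + _ = eps) //; ring.
move=> y z; rewrite /Qf /= => DQ.
have [Uz|] := boolP (z \is a GRing.unit); last first.
  rewrite (unitN1 chainR) negbK => Dz; split=> //; apply: Dy2.
  rewrite -[_ ^+ 2](subrK (eps * z ^+ 2)); apply: DD => //.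
  by rewrite expr2; apply/DMl/DMr.
have Uy : y \is a GRing.unit.
  rewrite (unitN1 chainR); apply/negP => Dy; move: DQ; apply/negP.
  rewrite -(DBC chainR) || rewrite DBC; rewrite -(unitN1 chainR); apply: (unit_addD chainR).
    by rewrite unitrM Ueps unitrX.
  by rewrite DN expr2 DMr.
have := nzE (v (z / y)); rewrite /cj vV val_v val_v !mx2M mx2E (unitN1 chainR) => /negP[].
have -> : (z / y * a1 + 1 * 1) * 1 + (z / y * eps + 1 * a1) * - (z / y) = 1 - eps * (z / y) ^+ 2 by ring.
rewrite -(@DUl R pi 1 (y ^+ 2)) ?unitrX // mulrBr mulr1 mulrCA -exprMn [y * _]mulrC divrK //.
Qed.

Notation A1 a1 eps := (mx2 a1 eps 1 a1).

(** Trace and determinant are constant on orbits. *)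
Lemma P4_orbit eps i h a b y z a' b' y' z' : aniso pi eps ->
  Dm i (P4 eps a' b' y' z' - cj h (P4 eps a b y z)) ->
  D i (a' - a) /\ D i (eps * b' ^+ 2 + Qf eps (y', z') - (eps * b ^+ 2 + Qf eps (y, z))).
Proof.
move=> Qan; have [a0 [b0 [y0 [z0 E0]]]] := P4_onto chainR Qan (cj h (P4 eps a b y z)).
have Ea : a0 = a.
  have := cj_tr h (P4 eps a b y z); rewrite E0 !P4_tr -[a0 *+ 2]mulr_natr -[a *+ 2]mulr_natr; exact: (mulIr (unit2 chainR)).
have Ed := cj_det h (P4 eps a b y z); move: Ed; rewrite E0 !P4_det Ea => Ed.
have Ed' : eps * b ^+ 2 + Qf eps (y, z) = eps * b0 ^+ 2 + Qf eps (y0, z0).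
  have H w1 w2 w3 : w2 + w3 = w1 - (w1 - w2 - w3) :> R by ring.
  by rewrite [LHS](H (a ^+ 2)) [RHS](H (a ^+ 2)) Ed.
rewrite (P4_Dm chainR Qan) => /and4P[Da Db Dy Dz]; split=> //; rewrite Ed' /Qf /=.
have -> : eps * b' ^+ 2 + (y' ^+ 2 - eps * z' ^+ 2) - (eps * b0 ^+ 2 + (y0 ^+ 2 - eps * z0 ^+ 2)) =
  (b' - b0) * (eps * (b' + b0)) + (y' - y0) * (y' + y0) - (z' - z0) * (eps * (z' + z0)) by ring.
by apply: DB; [apply: DD|]; apply: DMr.
Qed.

Lemma Q_cong_sub (i k : nat) eps y z y' z' : D k (y' - y) -> D k (z' - z) -> D i y -> D i z -> D i y' -> D i z' ->
  D (k + i) (Qf eps (y', z') - Qf eps (y, z)).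
Proof.
move=> h1 h2 h3 h4 h5 h6; rewrite /Qf /=.
have -> : y' ^+ 2 - eps * z' ^+ 2 - (y ^+ 2 - eps * z ^+ 2) =
  (y' - y) * (y' + y) - (z' - z) * (z' + z) * eps by ring.
by apply: DB; [|apply: DMr]; apply: DM => //; apply: DD.
Qed.

(** [B] and [A1 + B] each stay in one orbit modulo p^m, and adding [A1] replaces [b] by [1 + b]. The
    difference of the two quadratic invariants is linear in [b], so it fixes [b], and then the value
    of [Qf]. *)
Lemma good_cong a1 eps a b y z a' b' y' z' : aniso pi eps ->
  Om (A1 a1 eps) (P4 eps a b y z) != 0 -> Om (A1 a1 eps) (P4 eps a' b' y' z') != 0 ->
  [/\ D m (a' - a), D m (b' - b) & D m (Qf eps (y', z') - Qf eps (y, z))].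
Proof.
move=> Qan nz nz'; have [_ n2 n3] := Om_neq0 nz; have [_ n2' n3'] := Om_neq0 nz'.
have [h Dh] := FF_orbit chainR psi_add psi_nt n2 n2'.
have [k] := FF_orbit chainR psi_add psi_nt n3 n3'; rewrite !P4D => Dk.
have [Da D1] := P4_orbit Qan Dh; have [_ D2] := P4_orbit Qan Dk.
have Db : D m (b' - b).
  have := DB D2 D1; rewrite (_ : _ - _ = (b' - b) * (2%:R * eps)); last by rewrite /Qf /=; ring.
  by rewrite DUr // unitrM (unit2 chainR) (eps_unit chainR Qan).
split=> //; rewrite (_ : _ - _ = (eps * b' ^+ 2 + Qf eps (y', z') - (eps * b ^+ 2 + Qf eps (y, z)))
   - (b' - b) * (eps * (b' + b))); last by rewrite /Qf /=; ring.
by apply: DB => //; apply: DMr.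
Qed.

Lemma P4_CS eps (j d : nat) t g a b y z : aniso pi eps -> (j + d = m')%N -> (0 < j)%N ->
  D d y -> D d z -> gv g = 1%:M + (pi ^+ j * t) *: al eps -> g \in CS pi l (P4 eps a b y z) m'.
Proof.
move=> Qan jd j0 Dy Dz Eg; rewrite inE; apply/andP; split.
  apply/existsP; exists 1; rewrite Eg addrAC subrr add0r -scalerA; apply: DmW (Dmpi _ _ _).
  by clear -j0; lia.
have Eg2 : gv g = mx2 1 (pi ^+ j * t * eps) (pi ^+ j * t) 1.
  by rewrite Eg mx2_scalar mx2Z mx2D; congr mx2; ring.
rewrite (Dm_comm_P4 chainR Qan); rewrite Eg2 !mx2E.
- by rewrite -!mulrA -jd !DM ?Dpi // DMl.
- by rewrite [eps * _]mulrC subrr Dx0.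
- by rewrite subrr Dx0.
Qed.

(** The map is injective, as a unit multiple of [t - s] measures the difference of two values; on a
    finite ring it is therefore bijective. *)
Lemma phase_onto eps j x : (0 < j)%N -> exists t, x = t / (1 - (pi ^+ j * t) ^+ 2 * eps).
Proof.
move=> j0; have Dj t : D 1 (pi ^+ j * t) by apply: DW (DpiM _ _ _).
have U t s : 1 + pi ^+ j * t * s \is a GRing.unit.
  by apply: (unit_addD chainR); rewrite ?unitr1 // DMr.
have Ud t : 1 - (pi ^+ j * t) ^+ 2 * eps \is a GRing.unit.
  have -> : 1 - (pi ^+ j * t) ^+ 2 * eps = 1 + pi ^+ j * t * (- (pi ^+ j * t * eps)) by ring.
  exact: U.
pose dl t := 1 - (pi ^+ j * t) ^+ 2 * eps; pose f t := t / dl t.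
have fK t : f t * dl t = t by apply: divrK; apply: Ud.
have inj : injective f.
  move=> t s E; apply/eqP; rewrite -subr_eq0; apply/eqP.
  apply: (mulIr (U t (pi ^+ j * s * eps))); rewrite mul0r.
  transitivity (t * dl s - s * dl t); first by rewrite /dl; ring.
  by rewrite -{1}(fK t) -{2}(fK s) E; ring.
by exists (invF inj x); rewrite -[LHS](f_invF inj).
Qed.

(** Improves [good_cong] when the anticommuting coordinates lie in p^d. The elements 1 + pi^j t al
    with [j + d = m'] act as scalars on all three isotypic parts, so [Om_phase] applies to both
    types. Comparison through [FF_phase] makes [psi] trivial on the multiples of [b0 - b3 + 1] by
    p^j, a congruence modulo p^(m+d). *)
Lemma good_fine a1 eps (d : nat) a b y z a' b' y' z' : aniso pi eps -> (0 < d < m)%N ->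
  Om (A1 a1 eps) (P4 eps a b y z) != 0 -> Om (A1 a1 eps) (P4 eps a' b' y' z') != 0 ->
  D d y -> D d z -> D d y' -> D d z' -> D (m + d) (Qf eps (y', z') - Qf eps (y, z)).
Proof.
move=> Qan /andP[d0 dm] nz nz' Dy Dz Dy' Dz'.
have [Da Db _] := good_cong Qan nz nz'.
have [n1 n2 n3] := Om_neq0 nz; have [_ n2' n3'] := Om_neq0 nz'.
have dW i x : (i <= d)%N -> D d x -> D i x by apply: DW.
have mW x : D m x -> D d x by apply: DW; apply: ltnW.
have Ue := eps_unit chainR Qan.
have Ub' : b' \is a GRing.unit.
  by apply: (P4_nonscalar chainR (FF_nonscalar chainR psi_add r2 n2')); apply: dW.
have Ub : b \is a GRing.unit by rewrite -(unit_congr chainR (dW _ _ d0 (mW _ Db))).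
move: (n3) (n3'); rewrite !P4D => n4 n4'.
have Ub1' : 1 + b' \is a GRing.unit.
  by apply: (P4_nonscalar chainR (FF_nonscalar chainR psi_add r3 n4')); apply: dW.
have Ub1 : 1 + b \is a GRing.unit.
  by apply: (P4_nonscalar chainR (FF_nonscalar chainR psi_add r3 n4)); apply: dW.
have [h] := FF_orbit chainR psi_add psi_nt n2 n2'.
have [a0 [b0 [y0 [z0 E0]]]] := P4_onto chainR Qan (cj h (P4 eps a b y z)).
rewrite E0 => Dh; have := Dh; rewrite (P4_Dm chainR Qan) => /and4P[_ Db0 Dy0 Dz0].
have [k] := FF_orbit chainR psi_add psi_nt n4 n4'.
have [a3 [b3 [y3 [z3 E3]]]] := P4_onto chainR Qan (cj k (P4 eps (a1 + a) (1 + b) y z)).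
rewrite E3 => Dk; have := Dk; rewrite (P4_Dm chainR Qan) => /and4P[_ Db3 Dy3 Dz3].
have sub x x' : D d x' -> D m (x' - x) -> D d x.
  by move=> h1 h2; rewrite -[x](subKr x'); apply: DB => //; apply: mW.
have [Dy0' Dz0'] := (sub _ _ Dy' Dy0, sub _ _ Dz' Dz0).
have [Dy3' Dz3'] := (sub _ _ Dy' Dy3, sub _ _ Dz' Dz3).
pose j := (m' - d)%N.
have dm' : (d < m')%N by apply: leq_trans dm _; clear; lia.
have jd : (j + d = m')%N by rewrite subnK // ltnW.
have j0 : (0 < j)%N by rewrite subn_gt0.
have Ub0 : b0 \is a GRing.unit.
  by rewrite -(unit_congr chainR (_ : D 1 (b' - b0))) //; apply: DW Db0.
have Ub3 : b3 \is a GRing.unit.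
  by rewrite -(unit_congr chainR (_ : D 1 (1 + b' - b3))) //; apply: DW Db3.
have Dbb0 : D d (b - b0).
  by rewrite (_ : b - b0 = (b' - b0) - (b' - b)); [apply: DB; apply: mW | ring].
have Dbb3 : D d (1 + b - b3).
  by rewrite (_ : 1 + b - b3 = (1 + b' - b3) - (b' - b)); [apply: DB; apply: mW | ring].
have key x : D j x -> psi ((b0 - b3 + 1) * x) = 1.
  case/DP => x0 ->; have [t Et] := phase_onto eps (x0 / (2%:R * eps)) j0.
  have [g Kg Eg0] := K_elt chainR (t *: al eps) j0.
  have Eg : gv g = 1%:M + (pi ^+ j * t) *: al eps by rewrite Eg0 scalerA.
  have Ud : 1 - (pi ^+ j * t) ^+ 2 * eps \is a GRing.unit.
    apply: (unit_addD chainR); rewrite ?unitr1 // DN expr2 -!mulrA.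
    by apply: DW (DpiM _ _ _).
  have ph2 := FF_phase chainR psi_add 'chi_i2 E0 jd Dy Dz Dy0' Dz0' Dbb0 Ub0 Eg Ud.
  have ph3 := FF_phase chainR psi_add 'chi_i3 E3 jd Dy Dz Dy3' Dz3' Dbb3 Ub3 Eg Ud.
  move: ph2 ph3; set X2 := _ / _; set X3 := _ / _.
  rewrite -(FF_per chainR psi_add 'chi_i2 g Dh) -(FF_per chainR psi_add 'chi_i3 g Dk) => ph2 ph3.
  have EA1 : A1 a1 eps = P4 eps a1 1 0 0 by rewrite /P4; congr mx2; ring.
  have U1 y1 z1 b1 a2 : b1 \is a GRing.unit -> D d z1 -> P4 eps a2 b1 y1 z1 1 0 \is a GRing.unit.
    by move=> Ub2 Dz1; rewrite mx2E (unit_addD chainR) //; apply: dW.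
  have cen (i : Iirr GG) a2 b1 y1 z1 : b1 \is a GRing.unit -> D d y1 -> D d z1 ->
      FF 'chi_i (P4 eps a2 b1 y1 z1) 1%g != 0 ->
      FF 'chi_i (P4 eps a2 b1 y1 z1) 1%g = e /\
      `|FF 'chi_i (P4 eps a2 b1 y1 z1) g| = FF 'chi_i (P4 eps a2 b1 y1 z1) 1%g.
    move=> Ub2 Dy1 Dz1 ni.
    have [-> H] := FF_central chainR psi_add psi_nt (irr_char i) (wh_irr_le1 i) (U1 y1 z1 b1 a2 Ub2 Dz1) ni.
    split=> //; rewrite H //; first exact: P4_CS jd j0 Dy1 Dz1 Eg.
  have [e1 c1] : F1 (A1 a1 eps) 1%g = e /\ `|F1 (A1 a1 eps) g| = F1 (A1 a1 eps) 1%g.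
    by rewrite EA1; apply: cen; rewrite ?unitr1 ?Dx0 // -EA1.
  have [e2 c2] := cen _ _ _ _ _ Ub Dy Dz n2; have [e2' c2'] := cen _ _ _ _ _ Ub' Dy' Dz' n2'.
  have [e3 c3] := cen _ _ _ _ _ Ub1 Dy Dz n4; have [e3' c3'] := cen _ _ _ _ _ Ub1' Dy' Dz' n4'.
  have := Om_phase nz c1 c2; rewrite !P4D => /(_ c3) O1.
  have := Om_phase nz' c1 c2'; rewrite !P4D => /(_ c3') O2.
  rewrite ph2 ph3 e1 e2' e3' in O2; rewrite e1 e2 e3 in O1.
  rewrite e1 in c1; rewrite e2 in c2; rewrite e3 in c3.
  have e0 : e != 0 by rewrite (nzq chainR).
  have EX : X2 - X3 = (b0 - b3 + 1) * (pi ^+ j * x0).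
    have Ux : x0 = 2%:R * eps * (t / (1 - (pi ^+ j * t) ^+ 2 * eps)).
      by rewrite -Et mulrC divrK // unitrM (unit2 chainR).
    by rewrite /X2 /X3 Ux; ring.
  rewrite -EX (psiD psi_add) -(psi_conj psi_add); move: O1 O2 c1 c2 c3.
  move: (F1 _ g) (F2 _ g) (F3 _ g) (psi X2) (psi X3) => x1 x2 x3 p2 p3 O1 O2 c1 c2 c3.
  have nzx : x1 * x2 * x3^* != 0 by rewrite -normr_eq0 !normrM norm_conjC c1 c2 c3 !mulf_neq0.
  apply: (mulfI nzx); rewrite mulr1 [RHS]O1 -O2 rmorphM /=; ring.
have H1 := psi_nondeg chainR psi_nt (_ : j <= l)%N key.
have {}H1 : D (m + d) (b0 - b3 + 1).
  have <- : (l - j = m + d)%N by rewrite /j; clear -dm; lia.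
  by apply: H1; rewrite /j; clear; lia.
have Ed (h0 : {'GL_2[R]}) c0 c1 c2 c3 c4 c5 c6 c7 : cj h0 (P4 eps c0 c1 c2 c3) = P4 eps c4 c5 c6 c7 ->
   eps * c5 ^+ 2 + Qf eps (c6, c7) = eps * c1 ^+ 2 + Qf eps (c2, c3).
  move=> E; have Ea : c4 = c0.
    have := cj_tr h0 (P4 eps c0 c1 c2 c3); rewrite E !P4_tr -[c4 *+ 2]mulr_natr -[c0 *+ 2]mulr_natr; exact: (mulIr (unit2 chainR)).
  have := cj_det h0 (P4 eps c0 c1 c2 c3); rewrite E !P4_det Ea => Ed.
  have H w1 w2 w3 : w2 + w3 = w1 - (w1 - w2 - w3) :> R by ring.
  by rewrite [LHS](H (c0 ^+ 2)) [RHS](H (c0 ^+ 2)) Ed.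
(* [Qf] is quadratic and the coordinates lie in p^d, so their congruence modulo p^m improves by a
   factor p^d. *)
have Q0 : D (m + d) (Qf eps (y', z') - Qf eps (y0, z0)) by apply: Q_cong_sub.
have Q3 : D (m + d) (Qf eps (y', z') - Qf eps (y3, z3)) by apply: Q_cong_sub.
have E0' := Ed _ _ _ _ _ _ _ _ _ E0; have E3' := Ed _ _ _ _ _ _ _ _ _ E3.
have Hb : D (m + d) (b0 - b).
  have : D (m + d) ((b0 - b) * (2%:R * eps)).
    have -> : (b0 - b) * (2%:R * eps) = (b0 - b3 + 1) * (eps * (b0 + b3 + 1))
      + (Qf eps (y', z') - Qf eps (y3, z3)) - (Qf eps (y', z') - Qf eps (y0, z0))
      + ((eps * b3 ^+ 2 + Qf eps (y3, z3)) - (eps * b0 ^+ 2 + Qf eps (y0, z0)) - eps * (1 + b *+ 2)) by ring.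
    rewrite E0' E3' [X in _ + X](_ : _ = 0); last by ring.
    by rewrite addr0; apply: DB => //; apply: DD => //; apply: DMr.
  by rewrite DUr // unitrM (unit2 chainR).
have -> : Qf eps (y', z') - Qf eps (y, z) = (Qf eps (y', z') - Qf eps (y0, z0)) - (b0 - b) * (eps * (b0 + b))
   + ((eps * b0 ^+ 2 + Qf eps (y0, z0)) - (eps * b ^+ 2 + Qf eps (y, z))) by ring.
by rewrite E0' subrr addr0; apply: DB => //; apply: DMr.
Qed.

Lemma card_par eps (W : {set R * R}) r : (r <= l)%N ->
  (#|[set g : {'GL_2[R]} | [&& (gv g 0%R 0%R, gv g 1%R 0%R) \in W,
       D r (gv g 0 1 - eps * gv g 1 0)%R & D r (gv g 1 1 - gv g 0 0)%R]]| <= #|W| * (q ^ (l - r)) ^ 2)%N.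
Proof.
move=> rl; set G := [set g | _].
pose f g := ((gv g 0 0, gv g 1 0), (gv g 0 1 - eps * gv g 1 0, gv g 1 1 - gv g 0 0)).
have inj : injective f.
  move=> g h [E1 E2 E3 E4]; apply: gvI; rewrite [LHS]mx2_eta [RHS]mx2_eta.
  by move: E3 E4; rewrite E1 E2 => /addIr-> /addIr->.
rewrite -(card_imset _ inj).
apply: leq_trans (_ : #|setX W (setX (ideal r) (ideal r))| <= _)%N.
  apply/subset_leq_card/subsetP => _ /imsetP[g + ->]; rewrite inE => /and3P[h1 h2 h3].
  by rewrite !in_setX !inE h1 h2 h3.
by rewrite !cardsX !(card_ideal chainR) // mulnn.
Qed.

(** The constant for which the bounds over all [A] add up to multiplicity 1: see the identity for
    [K0 * #|GG|] in [cus_mult_le1]. *)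
Definition Bn := ((q ^ 2 - 1) * q ^ (5 * l - 2))%N.

(** By [okd_P4] this puts the anticommuting coordinates in p^d; it is phrased with entries so that
    no coordinates need be chosen. *)
Definition okd eps (d : nat) A := D d (A 0 0 - A 1 1) && D d (eps * A 1 0 - A 0 1).

Lemma okd_P4 eps d a b y z : aniso pi eps -> okd eps d (P4 eps a b y z) = D d y && D d z.
Proof.
move=> Qan; rewrite /okd !mx2E (_ : _ - _ = y *+ 2); last by ring.
rewrite (D2 chainR) (_ : _ - _ = z *+ 2 * eps); last by ring.
by rewrite DUr ?(D2 chainR) // (eps_unit chainR Qan).
Qed.

Lemma sum_Om_le a1 eps (G : nat) (C : algC) : 0 <= C ->
  (#|[set B | Om (A1 a1 eps) B != 0%R]| <= G)%N ->
  (forall B, Om (A1 a1 eps) B != 0 -> `|Om (A1 a1 eps) B| <= C) ->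
  \sum_B `|Om (A1 a1 eps) B| <= G%:R * C.
Proof.
move=> C0 cG HC; rewrite (bigID (fun B => Om (A1 a1 eps) B != 0)) /= [X in _ + X]big1 ?addr0; last first.
  by move=> B; rewrite negbK => /eqP->; rewrite normr0.
apply: le_trans (ler_sum _ (fun B => HC B)) _.
rewrite sumr_const -[leLHS]mulr_natl ler_wpM2r // ler_nat; apply: leq_trans cG.
by rewrite cardsE.
Qed.

Lemma sum_Om_le2 a1 eps (G C : nat) :
  (#|[set B | Om (A1 a1 eps) B != 0%R]| <= G)%N -> (G * C <= Bn)%N ->
  (forall B, Om (A1 a1 eps) B != 0 -> `|Om (A1 a1 eps) B| <= F1 (A1 a1 eps) 1%g * e ^+ 2 * C%:R) ->
  \sum_B `|Om (A1 a1 eps) B| <= F1 (A1 a1 eps) 1%g * e ^+ 2 * Bn%:R.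
Proof.
have := FF1_ge0 chainR psi_add (A1 a1 eps) (irr_char i1); move: (F1 _ 1%g) => x x0 cG GC HC.
have xe : 0 <= x * e ^+ 2 by rewrite mulr_ge0 // exprn_ge0 ?ler0n.
apply: le_trans (sum_Om_le _ cG HC) _; first by rewrite mulr_ge0 ?ler0n.
by rewrite mulrCA ler_wpM2l // -natrM ler_nat.
Qed.

Lemma gt0q (i : nat) : (0 < q ^ i)%N.
Proof. by rewrite expn_gt0 (q_gt0 chainR). Qed.

(** The pairs [(y, z)] lie over one fibre of [Qf], rescaled by pi^d, and a contributing [g] nearly
    centralizes both [A1] and [B], which puts its corner in p^(m'-d). As [d] grows, the bound for
    the [g] gains [q ^ d] and that for the [B] loses [q ^ d], so the product does not depend on
    [d]. *)
Lemma key_small a1 eps (d : nat) a b y z : aniso pi eps -> (d < m)%N ->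
  Om (A1 a1 eps) (P4 eps a b (pi ^+ d * y) (pi ^+ d * z)) != 0 -> Qf eps (y, z) \is a GRing.unit ->
  (forall B, Om (A1 a1 eps) B != 0 -> okd eps d B) ->
  \sum_B `|Om (A1 a1 eps) B| <= F1 (A1 a1 eps) 1%g * e ^+ 2 * Bn%:R.
Proof.
move=> Qan dm nz UQ ok; set k := Qf eps (y, z).
have dl : (d <= l)%N by apply: leq_trans (ltnW dm) ml.
have mdl : (m + d <= l)%N by clear -dm; lia.
pose S := [set (pi ^+ d * w.1, pi ^+ d * w.2) | w in [set w | D (m - d) (Qf eps w - k)]].
have coord B : Om (A1 a1 eps) B != 0 -> exists a' b' y' z',
   [/\ B = P4 eps a' b' (pi ^+ d * y') (pi ^+ d * z'), D m (a' - a), D m (b' - b) &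
       D (m - d) (Qf eps (y', z') - k)].
  move=> nB; have [a' [b' [y0 [z0 EB]]]] := P4_onto chainR Qan B.
  have okB := ok B nB; move: okB nB; rewrite EB okd_P4 // => /andP[/DP[y' ->] /DP[z' ->]] nB.
  have [Da Db DQ] := good_cong Qan nz nB; exists a', b', y', z'; split=> //.
  have DQ' : D (m + d) (Qf eps (pi ^+ d * y', pi ^+ d * z') - Qf eps (pi ^+ d * y, pi ^+ d * z)).
    have [d0|] := posnP d; first by rewrite {1}d0 addn0.
    by move=> d0; apply: (good_fine Qan _ nz nB); rewrite ?DpiM ?d0.
  have E2 : Qf eps (pi ^+ d * y', pi ^+ d * z') - Qf eps (pi ^+ d * y, pi ^+ d * z) =
     pi ^+ (d + d) * (Qf eps (y', z') - k) by rewrite /k /Qf /= exprD; ring.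
  move: DQ'; rewrite E2 (_ : m + d = d + d + (m - d))%N; last by clear -dm; lia.
  by rewrite (DpiE chainR) //; clear -dm; lia.
have cG : (#|[set B | Om (A1 a1 eps) B != 0%R]| <= q ^ m' * q ^ m' * #|S|)%N.
  have -> : (q ^ m' * q ^ m' * #|S| = #|setX (setX (ideal m) (ideal m)) S|)%N.
    by rewrite !cardsX (card_ideal chainR).
  pose f (w : (R * R) * (R * R)) := P4 eps (a + w.1.1) (b + w.1.2) w.2.1 w.2.2.
  apply: leq_trans (leq_imset_card f _); apply/subset_leq_card/subsetP => B; rewrite inE => nB.
  have [a' [b' [y' [z' [EB Da Db DQ]]]]] := coord B nB.
  apply/imsetP; exists ((a' - a, b' - b), (pi ^+ d * y', pi ^+ d * z')).
    rewrite !in_setX !inE Da Db /=; apply/imsetP; exists (y', z') => //.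
    by rewrite inE.
  by rewrite EB /f /=; congr (P4 eps _ _ _ _); rewrite addrC subrK.
have cS : (q ^ (2 * d) * #|S| <= q ^ (l - (m - d)) * ((q + 1) * q ^ l.-1))%N.
  by apply: (card_Q_scaled chainR Qan) => //; clear -dm; lia.
pose C := [set g : {'GL_2[R]} | [&& (gv g 0 0, gv g 1 0) \in setX (units R) (ideal (m' - d)),
       D m' (gv g 0 1 - eps * gv g 1 0) & D m' (gv g 1 1 - gv g 0 0)]].
have m'l : (m' <= l)%N by clear; lia.
have md' : (m' - d <= l)%N by clear; lia.
have cC : (#|C| <= ((q - 1) * q ^ l.-1 * q ^ (l - (m' - d))) * (q ^ (l - m')) ^ 2)%N.
  apply: leq_trans (card_par _ _ m'l) _.
  by rewrite cardsX (card_unitsE chainR) (card_ideal chainR).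
have HC B : Om (A1 a1 eps) B != 0 -> `|Om (A1 a1 eps) B| <= F1 (A1 a1 eps) 1%g * e ^+ 2 * #|C|%:R.
  move=> nB; apply: Om_bound => // g g1 g2.
  have [a' [b' [y' [z' [EB _ _ DQ]]]]] := coord B nB.
  have UQ' : Qf eps (y', z') \is a GRing.unit.
    by rewrite (unit_congr chainR (DW _ DQ)) //; clear -dm; lia.
  have supp i s : (d <= i)%N -> (i <= l)%N -> Dm i (cj g (A1 a1 eps) - A1 a1 eps) -> Dm i (cj g B - B) ->
      [/\ D i (gv g 0 1 - eps * gv g 1 0), D i (gv g 1 1 - gv g 0 0) & D (i - d) (gv g 1 0)].
    move=> di il; rewrite Dm_comm_A1 => /andP[k1 k2]; rewrite EB (Dm_comm_P4 chainR Qan) //.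
    move=> /andP[k3 k4]; split=> //.
    have H x : D i (gv g 1 0 * (pi ^+ d * x)) -> x \is a GRing.unit -> D (i - d) (gv g 1 0).
      move=> k5 Ux; move: k5; rewrite mulrCA -{1}(subnKC di) (DpiE chainR); last by rewrite subnKC.
      by rewrite DUr.
    by move: UQ'; rewrite (Qf_unit chainR Qan) => /orP[]; [apply: H k3 | apply: H k4].
  have s1 := FF_supp0 chainR psi_add psi_nt g1; have s2 := FF_supp0 chainR psi_add psi_nt g2.
  have [t1 t2 t3] := supp m 0 (ltnW dm) ml s1 s2.
  have sc : Dm (m' - m) (gv g - (gv g 0 0)%:M).
    rewrite Dm2 !mxE /= !mulr1n !mulr0n !subr0 subrr Dx0 /=.
    have h10 : D (m' - m) (gv g 1 0) by apply: DW t3; clear -dm; lia.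
    have mm : (m' - m <= m)%N by clear -m0; lia.
    rewrite h10 (DW mm t2) -(subrK (eps * gv g 1 0) (gv g 0 1)) !andbT.
    by apply: DD; [apply: DW t1 | apply: DMl].
  have v1 := FF_suppV chainR psi_add psi_nt g1 sc; have v2 := FF_suppV chainR psi_add psi_nt g2 sc.
  have dm' : (d <= m')%N by clear -dm; lia.
  have [w1 w2 w3] := supp m' 0 dm' m'l v1 v2.
  rewrite inE w1 w2 in_setX !inE w3 !andbT.
  have Dg : D 1 (gv g 1 0) by apply: DW w3; clear -dm; lia.
  have := gl_det g; rewrite (unitN1 chainR) [in X in _ -> X](unitN1 chainR).
  apply: contra => Da; apply: DB; [exact: DMr | exact: DMl].
apply: (sum_Om_le2 cG _ HC).
rewrite -(leq_pmul2l (gt0q (2 * d))).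
apply: leq_trans (_ : (q ^ m' * q ^ m' * (q ^ (l - (m - d)) * ((q + 1) * q ^ l.-1))) *
   (((q - 1) * q ^ l.-1 * q ^ (l - (m' - d))) * (q ^ (l - m')) ^ 2) <= _)%N.
  have -> : (q ^ (2 * d) * (q ^ m' * q ^ m' * #|S| * #|C|) =
    q ^ m' * q ^ m' * (q ^ (2 * d) * #|S|) * #|C|)%N by ring.
  by apply: leq_mul => //; apply: leq_mul.
rewrite /Bn (_ : q ^ 2 - 1 = (q + 1) * (q - 1))%N; last first.
  by have := q_gt0 chainR; clear; nia.
have -> : (q ^ (2 * d) * ((q + 1) * (q - 1) * q ^ (5 * l - 2)) =
  (q + 1) * (q - 1) * q ^ (2 * d + (5 * l - 2)))%N by rewrite mulnCA expnD.
have -> : (2 * d + (5 * l - 2) = m' + m' + ((l - (m - d)) + l.-1) + (l.-1 + (l - (m' - d)) + (l - m') * 2))%N.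
  by have := l_gt0 chainR; clear -dm; lia.
rewrite !expnD expnM; apply/eq_leq; ring.
Qed.

Lemma okd_coord a1 eps a b y z B : aniso pi eps ->
  Om (A1 a1 eps) (P4 eps a b y z) != 0 -> Om (A1 a1 eps) B != 0 -> okd eps m B ->
  exists a' b' y' z', [/\ B = P4 eps a' b' y' z', D m (a' - a), D m (b' - b) & D m y' /\ D m z'].
Proof.
move=> Qan nz nB; have [a' [b' [y' [z' EB]]]] := P4_onto chainR Qan B.
move: nB; rewrite EB okd_P4 // => nB /andP[Dy Dz].
by have [Da Db DQ] := good_cong Qan nz nB; exists a', b', y', z'.
Qed.

Lemma card_good_top a1 eps a b y z : aniso pi eps -> Om (A1 a1 eps) (P4 eps a b y z) != 0 ->
  (forall B, Om (A1 a1 eps) B != 0 -> okd eps m B) ->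
  (#|[set B | Om (A1 a1 eps) B != 0%R]| <= q ^ (4 * m'))%N.
Proof.
move=> Qan nz ok.
have -> : (q ^ (4 * m') = #|setX (setX (ideal m) (ideal m)) (setX (ideal m) (ideal m))|)%N.
  by rewrite !cardsX (card_ideal chainR) // -!expnD; congr (_ ^ _)%N; clear; lia.
pose f (w : (R * R) * (R * R)) := P4 eps (a + w.1.1) (b + w.1.2) w.2.1 w.2.2.
apply: leq_trans (leq_imset_card f _); apply/subset_leq_card/subsetP => B; rewrite inE => nB.
have [a' [b' [y' [z' [EB Da Db [Dy Dz]]]]]] := okd_coord Qan nz nB (ok B nB).
apply/imsetP; exists ((a' - a, b' - b), (y', z')); first by rewrite !in_setX !inE Da Db Dy Dz.
by rewrite EB /f /=; congr (P4 eps _ _ _ _); rewrite addrC subrK.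
Qed.

(** Every contributing [B] now lies modulo p^m in the algebra generated by [al], and [g] may be any
    unit of that algebra modulo p^m; hence the count of pairs [(e00 g, e10 g)] not both in p. *)
Lemma key_even a1 eps a b y z : aniso pi eps -> m' = m -> Om (A1 a1 eps) (P4 eps a b y z) != 0 ->
  (forall B, Om (A1 a1 eps) B != 0 -> okd eps m B) ->
  \sum_B `|Om (A1 a1 eps) B| <= F1 (A1 a1 eps) 1%g * e ^+ 2 * Bn%:R.
Proof.
move=> Qan mm nz ok; have cG := card_good_top Qan nz ok.
pose W := ~: setX (ideal 1) (ideal 1).
pose C := [set g : {'GL_2[R]} | [&& (gv g 0 0, gv g 1 0) \in W,
       D m (gv g 0 1 - eps * gv g 1 0) & D m (gv g 1 1 - gv g 0 0)]].
have l0 := l_gt0 chainR.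
have cC : (#|C| <= (q ^ l * q ^ l - q ^ l.-1 * q ^ l.-1) * (q ^ (l - m)) ^ 2)%N.
  apply: leq_trans (card_par _ _ ml) _; rewrite leq_mul2r; apply/orP; right.
  rewrite cardsCs setCK cardsX (card_ideal chainR) // subn1.
  by rewrite card_prod (card_R chainR).
have HC B : Om (A1 a1 eps) B != 0 -> `|Om (A1 a1 eps) B| <= F1 (A1 a1 eps) 1%g * e ^+ 2 * #|C|%:R.
  move=> nB; apply: Om_bound => // g g1 g2.
  have := FF_supp0 chainR psi_add psi_nt g1; rewrite Dm_comm_A1 => /andP[k1 k2].
  rewrite inE k1 k2 !andbT in_setC in_setX !inE; apply/negP => /andP[Da Dc].
  have := gl_det g; rewrite (unitN1 chainR) => /negP[]; apply: DB; [exact: DMr | exact: DMl].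
apply: (sum_Om_le2 cG _ HC).
apply: leq_trans (leq_mul (leqnn _) cC) _; rewrite /Bn.
have -> : (q ^ l * q ^ l - q ^ l.-1 * q ^ l.-1 = (q ^ 2 - 1) * (q ^ l.-1 * q ^ l.-1))%N.
  by rewrite mulnBl mul1n -{1 2}(prednK l0) !expnS; congr (_ - _)%N; ring.
have -> : (5 * l - 2 = 4 * m' + (l.-1 + l.-1 + (l - m) * 2))%N by clear -mm l0; lia.
rewrite !expnD expnM; apply/eq_leq; ring.
Qed.

(** Elements of [C1], scalar modulo p, carry values up to [q]; those of [C2], with a unit corner,
    carry values at most 1 by [odd_le1]. The two families have equal bounds, whose sum is
    [2 * q / (q + 1)] times the target. *)
Lemma key_odd a1 eps a b y z : aniso pi eps -> m' = m.+1 -> Om (A1 a1 eps) (P4 eps a b y z) != 0 ->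
  (forall B, Om (A1 a1 eps) B != 0 -> okd eps m B) ->
  (q + 1)%:R * (\sum_B `|Om (A1 a1 eps) B|) <= (2 * q)%:R * (F1 (A1 a1 eps) 1%g * e ^+ 2 * Bn%:R).
Proof.
move=> Qan mm nz ok; have cG := card_good_top Qan nz ok.
have EA1 : A1 a1 eps = P4 eps a1 1 0 0 by rewrite /P4; congr mx2; ring.
have [n1 _ _] := Om_neq0 nz.
have e1 : (m' - m = 1)%N by rewrite mm subSnn.
have U1 : A1 a1 eps 1 0 \is a GRing.unit by rewrite mx2E unitr1.
have [Ee _] := FF_central chainR psi_add psi_nt (irr_char i1) (wh_irr_le1 i1) U1 n1.
rewrite Ee e1 expn1.
have m'l : (m' <= l)%N by clear; lia.
pose C1 := [set g : {'GL_2[R]} | [&& (gv g 0 0, gv g 1 0) \in setX (units R) (ideal 1),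
       D m' (gv g 0 1 - eps * gv g 1 0) & D m' (gv g 1 1 - gv g 0 0)]].
pose C2 := [set g : {'GL_2[R]} | [&& (gv g 0 0, gv g 1 0) \in setX [set: R] (units R),
       D m (gv g 0 1 - eps * gv g 1 0) & D m (gv g 1 1 - gv g 0 0)]].
have l0 := l_gt0 chainR.
have cC1 : (#|C1| <= (q - 1) * q ^ l.-1 * q ^ l.-1 * (q ^ (l - m')) ^ 2)%N.
  apply: leq_trans (card_par _ _ m'l) _.
  by rewrite cardsX (card_unitsE chainR) (card_ideal chainR l0) (_ : l - 1 = l.-1)%N // subn1.
have cC2 : (#|C2| <= q ^ l * ((q - 1) * q ^ l.-1) * (q ^ (l - m)) ^ 2)%N.
  apply: leq_trans (card_par _ _ ml) _.
  by rewrite cardsX (card_unitsE chainR) cardsT (card_R chainR).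
have HC B : Om (A1 a1 eps) B != 0 -> `|Om (A1 a1 eps) B| <= (q ^ 3 * #|C1| + #|C2|)%:R.
  move=> nB; have [a' [b' [y' [z' [EB _ _ [Dy Dz]]]]]] := okd_coord Qan nz nB (ok B nB).
  have [_ n2 n3] := Om_neq0 nB.
  have Dy1 : D 1 y' by apply: DW Dy.
  have Dz1 : D 1 z' by apply: DW Dz.
  have Ub : b' \is a GRing.unit.
    by move: n2; rewrite EB => n2; apply: (P4_nonscalar chainR (FF_nonscalar chainR psi_add r2 n2) Dy1 Dz1).
  have E3 : A1 a1 eps + B = P4 eps (a1 + a') (1 + b') y' z' by rewrite EB P4D.
  have Ub1 : 1 + b' \is a GRing.unit.
    by move: n3; rewrite E3 => n3; apply: (P4_nonscalar chainR (FF_nonscalar chainR psi_add r3 n3) Dy1 Dz1).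
  have leq (i : Iirr GG) A g : regc 'chi_i -> FF 'chi_i A 1%g != 0 -> `|FF 'chi_i A g| <= q%:R.
    move=> ri ni; apply: le_trans (FF_le1 chainR psi_add psi_nt _ _ (irr_char i)) _.
    have := FF1_le chainR psi_add psi_nt (irr_char i) (wh_irr_le1 i) (FF_nonscalar chainR psi_add ri ni).
    by rewrite e1 expn1.
  have H (w1 w2 w3 b1 : algC) : 0 <= b1 -> `|w1| <= b1 -> `|w2| <= b1 -> `|w3| <= b1 ->
      `|w1 * w2 * w3^*| <= b1 ^+ 3.
    move=> b0 h1 h2 h3; rewrite !normrM norm_conjC exprSr expr2.
    by apply: ler_pM => //; [rewrite mulr_ge0 | apply: ler_pM].
  apply: le_trans (ler_norm_sum _ _ _) _.
  apply: le_trans (_ : \sum_g ((g \in C1)%:R * (q ^ 3)%:R + (g \in C2)%:R) <= _); last first.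
    rewrite big_split /= -mulr_suml natrD natrM.
    have cnt (C : {set {'GL_2[R]}}) : \sum_g (g \in C)%:R = #|C|%:R :> algC.
      by rewrite -sum1_card natr_sum [RHS]big_mkcond; apply: eq_bigr => g _; case: (g \in C).
    by rewrite !cnt mulrC.
  apply: ler_sum => g _.
  have [->|g1] := eqVneq (F1 (A1 a1 eps) g) 0.
    by rewrite !mul0r normr0 addr_ge0 ?mulr_ge0 ?ler0n.
  have s1 := FF_supp0 chainR psi_add psi_nt g1.
  have := s1; rewrite Dm_comm_A1 => /andP[k1 k2].
  have sal : Dm m (cj g (al eps) - al eps) by rewrite cj_comm_al k1 k2.
  have [Ug|nUg] := boolP (gv g 1 0 \is a GRing.unit).
    have -> : g \in C2 by rewrite inE k1 k2 in_setX !inE Ug.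
    apply: le_trans (_ : 1 <= _); last by rewrite lerDr mulr_ge0 ?ler0n.
    have le1 (i : Iirr GG) a2 b1 y1 z1 : b1 \is a GRing.unit -> D m y1 -> D m z1 ->
        FF 'chi_i (P4 eps a2 b1 y1 z1) 1%g != 0 -> `|FF 'chi_i (P4 eps a2 b1 y1 z1) g| <= 1.
      move=> Ub2 Dy2 Dz2 ni.
      exact: (odd_le1 chainR psi_add psi_nt Qan mm (irr_char i) (wh_irr_le1 i) Dy2 Dz2 Ub2 sal Ug ni).
    rewrite -(expr1n algC 3); apply: H; rewrite ?ler01 //.
    - by rewrite EA1; apply: le1; rewrite ?unitr1 ?Dx0 // -EA1.
    - by rewrite EB; apply: le1 => //; rewrite -EB.
    - by rewrite E3; apply: le1 => //; rewrite -E3.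
  have Dc : D 1 (gv g 1 0) by apply: contraR nUg; rewrite (unitN1 chainR).
  have sc : Dm (m' - m) (gv g - (gv g 0 0)%:M).
    rewrite e1 Dm2 !mxE /= !mulr1n !mulr0n !subr0 subrr Dx0 /= Dc (DW m0 k2) !andbT.
    rewrite -(subrK (eps * gv g 1 0) (gv g 0 1)); apply: DD; [exact: DW k1 | exact: DMl].
  have := FF_suppV chainR psi_add psi_nt g1 sc; rewrite Dm_comm_A1 => /andP[k3 k4].
  have -> : g \in C1.
    rewrite inE k3 k4 in_setX !inE Dc !andbT.
    have := gl_det g; rewrite (unitN1 chainR) [in X in _ -> X](unitN1 chainR).
    by apply: contra => Da; apply: DB; [exact: DMr | exact: DMl].
  rewrite mul1r natrX; apply: le_trans (_ : q%:R ^+ 3 <= _); last by rewrite lerDl ler0n.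
  by apply: H; rewrite ?ler0n //; apply: leq.
apply: le_trans (ler_wpM2l (ler0n _ _) (sum_Om_le (ler0n _ _) cG HC)) _.
rewrite -!natrM -natrX -!natrM ler_nat.
apply: leq_trans (leq_mul (leqnn _) (leq_mul (leqnn _) (leq_add (leq_mul (leqnn _) cC1) cC2))) _.
rewrite /Bn (_ : q ^ 2 - 1 = (q + 1) * (q - 1))%N; last by have := q_gt0 chainR; clear; nia.
have Ell : (l = m + m.+1)%N by rewrite -mm; clear; lia.
have pl1 : (q ^ l.-1 = q ^ m * q ^ m)%N by rewrite -expnD; congr (_ ^ _)%N; clear -Ell; lia.
have pl : (q ^ l = q * (q ^ m * q ^ m))%N by rewrite -expnD -expnS; congr (_ ^ _)%N; clear -Ell; lia.
have pm' : (q ^ (l - m') = q ^ m)%N by congr (_ ^ _)%N; clear; lia.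
have pm : (q ^ (l - m) = q * q ^ m)%N by rewrite -expnS; congr (_ ^ _)%N; exact: mm.
have p4 : (q ^ (4 * m') = (q * q ^ m) ^ 4)%N.
  by rewrite -expnS -expnM; congr (_ ^ _)%N; clear -mm; lia.
have p5 : (q ^ (5 * l - 2) = q ^ 3 * (q ^ m) ^ 10)%N.
  by rewrite -expnM -expnD; congr (_ ^ _)%N; clear -Ell; lia.
rewrite pl1 pl pm' pm p4 p5; move: (q - 1)%N (q ^ m)%N => w X; apply/eq_leq; ring.
Qed.

Lemma key A : (q + 1)%:R * (\sum_B `|Om A B|) <= (2 * q)%:R * (F1 A 1%g * e ^+ 2 * Bn%:R).
Proof.
have [E0|nz] := eqVneq (F1 A 1%g) 0.
  rewrite E0 !mul0r mulr0 big1 ?mulr0 // => B _; apply/eqP; rewrite normr_eq0.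
  by apply: contraT => /Om_neq0[]; rewrite E0 eqxx.
have [h [a1 [eps [EA Qan]]]] := normal_form nz.
have -> : \sum_B `|Om A B| = \sum_B `|Om (A1 a1 eps) B|.
  by rewrite [RHS](reindex_inj (can_inj (cjK h))); apply: eq_bigr => B _; rewrite -EA Om_cj.
rewrite -(FFJ1 _ _ _ _ _ h) EA.
have F0 := FF1_ge0 chainR psi_add (A1 a1 eps) (irr_char i1).
have weak : \sum_B `|Om (A1 a1 eps) B| <= F1 (A1 a1 eps) 1%g * e ^+ 2 * Bn%:R ->
    (q + 1)%:R * (\sum_B `|Om (A1 a1 eps) B|) <= (2 * q)%:R * (F1 (A1 a1 eps) 1%g * e ^+ 2 * Bn%:R).
  move=> H; apply: (ler_pM _ _ _ H); [exact: ler0n | by apply: sumr_ge0 |].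
  by rewrite ler_nat; have := q_gt0 chainR; clear; lia.
have [S0|[B0]] := set_0Vmem [set B | Om (A1 a1 eps) B != 0].
  apply: weak; apply: (@sum_Om_le2 _ _ 0 0) => // [|B nB]; first by rewrite S0 cards0.
  by have : B \in [set B | Om (A1 a1 eps) B != 0]; [rewrite inE | rewrite S0 inE].
rewrite inE => nB0.
(* The largest level, capped at [m], to which all contributing [B] lie in the algebra of [al]. If it
   is below [m], some [B] attains it, and its rescaled coordinates have unit norm. *)
pose P d := [forall B, (Om (A1 a1 eps) B != 0) ==> okd eps d B] && (d <= m)%N.
have P0 : exists d, P d.
  by exists 0%N; rewrite /P leq0n andbT; apply/forallP => B; rewrite /okd !D0x implybT.
have Pm d : P d -> (d <= m)%N by case/andP.
case: (ex_maxnP P0 Pm) => d /andP[/forallP ok' dm] dmax.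
have ok B : Om (A1 a1 eps) B != 0 -> okd eps d B by move=> nB; have := ok' B; rewrite nB.
have [a [b [y [z E0]]]] := P4_onto chainR Qan B0; rewrite E0 in nB0.
move: dm; rewrite leq_eqVlt => /orP[/eqP Edm|dm].
  rewrite Edm in ok.
  have [mm|mm] : m' = m \/ m' = m.+1 by clear -m0; lia.
    by apply: weak; apply: key_even nB0 ok.
  exact: key_odd nB0 ok.
apply: weak.
have : ~~ P d.+1 by apply/negP => /dmax; rewrite ltnn.
rewrite /P dm andbT => /forallPn[B]; rewrite negb_imply => /andP[nB nok].
have [a' [b' [y' [z' EB]]]] := P4_onto chainR Qan B.
have okB := ok B nB; move: okB nok nB; rewrite EB !okd_P4 // => /andP[/DP[y1 ->] /DP[z1 ->]] nok nB.
apply: (key_small Qan dm nB) => //.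
rewrite (Qf_unit chainR Qan) !(unitN1 chainR) -negb_and; apply: contra nok => /andP[Dy Dz].
by rewrite -addn1 !DM ?Dpi.
Qed.

Lemma cus_mult_le1 : '['chi_i1 * 'chi_i2, 'chi_i3] <= 1.
Proof.
have /natrP[n En] : '['chi_i1 * 'chi_i2, 'chi_i3] \in Num.nat.
  by apply: Cnat_cfdot_char; rewrite ?rpredM ?irr_char.
rewrite En (ler_nat _ n 1).
have q0 := q_gt0 chainR.
suff : (q + 1)%:R * n%:R <= (2 * q)%:R :> algC.
  by rewrite -natrM ler_nat; clear -q0; nia.
pose K0 := (q ^ (4 * m'))%:R : algC.
have SK : \sum_A F1 A 1%g = K0 * ((q - 1) * q ^ l.-1)%:R.
  rewrite (FF_inv chainR psi_add psi_nt) (irr1_reg chainR psi_add psi_nt r1) cus1 mulr0 add0r.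
  congr (_ * _); rewrite (card_N chainR); apply: (canLR (mulfK (nzq chainR _))).
  by rewrite -natrM -expnD; congr ((q ^ _)%:R); clear; lia.
have H : (q + 1)%:R * (K0 ^+ 2 * #|GG|%:R * n%:R) <=
   (2 * q)%:R * (K0 * ((q - 1) * q ^ l.-1)%:R * e ^+ 2 * Bn%:R).
  have S0 : 0 <= K0 ^+ 2 * #|GG|%:R * n%:R by rewrite !mulr_ge0 ?exprn_ge0 ?ler0n.
  rewrite -[X in _ * X <= _](ger0_norm S0) -En -sum_Om -SK !mulr_suml !mulr_sumr.
  apply: le_trans (ler_wpM2l (ler0n _ _) (ler_norm_sum _ _ _)) _.
  rewrite mulr_sumr; apply: ler_sum => A _; apply: le_trans (key A).
  by rewrite ler_wpM2l ?ler0n // ler_norm_sum.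
have EG : K0 * #|GG|%:R = ((q - 1) * q ^ l.-1)%:R * e ^+ 2 * Bn%:R.
  rewrite /K0 (card_GG chainR) (card_unitsE chainR) /Bn -natrX -!natrM; congr (_%:R).
  rewrite (_ : q ^ 2 - 1 = (q + 1) * (q - 1))%N; last by clear -q0; nia.
  have l0 := l_gt0 chainR.
  have -> : (q ^ (4 * m') * (((q - 1) * q ^ l.-1) ^ 2 * (q ^ (l + l.-1) * (q + 1))) =
     (q - 1) ^ 2 * (q + 1) * q ^ (4 * m' + l.-1 * 2 + (l + l.-1)))%N.
    by rewrite !expnD expnM; ring.
  have -> : (4 * m' + l.-1 * 2 + (l + l.-1) = l.-1 + (m' - m) * 2 + (5 * l - 2))%N by clear -l0; lia.
  by rewrite !expnD expnM; ring.
have nK : 0 < K0 * (K0 * #|GG|%:R).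
  by rewrite !mulr_gt0 ?ltr0n ?gt0q // cardG_gt0.
rewrite -(ler_pM2r nK); move: H; rewrite -[X in _ <= _ * X]mulrA -[X in _ <= _ * X]mulrA (mulrA _ (e ^+ 2)) -EG.
by rewrite (_ : (q + 1)%:R * (K0 ^+ 2 * #|GG|%:R * n%:R) = (q + 1)%:R * n%:R * (K0 * (K0 * #|GG|%:R))) //; ring.
Qed.

End Triple.

(** * Products with a split semisimple character *)

Section CharacterHelpers.
Variable gT : finGroupType.
Implicit Types G H : {group gT}.

Lemma char_eq_irr G (phi : 'CF(G)) i : phi \is a character -> '[phi, 'chi_i] != 0 ->
  phi 1%g <= 'chi_i 1%g -> phi = 'chi_i.
Proof.
move=> Nphi nz; have [rest Nrest ->] := constt_charP i Nphi nz.
rewrite cfunE gerDl => le0; have /eqP -> : rest == 0.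
  by rewrite -char1_eq0 // eq_le le0 char1_ge0.
by rewrite addr0.
Qed.

Lemma Ind_eigen G H (mu : 'CF(H)) z c : H \subset G -> mu \is a linear_char ->
  (forall y, y \in G -> (z ^ y)%g \in H /\ mu (z ^ y)%g = c) ->
  {in G, forall g, 'Ind[G] mu (g * z)%g = c * 'Ind[G] mu g}.
Proof.
move=> sHG Lmu Hz g gG; rewrite !cfIndE // mulrCA; congr (_ * _); rewrite mulr_sumr.
apply: eq_bigr => y yG; have [zH Ez] := Hz y yG; rewrite conjMg.
have [gH|gH] := boolP ((g ^ y)%g \in H); first by rewrite lin_charM // Ez mulrC.
by rewrite (cfun0 _ gH) mulr0 cfun0 // groupMr.
Qed.

Lemma cfdot_eigen G (phi xi : 'CF(G)) z a b : z \in G -> a * b^* != 1 ->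
  {in G, forall g, phi (g * z)%g = a * phi g} -> {in G, forall g, xi (g * z)%g = b * xi g} ->
  '[phi, xi] = 0.
Proof.
move=> zG ne Ha Hb; apply/eqP; rewrite -(mulrI_eq0 _ (_ : GRing.lreg (1 - a * b^*))); last first.
  by apply/lregP; rewrite subr_eq0 eq_sym.
rewrite mulrBl mul1r subr_eq0 cfdotE mulrCA; apply/eqP; congr (_ * _).
rewrite mulr_sumr (reindex_inj (mulIg z)) /=; apply: eq_big => [g|g]; first by rewrite groupMr.
by rewrite groupMr // => gG; rewrite Ha // Hb // rmorphM /=; ring.
Qed.

End CharacterHelpers.

Section Principal.
Variables (R : finComUnitRingType) (pi : R) (l q : nat) (psi : R -> algC).
Hypothesis chainR : chain_ring pi l q.
Hypothesis psi_add : additive_char psi.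
Hypothesis psi_nt : exists2 x, x \in [set: R] & psi (pi ^+ l.-1 * x) != 1.

Notation D i x := (dvdR (pi ^+ i) x).
Notation ideal i := (ideal pi i).
Notation wh := (wh l q psi).
Notation GG := (GG R).
Notation regc := (regc pi l).
Notation fi := (fi pi l psi).
Notation ssB := (@ssB R pi l psi).
Notation mlow := (mlow pi l q psi).
Notation whf := (whf l q psi).
Implicit Types (g h : {'GL_2[R]}) (a b c d x y z s t : R).
Notation Bg := (box_group pi 0 l).
Notation Ig := (box_group pi 0 1).
Notation Dg := (box_group pi l.-1 1).
Notation Pg := (Pset_group pi l).
Notation Vp := (Vp pi l).
Notation Wp := (Wp pi l).
Notation M1 := (M1_group pi l).
Notation Ug := (Uset_group R).
Notation addm := (addm pi l).

Let l0 := l_gt0 chainR.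

Lemma sBI : Bg \subset Ig. Proof. exact: box_sub. Qed.
Lemma sDI : Dg \subset Ig. Proof. exact: box_sub. Qed.
Lemma uB x : u x \in Bg. Proof. by have := u_box l (D0x pi x). Qed.
Lemma hhB s : D l.-1 s -> hh s \in Bg.
Proof. by move=> Ds; have := subsetP (box_sub pi (leq0n l) (leqnn l)) _ (hh_box chainR Ds). Qed.
Lemma dgB a d : a \is a GRing.unit -> d \is a GRing.unit -> dg a d \in Bg.
Proof. by move=> Ua Ud; have := subsetP (box_sub pi (leq0n l) (leqnn l)) _ (dg_box pi l Ua Ud). Qed.
Lemma sUB : Ug \subset Bg.
Proof. by apply/subsetP => _ /imsetP[x _ ->]; apply: uB. Qed.
Lemma sPB : Pg \subset Bg.
Proof. by apply/subsetP => _ /imsetP[x _ ->]; apply: uB. Qed.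

Lemma card_Ind_I k (mu : 'CF(Bg)) : ssB k mu -> 'Ind[Ig] mu 1%g = (q ^ l.-1)%:R.
Proof.
case=> Lmu _ _; rewrite cfInd1 ?sBI // (lin_char1 Lmu) mulr1; congr (_%:R).
rewrite -divgS ?sBI // !(card_box chainR) ?l0 ?leqnn // subn0 subnn subn1 muln1 mulKn //.
by rewrite muln_gt0 expn_gt0 (gt0q chainR) andbT lt0n; have := nzU chainR; rewrite pnatr_eq0 => ->.
Qed.

Lemma Y_hh k (mu : 'CF(Bg)) g s : ssB k mu -> g \in Ig -> D l.-1 s ->
  'Ind[Ig] mu (g ** hh s) = psi (k * s) * 'Ind[Ig] mu g.
Proof.
case=> Lmu muu muh gI Ds; apply: Ind_eigen => //; first exact: sBI.
move=> y yI; rewrite conjgE (hhI_conj chainR yI Ds) mulKg groupM ?uB ?hhB //; split=> //.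
by rewrite (lin_charM Lmu) ?uB ?hhB // muu muh // mulr1.
Qed.

Lemma Y_ker k (mu : 'CF(Bg)) : ssB k mu -> Pg \subset cfker ('Ind[Ig] mu).
Proof.
case=> Lmu muu muh; apply/subsetP => h /imsetP[x]; rewrite inE => Dx ->.
rewrite cfkerEchar ?cfInd_char ?lin_charW // inE (uI chainR) /= -[u x]mul1g.
rewrite (@Ind_eigen _ Ig Bg mu (u x) 1) ?mul1r ?group1 ?sBI //.
by move=> y yI; rewrite conjgE (uI_conj chainR yI Dx) mulKg uB muu.
Qed.

(** Induction in stages passes through the Iwahori subgroup, where the induced character is trivial
    on [Pset], so V and W separate. *)
Lemma triple_split k (mu : 'CF(Bg)) i2 j : ssB k mu ->
  '['Ind[GG] mu * 'chi_i2, 'chi_j] =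
  '['Ind[Ig] mu * Vp i2, Vp j] + '['Ind[Ig] mu * Wp i2, Wp j].
Proof.
move=> smu; have [Lmu _ _] := smu.
have E : 'Ind[GG] mu = 'Ind[GG] ('Ind[Ig] mu) by rewrite cfIndInd ?subsetT ?sBI.
rewrite E -[in LHS]cfIndM ?subsetT // -[in LHS]Frobenius_reciprocity.
apply: cfdot_cfFix_split; rewrite ?cfInd_char ?cfRes_char ?irr_char ?lin_charW //.
exact: Y_ker smu.
Qed.

Lemma whf_nat (H : {group {'GL_2[R]}}) (phi : 'CF(H)) : Ug \subset H -> phi \is a character ->
  whf (fun x => phi (u x)) 1 \in Num.nat.
Proof.
move=> sUH Nphi; pose lam g := psi (e01 g).
have lamM : mulon Ug lam.
  split=> [|_ _ /imsetP[x _ ->] /imsetP[y _ ->]]; first by rewrite /lam entries1 (psi0 psi_add).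
  by rewrite uM /lam !uE (psiD psi_add).
have := mulon_mult_nat sUH Nphi lamM.
rewrite card_imset; last exact: u_inj.
rewrite big_imset /=; last by move=> x y _ _; apply: u_inj.
rewrite (card_R chainR) (eq_bigr (fun x => phi (u x) * psi (- (1 * x)))) // => x _.
by rewrite /lam uE mul1r (psi_conj psi_add).
Qed.

Lemma sumP_ge0 (H : {group {'GL_2[R]}}) (phi : 'CF(H)) : Pg \subset H -> phi \is a character ->
  0 <= \sum_(x in ideal l.-1) phi (u x).
Proof.
move=> sPH Nphi; have mP : mulon Pg (fun=> 1) by split=> // *; rewrite mulr1.
have /natrP[n] := mulon_mult_nat sPH Nphi mP.
rewrite (sum_Pg) (card_Pg chainR) (eq_bigr (fun x => phi (u x))) => [|x _]; last by rewrite rmorph1 mulr1.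
by move=> En; have := ler0n algC n; rewrite -En pmulr_rge0 // invr_gt0 ltr0n (q_gt0 chainR).
Qed.

Lemma B_deg (phi : 'CF(Bg)) : \sum_(x in ideal l.-1) phi (u x) = 0 ->
  phi 1%g = #|units R|%:R * whf (fun x => phi (u x)) 1.
Proof.
move=> S0; have fU a x : a \is a GRing.unit -> phi (u (a * x)) = phi (u x).
  move=> Ua; pose da := dg a 1; have E : u (a * x) = conjg (u x) da^-1%g.
    by rewrite conjgE invgK mulgA /da (dg_u _ Ua (unitr1 _)) divr1 mulgK.
  by rewrite E cfunJ // groupV dgB ?unitr1.
by have := whf_sum chainR psi_add psi_nt fU; rewrite S0 mulr0 add0r u0.
Qed.

(** A constituent of W has no vector fixed by [Pset], so by [B_deg] its degree is a positive
    multiple of [#|units R|]. W has Whittaker multiplicity at most 1, so its own degree is at most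
    [#|units R|]. *)
Lemma ResW_irr i : 'Res[Bg] (Wp i) = 0 \/ 'Res[Bg] (Wp i) \in irr Bg.
Proof.
set A := 'Res[Bg] (Wp i); have NA : A \is a character by rewrite cfRes_char // Wp_char.
have [->|nzA] := eqVneq A 0; [by left | right].
have [t tA] : exists t : Iirr Bg, t \in irr_constt A.
  by apply/existsP; apply: contraNT nzA; rewrite negb_exists => /forallP H;
     rewrite [A]cfun_sum_constt big_pred0 // => w; apply/negbTE/H.
have [rest Nrest EA] := constt_charP t NA tA.
have kV x : D l.-1 x -> Vp i (u x) = Vp i 1%g.
  move=> Dx; rewrite -[u x]mul1g cfkerMr //.
  have /subsetP -> // : Pg \subset cfker (Vp i) by apply: cfker_cfFix; case/andP: (Pg_norm chainR).
  by rewrite imset_f // inE.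
have SA : \sum_(x in ideal l.-1) A (u x) = 0.
  transitivity (\sum_(x in ideal l.-1) ('chi_i (u x) - Vp i 1%g)).
    apply: eq_bigr => x; rewrite inE => Dx; rewrite cfResE ?sBI ?uB //.
    by rewrite -(VWE l i (uI chainR x)) kV // addrC addKr.
  rewrite sumrB sumr_const -(qE chainR) (Vp1 chainR) -[X in _ - X]mulr_natl mulVKf ?(nzq1 chainR) //.
  exact: subrr.
have [S1 S2] : \sum_(x in ideal l.-1) 'chi_t (u x) = 0 /\ \sum_(x in ideal l.-1) rest (u x) = 0.
  have E : \sum_(x in ideal l.-1) 'chi_t (u x) + \sum_(x in ideal l.-1) rest (u x) = 0.
    by rewrite -big_split -[RHS]SA; apply: eq_bigr => x _; rewrite EA cfunE.
  have P1 := sumP_ge0 sPB (irr_char t); have P2 := sumP_ge0 sPB Nrest.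
  by move/eqP: E; rewrite paddr_eq0 // => /andP[/eqP-> /eqP->].
have wA : whf (fun x => A (u x)) 1 <= 1.
  have : whf (fun x => A (u x)) 1 + whf (fun x => 'Res[Bg] (Vp i) (u x)) 1 = wh 'chi_i 1.
    rewrite -mulrDr -big_split; congr (_ * _); apply: eq_bigr => x _ /=.
    by rewrite -mulrDl !cfResE ?sBI ?uB // addrC VWE // (uI chainR).
  have NV : 'Res[Bg] (Vp i) \is a character by rewrite cfRes_char // Vp_char.
  have := natr_ge0 (whf_nat sUB NV); rewrite (regcP chainR psi_add psi_nt) => w0 E.
  apply: le_trans (_ : (regc 'chi_i)%:R <= 1); first by rewrite -E lerDl.
  by case: regc; rewrite ?lexx ?ler01.
have U0 : 0 < #|units R|%:R :> algC by rewrite lt_def (nzU chainR) ler0n.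
have dt : #|units R|%:R <= 'chi_t 1%g.
  rewrite (B_deg S1) ler_peMr ?ler0n //; have /natrP[n En] := whf_nat sUB (irr_char t).
  rewrite En (ler_nat _ 1 n) lt0n; apply/eqP => n0.
  by have := irr1_neq0 t; rewrite (B_deg S1) En n0 mulr0 eqxx.
suff -> : A = 'chi_t by apply: mem_irr.
apply: char_eq_irr => //; apply: le_trans dt; rewrite (B_deg SA).
by rewrite ler_piMr ?ler0n.
Qed.

Lemma W_le1 k (mu : 'CF(Bg)) i j : ssB k mu -> '['Ind[Ig] mu * Wp i, Wp j] <= 1.
Proof.
case=> Lmu _ _; rewrite -cfIndM ?sBI // -Frobenius_reciprocity.
have [->|/(mul_lin_irr Lmu)/irrP[t1 ->]] := ResW_irr i; first by rewrite mulr0 cfdot0l ler01.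
have [->|/irrP[t2 ->]] := ResW_irr j; first by rewrite cfdot0r ler01.
by rewrite cfdot_irr; case: eqP; rewrite ?lexx ?ler01.
Qed.

Lemma Y_irr k (mu : 'CF(Bg)) : k \is a GRing.unit -> ssB k mu -> 'Ind[Ig] mu \in irr Ig.
Proof.
move=> Uk smu; have [Lmu _ _] := smu; have [i E _] := IndB_irr chainR psi_add psi_nt Uk smu.
apply: (@Ind_irr_irr _ GG); rewrite ?subsetT ?cfInd_char ?lin_charW //.
by rewrite cfIndInd ?subsetT ?sBI // E mem_irr.
Qed.

Lemma DgBg : (Dg * Bg)%g = Ig.
Proof.
apply/eqP; rewrite eqEsubset mul_subG ?sDI ?sBI //=; apply/subsetP => g gI.
have [Ua _] := box_units chainR (ltn0Sn 0) gI; have := gI; rewrite inE => /andP[_ Dc].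
apply/mulsgP; exists (v (e10 g / e00 g)) (v (- (e10 g / e00 g)) ** g).
- by apply: (subsetP (box_sub pi (leq_pred l) (leqnn 1))); apply: v_box; apply: DMr.
- by rewrite (in_Bg chainR) entriesM !vE mulNr divrK // mul1r addNr.
- by rewrite -vV mulKVg.
Qed.

(** Products of p^(l-1) and p vanish, so [mu] of the diagonal is multiplicative on [Dg]. Both
    inductions have the same degree and share a constituent. Passing to [Dg] allows V to be
    restricted to a group where it is irreducible for type sns. *)
Lemma muD_exists k (mu : 'CF(Bg)) : k \is a GRing.unit -> ssB k mu ->
  exists2 muD : 'CF(Dg), muD \is a linear_char /\
    {in Dg, forall g, muD g = mu (dg (e00 g) (e11 g))} & 'Ind[Ig] muD = 'Ind[Ig] mu.
Proof.
move=> Uk smu; have [Lmu muu muh] := smu.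
have UD g : g \in Dg -> (e00 g \is a GRing.unit) /\ (e11 g \is a GRing.unit) by move=> gD; apply: (box_units chainR _ gD).
have M : mulon Dg (fun g => mu (dg (e00 g) (e11 g))).
  split=> [|g h gD hD].
    rewrite !entries1; have -> : dg 1 1 = 1%g :> {'GL_2[R]}.
      by apply: gl_eq; rewrite val_dg ?unitr1 // -mx2_scalar.
    exact: lin_char1.
  have [[Ua Ud] [Ua' Ud']] := (UD g gD, UD h hD).
  move: gD hD; rewrite !inE => /andP[b1 c1] /andP[b2 c2].
  rewrite !entriesM (Dtop1 chainR b1 c2) [e10 g * _]mulrC (Dtop1 chainR b2 c1) addr0 add0r.
  by rewrite -dgM // lin_charM // dgB.
have [muD LD ED] := lin_of_mulon M; exists muD => //.
have NY : 'Ind[Ig] muD \is a character by rewrite cfInd_char ?lin_charW.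
have /irrP[t Et] := Y_irr Uk smu; rewrite Et; apply: char_eq_irr => //.
  rewrite -Et (cfdot_Ind_mulG _ _ DgBg) mulf_neq0 //.
    by rewrite mulf_neq0 ?invr_eq0 ?mulf_neq0 ?neq0CG.
  rewrite (big_setID Bg) /= [X in _ + X]big1 ?addr0 => [|g]; last first.
    by rewrite in_setD => /andP[gB _]; rewrite (cfun0 mu gB) rmorph0 mulr0.
  rewrite (eq_bigr (fun=> 1)) => [|g].
    by rewrite sumr_const pnatr_eq0 -lt0n; apply/card_gt0P; exists 1%g; rewrite group1.
  rewrite in_setI => /andP[gD gB]; rewrite ED //.
  have [Ua Ud] := UD g gD; move: (gB); rewrite (in_Bg chainR) => /eqP c0.
  have -> : mu g = mu (dg (e00 g) (e11 g)).
    have Eg : g = dg (e00 g) (e11 g) ** u (e01 g / e00 g).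
      apply: gl_eq; rewrite GL_MxE val_dg // val_u [LHS]mx2_eta mx2M c0.
      by rewrite [e00 g * (_ / _)]mulrC divrK //; congr mx2; ring.
    by rewrite {1}Eg lin_charM ?dgB ?uB // muu mulr1.
  by rewrite -normCK normC_lin_char ?dgB // expr1n.
rewrite -Et (card_Ind_I smu) cfInd1 ?sDI // (lin_char1 LD) mulr1 ler_nat.
rewrite -divgS ?sDI // !(card_box chainR) ?leq_pred ?l0 // subn0 subn1.
rewrite (_ : l - l.-1 = 1)%N; last by clear -l0; lia.
have -> : (q ^ l = q * q ^ l.-1)%N by rewrite -expnS prednK.
rewrite expn1 (_ : _ * _ * _ = q ^ l.-1 * (#|units R| ^ 2 * q * q ^ l.-1))%N; last by ring.
have U0 : (0 < #|units R|)%N by rewrite lt0n; have := nzU chainR; rewrite pnatr_eq0.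
by rewrite mulnK // !muln_gt0 !expn_gt0 U0 (q_gt0 chainR).
Qed.

Definition vset (j : nat) : {set {'GL_2[R]}} := [set v y | y in ideal j].
Lemma vset_group_set j : group_set (vset j).
Proof.
apply/group_setP; split=> [|g h]; first by rewrite -(v0 R) imset_f // inE Dx0.
move=> /imsetP[x xI ->] /imsetP[y yI ->]; rewrite vM imset_f // inE.
by rewrite !inE in xI yI; apply: DD.
Qed.
Canonical vset_group j := Group (vset_group_set j).

Definition hset : {set {'GL_2[R]}} := [set hh s | s in ideal l.-1].
Lemma hset_group_set : group_set hset.
Proof.
apply/group_setP; split=> [|g h]; first by rewrite -(hh0 chainR) imset_f // inE Dx0.
move=> /imsetP[x + ->] /imsetP[y + ->]; rewrite !inE => Dx Dy.
by rewrite (hhM chainR) // imset_f // inE DD.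
Qed.
Canonical hset_group := Group hset_group_set.

Lemma hh_sum_ge0 k (phi : 'CF(Ig)) : phi \is a character ->
  0 <= \sum_(s in ideal l.-1) phi (hh s) * psi (- (k * s)).
Proof.
move=> Nphi; have sH : hset_group \subset Ig.
  by apply/subsetP => g /imsetP[s]; rewrite inE => Ds ->; exact: (hhI chainR Ds).
have mP : mulon hset_group (fun g => psi (k * (e00 g - 1))).
  split=> [|g h]; first by rewrite entries1 subrr mulr0 (psi0 psi_add).
  move=> /imsetP[x + ->] /imsetP[y + ->]; rewrite !inE => Dx Dy.
  rewrite (hhM chainR) // !(hhE chainR) ?DD // -(psiD psi_add); congr psi; ring.
have := natr_ge0 (mulon_mult_nat sH Nphi mP); rewrite pmulr_rge0 ?invr_gt0 ?ltr0n ?cardG_gt0 //.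
rewrite big_imset /=; last first.
  move=> x y; rewrite !inE => Dx Dy /(congr1 (fun g : {'GL_2[R]} => e00 g)).
  by rewrite !(hhE chainR) // => /addrI.
rewrite (eq_bigr (fun s => phi (hh s) * psi (- (k * s)))) // => s; rewrite inE => Ds.
by rewrite (hhE chainR) // addrAC subrr add0r (psi_conj psi_add).
Qed.

(** The remaining constituents contribute nonnegative terms, so one constituent of frequency [k]
    makes the sum positive. *)
Lemma V_fi k (j : Iirr GG) (w : Iirr Ig) : '[Vp j, 'chi_w] != 0 ->
  (forall s, D l.-1 s -> 'chi_w (hh s) = psi (k * s) * 'chi_w 1%g) -> fi l.-1 k 'chi_j != 0.
Proof.
move=> nz Hw; have [r Nr Er] := constt_charP w (Vp_char pi l j) nz.
have -> : fi l.-1 k 'chi_j = q%:R * (q%:R * 'chi_w 1%g + \sum_(s in ideal l.-1) r (hh s) * psi (- (k * s))).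
  rewrite (fi_Vp psi chainR); congr (_ * _).
  rewrite mulr_natl [X in _ *+ X](qE chainR) -sumr_const -big_split; apply: eq_bigr => s; rewrite inE => Ds /=.
  rewrite Er cfunE mulrDl Hw // mulrAC -(psiD psi_add) subrr (psi0 psi_add) mul1r //.
rewrite mulf_neq0 ?(nzq1 chainR) // gt_eqF // ltr_pwDl ?hh_sum_ge0 //.
by rewrite mulr_gt0 ?irr1_gt0 // ltr0n (q_gt0 chainR).
Qed.

Lemma norm_add_eq (x y a b : algC) : `|x| <= a -> `|y| <= b -> x + y = a + b -> x = a.
Proof.
move=> hx hy E; pose F (e : bool) := if e then x else y; pose F' (e : bool) := if e then a else b.
have H : forall e : bool, true -> F e = F' e.
  apply: (@normC_sum_upper _ bool (fun=> true)); first by case.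
  by rewrite !big_bool.
exact: (H true isT).
Qed.

Lemma constt_eigen (G : {group {'GL_2[R]}}) (phi : 'CF(G)) (w : Iirr G) (z : {'GL_2[R]}) (c : algC) :
  phi \is a character -> '[phi, 'chi_w] != 0 -> `|c| = 1 -> phi z = c * phi 1%g ->
  'chi_w z = c * 'chi_w 1%g.
Proof.
move=> Nphi nz c1 E; have [r Nr Er] := constt_charP w Nphi nz.
have cc : c^* * c = 1 by rewrite mulrC -normCK c1 expr1n.
have nn (xi : 'CF(G)) : xi \is a character -> `|c^* * xi z| <= xi 1%g.
  by move=> Nxi; rewrite normrM norm_conjC c1 mul1r char1_ge_norm.
have : c^* * 'chi_w z = 'chi_w 1%g.
  apply: (@norm_add_eq _ (c^* * r z) _ (r 1%g)); rewrite ?nn ?irr_char //.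
  by have := congr1 (fun x0 : algC => c^* * x0) E; rewrite /= mulrA cc mul1r Er !cfunE mulrDr.
by move=> <-; rewrite mulrA -normCK c1 expr1n mul1r.
Qed.

Section SNS.
Variable i : Iirr GG.
Hypothesis ri : regc 'chi_i.
Hypothesis deg_i : 'chi_i 1%g = ((q ^ 2 - 1) * q ^ l.-2)%:R.

Lemma sns_fi k : k \is a GRing.unit -> fi l.-1 k 'chi_i = 0.
Proof.
move=> Uk; apply/eqP; apply: contraT => nz.
have [mu smu E] := fi_ss chainR psi_add psi_nt Uk nz.
have := IndB_deg chainR smu; rewrite -E deg_i => /eqP; rewrite eqr_nat.
have -> : (q ^ l.-1 = q * q ^ l.-2)%N by rewrite -expnS; congr (_ ^ _)%N; have := l_gt1 chainR; clear; lia.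
have := q_gt1 chainR; have := gt0q chainR l.-2; move: (q ^ l.-2)%N => X; clear; nia.
Qed.

Lemma sns_kh s : D l.-1 s -> hh s \in cfker (Vp i).
Proof. exact: (fi0_hh chainR psi_add psi_nt sns_fi). Qed.

Lemma sns_V : q%:R * Vp i 1%g = #|units R|%:R /\ mlow (fun y => Vp i (v y)) 1 = 1.
Proof.
have [m m1 [Em Eq]] := Vp_mlow chainR psi_add psi_nt ri sns_kh.
have := reg_deg chainR psi_add psi_nt ri; rewrite deg_i => E0.
have E : ((q ^ 2 - 1) * q ^ l.-2)%:R - ((q - 1) * q ^ l.-1)%:R = Vp i 1%g by rewrite E0 addrK.
have Eq2 : (q ^ 2 - 1 = (q - 1) * (q + 1))%N by have := q_gt0 chainR; clear; nia.
have EU : q%:R * Vp i 1%g = #|units R|%:R.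
  rewrite -E (card_unitsE chainR) mulrBr -!natrM -natrB.
    congr (_%:R).
    have -> : (q ^ l.-1 = q * q ^ l.-2)%N by rewrite -expnS; congr (_ ^ _)%N; have := l_gt1 chainR; clear; lia.
    rewrite Eq2 (_ : q * ((q - 1) * (q + 1) * q ^ l.-2) =
      q * ((q - 1) * (q * q ^ l.-2)) + (q - 1) * (q * q ^ l.-2))%N ?addKn //; ring.
  have -> : (q ^ l.-1 = q * q ^ l.-2)%N by rewrite -expnS; congr (_ ^ _)%N; have := l_gt1 chainR; clear; lia.
  rewrite Eq2 -!mulnA leq_mul2l leq_mul2l mulnDl leq_addr !orbT //.
split=> //; rewrite Em; move: Eq; rewrite EU -[LHS]mulr1 => /(mulfI (nzU chainR)) /eqP.
by rewrite (eqr_nat _ 1 m) => /eqP<-.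
Qed.

Definition Nm (tau : R -> algC) (phi : {'GL_2[R]} -> algC) := (q * q ^ l.-1)%:R^-1 *
  (\sum_(s in ideal l.-1) \sum_(y in ideal 1) phi (ds s ** v y) * ((tau s)^* * psi (- y))).

Lemma NmD tau (phi xi : {'GL_2[R]} -> algC) :
  Nm tau (fun g => phi g + xi g) = Nm tau phi + Nm tau xi.
Proof.
rewrite /Nm -mulrDr -big_split; congr (_ * _); apply: eq_bigr => s _ /=.
by rewrite -big_split; apply: eq_bigr => y _; rewrite /= mulrDl.
Qed.

Lemma eq_Nm tau (phi xi : {'GL_2[R]} -> algC) : {in M1, phi =1 xi} -> Nm tau phi = Nm tau xi.
Proof.
move=> E; congr (_ * _); apply: eq_bigr => s; rewrite inE => Ds; apply: eq_bigr => y; rewrite inE => Dy.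
congr (_ * _); apply: E; rewrite inE (val_dsv chainR) // !mx2E !eqxx.
by rewrite addrAC subrr add0r Ds Dy.
Qed.

(** V has no vector fixed by the lower unipotents of the socle, so any constituent on [Dg] has
    degree at least [#|units R| / q], already the degree of V. *)
Lemma sns_D_irr : 'Res[Dg] (Vp i) \in irr Dg.
Proof.
have [EU Em] := sns_V.
set A := 'Res[Dg] (Vp i); have NA : A \is a character by rewrite cfRes_char // Vp_char.
have vD y : D 1 y -> v y \in Dg.
  by move=> Dy; have := subsetP (box_sub pi (leq_pred l) (leqnn 1)) _ (v_box l Dy).
have nzA : A != 0.
  apply/eqP => A0; have := congr1 (fun f : 'CF(Dg) => f 1%g) A0.
  rewrite /= cfRes1 cfunE => V0; move/eqP: EU; rewrite V0 mulr0 eq_sym.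
  by rewrite (negPf (nzU chainR)).
have [w wA] : exists w : Iirr Dg, w \in irr_constt A.
  by apply/existsP; apply: contraNT nzA; rewrite negb_exists => /forallP H;
     rewrite [A]cfun_sum_constt big_pred0 // => w; apply/negbTE/H.
have [rest Nrest EA] := constt_charP w NA wA.
have sL j : (0 < j)%N -> vset_group j \subset Dg.
  by move=> j0; apply/subsetP => g /imsetP[y]; rewrite inE => Dy ->; apply/vD; apply: DW Dy.
have sum_ge0 (phi : 'CF(Dg)) : phi \is a character -> 0 <= \sum_(y in ideal l.-1) phi (v y).
  move=> Nphi; have mP : mulon (vset_group l.-1) (fun=> 1) by split=> // *; rewrite mulr1.
  have sL1 : vset_group l.-1 \subset Dg by apply: sL; have := l_gt1 chainR; clear; lia.
  have := natr_ge0 (mulon_mult_nat sL1 Nphi mP); rewrite pmulr_rge0 ?invr_gt0 ?ltr0n ?cardG_gt0 //.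
  rewrite big_imset /=; last by move=> x y _ _; apply: v_inj.
  by rewrite (eq_bigr (fun y => phi (v y))) // => y _; rewrite rmorph1 mulr1.
have SA : \sum_(y in ideal l.-1) A (v y) = 0.
  rewrite -[RHS](Vp_fixv chainR ri sns_kh); apply: eq_bigr => y; rewrite inE => Dy.
  by rewrite cfResE ?sDI // vD // (Dtop_1 chainR).
have S1 : \sum_(y in ideal l.-1) 'chi_w (v y) = 0.
  have E : \sum_(x in ideal l.-1) 'chi_w (v x) + \sum_(x in ideal l.-1) rest (v x) = 0.
    by rewrite -big_split -[RHS]SA; apply: eq_bigr => x _; rewrite EA cfunE.
  by move/eqP: E; rewrite paddr_eq0 ?sum_ge0 ?irr_char // => /andP[/eqP->].
pose f y := if D 1 y then 'chi_w (v y) else 0.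
have fU a x : a \is a GRing.unit -> f (a * x) = f x.
  move=> Ua; rewrite /f DUl //; case: ifP => // Dx.
  have E : v x ** dg a 1 = dg a 1 ** v (a * x).
    by rewrite dg_v ?unitr1 // mul1r mulrAC mulrV // mul1r.
  have -> : v (a * x) = conjg (v x) (dg a 1) by rewrite conjgE E mulKg.
  rewrite cfunJ //; have := subsetP (box_sub pi (leq_pred l) l0) _ (dg_box pi l Ua (unitr1 R)); by [].
have := mlow_sum chainR psi_add psi_nt fU; rewrite {1}/f Dx0 v0.
rewrite (eq_bigr (fun y => 'chi_w (v y))) => [|y]; last by rewrite inE /f => /(Dtop_1 chainR)->.
rewrite S1 add0r => Ew.
have /natrP[n En] : mlow f 1 \in Num.nat.
  have mP : mulon (vset_group 1) (fun g => psi (e10 g)).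
    split=> [|_ _ /imsetP[x _ ->] /imsetP[y _ ->]]; first by rewrite entries1 (psi0 psi_add).
    by rewrite vM !vE (psiD psi_add).
  have := mulon_mult_nat (sL 1%N (leqnn 1)) (irr_char w) mP.
  rewrite card_imset; last exact: v_inj.
  rewrite big_imset /=; last by move=> x y _ _; apply: v_inj.
  rewrite (card_ideal chainR l0) subn1; set S := \sum_(_ in _) _; suff -> : S = \sum_(x in ideal 1) f x * psi (- (1 * x)) by [].
  by apply: eq_bigr => y; rewrite inE vE /f mul1r (psi_conj psi_add) => ->.
suff -> : A = 'chi_w by apply: mem_irr.
apply: char_eq_irr => //.
rewrite cfRes1 -(ler_pM2l (_ : 0 < q%:R)) ?ltr0n ?(q_gt0 chainR) // EU Ew En ler_peMr ?ler0n //.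
rewrite (ler_nat _ 1 n) lt0n; apply/eqP => n0; have := irr1_neq0 w.
by have := Ew; rewrite En n0 mulr0 => /eqP; rewrite mulf_eq0 (negPf (nzq1 chainR)) /= => ->.
Qed.

(** Two copies of the irreducible [muD * V] inside the V of ['chi_j] would contain the character
    [tau' s * psi y] of [M1] twice, but it occurs at most once in ['chi_j] by [mirabolic_mult]. *)
Lemma sns_V_le1 k (mu : 'CF(Bg)) (j : Iirr GG) : k \is a GRing.unit -> ssB k mu ->
  '['Ind[Ig] mu * Vp i, Vp j] <= 1.
Proof.
move=> Uk smu; have [Lmu muu muh] := smu.
have [muD [LD ED] <-] := muD_exists Uk smu.
have [EU Em] := sns_V; have [tau atau Htau] := Vp_tau chainR sns_kh.
rewrite -cfIndM ?sDI // -Frobenius_reciprocity.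
have /irrP[w Ew] := mul_lin_irr LD sns_D_irr; rewrite Ew cfdotC.
have NV : 'Res[Dg] (Vp j) \is a character by rewrite cfRes_char // Vp_char.
have /natrP[n En] : '['Res[Dg] (Vp j), 'chi_w] \in Num.nat by rewrite Cnat_cfdot_char ?irr_char.
rewrite En rmorph_nat (ler_nat _ n 1) leqNgt; apply/negP => n2.
have nz1 : '['Res[Dg] (Vp j), 'chi_w] != 0 by rewrite En pnatr_eq0; case: (n) n2.
have [r1 N1 E1] := constt_charP w NV nz1.
have nz2 : '[r1, 'chi_w] != 0.
  have := En; rewrite E1 cfdotDl cfnorm_irr => E2.
  have -> : '[r1, 'chi_w] = n%:R - 1 by rewrite -E2 addrC addKr.
  by rewrite subr_eq0 (eqr_nat _ n 1); apply: contraTneq n2 => ->.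
have [r2 N2 E2] := constt_charP w N1 nz2.
pose tau' s := tau s * mu (ds s).
have Uds s : D l.-1 s -> ds s \in Bg by move=> Ds; rewrite dgB ?unitr1 ?(Dtop_unit chainR).
have atau' : addm tau'.
  case: (atau) => t0 tD; split=> [|s t Ds Dt].
    by rewrite /tau' t0 mul1r /ds addr0 (_ : dg 1 1 = 1%g) ?lin_char1 //; apply: gl_eq;
       rewrite val_dg ?unitr1 // -mx2_scalar.
  rewrite /tau' tD // mulrACA; congr (_ * _); rewrite -lin_charM ?Uds //; congr (mu _).
  rewrite /ds dgM ?unitr1 ?(Dtop_unit chainR) // mulr1; congr dg.
  by rewrite mulrDl mul1r mulrDr mulr1 (Dtoptop chainR Ds Dt) addr0 addrA addrAC.
have Nw : Nm tau' 'chi_w = 1.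
  rewrite -Em -(Vp_M1 psi chainR atau Htau) -Ew; congr (_ * _).
  apply: eq_bigr => s; rewrite inE => Ds; apply: eq_bigr => y; rewrite inE => Dy.
  have gM : ds s ** v y \in M1.
    rewrite inE (val_dsv chainR) // !mx2E !eqxx.
    by rewrite addrAC subrr add0r Ds Dy.
  have gD := subsetP (M1_sub pi (leq_pred l)) _ gM.
  rewrite [(muD * _) _]cfunE (ED _ gD) cfResE ?sDI // (val_dsv chainR) // !mx2E -/(ds s) /tau' rmorphM /=.
  have E : mu (ds s) * (mu (ds s))^* = 1 by rewrite -normCK normC_lin_char ?Uds // expr1n.
  transitivity ((mu (ds s) * (mu (ds s))^*) * (Vp i (ds s ** v y) * ((tau s)^* * psi (- y)))); first by ring.
  by rewrite E mul1r.
have NVj : Nm tau' (Vp j) = 2%:R + Nm tau' r2.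
  rewrite (@eq_Nm _ _ (fun g => 'chi_w g + ('chi_w g + r2 g))) ?NmD ?Nw; last first.
    move=> g gM; have gD := subsetP (M1_sub pi (leq_pred l)) _ gM.
    by rewrite -(cfResE _ sDI gD) E1 E2 !cfunE.
  by rewrite addrA.
have Nr : 0 <= Nm tau' r2.
  by apply: natr_ge0; apply: (M1_nat chainR psi_add (M1_sub pi (leq_pred l)) N2 atau').
have NW : 0 <= Nm tau' (Wp j).
  by apply: natr_ge0; apply: (M1_nat chainR psi_add (M1_sub pi (leq0n l)) (Wp_char pi l j) atau').
have : Nm tau' (Vp j) + Nm tau' (Wp j) <= 1.
  rewrite -NmD (@eq_Nm _ _ 'chi_j) => [|g gM]; last first.
    by rewrite VWE // (subsetP (M1_sub pi (leq0n l))).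
  have tc0 : (fun s => (tau' s)^*) 0 = 1 by case: atau' => /= ->; rewrite rmorph1.
  have := @mirabolic_mult _ _ _ _ _ chainR psi_add psi_nt 'chi_j (fun s => (tau' s)^*) tc0.
  by rewrite -[LHS]/(Nm tau' 'chi_j) => ->; rewrite (regcP chainR psi_add psi_nt); case: regc; rewrite ?lexx ?ler01.
rewrite NVj => le1; have : 2%:R <= 1 :> algC.
  by apply: le_trans le1; rewrite -addrA lerDl addr_ge0.
by rewrite (ler_nat _ 2 1).
Qed.

(** For type sns the elements [hh s] act trivially on V, so the product has the single frequency
    [k], which a common constituent passes on to ['chi_j]. *)
Lemma sns_V_ss k (mu : 'CF(Bg)) (j : Iirr GG) : k \is a GRing.unit -> ssB k mu ->
  '['Ind[Ig] mu * Vp i, Vp j] != 0 -> fi l.-1 k 'chi_j != 0.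
Proof.
move=> Uk smu nz; have [Lmu _ _] := smu.
have NY : 'Ind[Ig] mu * Vp i \is a character by apply: rpredM; [rewrite cfInd_char ?lin_charW | apply: Vp_char].
have /existsP[w /andP[w1 w2]] :
    [exists w : Iirr Ig, ('['Ind[Ig] mu * Vp i, 'chi_w] != 0) && ('[Vp j, 'chi_w] != 0)].
  apply: contraR nz; rewrite negb_exists => /forallP H; rewrite cfdot_sum_irr big1 // => w _.
  by have := H w; rewrite negb_and !negbK => /orP[]/eqP->; rewrite ?mul0r ?rmorph0 ?mulr0.
apply: (V_fi w2) => s Ds; apply: (constt_eigen NY w1); first exact: psi_norm.
rewrite ![('Ind[Ig] mu * Vp i) _]cfunE -[hh s]mul1g (Y_hh smu (group1 _) Ds) (cfkerMr _ (sns_kh Ds)).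
by rewrite mulrA.
Qed.

End SNS.

Lemma ss_sns_mult (i1 i2 j : Iirr GG) : regc 'chi_i1 -> regc 'chi_i2 ->
  'chi_i1 1%g = ((q + 1) * q ^ l.-1)%:R -> 'chi_i2 1%g = ((q ^ 2 - 1) * q ^ l.-2)%:R ->
  '['chi_i1 * 'chi_i2, 'chi_j] <= 2%:R /\
  ('['chi_i1 * 'chi_i2, 'chi_j] = 2%:R -> regc 'chi_j /\ 'chi_j 1%g = ((q + 1) * q ^ l.-1)%:R).
Proof.
move=> r1 r2 d1 d2; have [k [mu [Uk smu ->]]] := ss_struct chainR psi_add psi_nt r1 d1.
rewrite (triple_split _ _ smu).
have W1 := W_le1 i2 j smu; have V1 := sns_V_le1 r2 d2 j Uk smu.
split; first exact: lerD V1 W1.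
move=> E; have nz : '['Ind[Ig] mu * Vp i2, Vp j] != 0.
  apply/eqP => V0; move: E W1; rewrite V0 add0r => ->.
  by rewrite (ler_nat _ 2 1).
have fj := sns_V_ss d2 Uk smu nz.
have [mu' smu' Ej] := fi_ss chainR psi_add psi_nt Uk fj.
have [t Et rt] := IndB_irr chainR psi_add psi_nt Uk smu'.
by rewrite Ej (IndB_deg chainR smu') Et rt.
Qed.

End Principal.

(** * Two induced factors, and nonregular constituents of cuspidal products *)

Section SplitSplit.
Variables (R : finComUnitRingType) (pi : R) (l q : nat) (psi : R -> algC).
Hypothesis chainR : chain_ring pi l q.
Hypothesis psi_add : additive_char psi.
Hypothesis psi_nt : exists2 x, x \in [set: R] & psi (pi ^+ l.-1 * x) != 1.

Notation D i x := (dvdR (pi ^+ i) x).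
Notation ideal i := (ideal pi i).
Notation GG := (GG R).
Notation regc := (regc pi l).
Notation fi := (fi pi l psi).
Notation ssB := (@ssB R pi l psi).
Implicit Types (g h : {'GL_2[R]}) (a b c d x y z s t : R).
Notation Bg := (box_group pi 0 l).
Notation Ig := (box_group pi 0 1).
Notation Dg := (box_group pi l.-1 1).
Notation Pg := (Pset_group pi l).
Notation Vp := (Vp pi l).
Notation Wp := (Wp pi l).
Notation Sg := (Sset_group chainR).

Let l0 := l_gt0 chainR.

Lemma wwE : ((e00 (ww R) = 0) * (e01 (ww R) = 1)) * ((e10 (ww R) = 1) * (e11 (ww R) = 0)).
Proof. by rewrite /ww gl_val ?det_ww // !mx2E. Qed.

(** Up to a positive factor, the multiplicity of a linear character of [Sset] with diagonal
    frequency [k] and lower frequency [b]. Conjugation by [u z] clears [b] when [k] is a unit, and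
    [ww] changes the sign of [k]. *)
Definition Tsum (chi : 'CF(GG)) k b := \sum_(g in Sg) chi g * psi (- (k * (e00 g - 1) + b * e10 g)).

Lemma Tsum_conj (chi : 'CF(GG)) k b h : Tsum chi k b =
  \sum_(g in Sg) chi g * psi (- (k * (e00 (g ^ h)%g - 1) + b * e10 (g ^ h)%g)).
Proof.
rewrite /Tsum (reindex_inj (conjg_inj h)) /=; apply: eq_big => g.
  have /andP[_ /subsetP nS] := Sg_norm chainR.
  by rewrite memJ_norm // nS // in_setT.
by move=> _; rewrite cfunJ ?inGG.
Qed.

Lemma Tsum_u (chi : 'CF(GG)) k b z : Tsum chi k b = Tsum chi k (b - k * z).
Proof.
rewrite (Tsum_conj _ _ _ (u z)); apply: eq_bigr => g _; congr (_ * psi (- _)).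
rewrite conjgE uV !entriesM !uE; ring.
Qed.

Lemma Tsum_b (chi : 'CF(GG)) k b : k \is a GRing.unit -> Tsum chi k b = Tsum chi k 0.
Proof. by move=> Uk; rewrite (Tsum_u _ _ _ (b / k)) mulrC divrK // subrr. Qed.

Lemma Tsum_ww (chi : 'CF(GG)) k : Tsum chi k 0 = Tsum chi (- k) 0.
Proof.
rewrite (Tsum_conj _ _ _ (ww R)); apply: eq_bigr => g gS; congr (_ * psi _).
have -> : e00 (g ^ ww R)%g = e11 g.
  have : e10 (g ** ww R) = e10 (ww R ** (g ^ ww R)%g) by rewrite -conjgC.
  move: (g ^ ww R)%g => z; rewrite !entriesM !wwE.
  by rewrite mulr0 mulr1 mul1r mul0r add0r addr0 => ->.
move: gS; rewrite inE mx2_tr => /andP[_ /eqP E].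
have -> : e11 g = 2%:R - e00 g by rewrite -E addrC addKr.
ring.
Qed.

Lemma Tsum_fi (chi : 'CF(GG)) k : \sum_b Tsum chi k b = (q ^ l)%:R * fi l.-1 k chi.
Proof.
pose F g : algC := \sum_b chi g * psi (- (k * (e00 g - 1) + b * e10 g)).
transitivity (\sum_(g in Sg) F g); first by rewrite /Tsum exchange_big.
have FE y s x : D l.-1 y -> D l.-1 s -> D l.-1 x ->
    F (su (y, (s, x))) = chi (su (y, (s, x))) * psi (- (k * s)) * (\sum_b psi (- y * b)).
  move=> Dy Ds Dx; rewrite /F mulr_sumr; apply: eq_bigr => b _.
  rewrite (val_su chainR Dx Dy Ds) !mx2E -mulrA -(psiD psi_add); congr (_ * psi _); ring.
rewrite (sum_Sg chainR F) (big_setD1 0) ?inE ?Dx0 //= [X in _ + X]big1 => [|y].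
  rewrite addr0 /fi mulr_sumr; apply: eq_bigr => s; rewrite inE => Ds.
  rewrite mulr_sumr; apply: eq_bigr => x; rewrite inE => Dx.
  rewrite FE ?Dx0 // (sum_psi chainR psi_add psi_nt) oppr0 eqxx mulrC.
  by rewrite -[su _]/(v 0 ** (hh s ** u x)) v0 mul1g.
rewrite !inE => /andP[y0 Dy]; apply: big1 => s; rewrite inE => Ds; apply: big1 => x; rewrite inE => Dx.
by rewrite FE // (sum_psi chainR psi_add psi_nt) oppr_eq0 (negPf y0) mulr0.
Qed.

Lemma fi_neg (chi : 'CF(GG)) k : k \is a GRing.unit -> fi l.-1 (- k) chi = fi l.-1 k chi.
Proof.
move=> Uk; apply: (mulfI (nzq chainR l)); rewrite -!Tsum_fi.
by apply: eq_bigr => b _; rewrite !Tsum_b ?unitrN // -Tsum_ww.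
Qed.

Lemma Vp_Y (i : Iirr GG) (mu : 'CF(Bg)) k : ssB k mu -> 'chi_i = 'Ind[GG] mu ->
  '[Vp i, 'Ind[Ig] mu] = 1.
Proof.
move=> smu E; have [Lmu _ _] := smu; set Y := 'Ind[Ig] mu.
have NY : Y \is a character by rewrite cfInd_char ?lin_charW.
have kY : Pg \subset cfker Y by exact: (Y_ker chainR smu).
have := cfdot_cfFixC ('Res[Ig] 'chi_i) NY kY; rewrite -/(Vp i) cfdotBr => /eqP; rewrite subr_eq0 => /eqP E1.
rewrite cfdotC -E1 -cfdotC cfdot_Res_l /Y cfIndInd ?subsetT ?(sBI chainR) // -E cfnorm_irr //.
Qed.

Lemma Y_ne k k' (mu mu' : 'CF(Bg)) : k \is a GRing.unit -> k' \is a GRing.unit ->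
  ssB k mu -> ssB k' mu' -> ~~ D 1 (k - k') -> '['Ind[Ig] mu, 'Ind[Ig] mu'] = 0.
Proof.
move=> Uk Uk' smu smu' nD.
have [s Ds ne] : exists2 s, D l.-1 s & psi ((k - k') * s) != 1.
  case: (boolP [exists s, D l.-1 s && (psi ((k - k') * s) != 1)]) => [/existsP[s /andP[]]|]; first by exists s.
  rewrite negb_exists => /forallP H; case/negP: nD.
  rewrite (_ : 1 = l - l.-1)%N; last by clear -l0; lia.
  apply: (psi_nondeg chainR psi_nt); first exact: leq_pred.
  by move=> s Ds; have := H s; rewrite Ds /= negbK => /eqP.
apply: (@cfdot_eigen _ _ _ _ (hh s) (psi (k * s)) (psi (k' * s))); rewrite ?(hhI chainR) //.
- by rewrite (psi_conj psi_add) -(psiD psi_add) -mulNr -mulrDl.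
- by move=> g gI; exact: (Y_hh chainR smu gI Ds).
- by move=> g gI; exact: (Y_hh chainR smu' gI Ds).
Qed.

(** The frequencies [k] and [- k] both occur, by [fi_neg], in orthogonal characters since [2 k] is a
    unit, and together they exhaust the degree of V. *)
Lemma Vp_ss (i : Iirr GG) k (mu : 'CF(Bg)) : regc 'chi_i -> k \is a GRing.unit -> ssB k mu ->
  'chi_i = 'Ind[GG] mu ->
  exists2 mu' : 'CF(Bg), ssB (- k) mu' & Vp i = 'Ind[Ig] mu + 'Ind[Ig] mu'.
Proof.
move=> ri Uk smu E; have /irrP[w Ew] := Y_irr chainR psi_add psi_nt Uk smu.
have nz : fi l.-1 k 'chi_i != 0.
  apply: (@V_fi _ _ _ _ _ chainR psi_add _ _ w); first by rewrite -Ew (Vp_Y smu E) oner_neq0.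
  by move=> s Ds; rewrite -Ew -[hh s]mul1g (Y_hh chainR smu (group1 _) Ds).
rewrite -fi_neg // in nz; have UNk : - k \is a GRing.unit by rewrite unitrN.
have [mu' smu' E'] := fi_ss chainR psi_add psi_nt UNk nz; exists mu' => //.
have /irrP[w' Ew'] := Y_irr chainR psi_add psi_nt UNk smu'.
have nD : ~~ D 1 (k - - k).
  by rewrite opprK -mulr2n (D2 chainR) -(unitN1 chainR).
have V1 := Vp_Y smu E; have V2 := Vp_Y smu' E'; have O := Y_ne Uk UNk smu smu' nD.
rewrite Ew Ew' in V1 V2 O *.
have nz1 : '[Vp i, 'chi_w] != 0 by rewrite V1 oner_neq0.
have [r1 N1 E1] := constt_charP w (Vp_char pi l i) nz1.
have nz2 : '[r1, 'chi_w'] != 0.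
  by move: V2; rewrite E1 cfdotDl O add0r => ->; rewrite oner_neq0.
have [r2 N2 E2] := constt_charP w' N1 nz2.
have := reg_deg chainR psi_add psi_nt ri; rewrite E (IndB_deg chainR smu) E1 E2 !cfunE -Ew -Ew'.
rewrite !(card_Ind_I chainR smu) (card_Ind_I chainR smu') => Edeg.
have /eqP r20 : r2 == 0.
  rewrite -char1_eq0 //; move/eqP: Edeg.
  have -> : ((q + 1) * q ^ l.-1)%:R = (q ^ l.-1)%:R + (q ^ l.-1)%:R + ((q - 1) * q ^ l.-1)%:R :> algC.
    rewrite -!natrD; congr (_%:R); have := q_gt0 chainR; clear; move: (q ^ _)%N => X; nia.
  by rewrite addrA (inj_eq (addIr _)) -{1}[_ + _]addr0 (inj_eq (addrI _)) eq_sym.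
by rewrite r20 addr0 Ew Ew'.
Qed.

(** Each valuation of [c] from [j] to [l] contributes the same [#|units R| ^ 2]: the scarcity of [c]
    balances the abundance of [d] congruent to [a]. This is where the linear growth in [l] comes
    from. *)
Lemma sum_annihilated (j : nat) : (0 < j <= l)%N ->
  \sum_(c in ideal j) \sum_(a in units R) \sum_(d in units R) (c * (d - a) == 0)%:R =
  ((l - j).+1 * #|units R| ^ 2)%:R :> algC.
Proof.
move=> /andP[j0 jl]; have [n En] : exists n, n = (l - j)%N by exists (l - j)%N.
rewrite -En; elim: n j j0 jl En => [|n IHn] j j0 jl En.
  have -> : j = l by clear -jl En; lia.
  rewrite (big_setD1 0) ?inE ?Dx0 //= [X in _ + X]big1 => [|c]; last first.
    by rewrite !inE (Dl chainR) => /andP[/negPf->].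
  rewrite addr0 (eq_bigr (fun=> #|units R|%:R)) => [|a _]; last first.
    by rewrite (eq_bigr (fun=> 1)) ?sumr_const // => d _; rewrite mul0r eqxx.
  by rewrite sumr_const mul1n -mulnn natrM mulr_natr.
have jl' : (j < l)%N by clear -En; lia.
have sub : ideal j.+1 \subset ideal j by apply/subsetP => x; rewrite !inE; apply: DW.
rewrite (big_setID (ideal j.+1)) /= (setIidPr sub) (IHn j.+1) //; last by clear -En; lia.
rewrite (eq_bigr (fun=> (#|units R| * q ^ j)%:R)) => [|c]; last first.
  rewrite !inE => /andP[nDc Dc]; have [w Ec] := DP _ _ _ Dc.
  have Uw : w \is a GRing.unit.
    rewrite (unitN1 chainR); apply: contra nDc => Dw; rewrite Ec -addn1.
    by apply: DM => //; apply: Dpi.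
  rewrite (eq_bigr (fun=> (q ^ j)%:R)) => [|a]; first by rewrite sumr_const natrM mulr_natl.
  rewrite inE => Ua; have -> : (q ^ j)%:R = \sum_(z in ideal (l - j)) 1 :> algC.
    by rewrite sumr_const (card_ideal chainR) ?leq_subr // subKn.
  rewrite (reindex_inj (addrI a)) /= big_mkcond [RHS]big_mkcond; apply: eq_bigr => z _.
  rewrite !inE addrAC subrr add0r Ec -mulrA (Dann chainR) // DUl //.
  case Dz: (D _ z); last by case: ifP.
  rewrite (unit_addD chainR) //; apply: DW Dz; clear -jl'; lia.
rewrite sumr_const cardsD (setIidPr sub) !(card_ideal chainR) // -[X in _ + X]mulr_natr -natrM -natrD.
congr (_%:R); rewrite (card_unitsE chainR).
have -> : (l - j = (l - j.+1).+1)%N by clear -jl'; lia.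
have -> : (q ^ l.-1 = q ^ (l - j.+1) * q ^ j)%N by rewrite -expnD; congr (_ ^ _)%N; clear -jl'; lia.
rewrite (expnS q (l - j.+1)) -!mulnn; have := q_gt0 chainR; clear.
move: (q ^ (l - j.+1))%N (q ^ j)%N => X Z q0; have -> : (q * X - X = (q - 1) * X)%N by rewrite mulnBl mul1n.
move: (q - 1)%N => Q; ring.
Qed.

Lemma gl_unit_det (j : nat) a b c d : (0 < j)%N -> a \is a GRing.unit -> d \is a GRing.unit -> D j c ->
  a * d - b * c \is a GRing.unit.
Proof.
move=> j0 Ua Ud Dc; apply: (unit_addD chainR); first by rewrite unitrM Ua.
by rewrite DN; apply: DMl; apply: DW Dc.
Qed.

Lemma sum_I_lower (f : R -> algC) :
  \sum_(y in Ig) f (e10 y) = (#|units R| ^ 2 * q ^ l)%:R * \sum_(c in ideal 1) f c.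
Proof.
rewrite (box_sum chainR) // mulr_sumr; apply: eq_bigr => c; rewrite inE => Dc.
rewrite (eq_bigr (fun=> (#|units R| * q ^ l)%:R * f c)) => [|a]; last first.
  rewrite inE => Ua; rewrite (eq_bigr (fun=> (q ^ l)%:R * f c)) => [|d]; last first.
    rewrite inE => Ud; rewrite (eq_bigr (fun=> f c)) => [|b _].
      by rewrite sumr_const (card_ideal chainR) // subn0 mulr_natl.
    by rewrite gl_val ?mx2E // (@gl_unit_det 1).
  by rewrite sumr_const natrM -mulrA [RHS]mulr_natl.
by rewrite sumr_const -mulnn -mulnA [in RHS]natrM -[RHS]mulrA [RHS]mulr_natl.
Qed.

Lemma sum_box_diag (f : R -> R -> algC) : \sum_(x in box pi l.-1 l) f (e00 x) (e11 x) =
  q%:R * \sum_(a in units R) \sum_(d in units R) f a d.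
Proof.
rewrite (box_sum chainR) // (big_setD1 0) ?inE ?Dx0 //= [X in _ + X]big1 => [|c]; last first.
  by rewrite !inE (Dl chainR) => /andP[/negPf->].
rewrite addr0 mulr_sumr; apply: eq_bigr => a; rewrite inE => Ua; rewrite mulr_sumr.
apply: eq_bigr => d; rewrite inE => Ud; rewrite (eq_bigr (fun=> f a d)) => [|b _].
  by rewrite sumr_const -(qE chainR) mulr_natl.
by rewrite gl_val ?mx2E // (@gl_unit_det l) // Dx0.
Qed.

Lemma Y_norm_le (mu : 'CF(Bg)) g : mu \is a linear_char ->
  `|'Ind[Ig] mu g| <= #|Bg|%:R^-1 * \sum_(y in Ig) ((g ^ y)%g \in Bg)%:R.
Proof.
move=> Lmu; rewrite cfIndE ?(sBI chainR) // normrM ger0_norm ?invr_ge0 ?ler0n // ler_wpM2l ?invr_ge0 ?ler0n //.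
apply: le_trans (ler_norm_sum _ _ _) _; apply: ler_sum => y _.
have [gB|gB] := boolP ((g ^ y)%g \in Bg); first by rewrite normC_lin_char.
by rewrite (cfun0 _ gB) normr0.
Qed.

Lemma conj_lower g h : g \in box pi l.-1 l -> h \in Ig ->
  ((g ^ h)%g \in Bg) = (e10 h * (e11 g - e00 g) == 0).
Proof.
move=> gB hI; have [Ua Ud] := box_units chainR (ltn0Sn 0) hI.
rewrite (in_Bg chainR); have := gB; have := hI; rewrite !inE => /andP[_ D3] /andP[D1 D2].
have c0 : e10 g = 0 by apply/eqP; rewrite -(Dl chainR).
have bc := Dtop1 chainR D1 D3.
have C : g ** h = h ** (g ^ h)%g by rewrite -conjgC.
move: (g ^ h)%g C => z C; have C0 : e00 (g ** h) = e00 (h ** z) by rewrite C.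
have C1 : e10 (g ** h) = e10 (h ** z) by rewrite C.
move: C0 C1; rewrite !entriesM c0 bc mul0r add0r addr0.
move: (GLval z 0 0) (GLval z 1 0) => z00 z10 C0 C1.
have E : e00 h * (e10 h * (e11 g - e00 g)) = z10 * (e00 h * e11 h - e01 h * e10 h).
  rewrite (_ : e00 h * (e10 h * (e11 g - e00 g)) = e00 h * (e11 g * e10 h) - e10 h * (e00 g * e00 h)); last by ring.
  by rewrite C0 C1; ring.
have UD := gl_det h.
apply/eqP/eqP => [z0|t0]; first by apply: (mulrI Ua); rewrite mulr0 E z0 mul0r.
by apply: (mulIr UD); rewrite mul0r -E t0 mulr0.
Qed.

(** Inducing one factor from [Dg] and another from [Bg] gives a single double coset and a sum over
    [Dg :&: Bg]. Linear characters have modulus 1, the third factor is bounded by its number of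
    fixed cosets, and [sum_annihilated] with [j = 1] counts [l] valuations. *)
Lemma triple_Y_le k1 k2 k3 (mu1 mu2 mu3 : 'CF(Bg)) : k1 \is a GRing.unit ->
  ssB k1 mu1 -> ssB k2 mu2 -> ssB k3 mu3 ->
  '['Ind[Ig] mu1 * 'Ind[Ig] mu2, 'Ind[Ig] mu3] <= l%:R.
Proof.
move=> Uk s1 s2 s3; have [[L1 _ _] [L2 _ _] [L3 _ _]] := And3 s1 s2 s3.
set E := '[_, _]; have -> : E = `|E|.
  rewrite ger0_norm // natr_ge0 // Cnat_cfdot_char ?rpredM ?cfInd_char ?lin_charW //.
rewrite {}/E; have [muD [LD ED] <-] := muD_exists chainR psi_add psi_nt Uk s1.
rewrite (cfdot_IndM_mulG _ _ _ (DgBg chainR)) normrM.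
set C := _ / _; have C0 : 0 <= C by rewrite divr_ge0 ?mulr_ge0 ?ler0n.
rewrite (ger0_norm C0).
have -> : l%:R = C * (#|Bg|%:R^-1 * ((#|units R| ^ 2 * q ^ l)%:R * (q%:R * (l * #|units R| ^ 2)%:R))).
  rewrite /C !(card_box chainR) ?l0 ?leqnn ?leq_pred // subn0 subnn subn1 muln1.
  rewrite (_ : l - l.-1 = 1)%N; last by clear -l0; lia.
  rewrite expn1 (_ : q ^ l = q * q ^ l.-1)%N; last by rewrite -expnS prednK.
  have nq := nzq1 chainR; have nU := nzU chainR; have nX := nzq chainR l.-1.
  move: (q ^ l.-1)%N nX (#|units R|) nU => X nX N nN; rewrite -!mulnn !natrM.
  by field; rewrite ?nq ?nX ?nN ?mulf_neq0.
apply: ler_wpM2l => //; apply: le_trans (ler_norm_sum _ _ _) _.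
apply: (@le_trans _ _ (\sum_(x in box pi l.-1 l) `|'Ind[Ig] mu3 x|)).
  rewrite big_mkcond [X in _ <= X]big_mkcond; apply: ler_sum => x _.
  have -> : (x \in box pi l.-1 l) = (x \in Dg) && (x \in Bg).
    rewrite !inE D0x /=; case Dx: (D l (e10 x)); rewrite ?andbT ?andbF //.
    by rewrite (DW _ Dx) ?andbT.
  case: ifP => //= xD; rewrite !normrM norm_conjC normC_lin_char // mul1r.
  have [xB|xB] := boolP (x \in Bg); first by rewrite normC_lin_char // mul1r.
  by rewrite (cfun0 _ xB) normr0 mul0r.
apply: (@le_trans _ _ (\sum_(x in box pi l.-1 l) #|Bg|%:R^-1 * \sum_(y in Ig) (e10 y * (e11 x - e00 x) == 0)%:R)).
  apply: ler_sum => x xB; apply: le_trans (Y_norm_le _ L3) _.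
  by rewrite (eq_bigr (fun y : {'GL_2[R]} => (e10 y * (e11 x - e00 x) == 0)%:R)) // => y yI; rewrite conj_lower.
rewrite -mulr_sumr ler_wpM2l ?invr_ge0 ?ler0n //.
under eq_bigr => x _ do rewrite (sum_I_lower (fun c => (c * (e11 x - e00 x) == 0)%:R)).
rewrite -mulr_sumr ler_wpM2l ?ler0n //.
rewrite (sum_box_diag (fun a d => \sum_(c in ideal 1) (c * (d - a) == 0)%:R)) ler_wpM2l ?ler0n //.
rewrite (eq_bigr (fun a => \sum_(c in ideal 1) \sum_(d in units R) (c * (d - a) == 0)%:R)) => [|a _]; last by rewrite exchange_big.
rewrite exchange_big /= sum_annihilated ?l0 // subn1 prednK //.
Qed.

Lemma triple_Y_eq0 k1 k2 k3 (mu1 mu2 mu3 : 'CF(Bg)) :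
  ssB k1 mu1 -> ssB k2 mu2 -> ssB k3 mu3 -> ~~ D 1 (k1 + k2 - k3) ->
  '['Ind[Ig] mu1 * 'Ind[Ig] mu2, 'Ind[Ig] mu3] = 0.
Proof.
move=> s1 s2 s3 nD.
have [s Ds ne] : exists2 s, D l.-1 s & psi ((k1 + k2 - k3) * s) != 1.
  case: (boolP [exists s, D l.-1 s && (psi ((k1 + k2 - k3) * s) != 1)]) => [/existsP[s /andP[]]|]; first by exists s.
  rewrite negb_exists => /forallP H; case/negP: nD.
  rewrite (_ : 1 = l - l.-1)%N; last by clear -l0; lia.
  apply: (psi_nondeg chainR psi_nt); first exact: leq_pred.
  by move=> s Ds; have := H s; rewrite Ds /= negbK => /eqP.
apply: (@cfdot_eigen _ _ _ _ (hh s) (psi (k1 * s) * psi (k2 * s)) (psi (k3 * s))); rewrite ?(hhI chainR) //.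
- by rewrite (psi_conj psi_add) -!(psiD psi_add) -mulNr -!mulrDl.
- by move=> g gI; rewrite !cfunE (Y_hh chainR s1) // (Y_hh chainR s2) // mulrACA.
- by move=> g gI; exact: (Y_hh chainR s3 gI Ds).
Qed.

Lemma at_most_one (P1 P2 P3 P4 : bool) (x1 x2 x3 x4 B : algC) : 0 <= B ->
  x1 <= B -> x2 <= B -> x3 <= B -> x4 <= B ->
  (~~ P1 -> x1 = 0) -> (~~ P2 -> x2 = 0) -> (~~ P3 -> x3 = 0) -> (~~ P4 -> x4 = 0) ->
  [&& ~~ (P1 && P2), ~~ (P1 && P3), ~~ (P1 && P4), ~~ (P2 && P3), ~~ (P2 && P4) & ~~ (P3 && P4)] ->
  x1 + x2 + (x3 + x4) <= B.
Proof.
move=> B0 h1 h2 h3 h4 z1 z2 z3 z4.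
case: P1 z1 => z1; case: P2 z2 => z2; case: P3 z3 => z3; case: P4 z4 => z4 //= _;
  rewrite ?(z1 isT) ?(z2 isT) ?(z3 isT) ?(z4 isT) ?addr0 ?add0r //.
Qed.

Lemma ss_ss_mult (i1 i2 j : Iirr GG) : regc 'chi_i1 -> regc 'chi_i2 -> regc 'chi_j ->
  'chi_i1 1%g = ((q + 1) * q ^ l.-1)%:R -> 'chi_i2 1%g = ((q + 1) * q ^ l.-1)%:R ->
  'chi_j 1%g = ((q + 1) * q ^ l.-1)%:R ->
  '['chi_i1 * 'chi_i2, 'chi_j] <= (l + 1)%:R.
Proof.
move=> r1 r2 r3 d1 d2 d3.
have [k1 [mu1 [U1 s1 E1]]] := ss_struct chainR psi_add psi_nt r1 d1.
have [k2 [mu2 [U2 s2 E2]]] := ss_struct chainR psi_add psi_nt r2 d2.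
have [k3 [mu3 [U3 s3 E3]]] := ss_struct chainR psi_add psi_nt r3 d3.
rewrite E1 (triple_split chainR _ _ s1) natrD; apply: lerD; last exact: (W_le1 chainR psi_add psi_nt i2 j s1).
have [mu2' s2' ->] := Vp_ss r2 U2 s2 E2; have [mu3' s3' ->] := Vp_ss r3 U3 s3 E3.
rewrite mulrDr cfdotDl !cfdotDr.
apply: (@at_most_one (D 1 (k1 + k2 - k3)) (D 1 (k1 + k2 - - k3)) (D 1 (k1 - k2 - k3)) (D 1 (k1 - k2 - - k3)));
  [exact: ler0n | exact: triple_Y_le U1 s1 s2 s3 | exact: triple_Y_le U1 s1 s2 s3'
  | exact: triple_Y_le U1 s1 s2' s3 | exact: triple_Y_le U1 s1 s2' s3'
  | exact: triple_Y_eq0 s1 s2 s3 | exact: triple_Y_eq0 s1 s2 s3'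
  | exact: triple_Y_eq0 s1 s2' s3 | exact: triple_Y_eq0 s1 s2' s3' |].
(* Any two of the four congruences together would put twice one of the units [k1], [k2], [k3] into
   p. *)
have contra x : x \is a GRing.unit -> D 1 (x *+ 2) -> False.
  by move=> Ux; rewrite (D2 chainR); rewrite (unitN1 chainR) in Ux; apply/negP.
apply/and5P; split; [| | | |apply/andP; split]; apply/negP => /andP[A B].
- apply: (contra _ U3); have := DB B A.
  by rewrite (_ : _ - _ = k3 *+ 2) //; ring.
- by apply: (contra _ U2); have := DB A B; rewrite (_ : _ - _ = k2 *+ 2) //; ring.
- by apply: (contra _ U1); have := DD A B; rewrite (_ : _ + _ = k1 *+ 2) //; ring.
- by apply: (contra _ U1); have := DD A B; rewrite (_ : _ + _ = k1 *+ 2) //; ring.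
- by apply: (contra _ U2); have := DB A B; rewrite (_ : _ - _ = k2 *+ 2) //; ring.
- by apply: (contra _ U3); have := DB B A; rewrite (_ : _ - _ = k3 *+ 2) //; ring.
Qed.

Lemma cus_sum0 (i : Iirr GG) : regc 'chi_i ->
  (\sum_(x in ideal l.-1) 'chi_i (u x) == 0) = ('chi_i 1%g == ((q - 1) * q ^ l.-1)%:R).
Proof.
move=> ri; rewrite (irr1_reg chainR psi_add psi_nt ri) -[X in _ = (_ == X)]add0r (inj_eq (addIr _)).
by rewrite mulf_eq0 invr_eq0 (negPf (nzq1 chainR)).
Qed.

Lemma cus_mult (i1 i2 j : Iirr GG) : regc 'chi_i1 -> regc 'chi_i2 ->
  'chi_i1 1%g = ((q - 1) * q ^ l.-1)%:R ->
  regc 'chi_j \/ 'chi_i2 1%g <> ((q - 1) * q ^ l.-1)%:R ->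
  '['chi_i1 * 'chi_i2, 'chi_j] <= 1.
Proof.
move=> r1 r2 d1 Hj; have /eqP c1 : \sum_(x in ideal l.-1) 'chi_i1 (u x) == 0 by rewrite cus_sum0 ?d1.
have [rj|nrj] := boolP (regc 'chi_j); first exact: (cus_mult_le1 chainR psi_add psi_nt).
case: Hj => [rj|nc]; first by rewrite rj in nrj.
have [->|nz] := eqVneq '['chi_i1 * 'chi_i2, 'chi_j] 0; first exact: ler01.
case: nc; apply/eqP; rewrite -cus_sum0 //.
(* By duality ['chi_i2] is a constituent of [X]. Here ['chi_j] is trivial on the socle unipotents
   and ['chi_i1] has no vectors fixed by them, so neither has [X], and ['chi_i2] would be
   cuspidal. *)
pose X := ('chi_i1)^*%CF * 'chi_j.
have NX : X \is a character by rewrite rpredM ?irr_char // cfAut_char irr_char.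
have EXg g : X g = ('chi_i1 g)^* * 'chi_j g by rewrite /X [LHS]cfunE cfunE.
have nz' : '[X, 'chi_i2] != 0.
  rewrite cfdotC conjC_eq0 (_ : '[_, _] = '['chi_i1 * 'chi_i2, 'chi_j]) //.
  rewrite !cfdotE; congr (_ * _); apply: eq_bigr => g _.
  by rewrite EXg rmorphM /= conjCK [('chi_i1 * 'chi_i2) g]cfunE mulrCA mulrA.
have [r Nr Er] := constt_charP i2 NX nz'.
have EX : \sum_(x in ideal l.-1) X (u x) = 0.
  rewrite (eq_bigr (fun x => ('chi_i1 (u x))^* * 'chi_j 1%g)) => [|x].
    by rewrite -mulr_suml -rmorph_sum c1 rmorph0 mul0r.
  rewrite inE => Dx; have [kx _ _] := not_reg_ker chainR nrj Dx.
  by rewrite EXg; congr (_ * _); rewrite -[u x]mulg1 cfkerMl.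
have S0 (phi : 'CF(GG)) : phi \is a character -> 0 <= \sum_(x in ideal l.-1) phi (u x).
  move=> Nphi; have sP : Pg \subset GG by apply: subsetT.
  have mP : mulon Pg (fun=> 1) by split=> // *; rewrite mulr1.
  have := natr_ge0 (mulon_mult_nat sP Nphi mP); rewrite pmulr_rge0 ?invr_gt0 ?ltr0n ?cardG_gt0 //.
  by rewrite sum_Pg; under eq_bigr => x _ do rewrite rmorph1 mulr1.
have : \sum_(x in ideal l.-1) 'chi_i2 (u x) + \sum_(x in ideal l.-1) r (u x) == 0.
  by apply/eqP; rewrite -big_split; apply: etrans EX; apply: eq_bigr => x _; rewrite Er cfunE.
by rewrite paddr_eq0 ?S0 ?irr_char // => /andP[].
Qed.

End SplitSplit.

(** * A non-semisimple character with a large multiplicity *)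

Section NonSplit.
Variables (R : finComUnitRingType) (pi : R) (l q : nat) (psi : R -> algC).
Hypothesis chainR : chain_ring pi l q.
Hypothesis psi_add : additive_char psi.
Hypothesis psi_nt : exists2 x, x \in [set: R] & psi (pi ^+ l.-1 * x) != 1.

Notation D i x := (dvdR (pi ^+ i) x).
Notation ideal i := (ideal pi i).
Notation GG := (GG R).
Notation regc := (regc pi l).
Implicit Types (g h : {'GL_2[R]}) (a b c d x y z s t : R).
Notation m := (l./2).
Notation m' := (l - l./2)%N.

Let l0 := l_gt0 chainR.
Let m0 : (0 < m)%N. Proof. by have := l_gt1 chainR; clear; lia. Qed.
Let m'0 : (0 < m')%N. Proof. by have := l_gt1 chainR; clear; lia. Qed.
Let mm' : (m <= m')%N. Proof. by clear; lia. Qed.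
Let m'l : (m' <= l.-1)%N. Proof. by have := l_gt1 chainR; clear; lia. Qed.

(** The levels add up to [l], so products of p^m and p^m' vanish; this makes [e10 g / e00 g]
    additive on the group, whence the linear characters [phif s]. *)
Definition Jset : {set {'GL_2[R]}} := [set g : {'GL_2[R]} | D m (e00 g - e11 g) && D m' (e10 g)].

Lemma DmMm' x y : D m x -> D m' y -> x * y = 0.
Proof. by move=> Dx Dy; apply: (Dge chainR _ (DM Dx Dy)); clear; lia. Qed.

Lemma Dm'Mm' x y : D m' x -> D m' y -> x * y = 0.
Proof. by move=> Dx; apply: DmMm'; apply: DW Dx. Qed.

Lemma J_group_set : group_set Jset.
Proof.
apply/group_setP; split=> [|g h]; first by rewrite inE !entries1 subrr !Dx0.
rewrite !inE !entriesM => /andP[g1 g2] /andP[h1 h2]; apply/andP; split; last first.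
  by apply: DD; [apply: DMr | apply: DMl].
rewrite (_ : _ - _ = (e00 g - e11 g) * e00 h + e11 g * (e00 h - e11 h) + (e01 g * e10 h - e10 g * e01 h)); last by ring.
apply: DD; first by apply: DD; [apply: DMr | apply: DMl].
by apply: DB; [apply: DMl; apply: DW h2 | apply: DMr; apply: DW g2].
Qed.
Canonical J_group := Group J_group_set.
Notation Jg := J_group.

Lemma J_units g : g \in Jg -> (e00 g \is a GRing.unit) /\ (e11 g \is a GRing.unit).
Proof.
rewrite inE => /andP[_ Dc]; apply: (@box_units _ _ _ _ chainR 0 m') => //.
by rewrite inE D0x.
Qed.

Lemma card_J : #|Jg| = (#|units R| * q ^ (l + l))%N.
Proof.
apply/eqP; rewrite -(eqr_nat algC) -sum1_card natr_sum; apply/eqP.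
rewrite (_ : \sum_(i in Jg) _ = \sum_(g in box pi 0 m') (D m (e00 g - e11 g))%:R); last first.
  rewrite [LHS]big_mkcond [RHS]big_mkcond; apply: eq_bigr => g _; rewrite !inE D0x /=.
  by case: (D m' _); rewrite ?andbT ?andbF //; case: (D m _).
rewrite (box_sum chainR) // (eq_bigr (fun=> (#|units R| * (q ^ m' * q ^ l))%:R)) => [|c]; last first.
  rewrite inE => Dc; rewrite (eq_bigr (fun=> (q ^ m' * q ^ l)%:R)) => [|a].
    by rewrite sumr_const [RHS]natrM [RHS]mulr_natl.
  rewrite inE => Ua; transitivity (\sum_(z in ideal m) (q ^ l)%:R : algC); last first.
    by rewrite sumr_const (card_ideal chainR) ?[RHS]natrM ?[RHS]mulr_natl //; clear; lia.
  rewrite (reindex_inj (addrI a)) /= big_mkcond [RHS]big_mkcond; apply: eq_bigr => z _.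
  rewrite !inE; case: ifP => [Uaz|nU]; last first.
    by case: ifP => // Dz; move: nU; rewrite (unit_addD chainR) // (DW _ Dz).
  rewrite (eq_bigr (fun=> (D m z)%:R)) => [|b _]; last first.
    rewrite gl_val ?mx2E; last by apply: (@gl_unit_det _ _ _ _ chainR m').
    by rewrite opprD addrA subrr add0r DN.
  by rewrite sumr_const (card_ideal chainR) // subn0; case: (D m z); rewrite ?mul0rn.
rewrite sumr_const (card_ideal chainR) ?leq_subr // -[LHS]mulr_natr -natrM; congr (_%:R).
rewrite -!mulnA; congr (_ * _)%N; rewrite -!expnD; congr (_ ^ _)%N; clear; lia.
Qed.

Definition phif s g : algC := psi (s * (e10 g / e00 g)).

Lemma phif_mulon s : mulon Jg (phif s).
Proof.
split=> [|g h gJ hJ]; first by rewrite /phif !entries1 mul0r mulr0 (psi0 psi_add).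
have [Ua Ud] := J_units gJ; have [Ua' Ud'] := J_units hJ.
have [Ua'' _] := J_units (groupM gJ hJ).
rewrite /phif -(psiD psi_add) -mulrDr; congr (psi (s * _)); apply: (mulIr Ua''); rewrite divrK //.
move: gJ hJ; rewrite !inE !entriesM => /andP[g1 g2] /andP[h1 h2].
have cc := Dm'Mm' g2 h2; have c2 := Dm'Mm' h2 h2; have dc := DmMm' g1 h2.
rewrite (_ : (e10 g / e00 g + e10 h / e00 h) * (e00 g * e00 h + e01 g * e10 h) = e10 g * e00 h / e00 g * e00 g + e00 g * e10 h / e00 h * e00 h +
  e01 g / e00 g * (e10 g * e10 h) + e01 g / e00 h * (e10 h * e10 h)); last by ring.
rewrite cc c2 !mulr0 !addr0 !divrK //.
by rewrite -[RHS]subr0 -dc; ring.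
Qed.

Lemma phi_exists s : exists2 mu : 'CF(Jg), mu \is a linear_char & {in Jg, mu =1 phif s}.
Proof. exact: lin_of_mulon (phif_mulon s). Qed.

Lemma vJ x : D m' x -> v x \in Jg.
Proof. by move=> Dx; rewrite inE !vE subrr Dx0. Qed.

Lemma phif_v s x : phif s (v x) = psi (s * x).
Proof. by rewrite /phif !vE divr1. Qed.

Definition dg1 t : {'GL_2[R]} := dg 1 t.

Lemma J_dg g t : t \is a GRing.unit ->
  ((e00 (g ^ dg1 t)%g = e00 g) * (e10 (g ^ dg1 t)%g = e10 g / t)) * (e11 (g ^ dg1 t)%g = e11 g).
Proof.
move=> Ut; have C : g ** dg1 t = dg1 t ** (g ^ dg1 t)%g by rewrite -conjgC.
move: (g ^ dg1 t)%g C => z C.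
have C0 : e00 (g ** dg1 t) = e00 (dg1 t ** z) by rewrite C.
have C1 : e10 (g ** dg1 t) = e10 (dg1 t ** z) by rewrite C.
have C2 : e11 (g ** dg1 t) = e11 (dg1 t ** z) by rewrite C.
move: C0 C1 C2; rewrite !entriesM /dg1 !(dgE (unitr1 R) Ut) !mulr1 !mulr0 !mul1r !mul0r !addr0 !add0r => -> -> C2.
by split; [split=> //; rewrite mulrC mulKr | apply: (mulrI Ut); rewrite -C2 mulrC].
Qed.

(** Conjugation by a diagonal matrix multiplies the lower left entry by [s] and preserves the
    group. *)
Lemma Ind_phi s (mu mus : 'CF(Jg)) : s \is a GRing.unit ->
  {in Jg, mu =1 phif 1} -> {in Jg, mus =1 phif s} -> 'Ind[GG] mus = 'Ind[GG] mu.
Proof.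
move=> Us E1 Es; pose h := dg1 s^-1; apply/cfun_inP => g _; rewrite !cfIndE ?subsetT //; congr (_ * _).
rewrite [RHS](reindex_inj (mulIg (h))) /=; apply: eq_big => y; first by rewrite !inE.
move=> _; rewrite conjgM; set z := (g ^ y)%g.
have Us' : s^-1 \is a GRing.unit by rewrite unitrV.
have zJ : ((z ^ h)%g \in Jg) = (z \in Jg).
  rewrite !inE; move: (J_dg z Us'); move: (z ^ h)%g => z' Ez.
  by rewrite !Ez invrK DUr.
have [zin|zout] := boolP (z \in Jg); last by rewrite !cfun0 ?zJ.
rewrite Es // E1 ?zJ // /phif mul1r; move: (J_dg z Us'); move: (z ^ h)%g => z' Ez.
by rewrite !Ez invrK; congr psi; ring.
Qed.

Lemma J_index : (#|GG : Jg|%g = (q ^ 2 - 1) * q ^ l.-2)%N.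
Proof.
apply/eqP; rewrite -(eqn_pmul2l (cardG_gt0 Jg)) (Lagrange (subsetT Jg)) card_J (card_GG chainR).
rewrite expnS expn1 -!mulnA eqn_pmul2l; last by rewrite lt0n -(eqr_nat algC) (nzU chainR).
rewrite (card_unitsE chainR); apply/eqP.
have -> : l = l.-2.+2 by have := l_gt1 chainR; clear; lia.
rewrite /= !addnS !addSn !expnS.
have -> : (q * (q * 1) - 1 = (q - 1) * (q + 1))%N by have := q_gt0 chainR; clear; nia.
move: (q ^ l.-2)%N (q ^ (l.-2 + l.-2))%N (q - 1)%N => X Y Q; ring.
Qed.

(** The residue classes of 0 and -1 are excluded, whence [q - 2]. *)
Lemma card_consecutive_units : #|[set s | (s \is a GRing.unit) && (s + 1 \is a @GRing.unit R)]| = ((q - 2) * q ^ l.-1)%N.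
Proof.
set S := [set s | _].
have ES : S = ~: (ideal 1 :|: [set x - 1 | x in ideal 1]).
  apply/setP => s; rewrite !inE negb_or !(unitN1 chainR); congr (~~ _ && ~~ _).
  apply/idP/imsetP => [Ds|[x]]; first by exists (s + 1); rewrite ?inE ?addrK.
  by rewrite inE => Dx ->; rewrite subrK.
have ci : #|[set x - 1 | x in ideal 1]| = (q ^ l.-1)%N.
  by rewrite card_imset ?(card_ideal chainR) ?subn1 //; apply: addIr.
have dis : ideal 1 :&: [set x - 1 | x in ideal 1] = set0.
  apply/setP => s; rewrite !inE; apply/negP => /andP[Ds /imsetP[x]]; rewrite inE => Dx Es.
  have : D 1 (x - s) by apply: DB.
  by rewrite Es opprB addrCA subrr addr0; apply/negP; rewrite -(unitN1 chainR) unitr1.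
have := cardsCs S; rewrite ES setCK cardsU dis cards0 subn0 ci (card_ideal chainR) // subn1 (card_R chainR) => ->.
have -> : (q ^ l = q * q ^ l.-1)%N by rewrite -expnS prednK.
by rewrite mulnBl mul2n addnn.
Qed.

Lemma sns_exists : exists i : Iirr GG, [/\ regc 'chi_i, 'chi_i 1%g = ((q ^ 2 - 1) * q ^ l.-2)%:R,
  forall a, a \is a GRing.unit -> 'chi_i (dg a a) = 'chi_i 1%g &
  ((q - 2) * q ^ (l./2 - 1))%:R <= '['chi_i * 'chi_i, 'chi_i]].
Proof.
have [mu Lmu Emu] := phi_exists 1; pose rho := 'Ind[GG] mu.
have Nrho : rho \is a character by rewrite cfInd_char ?lin_charW.
have rho1 : rho 1%g = ((q ^ 2 - 1) * q ^ l.-2)%:R.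
  by rewrite /rho cfInd1 ?subsetT // (lin_char1 Lmu) mulr1 -J_index.
have reg j : '[rho, 'chi_j] != 0 -> regc 'chi_j.
  move=> nz; apply: contraT => nr.
  have /lin_char_irr/irrP[w Ew] := Lmu.
  have nz' : '['Res[Jg] 'chi_j, 'chi_w] != 0.
    by rewrite -Ew cfdot_Res_l -/rho cfdotC conjC_eq0.
  have [x Ux] := psi_nt; case/negP; pose y := pi ^+ l.-1 * x.
  have Dy : D l.-1 y by apply: DpiM.
  have yJ : v y \in Jg by apply: vJ; apply: DW Dy.
  have [_ ky _] := not_reg_ker chainR nr Dy.
  have := @constt_eigen _ Jg ('Res[Jg] 'chi_j) w (v y) 1; rewrite !mul1r -Ew normr1 (lin_char1 Lmu).
  rewrite Emu // phif_v mul1r => -> //; first by rewrite cfRes_char ?irr_char.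
    by rewrite Ew.
  rewrite !cfResE ?subsetT // -[v y]mulg1 cfkerMl //.
(* All constituents are regular, hence of degree at least [(q - 1) * q ^ l.-1]; two of them would
   exceed the degree of [rho], as [q + 1 < 2 * q]. *)
have irr_rho : rho \in irr GG.
  have nzr : rho != 0.
    apply/eqP => E; have := rho1; rewrite E cfunE => /esym/eqP; rewrite pnatr_eq0 muln_eq0 expn_eq0.
    by have := q_gt1 chainR; clear; nia.
  have [w wA] : exists w : Iirr GG, w \in irr_constt rho.
    by apply/existsP; apply: contraNT nzr; rewrite negb_exists => /forallP H;
       rewrite [rho]cfun_sum_constt big_pred0 // => w; apply/negbTE/H.
  have [r Nr Er] := constt_charP w Nrho wA.
  have big j (xi : 'CF(GG)) : xi \is a character -> '[xi, 'chi_j] != 0 -> regc 'chi_j ->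
      ((q - 1) * q ^ l.-1)%:R <= xi 1%g.
    move=> Nxi nz rj; have [r' Nr' ->] := constt_charP j Nxi nz.
    rewrite cfunE (reg_deg chainR psi_add psi_nt rj) addrAC lerDr addr_ge0 ?char1_ge0 ?Vp_char //.
  have [r0|nzr'] := eqVneq r 0; first by rewrite Er r0 addr0 mem_irr.
  have [w' wA'] : exists w : Iirr GG, w \in irr_constt r.
    by apply/existsP; apply: contraNT nzr'; rewrite negb_exists => /forallP H;
       rewrite [r]cfun_sum_constt big_pred0 // => w'; apply/negbTE/H.
  have rw' : regc 'chi_w'.
    apply: reg; rewrite Er cfdotDl gt_eqF // ltr_wpDl ?natr_ge0 ?Cnat_cfdot_char ?irr_char //.
    by rewrite lt_def -irr_consttE wA' natr_ge0 // Cnat_cfdot_char ?irr_char.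
  have B1 : ((q - 1) * q ^ l.-1)%:R <= 'chi_w 1%g.
    by apply: (big w); rewrite ?irr_char ?cfnorm_irr ?oner_neq0 // reg.
  have B2 := big w' r Nr wA' rw'.
  have E1 : 'chi_w 1%g + r 1%g = rho 1%g by rewrite Er cfunE.
  have := lerD B1 B2; rewrite E1 rho1 -natrD.
  rewrite ler_nat => le; exfalso; move: le.
  have -> : (q ^ l.-1 = q * q ^ l.-2)%N by rewrite -expnS; congr (_ ^ _)%N; have := l_gt1 chainR; clear; lia.
  have -> : (q ^ 2 - 1 = (q - 1) * (q + 1))%N by have := q_gt0 chainR; clear; nia.
  have := q_gt1 chainR; have := gt0q chainR l.-2; move: (q ^ l.-2)%N => X; clear => X0 q1.
  have [Q EQ] : exists Q, q = Q.+2 by exists q.-2; lia.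
  rewrite EQ subn1 /=; nia.
have /irrP[i Ei] := irr_rho; exists i; rewrite -Ei; split=> //.
- by rewrite Ei; apply: reg; rewrite Ei cfnorm_irr oner_neq0.
(* Triviality on scalars is what lets [transfer_back] carry this character to the unitary group. *)
- move=> a Ua; rewrite /rho !cfIndE ?subsetT //; congr (_ * _); apply: eq_bigr => y _.
  have -> : (dg a a ^ y)%g = dg a a.
    rewrite conjgE; apply: (canLR (mulKg y)); apply: gl_eq; rewrite !GL_MxE val_dg // -mx2_scalar.
    by rewrite mul_scalar_mx mul_mx_scalar.
  have aJ : dg a a \in Jg by rewrite inE !(dgE Ua Ua) subrr !Dx0.
  rewrite conj1g (lin_char1 Lmu) Emu // /phif !(dgE Ua Ua) mul0r mulr0; exact: (psi0 psi_add).
(* Frobenius reciprocity turns the multiplicity into the product of [mu * A] with [A]; both contain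
   [phif (s + 1)] once when [s] and [s + 1] are units. *)
set A := 'Res[Jg] rho; have NA : A \is a character by rewrite cfRes_char.
have -> : '[rho * rho, rho] = '[mu * A, A].
  by rewrite {1}/rho -cfIndM ?subsetT // -Frobenius_reciprocity.
have Anat (w : Iirr Jg) : '[A, 'chi_w] \in Num.nat by rewrite Cnat_cfdot_char ?irr_char.
have NmA : mu * A \is a character by apply: rpredM => //; apply: lin_charW.
have mAnat (w : Iirr Jg) : '[mu * A, 'chi_w] \in Num.nat by rewrite Cnat_cfdot_char ?irr_char.
pose S := [set s | (s \is a GRing.unit) && (s + 1 \is a @GRing.unit R)].
have ix s : exists w : Iirr Jg, [forall g in Jg, 'chi_w g == phif s g].
  have [mus Ls Es] := phi_exists s; have /lin_char_irr/irrP[w Ew] := Ls.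
  by exists w; apply/forall_inP => g gJ; rewrite -Ew Es.
pose f s := xchoose (ix (s + 1)).
have fE s : {in Jg, 'chi_(f s) =1 phif (s + 1)}.
  by move=> g gJ; apply/eqP; have /forall_inP := xchooseP (ix (s + 1)); apply.
have Aphi s (xi : 'CF(Jg)) : s \is a GRing.unit -> {in Jg, xi =1 phif s} -> '[A, xi] = 1.
  by move=> Us Exi; rewrite cfdot_Res_l (Ind_phi Us Emu Exi) -/rho Ei cfnorm_irr.
have one s : s \in S -> '[A, 'chi_(f s)] = 1 /\ '[mu * A, 'chi_(f s)] = 1.
  rewrite inE => /andP[Us Us1]; split; first exact: (Aphi _ _ Us1 (fE s)).
  have [mus Ls Es] := phi_exists s; rewrite -(Aphi s mus Us Es) !cfdotE; congr (_ * _).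
  apply: eq_bigr => g gJ; rewrite fE // Es // cfunE Emu //.
  have -> : phif (s + 1) g = phif s g * phif 1 g by rewrite /phif mulrDl (psiD psi_add).
  have E : phif 1 g * (phif 1 g)^* = 1 by rewrite (psi_conjM psi_add).
  rewrite rmorphM /=; transitivity ((phif 1 g * (phif 1 g)^*) * (A g * (phif s g)^*)); first by ring.
  by rewrite E mul1r.
apply: (@le_trans _ _ (#|f @: S|%:R)); last first.
  rewrite cfdot_sum_irr -sum1_card natr_sum [X in _ <= X](bigID (mem (f @: S))) /=.
  apply: ler_wpDr; first by apply: sumr_ge0 => w _; rewrite conj_natr // mulr_ge0 ?natr_ge0.
  by apply: ler_sum => _ /imsetP[s sS ->]; have [E1 E2] := one s sS; rewrite E1 E2 conjC1 mulr1.
rewrite ler_nat -(leq_pmul2l (gt0q chainR m')).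
have -> : (q ^ m' * ((q - 2) * q ^ (l./2 - 1)) = (q - 2) * q ^ l.-1)%N.
  rewrite mulnCA -expnD; congr (_ * _ ^ _)%N; have := l_gt1 chainR; clear; lia.
rewrite -card_consecutive_units -/S -sum1_card (partition_big_imset f) /= mulnC -sum_nat_const.
(* Distinct [s] can give the same character, but its values at the [v x] determine [s] modulo p^m,
   so a fibre of [f] has at most [q ^ m'] elements. *)
apply: leq_sum => _ /imsetP[t tS ->]; rewrite sum1_card.
have -> : (q ^ m' = #|[set (t + x)%R | x in ideal m]|)%N.
  by rewrite card_imset ?(card_ideal chainR) //; [clear; lia | apply: addrI].
apply/subset_leq_card/subsetP => s; rewrite unfold_in => /andP[sS /eqP fst].
apply/imsetP; exists (s - t); last by rewrite addrC subrK.
rewrite inE (_ : m = l - m')%N; last by clear; lia.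
apply: (psi_nondeg chainR psi_nt); first exact: leq_subr.
move=> x Dx; have E := fE s _ (vJ Dx); rewrite fst (fE t _ (vJ Dx)) !phif_v in E.
have -> : (s - t) * x = (s + 1) * x + - ((t + 1) * x) by ring.
by rewrite (psiD psi_add) -E -(psi_conj psi_add) (psi_conjM psi_add).
Qed.

End NonSplit.

(** * Central products *)

Section CentralProduct.
Variables (gT : finGroupType) (H Z A : {group gT}).
Hypothesis cZ : Z \subset 'Z(H)%g.
Hypothesis ZA : (Z * A)%g = H.

Let sZH : Z \subset H. Proof. exact: subset_trans cZ (center_sub H). Qed.
Let sAH : A \subset H. Proof. by rewrite -ZA mulG_subr. Qed.

Lemma average_central (f : gT -> algC) :
  {in Z & H, forall z h, f (h * z)%g = f h} ->
  #|A|%:R^-1 * \sum_(x in A) f x = #|H|%:R^-1 * \sum_(x in H) f x.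
Proof.
move=> fZ; have nA := neq0CG A; have nH := neq0CG H.
have E h : h \in H -> \sum_(x in A) f (x * h)%g = \sum_(x in A) f x.
  rewrite -{1}ZA => /mulsgP[z a zZ aA ->]; rewrite [RHS](reindex_inj (mulIg a)) /=.
  apply: eq_big => x; first by rewrite groupMr.
  move=> xA; have zx : (z * a = a * z)%g.
    by have := subsetP cZ z zZ; rewrite inE => /andP[_ /centP]; apply; rewrite (subsetP sAH).
  by rewrite zx mulgA fZ // groupM // (subsetP sAH).
have E2 : #|A|%:R * \sum_(x in H) f x = #|H|%:R * \sum_(x in A) f x.
  transitivity (\sum_(x in A) \sum_(h in H) f (x * h)%g).
    rewrite mulr_natl -sumr_const; apply: eq_bigr => x xA.
    rewrite [LHS](reindex_inj (mulgI x)) /=; apply: eq_bigl => h.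
    by rewrite groupMl // (subsetP sAH).
  rewrite exchange_big /= (eq_bigr (fun=> \sum_(x in A) f x)) ?sumr_const ?mulr_natl //.
by apply: (mulfI nH); rewrite mulrCA -E2 !mulrA mulVf // mulfV // mul1r.
Qed.

Lemma irr_central_norm (i : Iirr H) z : z \in Z -> `|'chi_i z| = 'chi_i 1%g.
Proof.
move=> zZ; have := subsetP cZ z zZ; rewrite -cap_cfcenter_irr => /bigcapP/(_ i isT).
by rewrite irr_cfcenterE ?(subsetP sZH) // => /eqP.
Qed.

Lemma irr_centralM (i : Iirr H) z h : z \in Z -> h \in H ->
  'chi_i (h * z)%g = 'chi_i z / 'chi_i 1%g * 'chi_i h.
Proof.
move=> zZ hH; apply: (mulIf (irr1_neq0 i)).
rewrite (char_center_mul (irr_char i) (subsetP sZH _ zZ) hH (irr_central_norm i zZ)).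
by rewrite mulrAC divfK ?irr1_neq0 // mulrC.
Qed.

Lemma irr_central_scalar_norm (i : Iirr H) z : z \in Z -> `|'chi_i z / 'chi_i 1%g| = 1.
Proof.
move=> zZ; rewrite normrM irr_central_norm // normfV ger0_norm ?char1_ge0 ?irr_char //.
by rewrite mulfV ?irr1_neq0.
Qed.

(** The squared modulus of an irreducible character is invariant under the central group [Z], so the
    norms over [A] and [H] agree. *)
Lemma Res_central_irr (i : Iirr H) : 'Res[A] 'chi_i \in irr A.
Proof.
rewrite irrEchar cfRes_char ?irr_char //= -(cfnorm_irr i) !cfdotE.
rewrite -(average_central (f := fun x => 'chi_i x * ('chi_i x)^*)) => [|z h zZ hH].
  by apply/eqP; congr (_ * _); apply: eq_bigr => x xA; rewrite cfResE.
by rewrite irr_centralM // -!normCK normrM irr_central_scalar_norm // mul1r.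
Qed.

(** A nonzero multiplicity forces the central characters to match, and then the summand is
    [Z]-invariant. *)
Lemma cfdot_central (i1 i2 i3 : Iirr H) : '['chi_i1 * 'chi_i2, 'chi_i3] != 0 ->
  '['Res[A] 'chi_i1 * 'Res[A] 'chi_i2, 'Res[A] 'chi_i3] = '['chi_i1 * 'chi_i2, 'chi_i3].
Proof.
move=> nz; rewrite !cfdotE -(average_central (f := fun x => ('chi_i1 * 'chi_i2) x * ('chi_i3 x)^*)).
  by congr (_ * _); apply: eq_bigr => x xA; rewrite !cfunE !cfResE.
move=> z h zZ hH.
set a := ('chi_i1 z / 'chi_i1 1%g) * ('chi_i2 z / 'chi_i2 1%g); set b := 'chi_i3 z / 'chi_i3 1%g.
have Ea g : g \in H -> ('chi_i1 * 'chi_i2) (g * z)%g = a * ('chi_i1 * 'chi_i2) g.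
  by move=> gH; rewrite !cfunE !(irr_centralM _ zZ gH) mulrACA.
have Eb g : g \in H -> 'chi_i3 (g * z)%g = b * 'chi_i3 g by move=> gH; rewrite irr_centralM.
have ab : a * b^* = 1.
  by apply/eqP; apply: contraNT nz => ne; rewrite (cfdot_eigen (subsetP sZH _ zZ) ne Ea Eb).
by rewrite Ea // Eb // rmorphM mulrACA ab mul1r.
Qed.

Lemma Res_central_eq (i : Iirr H) (w : Iirr A) : '['Ind[H] 'chi_w, 'chi_i] != 0 -> 'Res[A] 'chi_i = 'chi_w.
Proof.
have /irrP[t Et] := Res_central_irr i; rewrite -Frobenius_reciprocity Et cfdot_irr.
by case: (eqVneq w t) => [->|_]; rewrite ?eqxx.
Qed.

Lemma extend_irr (w : Iirr A) : exists i : Iirr H, 'Res[A] 'chi_i = 'chi_w.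
Proof.
have /existsP[i Hi] : [exists i : Iirr H, '['Ind[H] 'chi_w, 'chi_i] != 0].
  have nz : 'Ind[H] 'chi_w != 0.
    apply/eqP => E; have := congr1 (fun f : 'CF(H) => f 1%g) E; rewrite /= cfInd1 // cfunE => /eqP.
    rewrite mulf_eq0 (negPf (irr1_neq0 w)) orbF pnatr_eq0 => /eqP E0.
    by have := indexg_gt0 H A; rewrite E0.
  apply: contraR nz; rewrite negb_exists => /forallP Hi; rewrite -cfnorm_eq0 cfdot_sum_irr big1 // => i _.
  by have := Hi i; rewrite negbK => /eqP->; rewrite mul0r.
by exists i; apply: Res_central_eq.
Qed.

Lemma extend_triple (w1 w2 w3 : Iirr A) : '['chi_w1 * 'chi_w2, 'chi_w3] != 0 ->
  exists i1 i2 i3 : Iirr H, [/\ 'Res[A] 'chi_i1 = 'chi_w1, 'Res[A] 'chi_i2 = 'chi_w2,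
    'Res[A] 'chi_i3 = 'chi_w3, '['chi_i1 * 'chi_i2, 'chi_i3] != 0 &
    '['chi_i1 * 'chi_i2, 'chi_i3] = '['chi_w1 * 'chi_w2, 'chi_w3]].
Proof.
move=> nz; have [i1 E1] := extend_irr w1; have [i2 E2] := extend_irr w2.
have nz' : '['chi_i1 * 'chi_i2, 'Ind[H] 'chi_w3] != 0.
  by rewrite -cfdot_Res_l rmorphM /= E1 E2.
have /existsP[i3 /andP[n1 n2]] :
    [exists i : Iirr H, ('['chi_i1 * 'chi_i2, 'chi_i] != 0) && ('['Ind[H] 'chi_w3, 'chi_i] != 0)].
  apply: contraR nz'; rewrite negb_exists => /forallP Hi; rewrite cfdot_sum_irr big1 // => w _.
  by have := Hi w; rewrite negb_and !negbK => /orP[]/eqP->; rewrite ?mul0r ?rmorph0 ?mulr0.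
have E3 := Res_central_eq n2; exists i1, i2, i3; split=> //.
by rewrite -(cfdot_central n1) E1 E2 E3.
Qed.

(** The [Z]-fixed part of the induced character is nonzero because its values on [Z] are
    nonnegative, [Z :&: A] lying in the kernel; any constituent of it is the required extension. *)
Lemma extend_trivial (w : Iirr A) : Z :&: A \subset cfker 'chi_w ->
  exists2 i : Iirr H, 'Res[A] 'chi_i = 'chi_w & Z \subset cfker 'chi_i.
Proof.
move=> kw; have nZ : (Z <| H)%g by rewrite sub_center_normal.
set phi := 'Ind[H] 'chi_w.
have pos : cfFix Z phi 1%g != 0.
  rewrite cfFixE // mulf_neq0 ?invr_eq0 ?neq0CG // (big_setD1 1%g) //= gt_eqF //.
  apply: ltr_pwDl; first by rewrite mulg1 /phi cfInd1 // mulr_gt0 ?irr1_gt0 // ltr0n indexg_gt0.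
  apply: sumr_ge0 => z; rewrite !inE => /andP[_ zZ]; rewrite mul1g cfIndE // mulr_ge0 ?invr_ge0 ?ler0n //.
  apply: sumr_ge0 => y yH; have -> : (z ^ y)%g = z.
    have := subsetP cZ z zZ; rewrite inE => /andP[_ /centP/(_ y yH) C].
    by rewrite conjgE (C : z * y = y * z)%g mulKg.
  have [zA|zA] := boolP (z \in A); last by rewrite cfun0.
  have : z \in cfker 'chi_w by rewrite (subsetP kw) // inE zZ.
  by rewrite cfkerEirr inE => /eqP->; rewrite char1_ge0 ?irr_char.
have /existsP[i /andP[ki ni]] :
    [exists i : Iirr H, (Z \subset cfker 'chi_i) && ('[phi, 'chi_i] != 0)].
  apply: contraR pos; rewrite negb_exists => /forallP Hi; rewrite /cfFix big1 ?cfunE //.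
  by move=> i ki; have := Hi i; rewrite ki /= negbK => /eqP->; rewrite scale0r.
by exists i => //; apply: Res_central_eq.
Qed.

End CentralProduct.

(** * The subring fixed by a ring endomorphism *)

Section FixedRing.
Variables (R : finComUnitRingType) (c : {rmorphism R -> R}).

Definition fixpred : {pred R} := [pred x | c x == x].

Lemma fixpred_divring : divring_closed fixpred.
Proof.
split=> [|x y|x y]; rewrite ?inE ?rmorph1 // => /eqP Ex /eqP Ey; first by rewrite rmorphB Ex Ey.
have [Uy|nUy] := boolP (y \is a GRing.unit); first by rewrite rmorphM rmorphV // Ex Ey.
by rewrite invr_out // rmorphM Ex Ey.
Qed.

HB.instance Definition _ := GRing.isDivringClosed.Build R fixpred fixpred_divring.

Record fixring := FixRing { fixval : R; _ : fixval \in fixpred }.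
HB.instance Definition _ := [isSub for fixval].
HB.instance Definition _ := [Finite of fixring by <:].
HB.instance Definition _ := [SubChoice_isSubComUnitRing of fixring by <:].

End FixedRing.

Definition finc (R : finComUnitRingType) (c : {rmorphism R -> R}) (x : fixring c) : R := val x.
Arguments finc : simpl never.

Lemma finc_inj (R : finComUnitRingType) (c : {rmorphism R -> R}) : injective (@finc R c).
Proof. exact: val_inj. Qed.

HB.instance Definition _ (R : finComUnitRingType) (c : {rmorphism R -> R}) :=
  GRing.isZmodMorphism.Build (fixring c) R (@finc R c) (fun x y => erefl).
HB.instance Definition _ (R : finComUnitRingType) (c : {rmorphism R -> R}) :=
  GRing.isMonoidMorphism.Build (fixring c) R (@finc R c) (erefl, fun x y => erefl).

(** * Regularity *)

(** If ['chi_i] is not regular, [not_reg_ker] makes it trivial on every product [su] of socle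
    elements, and the sum over [Sset] is positive. *)
Lemma regc_sum (R : finComUnitRingType) (pi : R) (l q : nat) (chainR : chain_ring pi l q)
  (i : Iirr (GG R)) : regc pi l 'chi_i <-> \sum_(g in Sset pi l) 'chi_i g = 0.
Proof.
split=> [|S0]; first exact: (reg_sum_Sg chainR).
apply: contraT => nr; have K := not_reg_ker chainR nr.
move: S0; rewrite (sum_Sg chainR) (eq_bigr (fun=> (q * q)%:R * 'chi_i 1%g)) => [|y].
  rewrite sumr_const -(qE chainR) => /eqP; rewrite mulrn_eq0 mulf_eq0 pnatr_eq0 muln_eq0.
  by rewrite (negPf (irr1_neq0 i)) orbF !orbb; have := q_gt0 chainR; case: (q).
rewrite inE => Dy; rewrite (eq_bigr (fun=> q%:R * 'chi_i 1%g)) => [|s].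
  by rewrite sumr_const -(qE chainR) [in RHS]natrM -mulrA [RHS]mulr_natl.
rewrite inE => Ds; rewrite (eq_bigr (fun=> 'chi_i 1%g)) => [|x].
  by rewrite sumr_const -(qE chainR) mulr_natl.
rewrite inE => Dx; have [[ku _ _] [_ kv _] [_ _ kh]] := And3 (K x Dx) (K y Dy) (K s Ds).
by rewrite -[su _]/(v y ** (hh s ** u x)) -[RHS](cfkerMl 1%g (groupM kv (groupM kh ku))) mulg1.
Qed.

Section Regularity.
Variables (k : Gkind) (R : finComUnitRingType) (c : {rmorphism R -> R}).
Variables (pi : R) (l : nat) (psi : R -> algC).
Hypothesis psi_add : additive_char psi.
Hypotheses (l2 : (1 < l)%N) (pil : pi ^+ l = 0).
Implicit Types (g h : {'GL_2[R]}).
Notation K := (Kset k c pi l).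

Lemma KsetE : K = Ggrp k c :&: Kcong_group pi l.-1.
Proof. by apply/setP => g; rewrite inE in_setI [in RHS]inE. Qed.

Lemma psiA_mulon (A : 'M[R]_2) : mulon (Ggrp k c :&: Kcong_group pi l.-1) (psiA psi A).
Proof.
case: (psi_add) => p0 pD; split=> [|g h]; first by rewrite /psiA GL_1E subrr mulmx0 mxtrace0.
rewrite !in_setI => /andP[_ +] /andP[_ +]; rewrite !inE => Kg Kh.
have [X EX] := DmP _ _ _ (DmM Kg Kh).
have E0 : (GLval g - 1%:M) *m (GLval h - 1%:M) = 0 :> 'M[R]_2.
  apply: (etrans EX); have -> : (l.-1 + l.-1 = l + l.-2)%N by clear -l2; lia.
  by rewrite exprD pil mul0r scale0r.
rewrite /psiA -pD -raddfD -mulmxDr; congr (psi (\tr (A *m _))).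
rewrite GL_MxE -[RHS]addr0 -E0 mulmxBr !mulmxBl !mul1mx !mulmx1.
move: (GLval g) (GLval h) (GLval g *m GLval h) => G H GH.
by apply/matrixP => a b; rewrite !mxE; ring.
Qed.

Lemma psiA_scalar (a : R) g : psiA psi a%:M g = psi (a * (\tr (GLval g) - 2%:R)).
Proof. by rewrite /psiA mul_scalar_mx mxtraceZ raddfB /= mxtrace1. Qed.

Lemma scalar_modP (A : 'M[R]_2) : scalar_mod pi A -> exists a X, A = a%:M + pi *: X.
Proof.
move=> /existsP[a Ha]; have /DmP[X EX] : Dm pi 1 (A - a%:M).
  apply/forallP => i1; apply/forallP => i2; have /forallP/(_ i1)/forallP/(_ i2) := Ha.
  by rewrite !mxE expr1.
by exists a, X; rewrite -[pi]expr1 -EX addrC subrK.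
Qed.

Lemma psiA_scalar_mod (a : R) (X : 'M[R]_2) g : g \in K ->
  psiA psi (a%:M + pi *: X) g = psiA psi a%:M g.
Proof.
rewrite KsetE in_setI => /andP[_]; rewrite inE => /DmP[Y EY].
rewrite /psiA mulmxDl raddfD /= (_ : \tr (pi *: X *m _) = 0) ?addr0 //.
rewrite [GLval g - _]EY -scalemxAl -scalemxAr scalerA -exprS prednK; last by clear -l2; lia.
by rewrite pil scale0r mxtrace0.
Qed.

(** [tau] lists scalars that represent, as characters of [K], all matrices of the Lie algebra that
    are scalar modulo p: all of [R] for [GL_2], the fixed multiples of [theta] for [GU_2]. *)
Variables (T : finType) (tau : T -> R) (N : nat).
Hypothesis N0 : (0 < N)%N.
Hypothesis tau_lie : forall t, in_lie_mod k c pi (tau t)%:M.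
Hypothesis tau_all : forall a X, in_lie_mod k c pi (a%:M + pi *: X) ->
  exists t, {in K, psiA psi a%:M =1 psiA psi (tau t)%:M}.
Hypothesis tau_sum : forall g, g \in K ->
  \sum_t psi (- (tau t * (\tr (GLval g) - 2%:R))) = if \tr (GLval g) == 2%:R then N%:R else 0.

Lemma regular_iff (i : Iirr (Ggrp k c)) : regular k c pi l psi i <->
  \sum_(g in K | \tr (GLval g) == 2%:R) 'chi_i g = 0.
Proof.
pose occ t := \sum_(g in K) 'chi_i g * (psiA psi (tau t)%:M g)^*.
have E : \sum_t occ t = N%:R * \sum_(g in K | \tr (GLval g) == 2%:R) 'chi_i g.
  rewrite /occ exchange_big /= [RHS]mulr_sumr [RHS]big_mkcondr /=; apply: eq_bigr => g gK.
  rewrite -mulr_sumr (eq_bigr (fun t => psi (- (tau t * (\tr (GLval g) - 2%:R))))) => [|t _].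
    by rewrite tau_sum //; case: ifP => _; rewrite ?mulr0 // mulrC.
  by rewrite psiA_scalar (psi_conj psi_add).
have ge0 t : 0 <= occ t.
  have := natr_ge0 (mulon_mult_nat (subsetIl _ _) (irr_char i) (psiA_mulon (tau t)%:M)).
  rewrite pmulr_rge0 ?invr_gt0 ?ltr0n ?cardG_gt0 // => H; apply: (le_trans H).
  by rewrite le_eqVlt; apply/orP; left; apply/eqP; apply: eq_bigl => g; rewrite KsetE.
have nzN : N%:R != 0 :> algC by rewrite pnatr_eq0 -lt0n.
split=> [reg | S0].
  apply: (mulfI nzN); rewrite mulr0 -E; apply: big1 => t _; apply/eqP; apply: contraT => nz.
  have := reg _ (tau_lie t) nz; case/negP; apply/existsP; exists (tau t).
  apply/forallP => i1; apply/forallP => i2; rewrite !mxE subrr; apply/existsP; exists 0.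
  by rewrite mulr0.
move=> A lA oA; apply/negP => /scalar_modP[a [X EA]]; rewrite EA in lA oA.
have [t Et] := tau_all lA; move: E; rewrite S0 mulr0 => /eqP; rewrite psumr_eq0 // => /allP/(_ t).
rewrite mem_index_enum => /(_ isT) /= /eqP ot; case/negP: oA; apply/eqP.
rewrite -[RHS]ot; apply: eq_bigr => g gK; by rewrite psiA_scalar_mod // Et.
Qed.

End Regularity.

Lemma regular_GL (R : finComUnitRingType) (c : {rmorphism R -> R}) (pi : R) (l q : nat)
  (psi : R -> algC) (chainR : chain_ring pi l q) (psi_add : additive_char psi)
  (psi_nt : exists2 x, x \in [set: R] & psi (pi ^+ l.-1 * x) != 1) (i : Iirr (Ggrp GLk c)) :
  regular GLk c pi l psi i <-> regc pi l ('chi_i : 'CF(GG R)).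
Proof.
have l2 := l_gt1 chainR; have [_ [pil _] _ _ _] := chainR.
apply: iff_trans (iff_sym (@regc_sum _ _ _ _ chainR i)).
rewrite (@regular_iff GLk R c pi l psi psi_add l2 pil R id (q ^ l)) ?(gt0q chainR) //.
- have -> // : \sum_(g in Kset GLk c pi l | \tr (GLval g) == 2%:R) 'chi_i g = \sum_(g in Sset pi l) 'chi_i g.
  by apply: eq_bigl => g; rewrite KsetE !inE.
- by move=> a X _; exists a.
move=> g _; under eq_bigr => t _ do rewrite mulrC -mulNr.
by rewrite (sum_psi chainR psi_add psi_nt) oppr_eq0 subr_eq0.
Qed.

(** * The unitary group *)

Section NormForm.
Variables (R : finComUnitRingType) (pi : R) (l q : nat) (eps : R).
Hypothesis chainR : chain_ring pi l q.
Notation D i x := (dvdR (pi ^+ i) x).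
Notation ideal i := (ideal pi i).

(** Newton's iteration for the square root, with [2 * r] invertible. *)
Lemma square_lift t : t \is a GRing.unit -> D 1 (eps - t ^+ 2) -> exists r, r ^+ 2 = eps.
Proof.
move=> Ut Dt; suff [r _] : exists2 r, r \is a GRing.unit & D l (eps - r ^+ 2).
  by rewrite (Dl chainR) subr_eq0 => /eqP->; exists r.
have : (0 < l)%N by apply: l_gt0 chainR.
case: (l) => // n _; elim: n => [|n [r Ur Dr]]; first by exists t.
pose s := (eps - r ^+ 2) / (2%:R * r).
have U2r : 2%:R * r \is a GRing.unit by rewrite unitrM (unit2 chainR).
have Ds : D n.+1 s by apply: DMr.
exists (r + s); first by apply: (unit_addD chainR) => //; apply: DW Ds.
have -> : eps - (r + s) ^+ 2 = - (s * s).
  have E : s * (2%:R * r) = eps - r ^+ 2 by rewrite divrK.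
  transitivity (eps - r ^+ 2 - s * (2%:R * r) - s * s); first by ring.
  by rewrite E subrr sub0r.
by rewrite DN; apply: DW (DM Ds Ds); clear; lia.
Qed.

Lemma nonsquare_aniso : eps \is a GRing.unit -> ~ (exists r, r ^+ 2 = eps) -> aniso pi eps.
Proof.
move=> Ue nsq x y; rewrite /Qf /= => DQ.
have [Dy|nDy] := boolP (D 1 y).
  split=> //; have : D 1 (x ^+ 2) by rewrite -(subrK (eps * y ^+ 2) (x ^+ 2)); apply: DD => //; apply: DMl; rewrite expr2; apply: DMr.
  by apply: contraLR; rewrite -!(unitN1 chainR) expr2 unitrM => ->.
rewrite -(unitN1 chainR) in nDy; exfalso; apply: nsq.
have Dt : D 1 (eps - (x / y) ^+ 2).
  have -> : eps - (x / y) ^+ 2 = - (x ^+ 2 - eps * y ^+ 2) / y ^+ 2.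
    apply: (mulIr (_ : y ^+ 2 \is a GRing.unit)); first by rewrite unitrX.
    rewrite divrK ?unitrX // mulrBl expr_div_n divrK ?unitrX //; ring.
  by apply: DMr; rewrite DN.
apply: (square_lift _ Dt).
have -> : (x / y \is a GRing.unit) = ((x / y) ^+ 2 \is a GRing.unit) by rewrite unitrX_pos.
by rewrite -(unit_congr chainR Dt).
Qed.

Hypothesis Qan : aniso pi eps.

(** By [card_Q] a fibre over a unit has at most [(q + 1) * q ^ l.-1] points. If one fibre were
    empty, the others could not account for all pairs of unit norm. *)
Lemma Qf_surj (k : R) : k \is a GRing.unit -> exists w, Qf eps w = k.
Proof.
move=> Uk; suff /existsP[w /eqP E] : [exists w, Qf eps w == k] by exists w.
apply: contraT; rewrite negb_exists => /forallP H.
have l0 := l_gt0 chainR; have q1 := q_gt1 chainR.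
pose V : {set R * R} := [set w | Qf eps w \is a GRing.unit].
have EV : V = ~: setX (ideal 1) (ideal 1).
  apply/setP => -[x y]; rewrite !inE (unitN1 chainR); congr (~~ _).
  apply/idP/andP => [/Qan//|[Dx Dy]]; rewrite /Qf /= !expr2.
  by apply: DB; [apply: DMr | apply: DMl; apply: DMr].
have cV : (#|V| + q ^ l.-1 * q ^ l.-1 = q ^ l * q ^ l)%N.
  have := cardsC (setX (ideal 1) (ideal 1)); rewrite -EV cardsX !(card_ideal chainR) // subn1 card_prod !(card_R chainR).
  by move=> <-; rewrite addnC.
have le : (#|V| <= (#|units R| - 1) * ((q + 1) * q ^ l.-1))%N.
  rewrite -sum1_card (partition_big (Qf eps) (mem (units R :\ k))) /=; last first.
    by move=> w; rewrite !inE => ->; rewrite andbT H.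
  have -> : (#|units R| - 1 = #|units R :\ k|)%N by rewrite [in LHS](cardsD1 k) inE Uk addKn.
  rewrite -sum_nat_const; apply: leq_sum => t; rewrite !inE => /andP[_ Ut].
  apply: leq_trans (card_Q chainR Qan Ut); rewrite sum1_card; apply/subset_leq_card/subsetP => w.
  by rewrite unfold_in => /andP[_ /eqP<-]; rewrite inE.
move: le cV; rewrite (card_unitsE chainR).
have -> : (q ^ l = q * q ^ l.-1)%N by rewrite -expnS prednK.
have := gt0q chainR l.-1; move: (q ^ l.-1)%N (#|V|) q1; clear; move=> X V q1 X0 le cV; exfalso.
have [Q EQ] : exists Q, q = Q.+2 by exists q.-2; lia.
move: le cV; rewrite EQ (_ : Q.+2 - 1 = Q.+1)%N // => le cV.
have le2 : (V + (Q.+2 + 1) * X <= Q.+1 * X * ((Q.+2 + 1) * X))%N.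
  have p : (0 < Q.+1 * X)%N by rewrite muln_gt0.
  have E : (Q.+1 * X = (Q.+1 * X - 1) + 1)%N by lia.
  by move: ((Q.+2 + 1) * X)%N le => Y le; rewrite {1}E mulnDl mul1n leq_add2r.
have E3 : (Q.+1 * X * ((Q.+2 + 1) * X) + X * X = Q.+2 * X * (Q.+2 * X))%N by ring.
nia.
Qed.

End NormForm.

(** * Comparison of [GU_2] with [GL_2] over the fixed ring *)

Section Unitary.
Variables (R : finComUnitRingType) (c : {rmorphism R -> R}) (pi : fixring c) (l q : nat).
Variables (psi : R -> algC) (theta : R).
Notation S := (fixring c).
Notation inc := (@finc R c).
Hypothesis chainS : chain_ring pi l q.
Hypothesis psi_add : additive_char psi.
Hypothesis psi_nt : exists2 x : S, x \in [set: S] & psi (inc (pi ^+ l.-1 * x)) != 1.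
Hypothesis cK : forall x, c (c x) = x.
Hypothesis c_theta : c theta = - theta.
Hypothesis U_theta : theta \is a GRing.unit.
Hypothesis theta_nsq : ~ exists a : S, inc a ^+ 2 = theta ^+ 2.
Hypothesis decomp : forall x, exists a b : S, x = inc a + inc b * theta.
Notation DS i x := (@dvdR S (pi ^+ i) x).
Notation DR i x := (@dvdR R (inc pi ^+ i) x).
Implicit Types (g h : {'GL_2[S]}).

Lemma c_inc (x : S) : c (inc x) = inc x.
Proof. by have := valP x; rewrite inE => /eqP. Qed.

Lemma to_inc (x : R) : c x = x -> exists a : S, x = inc a.
Proof. by move=> E; exists (@FixRing R c x (introT eqP E)). Qed.

Lemma inc_unit (x : S) : (inc x \is a GRing.unit) = (x \is a GRing.unit).
Proof.
apply/idP/idP => [Ux|]; last exact: rmorph_unit.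
have [y Ey] : exists y : S, (inc x)^-1 = inc y by apply: to_inc; rewrite rmorphV // c_inc.
by apply/unitrPr; exists y; apply: finc_inj; rewrite rmorphM rmorph1 /= -Ey mulrV.
Qed.

Let U2 : (2%:R : R) \is a GRing.unit.
Proof. by rewrite -(rmorph_nat inc) inc_unit (unit2 chainS). Qed.

(** A quotient found in [R] is averaged with its conjugate to obtain one in the fixed ring, 2 being
    a unit. *)
Lemma DR_inc i (x : S) : DR i (inc x) = DS i x.
Proof.
apply/existsP/existsP => [[y /eqP E]|[y /eqP->]]; last first.
  by exists (inc y); rewrite rmorphM rmorphXn.
have [z Ez] : exists z : S, (y + c y) / 2%:R = inc z.
  by apply: to_inc; rewrite rmorphM rmorphV // rmorph_nat rmorphD cK addrC.
exists z; apply/eqP/finc_inj; rewrite rmorphM rmorphXn /= -Ez.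
have -> : inc pi ^+ i * ((y + c y) / 2%:R) = (inc pi ^+ i * y + inc pi ^+ i * c y) / 2%:R by ring.
have -> : inc pi ^+ i * c y = c (inc pi ^+ i * y) by rewrite rmorphM rmorphXn c_inc.
by rewrite -E c_inc; apply: (mulIr U2); rewrite divrK // mulr_natr mulr2n.
Qed.

(** Conjugation by diag(1, theta): diagonal entries stay fixed by [c] and the others change sign, so
    the image is unitary up to the determinant. *)
Definition iota g : {'GL_2[R]} :=
  gl (inc (e00 g)) (inc (e01 g) * theta) (inc (e10 g) / theta) (inc (e11 g)).

Lemma det_iota g : inc (e00 g) * inc (e11 g) - inc (e01 g) * theta * (inc (e10 g) / theta) =
  inc (e00 g * e11 g - e01 g * e10 g).
Proof.
rewrite rmorphB !rmorphM; congr (_ - _).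
by rewrite -mulrA; congr (_ * _); rewrite mulrC divrK.
Qed.

Lemma val_iota g : GLval (iota g) =
  mx2 (inc (e00 g)) (inc (e01 g) * theta) (inc (e10 g) / theta) (inc (e11 g)).
Proof. by rewrite gl_val // det_iota inc_unit gl_det. Qed.

Lemma iotaM : {in GG S &, {morph iota : g h / (g * h)%g}}.
Proof.
move=> g h _ _; apply: gl_eq; rewrite GL_MxE !val_iota mx2M !entriesM !rmorphD !rmorphM /=.
have tt : theta * theta^-1 = 1 by rewrite mulrV.
move: tt; move: (theta^-1) => t tt.
have E (x y : R) : x * theta * (y * t) = x * y.
  by transitivity (x * y * (theta * t)); [ring | rewrite tt mulr1].
have E' (x y : R) : x * t * (y * theta) = x * y.
  by transitivity (x * y * (theta * t)); [ring | rewrite tt mulr1].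
by rewrite E E'; congr mx2; ring.
Qed.
Canonical iota_morphism := Morphism iotaM.

Lemma iota_inj : injective iota.
Proof.
move=> g h E; have : GLval (iota g) = GLval (iota h) by rewrite E.
rewrite !val_iota => /mx2_inj[/finc_inj E0 E1 E2 /finc_inj E3].
have Ut' : theta^-1 \is a GRing.unit by rewrite unitrV.
by apply: gl_ext => //; apply: finc_inj; [apply: (mulIr U_theta) | apply: (mulIr Ut')].
Qed.

Lemma mxstar_mx2 (a b d e : R) : mxstar c (mx2 a b d e) = mx2 (c e) (c b) (c d) (c a).
Proof.
by apply: eq_mx2; rewrite /mxstar !mulmx2E !mxE /=; ring.
Qed.

Notation UU := (unitary_group c).

Definition scal (w : R) : {'GL_2[R]} := dg w w.
Lemma scalC w (x : {'GL_2[R]}) : w \is a GRing.unit -> (scal w * x)%g = (x * scal w)%g.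
Proof.
move=> Uw; apply: gl_eq; rewrite !GL_MxE /scal val_dg // -mx2_scalar.
by rewrite mul_scalar_mx mul_mx_scalar.
Qed.

Definition Zset : {set {'GL_2[R]}} := [set scal w | w in units R].
Lemma Zset_group_set : group_set Zset.
Proof.
apply/group_setP; split=> [|x y].
  apply/imsetP; exists 1; rewrite ?inE ?unitr1 //; apply: gl_eq; rewrite /scal val_dg ?unitr1 //.
  by rewrite -mx2_scalar.
move=> /imsetP[a + ->] /imsetP[b + ->]; rewrite !inE => Ua Ub.
by rewrite /scal dgM // -/(scal (a * b)) imset_f // inE unitrM Ua.
Qed.
Canonical Zset_group := Group Zset_group_set.

Lemma Zset_central (G : {group {'GL_2[R]}}) : Zset \subset G -> Zset \subset 'Z(G)%g.
Proof.
move=> sZ; rewrite subsetI sZ; apply/subsetP => _ /imsetP[a + ->]; rewrite inE => Ua.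
by apply/centP => x _; apply: scalC.
Qed.

Lemma det_unitary (x : {'GL_2[R]}) : x \in UU ->
  let a := e00 x in let b := e01 x in let d := e10 x in let e := e11 x in
  [/\ c e * a + c b * d = 1, c e * b + c b * e = 0, c d * a + c a * d = 0 & c d * b + c a * e = 1].
Proof.
rewrite inE => /eqP; rewrite [GLval x]mx2_eta mxstar_mx2 mx2M mx2_scalar !mx2E.
by case/mx2_inj.
Qed.

Lemma unitaryE (x : {'GL_2[R]}) (a b d e : R) : GLval x = mx2 a b d e ->
  c e * a + c b * d = 1 -> c e * b + c b * e = 0 -> c d * a + c a * d = 0 ->
  c d * b + c a * e = 1 -> x \in UU.
Proof. by move=> E h1 h2 h3 h4; rewrite inE E mxstar_mx2 mx2M h1 h2 h3 h4 mx2_scalar. Qed.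

Lemma norm_surj (k : S) : k \is a GRing.unit -> exists w : R, w * c w = inc k.
Proof.
move=> Uk; have [eps Ee] : exists eps : S, theta ^+ 2 = inc eps.
  by apply: to_inc; rewrite rmorphXn c_theta sqrrN.
have Ue : eps \is a GRing.unit by rewrite -inc_unit -Ee unitrX.
have an : aniso pi eps.
  apply: (nonsquare_aniso chainS Ue) => -[r Er]; apply: theta_nsq; exists r.
  by rewrite Ee -Er rmorphXn.
have [[x y] E] := Qf_surj chainS an Uk; exists (inc x + inc y * theta).
rewrite -E /Qf /= rmorphB rmorphXn rmorphM rmorphXn /= -Ee rmorphD rmorphM c_theta !c_inc; ring.
Qed.

(** The image of [g] preserves the hermitian form up to its determinant, which a scalar of norm
    [dt^-1] corrects. *)
Lemma iota_unitary g : exists2 w, w \is a GRing.unit & (scal w * iota g)%g \in UU.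
Proof.
pose dt := e00 g * e11 g - e01 g * e10 g.
have Ud : dt \is a GRing.unit by apply: gl_det.
have [|w Ew] := norm_surj (k := dt^-1); first by rewrite unitrV.
have Uw : w \is a GRing.unit.
  have : w * c w \is a GRing.unit by rewrite Ew inc_unit unitrV.
  by rewrite unitrM => /andP[].
exists w => //.
have Edt : w * c w * inc dt = 1 by rewrite Ew -rmorphM mulVr // rmorph1.
apply: (@unitaryE _ (w * inc (e00 g)) (w * (inc (e01 g) * theta)) (w * (inc (e10 g) / theta)) (w * inc (e11 g))).
  by rewrite GL_MxE /scal val_dg // val_iota mx2M !mul0r !addr0 !add0r.
all: rewrite !rmorphM /= ?rmorphV // ?c_theta !c_inc ?invrN.
- rewrite -[RHS]Edt -det_iota; ring.
- ring.
- ring.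
- rewrite -[RHS]Edt -det_iota; ring.
Qed.

(** Conjugating an entry of a unitary matrix divides it by the determinant, up to sign. A scalar [w]
    with [c w = w * De] then makes the diagonal entries fixed and the others odd, which is the shape
    of [iota]. *)
Lemma unitary_iota (x : {'GL_2[R]}) : x \in UU ->
  exists2 w, w \is a GRing.unit & exists g, (scal w * x)%g = iota g.
Proof.
move=> xU; have [] := det_unitary xU; have := gl_det x; have := mx2_eta (GLval x).
move: (e00 x) (e01 x) (e10 x) (e11 x) => a b d e Ex.
have [De EDe] : exists De, De = a * e - b * d by eexists.
rewrite -EDe => UD h1 h2 h3 h4.
have ce : c e * De = e.
  transitivity ((c e * a + c b * d) * e - (c e * b + c b * e) * d); first by rewrite EDe; ring.
  by rewrite h1 h2 mul1r mul0r subr0.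
have cb : c b * De = - b.
  transitivity ((c e * b + c b * e) * a - (c e * a + c b * d) * b); first by rewrite EDe; ring.
  by rewrite h1 h2 mul1r mul0r sub0r.
have ca : c a * De = a.
  transitivity ((c d * b + c a * e) * a - (c d * a + c a * d) * b); first by rewrite EDe; ring.
  by rewrite h3 h4 mul1r mul0r subr0.
have cd : c d * De = - d.
  transitivity ((c d * a + c a * d) * e - (c d * b + c a * e) * d); first by rewrite EDe; ring.
  by rewrite h3 h4 mul1r mul0r sub0r.
have cD : c De * De = 1.
  apply: (mulIr UD); rewrite mul1r {1}EDe rmorphB !rmorphM /=.
  transitivity ((c a * De) * (c e * De) - (c b * De) * (c d * De)); first by ring.
  by rewrite ca ce cb cd mulrNN.
(* Hilbert 90 for the norm 1 element [De]: both [1 + c De] and [theta * (1 - c De)] satisfy the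
   equation. The norms [k1] and [k2] have sum 4, so one of the candidates is a unit. *)
have [w Uw cw] : exists2 w, w \is a GRing.unit & c w = w * De.
  have [k1 E1] : exists k1 : S, (1 + c De) * (1 + De) = inc k1.
    by apply: to_inc; rewrite rmorphM !rmorphD rmorph1 cK mulrC.
  have [k2 E2] : exists k2 : S, (1 - c De) * (1 - De) = inc k2.
    by apply: to_inc; rewrite rmorphM !rmorphB rmorph1 cK mulrC.
  have E4 : k1 + k2 = 2%:R * 2%:R.
    apply: finc_inj; rewrite rmorphD rmorphM !rmorph_nat /= -E1 -E2.
    by transitivity (2%:R * (1 + c De * De)); [ring | rewrite cD].
  have [Uk1|nUk1] := boolP (k1 \is a GRing.unit).
    exists (1 + c De); last by rewrite rmorphD rmorph1 cK mulrDl mul1r cD addrC.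
    by move: Uk1; rewrite -inc_unit -E1 unitrM => /andP[].
  have Uk2 : k2 \is a GRing.unit.
    rewrite (unitN1 chainS); apply/negP => D2; have : DS 1 (k1 + k2).
      by apply: DD => //; move: nUk1; rewrite (unitN1 chainS) negbK.
    by apply/negP; rewrite E4 -(unitN1 chainS) unitrM (unit2 chainS).
  exists (theta * (1 - c De)); last first.
    rewrite rmorphM rmorphB rmorph1 cK c_theta.
    by transitivity (theta * De - theta * (c De * De)); [rewrite cD; ring | ring].
  by move: Uk2; rewrite -inc_unit -E2 unitrM => /andP[U1 _]; rewrite unitrM U_theta.
exists w => //.
have [al Eal] : exists al : S, w * a = inc al.
  by apply: to_inc; rewrite rmorphM cw -mulrA [De * _]mulrC ca.
have [be Ebe] : exists be : S, w * b / theta = inc be.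
  by apply: to_inc; rewrite !rmorphM rmorphV // c_theta cw invrN -[w * De * _]mulrA [De * _]mulrC cb; ring.
have [ga Ega] : exists ga : S, w * d * theta = inc ga.
  by apply: to_inc; rewrite !rmorphM c_theta cw -[w * De * _]mulrA [De * _]mulrC cd; ring.
have [dl Edl] : exists dl : S, w * e = inc dl.
  by apply: to_inc; rewrite rmorphM cw -mulrA [De * _]mulrC ce.
have Ebe' : w * b = inc be * theta by rewrite -Ebe divrK.
have Ega' : w * d = inc ga / theta by rewrite -Ega mulrK.
have UD' : al * dl - be * ga \is a GRing.unit.
  rewrite -inc_unit rmorphB !rmorphM /= -Eal -Edl -Ebe -Ega.
  rewrite (_ : _ - _ = w * w * De); first by rewrite !unitrM Uw.
  transitivity (w * a * (w * e) - w * b * (w * d) * (theta / theta)); first by ring.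
  by rewrite mulrV // EDe; ring.
exists (gl al be ga dl); apply: gl_eq; rewrite val_iota gl_val // !mx2E -Eal -Edl -Ebe' -Ega'.
by rewrite GL_MxE /scal val_dg // Ex mx2M !mul0r !addr0 !add0r.
Qed.

Definition BB : {group {'GL_2[R]}} := (iota @* GG S)%G.

Lemma in_BB x : reflect (exists g, x = iota g) (x \in BB).
Proof.
apply: (iffP morphimP) => [[g _ _ ->]|[g ->]]; first by exists g.
by exists g; rewrite ?inE.
Qed.

Lemma ZB_ZU : (Zset * BB)%g = (Zset * UU)%g.
Proof.
have VZ w : w \is a GRing.unit -> (scal w)^-1%g \in Zset_group.
  by move=> Uw; rewrite groupV imset_f // inE.
apply/eqP; rewrite eqEsubset; apply/andP; split; apply/subsetP => _ /mulsgP[z x zZ + ->].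
  case/in_BB => g ->; have [w Uw wU] := iota_unitary g.
  rewrite -[iota g](mulKg (scal w)) mulgA mem_mulg // (@groupM _ Zset_group) ?VZ //.
move=> xU; have [w Uw [g Eg]] := unitary_iota xU.
rewrite -[x](mulKg (scal w)) Eg mulgA mem_mulg // ?(@groupM _ Zset_group) ?VZ //.
by apply/in_BB; exists g.
Qed.

Definition HH : {group {'GL_2[R]}} := (Zset_group <*> UU)%G.

Lemma HH_U : (Zset_group * UU)%g = HH.
Proof.
symmetry; apply: norm_joinEr; apply: subset_trans (_ : 'C(Zset_group) \subset _)%g; last exact: cent_sub.
by apply/subsetP => x _; apply/centP => _ /imsetP[w + ->]; rewrite inE => Uw; apply/esym/scalC.
Qed.

Lemma HH_B : (Zset_group * BB)%g = HH.
Proof. by rewrite -HH_U; apply: ZB_ZU. Qed.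

Lemma Z_center : Zset_group \subset 'Z(HH)%g.
Proof. by apply: Zset_central; rewrite -HH_U mulG_subl. Qed.

Notation KU := (Kset GUk c (inc pi) l).

Let l2 : (1 < l)%N. Proof. exact: l_gt1 chainS. Qed.
Let pil : inc pi ^+ l = 0.
Proof. by case: chainS => _ [pl _] _ _ _; rewrite -rmorphXn /= pl rmorph0. Qed.

(** Products of two entries of [x - 1] vanish because [2 * l.-1 >= l], so the unitary equations
    become linear. *)
Lemma KU_lie (x : {'GL_2[R]}) : x \in KU ->
  [/\ DR l.-1 (e00 x - 1), DR l.-1 (e01 x), DR l.-1 (e10 x) & DR l.-1 (e11 x - 1)] /\
  [/\ c (e00 x - 1) = - (e11 x - 1), c (e11 x - 1) = - (e00 x - 1), c (e01 x) = - e01 x & c (e10 x) = - e10 x].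
Proof.
move=> xK; have := xK; rewrite inE => /andP[xU _].
have : Dm (inc pi) l.-1 (GLval x - 1%:M) by move: xK; rewrite KsetE in_setI => /andP[_]; rewrite inE.
rewrite Dm2 !mxE /= !subr0 => /and4P[D0 D1 D2 D3]; split=> //.
have [] := det_unitary xU.
have Dc y : DR l.-1 y -> DR l.-1 (c y).
  by move=> /DP[z ->]; rewrite rmorphM rmorphXn c_inc; apply: DpiM.
have D00 y z : DR l.-1 y -> DR l.-1 z -> y * z = 0.
  move=> /DP[y' ->] /DP[z' ->]; rewrite mulrACA -exprD.
  have -> : (l.-1 + l.-1 = l + l.-2)%N by clear -l2; lia.
  by rewrite exprD pil !mul0r.
have -> : e00 x = 1 + (e00 x - 1) by rewrite addrC subrK.
have -> : e11 x = 1 + (e11 x - 1) by rewrite addrC subrK.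
rewrite ![1 + _ - 1]addrAC !subrr !add0r.
move: (e00 x - 1) (e01 x) (e10 x) (e11 x - 1) D0 D1 D2 D3 => a b d e D0 D1 D2 D3.
rewrite !rmorphD !rmorph1 !mulrDl !mulrDr !mul1r !mulr1.
rewrite (D00 _ _ (Dc _ D3) D0) (D00 _ _ (Dc _ D1) D2) (D00 _ _ (Dc _ D3) D1) (D00 _ _ (Dc _ D1) D3).
rewrite (D00 _ _ (Dc _ D2) D0) (D00 _ _ (Dc _ D0) D2) (D00 _ _ (Dc _ D2) D1) (D00 _ _ (Dc _ D0) D3).
rewrite !addr0 !add0r => h1 h2 h3 h4; split.
- by apply/eqP; rewrite -addr_eq0 addrC; apply/eqP/(addrI (1 : R)); rewrite addr0 addrA.
- by apply/eqP; rewrite -addr_eq0 addrC; apply/eqP/(addrI (1 : R)); rewrite addr0 addrA.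
- by apply/eqP; rewrite -addr_eq0 addrC h2.
- by apply/eqP; rewrite -addr_eq0 h3.
Qed.

(** Elements of [Sset] have determinant 1, so [iota] needs no scalar correction on them. Conversely
    the linear equations of [KU_lie] and the trace condition place the entries in the fixed ring. *)
Lemma Sset_iota : [set x in KU | \tr (GLval x) == 2%:R] = [set iota g | g in Sset pi l].
Proof.
apply/setP => x; apply/idP/imsetP => [|[g gS ->]].
  rewrite inE mx2_tr => /andP[xK /eqP tx]; have [[D0 D1 D2 D3] [c0 c3 c1 c2]] := KU_lie xK.
  have E3 : e11 x - 1 = - (e00 x - 1).
    have -> : e11 x = 2%:R - e00 x by rewrite -tx addrC addKr.
    by ring.
  rewrite E3 opprK in c0.
  have [s Es] := to_inc c0.
  have [y Ey] : exists y : S, e01 x / theta = inc y.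
    by apply: to_inc; rewrite rmorphM rmorphV // c1 c_theta invrN mulrNN.
  have [z Ez] : exists z : S, e10 x * theta = inc z.
    by apply: to_inc; rewrite rmorphM c2 c_theta mulrNN.
  have Ds : DS l.-1 s by rewrite -DR_inc -Es.
  have Dy : DS l.-1 y by rewrite -DR_inc -Ey; apply: DMr.
  have Dz : DS l.-1 z by rewrite -DR_inc -Ez; apply: DMr.
  have Eg := val_su chainS Dy Dz Ds.
  exists (su (z, (s, y))); last first.
    apply: gl_eq; rewrite val_iota Eg !mx2E [GLval x]mx2_eta !rmorphD rmorphN rmorph1 /= -Es -Ey -Ez.
    rewrite divrK // mulrK // addrC subrK -E3 addrC subrK //.
  rewrite inE; apply/andP; split; last by rewrite Eg mx2_tr !mx2E; apply/eqP; ring.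
  by rewrite inE Dm2 Eg !mxE /= !subr0 [1 + s - 1]addrAC subrr add0r [1 - s - 1]addrAC subrr add0r DN Ds Dy Dz.
have [gK /eqP tg] : g \in Kcong pi l.-1 /\ \tr (GLval g) == 2%:R by apply/andP; have := gS; rewrite /Sset inE.
rewrite mx2_tr in tg; have : Dm pi l.-1 (GLval g - 1) by move: gK; rewrite inE.
rewrite Dm2 !mxE /= !subr0 => /and4P[D0 D1 D2 D3].
have E3 : e11 g = 2%:R - e00 g by rewrite -tg addrC addKr.
have Edet : e00 g * e11 g - e01 g * e10 g = 1.
  rewrite (Dtoptop chainS D1 D2) subr0 E3.
  transitivity (1 - (e00 g - 1) * (e00 g - 1)); first by ring.
  by rewrite (Dtoptop chainS D0 D0) subr0.
rewrite inE; apply/andP; split; last first.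
  by rewrite val_iota mx2_tr !mx2E -rmorphD tg rmorph_nat.
rewrite KsetE in_setI; apply/andP; split.
  have Ed := det_iota g; rewrite Edet rmorph1 in Ed.
  apply: (unitaryE (val_iota g)); rewrite ?rmorphM /= ?rmorphV // ?c_theta ?c_inc ?invrN.
  - by rewrite -[RHS]Ed; ring.
  - by ring.
  - by ring.
  - by rewrite -[RHS]Ed; ring.
have Ei y : inc y - 1 = inc (y - 1) by rewrite rmorphB rmorph1.
rewrite inE Dm2 val_iota !mxE /= !subr0 !Ei !DR_inc D0 D3 /=.
by rewrite andbT; apply/andP; split; apply: DMr; rewrite DR_inc.
Qed.

(** A scalar lies in the unitary Lie algebra modulo p when its fixed component is in p, so the
    multiples of [theta] represent all of them. *)
Lemma regular_GU (i : Iirr (Ggrp GUk c)) :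
  regular GUk c (inc pi) l psi i <-> \sum_(g in Sset pi l) 'chi_i (iota g) = 0.
Proof.
rewrite (@regular_iff GUk R c (inc pi) l psi psi_add l2 pil S (fun b => inc b * theta) (q ^ l)) ?(gt0q chainS) //.
- have -> // : \sum_(x in KU | \tr (GLval x) == 2%:R) 'chi_i x = \sum_(g in Sset pi l) 'chi_i (iota g).
  transitivity (\sum_(x in [set iota g | g in Sset pi l]) 'chi_i x); last first.
    by rewrite big_imset //= => g h _ _; apply: iota_inj.
  by rewrite -Sset_iota; apply: eq_bigl => x; rewrite [RHS]inE.
- move=> b; apply/forallP => i1; apply/forallP => i2; rewrite mx2_scalar mxstar_mx2 mx2D.
  rewrite rmorphM rmorph0 c_inc c_theta mulrN subrr addr0 -[mx2 _ _ _ _]/(mx2 0 0 0 0) -mx2_scalar.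
  by rewrite mxE mul0rn; apply/existsP; exists 0; rewrite mulr0.
- move=> a X /forallP H; have [s [b Ea]] := decomp a; exists b => x xK.
  rewrite !psiA_scalar; congr psi.
  have /forallP/(_ 0)/existsP[z /eqP] := H 0; rewrite [X]mx2_eta mx2Z mx2_scalar mx2D mxstar_mx2 mx2D mx2E.
  rewrite rmorphD rmorphM c_inc {1 2}Ea rmorphD rmorphM c_theta !c_inc => Ez.
  have [[D0 _ _ D3] _] := KU_lie xK.
  have /DP[t Et] : DR l.-1 (\tr (GLval x) - 2%:R).
    rewrite mx2_tr (_ : _ - _ = (e00 x - 1) + (e11 x - 1)); first exact: DD.
    by ring.
  rewrite Ea mulrDl (_ : inc s * _ = 0) ?add0r //.
  apply: (mulIr U2); rewrite mul0r Et.
  have E2s : inc s * 2%:R = inc pi * (z - X 0 0 - c (X 1 1)).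
    rewrite !mulrBr -Ez; ring.
  transitivity ((inc s * 2%:R) * (inc pi ^+ l.-1 * t)); first by ring.
  rewrite E2s mulrACA -exprS prednK ?pil ?mul0r //; clear -l2; lia.
move=> x xK; have [_ [c0 c3 _ _]] := KU_lie xK.
set y := \tr _ - _; have Ey : y = (e00 x - 1) + (e11 x - 1) by rewrite /y mx2_tr; ring.
have [y' Ey'] : exists y' : S, theta * y = inc y'.
  by apply: to_inc; rewrite rmorphM c_theta Ey rmorphD c0 c3; ring.
have pS : additive_char (fun b : S => psi (inc b)).
  case: psi_add => p0 pD; split=> [|b b']; first by rewrite rmorph0.
  by rewrite rmorphD pD.
have := sum_psi chainS pS psi_nt (- y'); rewrite oppr_eq0 => E.
transitivity (\sum_(b : S) psi (inc (- y' * b))).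
  by apply: eq_bigr => b _; congr psi; rewrite rmorphM rmorphN /= -Ey'; ring.
rewrite E; congr (if _ then _ else _).
by rewrite -[RHS]subr_eq0 -/y -(inj_eq (@finc_inj _ _)) -Ey' rmorph0 (mulrI_eq0 _ (mulrI U_theta)).
Qed.

Lemma Sset_UU g : g \in Sset pi l -> iota g \in UU.
Proof.
move=> gS; have : iota g \in [set x in KU | \tr (GLval x) == 2%:R] by rewrite Sset_iota imset_f.
by rewrite inE => /andP[]; rewrite KsetE in_setI => /andP[].
Qed.

(** The degree and the values on the trace 2 subgroup are all that type and regularity depend on. *)
Definition agree (w : Iirr UU) (j : Iirr (GG S)) :=
  'chi_j 1%g = 'chi_w 1%g /\ {in Sset pi l, forall g, 'chi_j g = 'chi_w (iota g)}.

Lemma agree_regular w j : agree w j -> (regular GUk c (inc pi) l psi w <-> regc pi l 'chi_j).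
Proof.
case=> _ E; apply: iff_trans (iff_sym (regc_sum chainS j)).
have -> : \sum_(g in Sset pi l) 'chi_j g = \sum_(g in Sset pi l) 'chi_w (iota g) by apply: eq_bigr => g gS; apply: E.
exact: regular_GU.
Qed.

Lemma pull_irr (i : Iirr HH) : exists j : Iirr (GG S),
  'chi_j = cfMorph ('Res[iota_morphism @* GG S] 'chi_i).
Proof.
have : cfMorph ('Res[iota_morphism @* GG S] 'chi_i) \in irr (GG S).
  by rewrite cfMorph_irr // (Res_central_irr Z_center HH_B).
by case/irrP => j ->; exists j.
Qed.

Lemma pull_agree (i : Iirr HH) (w : Iirr UU) (j : Iirr (GG S)) : 'Res[UU] 'chi_i = 'chi_w ->
  'chi_j = cfMorph ('Res[iota_morphism @* GG S] 'chi_i) -> agree w j.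
Proof.
move=> Ew Ej; split=> [|g gS]; first by rewrite Ej cfMorph1 -Ew !cfRes1.
have sBH : BB \subset HH by rewrite -HH_B mulG_subr.
have sUH : UU \subset HH by rewrite -HH_U mulG_subr.
rewrite Ej cfMorphE ?inGG // -Ew (cfResE _ sUH (Sset_UU gS)) cfResE //.
by apply/in_BB; exists g.
Qed.

(** The nonvanishing hypothesis makes it possible to choose extensions to [HH] with matching central
    characters, after which both restrictions keep the multiplicity. *)
Lemma transfer_triple (w1 w2 w3 : Iirr UU) : '['chi_w1 * 'chi_w2, 'chi_w3] != 0 ->
  exists j1 j2 j3 : Iirr (GG S), [/\ agree w1 j1, agree w2 j2, agree w3 j3 &
    '['chi_j1 * 'chi_j2, 'chi_j3] = '['chi_w1 * 'chi_w2, 'chi_w3]].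
Proof.
move=> nz; have [i1 [i2 [i3 [E1 E2 E3 n3 E]]]] := extend_triple Z_center HH_U nz.
have [[j1 F1] [j2 F2] [j3 F3]] := And3 (pull_irr i1) (pull_irr i2) (pull_irr i3).
exists j1, j2, j3; split; try (by apply: pull_agree; eassumption).
by rewrite F1 F2 F3 -rmorphM cfMorph_iso // (cfdot_central Z_center HH_B n3).
Qed.

Lemma transfer_back (j : Iirr (GG S)) :
  (forall a : S, a \is a GRing.unit -> 'chi_j (dg a a) = 'chi_j 1%g) ->
  exists w : Iirr UU, agree w j /\ '['chi_w * 'chi_w, 'chi_w] = '['chi_j * 'chi_j, 'chi_j].
Proof.
move=> Hj; have inj : ('injm iota_morphism)%g by apply/injmP => g h _ _; apply: iota_inj.
have iso : isom (GG S) BB iota_morphism := sub_isom (subxx _) (erefl _) inj.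
have /irrP[t Et] : cfIsom iso 'chi_j \in irr BB by rewrite cfIsom_irr mem_irr.
have tE g : 'chi_t (iota g) = 'chi_j g by rewrite -Et (cfIsomE iso) ?inGG.
have kt : Zset_group :&: BB \subset cfker 'chi_t.
  apply/subsetP => x; rewrite in_setI => /andP[/imsetP[w + Ex] /in_BB[g Eg]]; rewrite inE => Uw.
  have : GLval (scal w) = GLval (iota g) by rewrite -Ex Eg.
  rewrite /scal val_dg // val_iota => /mx2_inj[E0 E1 E2 E3].
  have z0 : inc 0 = 0 by apply: rmorph0.
  have b0 : e01 g = 0 by apply: finc_inj; apply: (mulIr U_theta); rewrite z0 mul0r -E1.
  have d0 : e10 g = 0.
    by apply: finc_inj; apply: (mulIr (_ : theta^-1 \is a GRing.unit)); rewrite ?unitrV // z0 mul0r -E2.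
  have e0 : e11 g = e00 g by apply: finc_inj; rewrite -E0 -E3.
  have Ua : e00 g \is a GRing.unit by rewrite -inc_unit -E0.
  have Edg : g = dg (e00 g) (e00 g) by apply: gl_ext; rewrite !(dgE Ua Ua).
  rewrite cfkerEirr inE Eg tE {1}Edg Hj // -[X in _ == 'chi_t X](_ : iota 1%g = 1%g) ?tE //.
  by rewrite (morph1 iota_morphism).
have [i Ei ki] := extend_trivial Z_center HH_B kt.
have /irrP[w Ew] := Res_central_irr Z_center HH_U i; exists w.
have Ej : 'chi_j = cfMorph ('Res[iota_morphism @* GG S] 'chi_i).
  by apply/cfun_inP => g _; rewrite cfMorphE ?inGG // -tE -Ei.
split; first exact: pull_agree Ew Ej.
have avg (A : {group {'GL_2[R]}}) : (Zset_group * A)%g = HH ->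
    '['Res[A] 'chi_i * 'Res[A] 'chi_i, 'Res[A] 'chi_i] = '['chi_i * 'chi_i, 'chi_i].
  move=> ZA; have sA : A \subset HH by rewrite -ZA mulG_subr.
  rewrite !cfdotE -(average_central Z_center ZA (f := fun x => ('chi_i * 'chi_i) x * ('chi_i x)^*)).
    by congr (_ * _); apply: eq_bigr => x xA; rewrite !cfunE !cfResE.
  by move=> z h zZ _; rewrite !cfunE !cfkerMr // (subsetP ki).
by rewrite -Ew (avg _ HH_U) Ej -rmorphM cfMorph_iso // (avg _ HH_B).
Qed.

End Unitary.

(** * Transfer of the bounds along a relation of irreducible characters *)

Section Assembly.
Variables (k : Gkind) (R : finComUnitRingType) (c : {rmorphism R -> R}).
Variables (pi : R) (l q : nat) (psi : R -> algC).
Variables (S : finComUnitRingType) (piS : S) (psiS : S -> algC).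
Hypothesis chainS : chain_ring piS l q.
Hypothesis psi_add : additive_char psiS.
Hypothesis psi_nt : exists2 x, x \in [set: S] & psiS (piS ^+ l.-1 * x) != 1.
(** Instantiated by equality for [GL_2] and by [agree] for [GU_2]. *)
Variable rel : Iirr (Ggrp k c) -> Iirr (GG S) -> Prop.
Hypothesis rel_deg : forall w j, rel w j -> 'chi_j 1%g = 'chi_w 1%g.
Hypothesis rel_reg : forall w j, rel w j -> (regular k c pi l psi w <-> regc piS l 'chi_j).
Hypothesis rel_triple : forall w1 w2 w3 : Iirr (Ggrp k c), '['chi_w1 * 'chi_w2, 'chi_w3] != 0 ->
  exists j1 j2 j3, [/\ rel w1 j1, rel w2 j2, rel w3 j3 &
    '['chi_j1 * 'chi_j2, 'chi_j3] = '['chi_w1 * 'chi_w2, 'chi_w3]].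
Hypothesis rel_back : forall j : Iirr (GG S),
  (forall a : S, a \is a GRing.unit -> 'chi_j (dg a a) = 'chi_j 1%g) ->
  exists w, rel w j /\ '['chi_w * 'chi_w, 'chi_w] = '['chi_j * 'chi_j, 'chi_j].

Lemma multiplicity_bounds :
  [/\
   (forall i1 i2 : Iirr (Ggrp k c),
      regular k c pi l psi i1 -> regular k c pi l psi i2 ->
      is_ss q l i1 -> is_sns q l i2 ->
      forall j : Iirr (Ggrp k c),
        '['chi_i1 * 'chi_i2, 'chi_j] <= 2%:R /\
        ('['chi_i1 * 'chi_i2, 'chi_j] = 2%:R ->
           regular k c pi l psi j /\ is_ss q l j)),
   (forall i1 i2 : Iirr (Ggrp k c),
      regular k c pi l psi i1 -> regular k c pi l psi i2 ->
      is_cus q l i1 -> ~ is_cus q l i2 ->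
      forall j : Iirr (Ggrp k c), '['chi_i1 * 'chi_i2, 'chi_j] <= 1),
   (forall i1 i2 : Iirr (Ggrp k c),
      regular k c pi l psi i1 -> regular k c pi l psi i2 ->
      is_cus q l i1 -> is_cus q l i2 ->
      forall j : Iirr (Ggrp k c), regular k c pi l psi j ->
        '['chi_i1 * 'chi_i2, 'chi_j] <= 1),
   (forall i1 i2 : Iirr (Ggrp k c),
      regular k c pi l psi i1 -> regular k c pi l psi i2 ->
      is_ss q l i1 -> is_ss q l i2 ->
      forall j : Iirr (Ggrp k c), regular k c pi l psi j -> is_ss q l j ->
        '['chi_i1 * 'chi_i2, 'chi_j] <= (l + 1)%:R) &
   (exists2 i : Iirr (Ggrp k c),
      regular k c pi l psi i /\ is_sns q l i &
      ((q - 2) * q ^ (l./2 - 1))%:R <= '['chi_i * 'chi_i, 'chi_i])].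
Proof.
split.
- move=> i1 i2 r1 r2 d1 d2 j.
  (* A zero multiplicity satisfies the bound trivially; only nonzero ones can be transferred. *)
  have [->|nz] := eqVneq '['chi_i1 * 'chi_i2, 'chi_j] 0.
    by split; [exact: ler0n | move/eqP; rewrite eq_sym pnatr_eq0].
  have [j1 [j2 [j3 [a1 a2 a3 E]]]] := rel_triple nz.
  have := ss_sns_mult chainS psi_add psi_nt j3 (iffLR (rel_reg a1) r1) (iffLR (rel_reg a2) r2).
  rewrite (rel_deg a1) (rel_deg a2) E => /(_ d1 d2)[le eq]; split=> // /eq[r3 d3]; split.
    exact: (iffRL (rel_reg a3)).
  by rewrite /is_ss -(rel_deg a3).
- move=> i1 i2 r1 r2 d1 d2 j.
  have [->|nz] := eqVneq '['chi_i1 * 'chi_i2, 'chi_j] 0; first exact: ler01.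
  have [j1 [j2 [j3 [a1 a2 a3 E]]]] := rel_triple nz; rewrite -E.
  apply: (cus_mult chainS psi_add psi_nt (iffLR (rel_reg a1) r1) (iffLR (rel_reg a2) r2)).
    by rewrite (rel_deg a1).
  by right; rewrite (rel_deg a2).
- move=> i1 i2 r1 r2 d1 d2 j rj.
  have [->|nz] := eqVneq '['chi_i1 * 'chi_i2, 'chi_j] 0; first exact: ler01.
  have [j1 [j2 [j3 [a1 a2 a3 E]]]] := rel_triple nz; rewrite -E.
  apply: (cus_mult chainS psi_add psi_nt (iffLR (rel_reg a1) r1) (iffLR (rel_reg a2) r2)).
    by rewrite (rel_deg a1).
  by left; apply: (iffLR (rel_reg a3)).
- move=> i1 i2 r1 r2 d1 d2 j rj dj.
  have [->|nz] := eqVneq '['chi_i1 * 'chi_i2, 'chi_j] 0; first exact: ler0n.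
  have [j1 [j2 [j3 [a1 a2 a3 E]]]] := rel_triple nz; rewrite -E.
  apply: (ss_ss_mult chainS psi_add psi_nt (iffLR (rel_reg a1) r1) (iffLR (rel_reg a2) r2) (iffLR (rel_reg a3) rj)).
  + by rewrite (rel_deg a1).
  + by rewrite (rel_deg a2).
  + by rewrite (rel_deg a3).
have [j [rj dj tj le]] := sns_exists chainS psi_add psi_nt.
have [w [aw E]] := rel_back tj; exists w; last by rewrite E.
by split; [apply: (iffRL (rel_reg aw)) | rewrite /is_sns -(rel_deg aw)].
Qed.

End Assembly.

Theorem theorem1p5 (k : Gkind) (R : finComUnitRingType) (c : {rmorphism R -> R})
  (pi : R) (l q : nat) (psi : R -> algC) :
  (2 <= l)%N -> setting k c pi l q -> additive_char psi ->
  (exists2 x, x \in oset k c & psi (pi ^+ l.-1 * x) != 1) ->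
  [/\
   (* (1) *)
   (forall i1 i2 : Iirr (Ggrp k c),
      regular k c pi l psi i1 -> regular k c pi l psi i2 ->
      is_ss q l i1 -> is_sns q l i2 ->
      forall j : Iirr (Ggrp k c),
        '['chi_i1 * 'chi_i2, 'chi_j] <= 2%:R /\
        ('['chi_i1 * 'chi_i2, 'chi_j] = 2%:R ->
           regular k c pi l psi j /\ is_ss q l j)),
   (* (2) *)
   (forall i1 i2 : Iirr (Ggrp k c),
      regular k c pi l psi i1 -> regular k c pi l psi i2 ->
      is_cus q l i1 -> ~ is_cus q l i2 ->
      forall j : Iirr (Ggrp k c), '['chi_i1 * 'chi_i2, 'chi_j] <= 1),
   (* (3) *)
   (forall i1 i2 : Iirr (Ggrp k c),
      regular k c pi l psi i1 -> regular k c pi l psi i2 ->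
      is_cus q l i1 -> is_cus q l i2 ->
      forall j : Iirr (Ggrp k c), regular k c pi l psi j ->
        '['chi_i1 * 'chi_i2, 'chi_j] <= 1),
   (* (4) *)
   (forall i1 i2 : Iirr (Ggrp k c),
      regular k c pi l psi i1 -> regular k c pi l psi i2 ->
      is_ss q l i1 -> is_ss q l i2 ->
      forall j : Iirr (Ggrp k c), regular k c pi l psi j -> is_ss q l j ->
        '['chi_i1 * 'chi_i2, 'chi_j] <= (l + 1)%:R) &
   (* (5) *)
   (exists2 i : Iirr (Ggrp k c),
      regular k c pi l psi i /\ is_sns q l i &
      ((q - 2) * q ^ (l./2 - 1))%:R <= '['chi_i * 'chi_i, 'chi_i])].
Proof.
move=> l2 []; case: k => /= -[piS pil pil' chn] qE oq.
  move=> _ psi_add psi_nt.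
  have chainR : chain_ring pi l q.
    split=> //; last by rewrite -qE /res_card cardsT.
    by move=> x; have [Ux|[y _ Ey]] := chn x (in_setT x); [left | right; exists y].
  apply: (@multiplicity_bounds GLk R c pi l q psi R pi psi chainR psi_add psi_nt
    (fun w j => w = j)) => //.
  - by move=> w j ->.
  - move=> w j Ewj; rewrite Ewj; exact (@regular_GL R c pi l q psi chainR psi_add psi_nt j).
  - by move=> w1 w2 w3 _; exists w1, w2, w3.
  - by move=> j _; exists j.
case=> cK [theta [c_theta U2 nsq dec]] psi_add [x0 x0S nt].
have lift x : x \in fixedR c -> exists a : fixring c, x = finc a.
  by rewrite inE => E; exists (@FixRing R c x E).
have fix_in (a : fixring c) : finc a \in fixedR c.
  by rewrite inE; have := valP a; rewrite inE.
have [p Ep] := lift _ piS; subst pi.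
have chainS : chain_ring p l q.
  split=> //.
  - by split; [apply: finc_inj; rewrite rmorphXn rmorph0 |
       apply: contraNneq pil' => E; rewrite -rmorphXn /= E rmorph0].
  - move=> x; have [Ux|[y /lift[a ->] Ey]] := chn (finc x) (fix_in x); [left | right].
      by rewrite -inc_unit.
    by exists a; apply: finc_inj; rewrite rmorphM.
  have im (A : {set fixring c}) : #|[set finc a | a in A]| = #|A| by rewrite card_imset //; apply: finc_inj.
  have F : fixedR c = [set finc a | a in [set: fixring c]].
    apply/setP => x; apply/idP/imsetP => [/lift[a ->]|[a _ ->]]; last exact: fix_in.
    by exists a; rewrite ?inE.
  have F2 : [set finc p * x | x in fixedR c] = [set finc b | b in [set p * a | a in [set: fixring c]]].
    by rewrite F -!imset_comp; apply: eq_imset => a /=; rewrite rmorphM.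
  by rewrite -qE /res_card F2 F !im cardsT.
have U_theta : theta \is a GRing.unit by move: U2; rewrite unitrX_pos.
have nsqS : ~ exists a : fixring c, finc a ^+ 2 = theta ^+ 2.
  by case=> a Ea; apply: nsq; exists (finc a).
have decS x : exists a b : fixring c, x = finc a + finc b * theta.
  by have [[a b] [[/= /lift[a' ->] /lift[b' ->] ->] _]] := dec x; exists a', b'.
have [a0 E0] := lift _ x0S.
have psi_addS : additive_char (fun a : fixring c => psi (finc a)).
  by case: psi_add => p0 pD; split=> [|a b]; rewrite ?rmorph0 // rmorphD pD.
have psi_ntS : exists2 x : fixring c, x \in [set: fixring c] & psi (finc (p ^+ l.-1 * x)) != 1.
  by exists a0; rewrite ?inE // rmorphM rmorphXn /= -E0.
apply: (@multiplicity_bounds GUk R c (finc p) l q psi (fixring c) p (fun a => psi (finc a))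
  chainS psi_addS psi_ntS (@agree R c p l theta)).
- by move=> w j [].
- by move=> w j Awj; eapply agree_regular; eassumption.
- by move=> w1 w2 w3 nz; eapply transfer_triple; eassumption.
- by move=> j Hj; eapply transfer_back; eassumption.
Qed.
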